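(* Let $M=M^n$ be a Wintgen ideal submanifold of dimension $n\ge 4$ and codimension $m\ge 1$ in a real space form $\mathbb{R}^{n+m}(\widetilde{k})$. Then the tensors $R\cdot C-C\cdot R$ and $Q(g,g\wedge\mathrm{Ricc})$ are linearly dependent if and only if $M$ is totally umbilical in $\mathbb{R}^{n+m}(\widetilde{k})$ (and hence $M$ is conformally flat).
   Context: Manifolds are connected, Riemannian and of class $C^\infty$. $\mathbb{R}^{n+m}(\widetilde{k})$ is a real space form: a Riemannian manifold of dimension $n+m$ and constant curvature $\widetilde{k}$, with metric $\widetilde{g}$. The submanifold $M$ carries the induced metric $g$ with Levi-Civita connection $\nabla$; $h$ is its second fundamental form and the shape operator $A_\xi$ for a normal field $\xi$ is given by $g(A_\xi X,Y)=\widetilde{g}(\xi,h(X,Y))$. $\{E_i\}_{i=1}^n$ is any local orthonormal tangent frame and $\{\xi_\alpha\}_{\alpha=1}^m$ any local orthonormal normal frame; $A_\alpha=A_{\xi_\alpha}$. The mean curvature vector is $\vec{H}=\frac1n\sum_i h(E_i,E_i)$ and $H=\|\vec{H}\|$. $M$ is totally umbilical if $h(X,Y)=g(X,Y)\vec{H}$. For a symmetric $(0,2)$-tensor $A$: $(X\wedge_A Y)Z=A(Y,Z)X-A(X,Z)Y$. $\mathcal{R}(X,Y)Z=\nabla_X\nabla_YZ-\nabla_Y\nabla_XZ-\nabla_{[X,Y]}Z$, $R(X,Y,Z,W)=g(\mathcal{R}(X,Y)Z,W)$, $\mathrm{Ricc}(X,Y)=\mathrm{tr}\{Z\mapsto\mathcal{R}(Z,X)Y\}$,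 $g(\mathcal{S}X,Y)=\mathrm{Ricc}(X,Y)$, $\kappa=\mathrm{tr}\,\mathcal{S}$, and the Weyl tensor is $C(X,Y,Z,W)=g(\mathcal{C}(X,Y)Z,W)$ with $\mathcal{C}(X,Y)=\mathcal{R}(X,Y)-\frac1{n-2}\left(X\wedge_g\mathcal{S}Y+\mathcal{S}X\wedge_gY-\frac{\kappa}{n-1}X\wedge_gY\right)$. The Kulkarni-Nomizu product of $(0,2)$-tensors is $(A\wedge B)(X_1,X_2;X,Y)=A(X_1,Y)B(X_2,X)+A(X_2,X)B(X_1,Y)-A(X_1,X)B(X_2,Y)-A(X_2,Y)B(X_1,X)$. For a skew family of endomorphisms $\mathcal{B}(X,Y)$ and a $(0,k)$-tensor $T$ put $(\mathcal{B}(X,Y)\cdot T)(X_1,\dots,X_k)=-\sum_{j=1}^k T(X_1,\dots,\mathcal{B}(X,Y)X_j,\dots,X_k)$. The $(0,k+2)$-tensors $R\cdot T$, $C\cdot T$, $Q(A,T)$ are defined by $(X_1,\dots,X_k;X,Y)\mapsto(\mathcal{B}(X,Y)\cdot T)(X_1,\dots,X_k)$ with $\mathcal{B}(X,Y)=\mathcal{R}(X,Y)$, $\mathcal{C}(X,Y)$, $X\wedge_AY$ respectively. Two tensors $T_1,T_2$ are called linearly dependent (on $M$) if they are linearly dependent at every point of $M$; on the set where $T_2\neq0$ this means $T_1=L\,T_2$ for some function $L$. Normalized scalar curvature: $\rho=\frac{2}{n(n-1)}\sum_{i<j}R(E_i,E_j,E_j,E_i)$. Normal curvature: $R^\perp(X,Y;\xi,\eta)=g([A_\xi,A_\eta]X,Y)$,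 and $\rho^\perp=\frac{2}{n(n-1)}\sqrt{\sum_{i<j}\sum_{\alpha<\beta}R^\perp(E_i,E_j;\xi_\alpha,\xi_\beta)^2}$. $M$ is a Wintgen ideal submanifold if $\rho=H^2-\rho^\perp+\widetilde{k}$ everywhere on $M$ (equality in the Wintgen inequality $\rho\le H^2-\rho^\perp+\widetilde{k}$). *)

(* Defs.v *)
From HB Require Import structures.
From mathcomp Require Import all_boot all_order all_algebra.
From mathcomp Require Import all_classical all_reals all_analysis.
Set Implicit Arguments.
Unset Strict Implicit.
Unset Printing Implicit Defensive.
Import Order.TTheory GRing.Theory Num.Theory.
Import numFieldNormedType.Exports.
Local Open Scope classical_set_scope.
Local Open Scope ring_scope.

(** Tangent vectors are row vectors of components in a chart.  Every tensor is
    evaluated at a point of coordinates [x]. *)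

(** [f] is of class C^oo on the open set [V]: all iterated directional
    derivatives are Frechet differentiable at the points of [V].  (Points
    outside [V] do not matter, as [V] is open.) *)
Definition smooth_on (R : realType) (n : nat) (W : normedModType R)
    (V : set 'rV[R]_n) (f : 'rV[R]_n -> W) : Prop :=
  forall (s : seq 'rV[R]_n) (x : 'rV[R]_n), V x ->
    differentiable (foldr (fun v h => 'D_v h) f s) x.

Section Algebra.
Context {R : realType} {n : nat}.
Local Notation V := 'rV[R]_n.
Implicit Types (u v w : V) (G : 'M[R]_n).

Definition ip G u v : R := (u *m G *m v^T) 0 0.

Definition orthonormal G (m : nat) (e : 'I_m -> V) : Prop :=
  forall i j, ip G (e i) (e j) = (i == j)%:R.

Definition basis_vec (k : 'I_n) : V := delta_mx 0 k.

Definition endo_trace (f : V -> V) : R := \tr (lin1_mx f).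

(** The vector [u] such that [ip G u w = l w] for every [w], when [l] is linear
    and [G] is symmetric and invertible. *)
Definition sharp G (l : V -> R) : V := (\row_k l (basis_vec k)) *m invmx G.

(** (X /\_A Y) Z *)
Definition wedge_endo (A : V -> V -> R) u v w : V := A v w *: u - A u w *: v.

Definition kulkarni_nomizu (A B : V -> V -> R) (x1 x2 x y : V) : R :=
  A x1 y * B x2 x + A x2 x * B x1 y - A x1 x * B x2 y - A x2 y * B x1 x.

(** The (0,6)-tensor (x1, ..., x4; x, y) |-> (B(x, y) . T)(x1, ..., x4). *)
Definition endo_act (B : V -> V -> V -> V) (T : V -> V -> V -> V -> R)
    (x1 x2 x3 x4 x y : V) : R :=
  - (T (B x y x1) x2 x3 x4 + T x1 (B x y x2) x3 x4
     + T x1 x2 (B x y x3) x4 + T x1 x2 x3 (B x y x4)).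

(** Q(A, T) *)
Definition tachibana (A : V -> V -> R) := endo_act (wedge_endo A).

Definition lin_dep6 (T1 T2 : V -> V -> V -> V -> V -> V -> R) : Prop :=
  exists a b : R, (a != 0 \/ b != 0) /\
    forall x1 x2 x3 x4 x y,
      a * T1 x1 x2 x3 x4 x y + b * T2 x1 x2 x3 x4 x y = 0.

End Algebra.

(** [G] is the matrix of the metric as a function of the coordinates. *)

Section LocalRiemannian.
Context {R : realType} {n : nat}.
Local Notation V := 'rV[R]_n.
Variable G : V -> 'M[R]_n.
Implicit Types (x u v w z : V) (X Y Z : V -> V).

(** Covariant derivative at [x] of the constant field [v] along [u], from the
    Koszul formula for constant fields (whose brackets vanish). *)
Definition christoffel x u v : V :=
  sharp (G x) (fun w =>
    2^-1 * (ip ('D_u G x) v w + ip ('D_v G x) u w - ip ('D_w G x) u v)).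

Definition nabla X Y : V -> V :=
  fun x => 'D_(X x) Y x + christoffel x (X x) (Y x).

Definition bracket X Y : V -> V :=
  fun x => 'D_(X x) Y x - 'D_(Y x) X x.

Definition curvature_fields X Y Z : V -> V :=
  nabla X (nabla Y Z) \- nabla Y (nabla X Z) \- nabla (bracket X Y) Z.

(** Values at a point, through the constant extensions of the arguments. *)
Definition curv_endo x u v w : V :=
  curvature_fields (cst u) (cst v) (cst w) x.

Definition curv x u v w z : R := ip (G x) (curv_endo x u v w) z.

Definition ricci x u v : R := endo_trace (fun z => curv_endo x z u v).

Definition ricci_op x u : V := sharp (G x) (ricci x u).

Definition scalar_curv x : R := endo_trace (ricci_op x).

Definition weyl_endo x u v w : V :=
  let g := ip (G x) in
  curv_endo x u v w - (n%:R - 2)^-1 *: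
    (wedge_endo g u (ricci_op x v) w + wedge_endo g (ricci_op x u) v w
     - (scalar_curv x / (n%:R - 1)) *: wedge_endo g u v w).

Definition weyl x u v w z : R := ip (G x) (weyl_endo x u v w) z.

Definition area2 x u v : R :=
  ip (G x) u u * ip (G x) v v - ip (G x) u v ^+ 2.

Definition sectional x u v : R := curv x u v v u / area2 x u v.

(** R . C - C . R *)
Definition RC_CR x (x1 x2 x3 x4 u v : V) : R :=
  endo_act (curv_endo x) (weyl x) x1 x2 x3 x4 u v
  - endo_act (weyl_endo x) (curv x) x1 x2 x3 x4 u v.

(** Q(g, g /\ Ricc) *)
Definition Qg_gRic x : V -> V -> V -> V -> V -> V -> R :=
  tachibana (ip (G x)) (kulkarni_nomizu (ip (G x)) (ricci x)).

Definition norm_scalar_curv x (e : 'I_n -> V) : R :=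
  2 / (n%:R * (n%:R - 1)) *
  \sum_(i < n) \sum_(j < n | (i < j)%N) curv x (e i) (e j) (e j) (e i).

End LocalRiemannian.

(** [F] is the local expression of the immersion, [G] and [Gt] are the metrics
    of the submanifold and of the ambient space. *)

Section LocalSubmanifold.
Context {R : realType} {n p m : nat}.
Local Notation V := 'rV[R]_n.
Local Notation W := 'rV[R]_p.
Variables (G : V -> 'M[R]_n) (Gt : W -> 'M[R]_p) (F : V -> W).
Implicit Types (x u v : V) (xi eta : W) (X Y : V -> V).

Definition push X : V -> W := fun x => 'D_(X x) F x.

(** Ambient covariant derivative along [X] of a field [S] of ambient vectors
    along [F]. *)
Definition nabla_along X (S : V -> W) : V -> W :=
  fun x => 'D_(X x) S x + christoffel Gt (F x) (push X x) (S x).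

(** Gauss formula: h(X,Y) is the ambient derivative minus the intrinsic one. *)
Definition second_ff x u v : W :=
  (nabla_along (cst u) (push (cst v)) \- push (nabla G (cst u) (cst v))) x.

Definition normal x xi : Prop :=
  forall u, ip (Gt (F x)) xi ('D_u F x) = 0.

Definition shape_op x xi u : V :=
  sharp (G x) (fun v => ip (Gt (F x)) xi (second_ff x u v)).

Definition mean_vec x (e : 'I_n -> V) : W :=
  n%:R^-1 *: \sum_(i < n) second_ff x (e i) (e i).

Definition mean_curv x (e : 'I_n -> V) : R :=
  Num.sqrt (ip (Gt (F x)) (mean_vec x e) (mean_vec x e)).

Definition normal_curv x u v xi eta : R :=
  ip (G x) (shape_op x xi (shape_op x eta u)
            - shape_op x eta (shape_op x xi u)) v.

Definition norm_normal_curv x (e : 'I_n -> V) (xi : 'I_m -> W) : R :=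
  2 / (n%:R * (n%:R - 1)) * Num.sqrt
    (\sum_(i < n) \sum_(j < n | (i < j)%N)
     \sum_(a < m) \sum_(b < m | (a < b)%N)
       normal_curv x (e i) (e j) (xi a) (xi b) ^+ 2).

Definition orthonormal_normal x (xi : 'I_m -> W) : Prop :=
  (forall a, normal x (xi a)) /\ orthonormal (Gt (F x)) xi.

End LocalSubmanifold.

(** A connected C^oo manifold of dimension [n], given by an atlas which need
    not be maximal. *)
Record manifold (R : realType) (n : nat) := Manifold {
  mf_space :> topologicalType;
  mf_idx : Type;
  mf_dom : mf_idx -> set mf_space;
  mf_chart : mf_idx -> mf_space -> 'rV[R]_n;
  mf_inv : mf_idx -> 'rV[R]_n -> mf_space;
  mf_hausdorff : hausdorff_space mf_space;
  mf_second_countable : @second_countable mf_space;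
  mf_nonempty : [set: mf_space] !=set0;
  mf_connected : connected [set: mf_space];
  mf_cover : forall p, exists i, mf_dom i p;
  mf_dom_open : forall i, open (mf_dom i);
  mf_img_open : forall i, open (mf_chart i @` mf_dom i);
  mf_chartK : forall i p, mf_dom i p -> mf_inv i (mf_chart i p) = p;
  mf_chart_cont : forall i p, mf_dom i p -> {for p, continuous (mf_chart i)};
  mf_inv_cont : forall i x, (mf_chart i @` mf_dom i) x ->
    {for x, continuous (mf_inv i)};
  mf_transition : forall i j,
    smooth_on (mf_chart i @` (mf_dom i `&` mf_dom j))
              (mf_chart j \o mf_inv i)
}.

(** [rm_metric i x] is the matrix of the metric in the chart [i] at the point of
    coordinates [x]. *)
Record riemannian (R : realType) (n : nat) := RiemannianManifold {
  rm_manifold :> manifold R n;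
  rm_metric : mf_idx rm_manifold -> 'rV[R]_n -> 'M[R]_n;
  rm_smooth : forall i,
    smooth_on (mf_chart i @` mf_dom i) (rm_metric i);
  rm_sym : forall i x, (mf_chart i @` mf_dom i) x ->
    (rm_metric i x)^T = rm_metric i x;
  rm_pos : forall i x, (mf_chart i @` mf_dom i) x ->
    forall u, u != 0 -> 0 < ip (rm_metric i x) u u;
  rm_compat : forall i j x, (mf_chart i @` (mf_dom i `&` mf_dom j)) x ->
    let tau := mf_chart j \o mf_inv i in
    forall u v, ip (rm_metric i x) u v
                = ip (rm_metric j (tau x)) ('D_u tau x) ('D_v tau x)
}.

Definition constant_curvature (R : realType) (p : nat) (N : riemannian R p)
    (k : R) : Prop :=
  forall i x, (mf_chart i @` mf_dom i) x ->
  forall u v, area2 (@rm_metric _ _ N i) x u v != 0 ->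
    sectional (rm_metric i) x u v = k.

(** Locally conformal to a flat metric. *)
Definition conformally_flat (R : realType) (n : nat) (M : riemannian R n)
    : Prop :=
  forall i x, (mf_chart i @` mf_dom i) x ->
  exists (U : set 'rV[R]_n) (phi : 'rV[R]_n -> R),
    [/\ open U /\ U x, U `<=` @mf_chart _ _ M i @` mf_dom i,
        smooth_on U phi, (forall y, U y -> 0 < phi y) &
        forall y, U y -> forall u v w,
          curv_endo (fun z => phi z *: rm_metric i z) y u v w = 0].

Definition RC_CR_dep_Q (R : realType) (n : nat) (M : riemannian R n) : Prop :=
  forall i x, (mf_chart i @` mf_dom i) x ->
    lin_dep6 (RC_CR (@rm_metric _ _ M i) x) (Qg_gRic (@rm_metric _ _ M i) x).

Section Submanifold.
Context {R : realType} {n p : nat}.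
Variables (M : riemannian R n) (N : riemannian R p) (f : M -> N).

Definition loc (i : mf_idx M) (j : mf_idx N) : 'rV[R]_n -> 'rV[R]_p :=
  mf_chart j \o f \o mf_inv i.

Definition loc_dom (i : mf_idx M) (j : mf_idx N) : set 'rV[R]_n :=
  mf_chart i @` (mf_dom i `&` f @^-1` mf_dom j).

(** [M] is a submanifold of [N] via [f], and its metric is the induced one;
    the map [f] is then an immersion, the metric of [M] being definite. *)
Definition isometric_immersion : Prop :=
  continuous f /\
  forall i j,
    smooth_on (loc_dom i j) (loc i j) /\
    forall x, loc_dom i j x -> forall u v,
      ip (rm_metric i x) u v
      = ip (rm_metric j (loc i j x)) ('D_u (loc i j) x) ('D_v (loc i j) x).

(** The quantities below do not depend on the charts [i], [j] nor on the
    orthonormal tangent frame [e] and normal frame [xi]. *)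
Definition wintgen_ideal (m : nat) (k : R) : Prop :=
  forall i j x, loc_dom i j x ->
  forall (e : 'I_n -> 'rV[R]_n) (xi : 'I_m -> 'rV[R]_p),
    let G := rm_metric i in let Gt := rm_metric j in
    orthonormal (G x) e ->
    orthonormal_normal Gt (loc i j) x xi ->
    norm_scalar_curv G x e
    = mean_curv G Gt (loc i j) x e ^+ 2
      - norm_normal_curv G Gt (loc i j) x e xi + k.

Definition totally_umbilical : Prop :=
  forall i j x, loc_dom i j x ->
  forall e : 'I_n -> 'rV[R]_n,
    let G := rm_metric i in let Gt := rm_metric j in
    orthonormal (G x) e ->
    forall u v, second_ff G Gt (loc i j) x u v
                = ip (G x) u v *: mean_vec G Gt (loc i j) x e.

End Submanifold.

(* Main.v *)
Require Import Defs.
From HB Require Import structures.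
From mathcomp Require Import all_boot all_order all_algebra.
From mathcomp Require Import all_classical all_reals all_analysis.
From mathcomp Require Import ring lra.
Set Implicit Arguments.
Unset Strict Implicit.
Unset Printing Implicit Defensive.
Import Order.TTheory GRing.Theory Num.Theory.
Import numFieldNormedType.Exports.
Local Open Scope classical_set_scope.
Local Open Scope ring_scope.

(** At a point where the Wintgen equality holds, the Gauss equation turns it into
    the equality case of the DDVV inequality for the tracefree shape operators.
    Hence the point is umbilic, or the tracefree shape operators act on a single
    tangent plane D and the curvature tensor has an explicit planar form.  In the
    latter case the linear dependence of R.C - C.R and Q(g, g /\ Ricc) forces
    R = f (tau g /\ g - 2 P /\ P) with f > 0 and P the orthogonal projection on D.
    No algebra at one point excludes this, but it would hold on an open set: there
    the second Bianchi identity makes f constant and D parallel along ker P, and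
    the Ricci identity for P gives tr (N_T N_S) = - 2 f tau g(T, S) on ker P for
    traceless endomorphisms N_T of the plane D, which is absurd as dim ker P >= 2.

    Conversely an umbilic point has curvature c(x) g /\ g, so the Weyl tensor and
    R.C - C.R vanish.  By Schur c is locally constant, and a solution of
    Hess v = - c v g gives the flat metric g / (1 + v)^2. *)

Opaque derive diff derivable.

(** * Directional derivatives and functions of class C^k *)

Section Calculus.
Context {R : realType} {V : normedModType R}.
Implicit Types x v : V.

(** The DDVV bound rests on an estimate for one symmetric matrix against an orthogonal family. The
    sharp constant follows because any admissible constant above 1 can be lowered, the equality case
    by varying the size of one member. The constant tau = 2(n-3)/((n-1)(n-2)) is the one for which a
    plane spanned by a vector of D and a vector orthogonal to D has the same sectional value for R
    and for the Weyl tensor. The obstacle to differentiating f and P is that they are given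
    pointwise, through chosen vectors. Both are recovered from the trace-free Ricci endomorphism; it
    vanishes at umbilic points and not at the others, so the latter form an open set. The absurdity
    is one of signature: the trace form on traceless 2x2 matrices admits no negative definite
    subspace of dimension 2, and n >= 4 is what gives ker P that dimension. For the converse, Hess v
    = - c v g is an overdetermined linear system in v and its gradient. It is solved along rays, and
    its integrability condition, which is constant curvature, makes the ray solutions solve it in
    all directions. *)

Lemma differentiable_bsum (W : normedModType R) (I : Type) (r : seq I)
    (P : pred I) (F : I -> V -> W) x :
  (forall i, differentiable (F i) x) ->
  differentiable (fun y => \sum_(i <- r | P i) F i y) x.
Proof.
move=> dF; elim: r => [|i r IH].
  have -> : (fun y => \sum_(i <- [::] | P i) F i y) = cst 0.
    by apply/funext => y; rewrite big_nil.
  exact: differentiable_cst.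
have -> : (fun y => \sum_(i0 <- i :: r | P i0) F i0 y) =
   if P i then F i \+ (fun y => \sum_(i <- r | P i) F i y)
   else (fun y => \sum_(i <- r | P i) F i y).
  by apply/funext => y; rewrite big_cons; case: (P i).
by case: (P i) => //; exact: differentiableD.
Qed.

Lemma differentiable_bprod (I : Type) (r : seq I)
    (P : pred I) (F : I -> V -> R) x :
  (forall i, differentiable (F i) x) ->
  differentiable (fun y => \prod_(i <- r | P i) F i y) x.
Proof.
move=> dF; elim: r => [|i r IH].
  have -> : (fun y => \prod_(i <- [::] | P i) F i y) = cst 1.
    by apply/funext => y; rewrite big_nil.
  exact: differentiable_cst.
have -> : (fun y => \prod_(i0 <- i :: r | P i0) F i0 y) =
   if P i then (fun y => F i y * (\prod_(i <- r | P i) F i y))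
   else (fun y => \prod_(i <- r | P i) F i y).
  by apply/funext => y; rewrite big_cons; case: (P i).
by case: (P i) => //; exact: differentiableM.
Qed.

Lemma differentiable_mxP m n (M : V -> 'M[R]_(m, n)) x :
  differentiable M x <-> forall i j, differentiable (fun y => M y i j) x.
Proof.
split=> [dM i j|dM].
  exact: (differentiable_comp dM (differentiable_coord _ i j)).
have -> : M = fun y => \sum_i \sum_j M y i j *: delta_mx i j.
  by apply/funext => y; rewrite -matrix_sum_delta.
apply: differentiable_bsum => i; apply: differentiable_bsum => j.
exact: differentiableZl.
Qed.

Lemma derive_entry m n (M : V -> 'M[R]_(m, n)) x v i j :
  differentiable M x -> 'D_v (fun y => M y i j) x = ('D_v M x) i j.
Proof. by move=> dM; rewrite derive_mx ?mxE//; exact: diff_derivable. Qed.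

Lemma deriveDf (W : normedModType R) (f g : V -> W) x v :
  differentiable f x -> differentiable g x ->
  'D_v (fun y => f y + g y) x = 'D_v f x + 'D_v g x.
Proof. by move=> df dg; apply: deriveD; exact: diff_derivable. Qed.

Lemma deriveBf (W : normedModType R) (f g : V -> W) x v :
  differentiable f x -> differentiable g x ->
  'D_v (fun y => f y - g y) x = 'D_v f x - 'D_v g x.
Proof. by move=> df dg; apply: deriveB; exact: diff_derivable. Qed.

Lemma deriveNf (W : normedModType R) (f : V -> W) x v :
  differentiable f x -> 'D_v (fun y => - f y) x = - 'D_v f x.
Proof. by move=> df; apply: deriveN; exact: diff_derivable. Qed.

Lemma deriveMf (f g : V -> R) x v :
  differentiable f x -> differentiable g x ->
  'D_v (fun y => f y * g y) x = 'D_v f x * g x + f x * 'D_v g x.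
Proof.
move=> df dg; rewrite [LHS]deriveM; [|exact: diff_derivable..].
by rewrite /GRing.scale /= addrC (mulrC (g x)).
Qed.

Lemma derive_bsum (W : normedModType R) (I : Type) (r : seq I)
    (P : pred I) (F : I -> V -> W) x v :
  (forall i, differentiable (F i) x) ->
  'D_v (fun y => \sum_(i <- r | P i) F i y) x = \sum_(i <- r | P i) 'D_v (F i) x.
Proof.
move=> dF; elim: r => [|i r IH].
  rewrite big_nil -[RHS](derive_cst (0 : W) x v); congr ('D_v _ x).
  by apply/funext => y; rewrite big_nil.
rewrite big_cons -IH.
have -> : (fun y => \sum_(i0 <- i :: r | P i0) F i0 y) =
   if P i then (fun y => F i y + (\sum_(i <- r | P i) F i y))
   else (fun y => \sum_(i <- r | P i) F i y).
  by apply/funext => y; rewrite big_cons; case: (P i).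
by case: (P i) => //; rewrite deriveDf//; exact: differentiable_bsum.
Qed.

Lemma differentiable_mulmx m n p (M : V -> 'M[R]_(m, n)) (N : V -> 'M[R]_(n, p)) x :
  differentiable M x -> differentiable N x ->
  differentiable (fun y => M y *m N y) x.
Proof.
move=> /differentiable_mxP dM /differentiable_mxP dN.
apply/differentiable_mxP => i j.
have -> : (fun y => (M y *m N y) i j) = fun y => \sum_k M y i k * N y k j.
  by apply/funext => y; rewrite mxE.
by apply: differentiable_bsum => k; exact: differentiableM.
Qed.

Lemma derive_mulmx m n p (M : V -> 'M[R]_(m, n)) (N : V -> 'M[R]_(n, p)) x v :
  differentiable M x -> differentiable N x ->
  'D_v (fun y => M y *m N y) x = 'D_v M x *m N x + M x *m 'D_v N x.
Proof.
move=> dM dN; apply/matrixP => i j.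
have dM' := (differentiable_mxP _ _).1 dM; have dN' := (differentiable_mxP _ _).1 dN.
rewrite -derive_entry; last exact: differentiable_mulmx.
have -> : (fun y => (M y *m N y) i j) = fun y => \sum_k M y i k * N y k j.
  by apply/funext => y; rewrite mxE.
rewrite derive_bsum; last by move=> k; exact: differentiableM.
rewrite !mxE -big_split /=; apply: eq_bigr => k _.
by rewrite deriveMf// !derive_entry.
Qed.

Lemma differentiable_trmx m n (M : V -> 'M[R]_(m, n)) x :
  differentiable M x -> differentiable (fun y => (M y)^T) x.
Proof.
move=> /differentiable_mxP dM; apply/differentiable_mxP => i j.
have -> : (fun y => (M y)^T i j) = fun y => M y j i by apply/funext => y; rewrite mxE.
exact: dM.
Qed.

Lemma derive_trmx m n (M : V -> 'M[R]_(m, n)) x v :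
  differentiable M x -> 'D_v (fun y => (M y)^T) x = ('D_v M x)^T.
Proof.
move=> dM; apply/matrixP => i j; rewrite mxE -derive_entry; last exact: differentiable_trmx.
rewrite -derive_entry//; congr ('D_v _ x).
by apply/funext => y; rewrite mxE.
Qed.

Lemma differentiable_det n (M : V -> 'M[R]_n) x :
  differentiable M x -> differentiable (fun y => \det (M y)) x.
Proof.
move=> /differentiable_mxP dM.
apply: differentiable_bsum => s; apply: differentiableM; first exact: differentiable_cst.
by apply: differentiable_bprod => i; exact: dM.
Qed.

(** The epsilon form of differentiability, obtained from the little-o one by uniqueness of the
    differential. It serves to differentiate functions known only through estimates, such as the
    solution of a total differential equation. *)
Lemma differentiable_eps (W : normedModType R) (f : V -> W) x (L : {linear V -> W}) :
  continuous L ->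
  (forall e, 0 < e -> \forall h \near (0 : V), `|f (h + x) - f x - L h| <= e * `|h|) ->
  differentiable f x /\ forall v, 'D_v f x = L v.
Proof.
move=> cL fL.
have fo : f \o shift x = cst (f x) + L +o_ (0 : V) id.
  apply/eqaddoP => e e0; near=> h => /=.
  rewrite /= opprD addrA; near: h; exact: fL.
have dL := diff_unique cL fo.
have df : differentiable f x.
  by apply/diff_locallyP; rewrite dL; split.
by split=> // v; rewrite deriveE// dL.
Unshelve. all: by end_near. Qed.

Lemma eps_differentiable (W : normedModType R) (f : V -> W) x e :
  differentiable f x -> 0 < e ->
  \forall h \near (0 : V), `|f (h + x) - f x - 'D_h f x| <= e * `|h|.
Proof.
move=> df e0; have /diff_locallyP[_ /eqaddoP fo] := df.
near=> h; rewrite deriveE//.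
have : `|(f \o shift x - (cst (f x) + 'd f x)) h| <= e * `|h|.
  by near: h; exact: fo.
by rewrite /= opprD addrA.
Unshelve. all: by end_near. Qed.

Lemma near_eq_differentiable (W : normedModType R) (f g : V -> W) x :
  (\near x, f x = g x) -> differentiable f x -> differentiable g x.
Proof.
move=> fg df; have fgx := nbhs_singleton fg.
have cdf := diff_continuous df.
apply: (differentiable_eps cdf _).1 => e e0.
have fg0 : \forall h \near (0 : V), f (h + x) = g (h + x).
  by move: fg; rewrite (near_shift 0 x) subr0.
near=> h.
have <- : f (h + x) = g (h + x) by near: h.
rewrite -fgx -deriveE//; near: h; exact: eps_differentiable.
Unshelve. all: by end_near. Qed.

Lemma differentiable_scale m n (f : V -> R) (M : V -> 'M[R]_(m, n)) x :
  differentiable f x -> differentiable M x ->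
  differentiable (fun y => f y *: M y) x.
Proof.
move=> df /differentiable_mxP dM; apply/differentiable_mxP => i j.
have -> : (fun y => (f y *: M y) i j) = fun y => f y * M y i j.
  by apply/funext => y; rewrite mxE.
exact: differentiableM.
Qed.

Lemma derive_scale m n (f : V -> R) (M : V -> 'M[R]_(m, n)) x v :
  differentiable f x -> differentiable M x ->
  'D_v (fun y => f y *: M y) x = 'D_v f x *: M x + f x *: 'D_v M x.
Proof.
move=> df dM; have dM' := (differentiable_mxP _ _).1 dM.
apply/matrixP => i j; rewrite -derive_entry; last exact: differentiable_scale.
have -> : (fun y => (f y *: M y) i j) = fun y => f y * M y i j.
  by apply/funext => y; rewrite mxE.
by rewrite deriveMf// !mxE derive_entry.
Qed.

Lemma near_unitmx n (M : V -> 'M[R]_n) x :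
  differentiable M x -> M x \in unitmx -> \forall y \near x, M y \in unitmx.
Proof.
move=> /differentiable_det/differentiable_continuous cd Mu.
have d0 : \det (M x) != 0 by rewrite -unitfE -unitmxE.
have : \forall y \near x, \det (M y) != 0.
  by apply: (cd [set z | z != 0]); apply: open_nbhs_nbhs; split => //; exact: open_neq.
by apply: filterS => y; rewrite unitmxE unitfE.
Qed.

Lemma differentiable_invmx n (M : V -> 'M[R]_n) x :
  differentiable M x -> M x \in unitmx -> differentiable (fun y => invmx (M y)) x.
Proof.
move=> dM Mu.
have dd := differentiable_det dM; have nu := near_unitmx dM Mu.
have d0 : \det (M x) != 0 by rewrite -unitfE -unitmxE.
apply: (@near_eq_differentiable _ (fun y => (\det (M y))^-1 *: \adj (M y))).
  by near=> y; rewrite /invmx ifT//; near: y.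
apply: differentiable_scale; first exact: differentiableV.
apply/differentiable_mxP => i j.
have -> : (fun y => (\adj (M y)) i j) = fun y => (-1) ^+ (j + i) * \det (row' j (col' i (M y))).
  by apply/funext => y; rewrite mxE.
apply: differentiableM; first exact: differentiable_cst.
apply: differentiable_det; apply/differentiable_mxP => k l.
have -> : (fun y => (row' j (col' i (M y))) k l) = fun y => M y (lift j k) (lift i l).
  by apply/funext => y; rewrite !mxE.
exact: (differentiable_mxP _ _).1 dM _ _.
Unshelve. all: by end_near. Qed.

Lemma derive_invmx n (M : V -> 'M[R]_n) x v :
  differentiable M x -> M x \in unitmx ->
  'D_v (fun y => invmx (M y)) x = - (invmx (M x) *m 'D_v M x *m invmx (M x)).
Proof.
move=> dM Mu; have dI := differentiable_invmx dM Mu.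
have H : 'D_v (fun y => M y *m invmx (M y)) x = 0.
  rewrite -[RHS](derive_cst (1%:M : 'M[R]_n) x v); apply: near_eq_derive.
  have nu := near_unitmx dM Mu.
  by near=> y; rewrite mulmxV//; near: y.
move: H; rewrite derive_mulmx// => /(congr1 (mulmx (invmx (M x)))).
by rewrite mulmx0 mulmxDr mulKmx// mulmxA => /eqP; rewrite addrC addr_eq0 => /eqP.
Unshelve. all: by end_near. Qed.

Lemma derive_dirD (W : normedModType R) (f : V -> W) x u v :
  differentiable f x -> 'D_(u + v) f x = 'D_u f x + 'D_v f x.
Proof. by move=> df; rewrite !deriveE// linearD. Qed.

Lemma derive_dirZ (W : normedModType R) (f : V -> W) x (a : R) u :
  differentiable f x -> 'D_(a *: u) f x = a *: 'D_u f x.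
Proof. by move=> df; rewrite !deriveE// linearZ. Qed.

Lemma derive_dirZR (f : V -> R) x (a : R) u :
  differentiable f x -> 'D_(a *: u) f x = a * 'D_u f x.
Proof. by move=> df; rewrite derive_dirZ. Qed.

Lemma derive_chain (U W : normedModType R) (f : V -> U) (g : U -> W) x v :
  differentiable f x -> differentiable g (f x) ->
  'D_v (fun y => g (f y)) x = 'D_('D_v f x) g (f x).
Proof.
move=> df dg; rewrite deriveE; last exact: differentiable_comp.
by rewrite (diff_comp df dg) /= !deriveE.
Qed.

Lemma is_derive_line (W : normedModType R) (f : V -> W) y u t :
  differentiable f (t *: u + y) ->
  is_derive t 1 (fun s => f (s *: u + y)) ('D_u f (t *: u + y)).
Proof.
move=> df.
have dl : differentiable (fun s : R => s *: u + y) t.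
  by apply: differentiableD; [exact: differentiableZl|exact: differentiable_cst].
apply: DeriveDef.
  by apply: diff_derivable; apply: differentiable_comp.
have D1 : 'D_(1:R) (fun s : R => s *: u + y) t = u.
  rewrite deriveE// (diffD _ (differentiable_cst _ _)); last exact: differentiableZl.
  by rewrite diff_cst /= addr0 diffZl// diff_val /= scale1r.
by rewrite deriveE; [|exact: differentiable_comp];
  rewrite (diff_comp dl df) /= -!deriveE// D1.
Qed.

Section Young.
Variables (f : V -> R) (x : V).
Hypothesis df : \forall y \near x, differentiable f y.

(** The second difference is the increment over [0, h] of the function [phi] below, so the mean
    value theorem turns it into h times a difference of D_u f at two points near x;
    differentiability of D_u f at x then gives the estimate. *)
Lemma young_half u v e : differentiable ('D_u f) x -> 0 < e ->
  \forall h \near 0^'+,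
    `|f (h *: u + h *: v + x) - f (h *: u + x) - f (h *: v + x) + f x
      - h ^+ 2 * 'D_v ('D_u f) x| <= e * h ^+ 2.
Proof.
(* The errors at two displacements, of sizes at most h(|u| + |v|) and h|u|, are added at the end;
   the final 1 keeps [K] positive. *)
move=> dg e0; pose K := `|u| + `|v| + `|u| + 1.
have K0 : 0 < K by rewrite ltr_wpDl// !addr_ge0.
have e'0 : 0 < e / K by rewrite divr_gt0.
have [d1 /= d10 H1] := (nbhs_ballP _ _).1 (eps_differentiable dg e'0).
have [d2 /= d20 H2] := (nbhs_ballP _ _).1 df.
near=> h.
have h0 : 0 < h by [].
have hd1 : h * K < d1.
  rewrite -ltr_pdivlMr//; near: h; apply: nbhs_right_lt; exact: divr_gt0.
have hd2 : h * K < d2.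
  rewrite -ltr_pdivlMr//; near: h; apply: nbhs_right_lt; exact: divr_gt0.
have B1 t : 0 <= t <= h -> `|t *: u| <= h * `|u|.
  by case/andP=> t0 th; rewrite normrZ ger0_norm// ler_wpM2r.
have B2 t : 0 <= t <= h -> `|t *: u + h *: v| <= h * (`|u| + `|v|).
  move=> th; rewrite (le_trans (ler_normD _ _))// mulrDr lerD// ?B1//.
  by rewrite normrZ ger0_norm// ltW.
have le1 : h * `|u| <= h * K.
  by rewrite ler_pM2l// /K -!addrA lerDl !addr_ge0.
have le2 : h * (`|u| + `|v|) <= h * K.
  by rewrite ler_pM2l// /K -!addrA lerD2l lerDl addr_ge0.
have inb d w : `|w| < d -> ball x d (w + x).
  by move=> wd; rewrite -ball_normE /ball_ /= opprD addrCA subrr addr0 normrN.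
have inb0 d w : `|w| < d -> ball (0 : V) d w.
  by move=> wd; rewrite -ball_normE /ball_ /= sub0r normrN.
pose phi t : R := f (t *: u + (h *: v + x)) - f (t *: u + x).
pose dphi t : R := 'D_u f (t *: u + (h *: v + x)) - 'D_u f (t *: u + x).
have dphiP t : 0 <= t <= h -> is_derive t 1 phi (dphi t).
  move=> th; apply: is_deriveB.
    apply: is_derive_line; apply: H2; rewrite addrA; apply: inb.
    by apply: le_lt_trans hd2; apply: le_trans le2; exact: B2.
  apply: is_derive_line; apply: H2; apply: inb.
  by apply: le_lt_trans hd2; apply: le_trans le1; exact: B1.
have [t th ft] : exists2 t, t \in `[0, h]%R & phi h - phi 0 = dphi t * (h - 0).
  apply: MVT_segment; first exact: ltW.
    by move=> t; rewrite in_itv /= => /andP[t0 th]; apply: dphiP; rewrite !ltW.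
  apply: derivable_within_continuous => t; rewrite in_itv /= => th.
  by have [] := dphiP _ th.
have {}th : 0 <= t <= h by move: th; rewrite in_itv.
have -> : f (h *: u + h *: v + x) - f (h *: u + x) - f (h *: v + x) + f x =
   phi h - phi 0.
  by rewrite /phi !scale0r !add0r opprB !addrA; ring.
rewrite ft subr0.
have -> : dphi t * h - h ^+ 2 * 'D_v ('D_u f) x = h * (dphi t - h * 'D_v ('D_u f) x) by ring.
rewrite normrM gtr0_norm// expr2 mulrCA ler_pM2l//.
have -> : dphi t - h * 'D_v ('D_u f) x =
    ('D_u f (t *: u + h *: v + x) - 'D_u f x - 'D_(t *: u + h *: v) ('D_u f) x)
  - ('D_u f (t *: u + x) - 'D_u f x - 'D_(t *: u) ('D_u f) x).
  rewrite derive_dirD// (derive_dirZR h)// (derive_dirZR t)// /dphi addrA.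
  move: ('D_u f _) ('D_u f _) ('D_u f _) ('D_u ('D_u f) x) ('D_v ('D_u f) x).
  by move=> a b c d d'; ring.
rewrite (le_trans (ler_normB _ _))//.
have b1 : `|t *: u + h *: v| < d1.
  by apply: le_lt_trans hd1; apply: le_trans le2; exact: B2.
have b2 : `|t *: u| < d1.
  by apply: le_lt_trans hd1; apply: le_trans le1; exact: B1.
have := lerD (H1 _ (inb0 _ _ b1)) (H1 _ (inb0 _ _ b2)) => /le_trans; apply.
rewrite -mulrDr -ler_pdivlMl// invfM invrK mulrA (mulrAC _ K) mulVf ?gt_eqF// mul1r.
have := lerD (B2 _ th) (B1 _ th) => /le_trans; apply.
by rewrite -mulrDr mulrC ler_pM2r// /K lerDl.
Unshelve. all: by end_near. Qed.

Let young_close (a b c d p q e h : R) : 0 < h ->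
  `|a - b - c + d - h * p| <= e / 2 * h -> `|a - c - b + d - h * q| <= e / 2 * h ->
  `|p - q| <= e.
Proof.
move=> h0 A1 A2; rewrite -(ler_pM2r h0) -{1}(gtr0_norm h0) -normrM.
have -> : (p - q) * h = (a - c - b + d - h * q) - (a - b - c + d - h * p) by ring.
by rewrite (le_trans (ler_normB _ _))// (splitr e) mulrDl lerD.
Qed.

(** The second difference is symmetric in u and v, and divided by h^2 it is close to both mixed
    derivatives. *)
Lemma young u v : differentiable ('D_u f) x -> differentiable ('D_v f) x ->
  'D_v ('D_u f) x = 'D_u ('D_v f) x.
Proof.
move=> du dv; apply/eqP; rewrite -subr_eq0 -normr_le0; apply/ler_addgt0Pr => e e0.
rewrite add0r; have e20 : 0 < e / 2 by rewrite divr_gt0.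
have N1 := young_half v du e20; have N2 := young_half u dv e20.
near (0:R)^'+ => h.
have h0 : 0 < h by [].
have h2 : 0 < h ^+ 2 by rewrite exprn_gt0.
have Euv : f (h *: v + h *: u + x) = f (h *: u + h *: v + x) by congr (f (_ + _)); exact: addrC.
have A1 : `|f (h *: u + h *: v + x) - f (h *: u + x) - f (h *: v + x) + f x
      - h ^+ 2 * 'D_v ('D_u f) x| <= e / 2 * h ^+ 2.
  exact: (near N1 h).
have A2 : `|f (h *: v + h *: u + x) - f (h *: v + x) - f (h *: u + x) + f x
      - h ^+ 2 * 'D_u ('D_v f) x| <= e / 2 * h ^+ 2.
  exact: (near N2 h).
rewrite Euv in A2.
exact: young_close h2 A1 A2.
Unshelve. all: by end_near. Qed.
End Young.

End Calculus.

Opaque derive diff derivable.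
Section Calculus.
Context {R : realType} {V : normedModType R}.
Implicit Types x v : V.
Lemma young_mx m n (M : V -> 'M[R]_(m, n)) x u v :
  (\forall y \near x, differentiable M y) ->
  differentiable ('D_u M) x -> differentiable ('D_v M) x ->
  'D_v ('D_u M) x = 'D_u ('D_v M) x.
Proof.
move=> dM du dv.
apply/matrixP => i j.
have E1 := derive_entry v i j du.
have E2 := derive_entry u i j dv.
rewrite <- E1.
rewrite <- E2.
have E w : \forall y \near x, 'D_w M y i j = 'D_w (fun y => M y i j) y.
  by apply: filterS dM => y dy; rewrite derive_entry.
have dE w : differentiable ('D_w M) x -> differentiable ('D_w (fun y => M y i j)) x.
  move=> dw; apply: (near_eq_differentiable (E w)).
  exact: (differentiable_mxP _ _).1 dw _ _.
rewrite (near_eq_derive v (E u)) (near_eq_derive u (E v)).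
apply: young; [|exact: dE..].
by apply: filterS dM => y /differentiable_mxP.
Qed.

End Calculus.

(** A locked copy of the directional derivative, so that rewriting and unification treat it as
    atomic. *)
HB.lock Definition pd (R : realType) (V W : normedModType R) (u : V) (f : V -> W) (x : V) : W :=
  'D_u f x.

Lemma pdE (R : realType) (V W : normedModType R) (u : V) (f : V -> W) :
  'D_u f = pd u f.
Proof. by apply/funext => x; rewrite unlock. Qed.

Lemma pdEx (R : realType) (V W : normedModType R) (u : V) (f : V -> W) x :
  'D_u f x = pd u f x.
Proof. by rewrite unlock. Qed.

Section PartialDerivatives.
Context {R : realType} {V : normedModType R}.
Implicit Types x u v : V.
Local Notation dfb := (@differentiable R V).

Lemma pd_cst (W : normedModType R) (a : W) x v : pd v (cst a) x = 0.
Proof. by rewrite unlock; exact: derive_cst. Qed.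

Lemma pd_near_eq (W : normedModType R) (f g : V -> W) x v :
  (\near x, f x = g x) -> pd v f x = pd v g x.
Proof. by rewrite !unlock; exact: near_eq_derive. Qed.

Lemma pdD (W : normedModType R) (f g : V -> W) x v :
  differentiable f x -> differentiable g x ->
  pd v (fun y => f y + g y) x = pd v f x + pd v g x.
Proof. by rewrite !unlock; exact: deriveDf. Qed.

Lemma pdB (W : normedModType R) (f g : V -> W) x v :
  differentiable f x -> differentiable g x ->
  pd v (fun y => f y - g y) x = pd v f x - pd v g x.
Proof. by rewrite !unlock; exact: deriveBf. Qed.

Lemma pdN (W : normedModType R) (f : V -> W) x v :
  differentiable f x -> pd v (fun y => - f y) x = - pd v f x.
Proof. by rewrite !unlock; exact: deriveNf. Qed.

Lemma pdM (f g : V -> R) x v :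
  differentiable f x -> differentiable g x ->
  pd v (fun y => f y * g y) x = pd v f x * g x + f x * pd v g x.
Proof. by rewrite !unlock; exact: deriveMf. Qed.

Lemma pd_bsum (W : normedModType R) (I : Type) (r : seq I)
    (P : pred I) (F : I -> V -> W) x v :
  (forall i, differentiable (F i) x) ->
  pd v (fun y => \sum_(i <- r | P i) F i y) x = \sum_(i <- r | P i) pd v (F i) x.
Proof. by move=> dF; rewrite [pd]unlock derive_bsum. Qed.

Lemma pd_mulmx m n p (M : V -> 'M[R]_(m, n)) (N : V -> 'M[R]_(n, p)) x v :
  differentiable M x -> differentiable N x ->
  pd v (fun y => M y *m N y) x = pd v M x *m N x + M x *m pd v N x.
Proof. by rewrite [pd]unlock; exact: derive_mulmx. Qed.

Lemma pd_trmx m n (M : V -> 'M[R]_(m, n)) x v :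
  differentiable M x -> pd v (fun y => (M y)^T) x = (pd v M x)^T.
Proof. by rewrite [pd]unlock; exact: derive_trmx. Qed.

Lemma pd_entry m n (M : V -> 'M[R]_(m, n)) x v i j :
  differentiable M x -> pd v (fun y => M y i j) x = (pd v M x) i j.
Proof. by rewrite [pd]unlock; exact: derive_entry. Qed.

Lemma pd_scale m n (f : V -> R) (M : V -> 'M[R]_(m, n)) x v :
  differentiable f x -> differentiable M x ->
  pd v (fun y => f y *: M y) x = pd v f x *: M x + f x *: pd v M x.
Proof. by rewrite !unlock; exact: derive_scale. Qed.

Lemma pd_invmx n (M : V -> 'M[R]_n) x v :
  differentiable M x -> M x \in unitmx ->
  pd v (fun y => invmx (M y)) x = - (invmx (M x) *m pd v M x *m invmx (M x)).
Proof. by rewrite [pd]unlock; exact: derive_invmx. Qed.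

Lemma pd_dirD (W : normedModType R) (f : V -> W) x u v :
  differentiable f x -> pd (u + v) f x = pd u f x + pd v f x.
Proof. by rewrite unlock; exact: derive_dirD. Qed.

Lemma pd_dirZ (W : normedModType R) (f : V -> W) x (a : R) u :
  differentiable f x -> pd (a *: u) f x = a *: pd u f x.
Proof. by rewrite unlock; exact: derive_dirZ. Qed.

Lemma pd_dir0 (W : normedModType R) (f : V -> W) x : pd 0 f x = 0.
Proof. by rewrite unlock; exact: derive0. Qed.

Lemma pd_chain (U W : normedModType R) (f : V -> U) (g : U -> W) x v :
  differentiable f x -> differentiable g (f x) ->
  pd v (fun y => g (f y)) x = pd (pd v f x) g (f x).
Proof. by move=> df dg; rewrite [pd]unlock; exact: derive_chain. Qed.

Lemma pd_line (W : normedModType R) (f : V -> W) y u (t : R) :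
  differentiable f (t *: u + y) ->
  is_derive t 1 (fun s => f (s *: u + y)) (pd u f (t *: u + y)).
Proof. by rewrite unlock; exact: is_derive_line. Qed.

Lemma pd_sym m n (M : V -> 'M[R]_(m, n)) x u v :
  (\forall y \near x, differentiable M y) ->
  differentiable (pd u M) x -> differentiable (pd v M) x ->
  pd v (pd u M) x = pd u (pd v M) x.
Proof. by rewrite -!pdE; exact: young_mx. Qed.

Lemma pd_Rinv (f : V -> R) x v : differentiable f x -> f x != 0 ->
  pd v (fun y => (f y)^-1) x = - (f x ^- 2 * pd v f x).
Proof.
move=> df f0; have dV : differentiable (fun y => (f y)^-1) x by exact: differentiableV.
have H : pd v (fun y => f y * (f y)^-1) x = 0.
  rewrite -(pd_cst (1 : R) x v); apply: pd_near_eq.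
  have : \forall y \near x, f y != 0.
    have cd := differentiable_continuous df.
    by apply: (cd [set z | z != 0]);
       apply: open_nbhs_nbhs; split => //; exact: open_neq.
  by apply: filterS => y y0; rewrite divff.
move: H; rewrite pdM// => /eqP; rewrite addrC addr_eq0 => /eqP E.
apply: (mulfI f0); rewrite E expr2 invfM; field.
by rewrite f0.
Qed.

Lemma differentiable_pd_eps (W : normedModType R) (f : V -> W) x (L : {linear V -> W}) :
  continuous L ->
  (forall e, 0 < e -> \forall h \near (0 : V), `|f (h + x) - f x - L h| <= e * `|h|) ->
  differentiable f x /\ forall v, pd v f x = L v.
Proof. by rewrite [pd]unlock; exact: differentiable_eps. Qed.

End PartialDerivatives.

Section Ck.
Context {R : realType} {V : normedModType R}.
Implicit Types (x v : V) (U : set V).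

(** The order is shifted by one: [Ck 0] already asks for differentiability on [U], and [Ck k] for
    that of all iterated directional derivatives of length at most [k]. *)
Fixpoint Ck (W : normedModType R) (k : nat) U (f : V -> W) : Prop :=
  (forall x, U x -> differentiable f x) /\
  if k is k'.+1 then forall v, Ck k' U (pd v f) else True.

Lemma Ck_diff (W : normedModType R) k U (f : V -> W) x :
  Ck k U f -> U x -> differentiable f x.
Proof. by case: k => [|k] -[df _]; exact: df. Qed.

Lemma Ck_pd (W : normedModType R) k U (f : V -> W) v : Ck k.+1 U f -> Ck k U (pd v f).
Proof. by move=> [_ h]; exact: h. Qed.

Lemma CkW (W : normedModType R) k U (f : V -> W) : Ck k.+1 U f -> Ck k U f.
Proof.
by elim: k f => [|k IH] f [df Df]; split => // v; apply: IH; exact: Df.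
Qed.

Lemma Ck_ext (W : normedModType R) k U (f g : V -> W) : open U ->
  (forall x, U x -> f x = g x) -> Ck k U f -> Ck k U g.
Proof.
move=> oU; have nU x : U x -> \forall y \near x, U y by move=> Ux; exact: open_nbhs_nbhs.
elim: k f g => [|k IH] f g fg [df Df]; split=> //.
- by move=> x Ux; apply: (near_eq_differentiable _ (df _ Ux)); apply: filterS (nU x Ux) => y; exact: fg.
- by move=> x Ux; apply: (near_eq_differentiable _ (df _ Ux)); apply: filterS (nU x Ux) => y; exact: fg.
move=> v; apply: (IH (pd v f) _ _ (Df v)) => x Ux.
by apply: pd_near_eq; apply: filterS (nU x Ux) => y; exact: fg.
Qed.

Lemma Ck_subset (W : normedModType R) k U U' (f : V -> W) :
  U' `<=` U -> Ck k U f -> Ck k U' f.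
Proof.
move=> UU; elim: k f => [|k IH] f [df Df]; split=> //.
- by move=> x /UU; exact: df.
- by move=> x /UU; exact: df.
- by move=> v; apply: IH; exact: Df.
Qed.

Lemma Ck_cst (W : normedModType R) k U (a : W) : Ck k U (cst a).
Proof.
elim: k a => [|k IH] a; split=> //; try by move=> x _; exact: differentiable_cst.
move=> v; have -> : pd v (cst a) = cst 0 by apply/funext => x; exact: pd_cst.
exact: IH.
Qed.

Lemma Ck_add (W : normedModType R) k U (f g : V -> W) : open U ->
  Ck k U f -> Ck k U g -> Ck k U (fun y => f y + g y).
Proof.
move=> oU; elim: k f g => [|k IH] f g [df Df] [dg Dg]; split => //;
  try by move=> x Ux; apply: differentiableD; auto.
move=> v; apply: (Ck_ext oU) (IH _ _ (Df v) (Dg v)) => x Ux.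
by rewrite pdD; auto.
Qed.

Lemma Ck_opp (W : normedModType R) k U (f : V -> W) : open U ->
  Ck k U f -> Ck k U (fun y => - f y).
Proof.
move=> oU; elim: k f => [|k IH] f [df Df]; split => //;
  try by move=> x Ux; apply: differentiableN; auto.
move=> v; apply: (Ck_ext oU) (IH _ (Df v)) => x Ux.
by rewrite pdN; auto.
Qed.

Lemma Ck_mulmx k m n p U (M : V -> 'M[R]_(m, n)) (N : V -> 'M[R]_(n, p)) : open U ->
  Ck k U M -> Ck k U N -> Ck k U (fun y => M y *m N y).
Proof.
move=> oU; elim: k M N => [|k IH] M N CM CN; have [dM DM] := CM; have [dN DN] := CN;
  split => //; try by move=> x Ux; apply: differentiable_mulmx; auto.
move=> v; have := Ck_add oU (IH _ _ (DM v) (CkW CN)) (IH _ _ (CkW CM) (DN v)).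
by apply: (Ck_ext oU) => x Ux; rewrite pd_mulmx; auto.
Qed.

Lemma Ck_scale k m n U (f : V -> R) (M : V -> 'M[R]_(m, n)) : open U ->
  Ck k U f -> Ck k U M -> Ck k U (fun y => f y *: M y).
Proof.
move=> oU; elim: k f M => [|k IH] f M Cf CM; have [df Df] := Cf; have [dM DM] := CM;
  split => //; try by move=> x Ux; apply: differentiable_scale; auto.
move=> v; have := Ck_add oU (IH _ _ (Df v) (CkW CM)) (IH _ _ (CkW Cf) (DM v)).
by apply: (Ck_ext oU) => x Ux; rewrite pd_scale; auto.
Qed.

Lemma Ck_mul k U (f g : V -> R) : open U ->
  Ck k U f -> Ck k U g -> Ck k U (fun y => f y * g y).
Proof.
move=> oU; elim: k f g => [|k IH] f g Cf Cg; have [df Df] := Cf; have [dg Dg] := Cg;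
  split => //; try by move=> x Ux; apply: differentiableM; auto.
move=> v; have := Ck_add oU (IH _ _ (Df v) (CkW Cg)) (IH _ _ (CkW Cf) (Dg v)).
by apply: (Ck_ext oU) => x Ux; rewrite pdM; auto.
Qed.

Lemma Ck_trmx k m n U (M : V -> 'M[R]_(m, n)) : open U ->
  Ck k U M -> Ck k U (fun y => (M y)^T).
Proof.
move=> oU; elim: k M => [|k IH] M [dM DM]; split => //;
  try by move=> x Ux; apply: differentiable_trmx; auto.
move=> v; apply: (Ck_ext oU) (IH _ (DM v)) => x Ux.
by rewrite pd_trmx; auto.
Qed.

Lemma Ck_entry k m n U (M : V -> 'M[R]_(m, n)) i j : open U ->
  Ck k U M -> Ck k U (fun y => M y i j).
Proof.
move=> oU; elim: k M => [|k IH] M [dM DM]; split => //;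
  try by move=> x Ux; have /differentiable_mxP := dM _ Ux; exact.
move=> v; apply: (Ck_ext oU) (IH _ (DM v)) => x Ux.
by rewrite pd_entry; auto.
Qed.

Lemma Ck_sum (W : normedModType R) (I : Type) (r : seq I) (P : pred I) k U
    (F : I -> V -> W) : open U ->
  (forall i, Ck k U (F i)) -> Ck k U (fun y => \sum_(i <- r | P i) F i y).
Proof.
move=> oU CF; elim: r => [|i r IH].
  by apply: (Ck_ext oU) (Ck_cst _ _ _) => x _; rewrite big_nil.
case Pi : (P i).
  by apply: (Ck_ext oU) (Ck_add oU (CF i) IH) => x _; rewrite big_cons Pi.
by apply: (Ck_ext oU) IH => x _; rewrite big_cons Pi.
Qed.

Lemma Ck_mx k m n U (M : V -> 'M[R]_(m, n)) : open U ->
  (forall i j, Ck k U (fun y => M y i j)) -> Ck k U M.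
Proof.
move=> oU CM.
have : Ck k U (fun y => \sum_i \sum_j M y i j *: delta_mx i j).
  apply: Ck_sum => // i; apply: Ck_sum => // j; apply: Ck_scale => //.
  exact: Ck_cst.
by apply: (Ck_ext oU) => x _; rewrite -matrix_sum_delta.
Qed.

(** The derivative of the inverse is a product of the inverse and the derivative of [M], so the
    induction on the order closes. *)
Lemma Ck_invmx k n U (M : V -> 'M[R]_n) : open U -> (forall x, U x -> M x \in unitmx) ->
  Ck k U M -> Ck k U (fun y => invmx (M y)).
Proof.
move=> oU uM; elim: k => [|k IH] CM; have [dM DM] := CM; split => //;
  try by move=> x Ux; apply: differentiable_invmx; auto.
move=> v; have CI := IH (CkW CM).
have := Ck_opp oU (Ck_mulmx oU (Ck_mulmx oU CI (DM v)) CI).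
by apply: (Ck_ext oU) => x Ux; rewrite pd_invmx; auto.
Qed.

Lemma Ck_Rinv k U (f : V -> R) : open U -> (forall x, U x -> f x != 0) ->
  Ck k U f -> Ck k U (fun y => (f y)^-1).
Proof.
move=> oU uf; elim: k => [|k IH] Cf; have [df Df] := Cf; split => //;
  try by move=> x Ux; apply: differentiableV; auto.
move=> v; have CI := IH (CkW Cf).
have := Ck_opp oU (Ck_mul oU (Ck_mul oU CI CI) (Df v)).
by apply: (Ck_ext oU) => x Ux; rewrite pd_Rinv; auto; rewrite expr2 invfM.
Qed.

End Ck.

(** In [foldr] the head of the list is the outermost derivative, so the one taken first is the last
    element; both directions therefore peel the list from its end. *)
Lemma smooth_onP (R : realType) (n : nat) (W : normedModType R)
    (U : set 'rV[R]_n) (f : 'rV[R]_n -> W) :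
  smooth_on U f <-> forall k, Ck k U f.
Proof.
split=> [+ k|Cf s x Ux].
  elim: k f => [|k IH] f sf; split=> //; try exact: (sf [::]).
  move=> v; apply: IH => s x Ux; have := sf (rcons s v) x Ux.
  by rewrite foldr_rcons pdE.
suff /(_ x Ux) : forall x, U x -> differentiable (foldr (fun v h => 'D_v h) f s) x by [].
have : exists k, (size s <= k)%N by exists (size s).
move=> [k]; have : Ck k U f by [].
elim/last_ind: s k {x Ux} f {Cf} => [|s v IH] k f Cf sk x Ux.
  exact: (Ck_diff Cf).
rewrite foldr_rcons pdE; rewrite size_rcons in sk.
by case: k Cf sk => // k Cf sk; apply: (IH k) => //; exact: Ck_pd.
Qed.

(** * Inner products given by a matrix *)

Section InnerProduct.
Context {R : realType} {n : nat}.
Implicit Types (G : 'M[R]_n) (u v w : 'rV[R]_n).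

Lemma ipDl G u v w : ip G (u + v) w = ip G u w + ip G v w.
Proof. by rewrite /ip !mulmxDl mxE. Qed.
Lemma ipDr G u v w : ip G w (u + v) = ip G w u + ip G w v.
Proof. by rewrite /ip linearD mulmxDr mxE. Qed.
Lemma ipZl G a u w : ip G (a *: u) w = a * ip G u w.
Proof. by rewrite /ip -!scalemxAl mxE. Qed.
Lemma ipZr G a u w : ip G w (a *: u) = a * ip G w u.
Proof. by rewrite /ip linearZ /= -scalemxAr mxE. Qed.
Lemma ipNl G u w : ip G (- u) w = - ip G u w.
Proof. by rewrite -scaleN1r ipZl mulN1r. Qed.
Lemma ipNr G u w : ip G w (- u) = - ip G w u.
Proof. by rewrite -scaleN1r ipZr mulN1r. Qed.
Lemma ipBl G u v w : ip G (u - v) w = ip G u w - ip G v w.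
Proof. by rewrite ipDl ipNl. Qed.
Lemma ipBr G u v w : ip G w (u - v) = ip G w u - ip G w v.
Proof. by rewrite ipDr ipNr. Qed.
Lemma ip0l G u : ip G 0 u = 0.
Proof. by rewrite -(scale0r 0) ipZl mul0r. Qed.
Lemma ip0r G u : ip G u 0 = 0.
Proof. by rewrite -(scale0r 0) ipZr mul0r. Qed.
Lemma ipDm G1 G2 u v : ip (G1 + G2) u v = ip G1 u v + ip G2 u v.
Proof. by rewrite /ip mulmxDr mulmxDl mxE. Qed.
Lemma ipZm a G u v : ip (a *: G) u v = a * ip G u v.
Proof. by rewrite /ip -scalemxAr -scalemxAl mxE. Qed.
Lemma ip0m u v : ip 0 u v = 0.
Proof. by rewrite /ip mulmx0 mul0mx mxE. Qed.

Lemma ip_suml G (I : Type) (r : seq I) (P : pred I) (F : I -> 'rV[R]_n) w :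
  ip G (\sum_(i <- r | P i) F i) w = \sum_(i <- r | P i) ip G (F i) w.
Proof. by apply: (big_morph (fun u => ip G u w)) => [u v|]; rewrite ?ipDl ?ip0l. Qed.
Lemma ip_sumr G (I : Type) (r : seq I) (P : pred I) (F : I -> 'rV[R]_n) w :
  ip G w (\sum_(i <- r | P i) F i) = \sum_(i <- r | P i) ip G w (F i).
Proof. by apply: (big_morph (ip G w)) => [u v|]; rewrite ?ipDr ?ip0r. Qed.

Lemma ip_tr G u v : ip G^T u v = ip G v u.
Proof.
rewrite /ip; have <- : (u *m G^T *m v^T)^T = v *m G *m u^T.
  by rewrite !trmx_mul !trmxK mulmxA.
by rewrite [RHS]mxE.
Qed.

Lemma ip_inj G u v : G \in unitmx -> (forall w, ip G u w = ip G v w) -> u = v.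
Proof.
move=> Gu H; apply: (can_inj (mulmxK Gu)); apply/rowP => j.
by have := H (basis_vec j); rewrite /ip /basis_vec trmx_delta -!colE !mxE.
Qed.

Lemma posdef_unitmx G : (forall u, u != 0 -> 0 < ip G u u) -> G \in unitmx.
Proof.
move=> pos; rewrite -row_free_unit; apply/row_freeP.
have : kermx G = 0.
  apply/row_matrixP => i; rewrite row0; apply/eqP; apply/negP => /negP /pos.
  rewrite /ip -row_mul mulmx_ker row0 mul0mx mxE ltxx //.
by move/eqP; rewrite kermx_eq0 => /row_freeP.
Qed.

Lemma sharpP G (l : 'rV[R]_n -> R) w : G^T = G -> G \in unitmx ->
  (forall a u v, l (a *: u + v) = a * l u + l v) -> ip G (sharp G l) w = l w.
Proof.
move=> Gs Gu lin; rewrite /ip /sharp mulmxKV// mxE.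
have l0 : l 0 = 0.
  by have := lin (-1) 0 0; rewrite scaler0 addr0 mulN1r addNr.
have lsum : l (\sum_k w 0 k *: basis_vec k) = \sum_k w 0 k * l (basis_vec k).
  elim/big_rec2: _ => [//|k y1 y2 _ <-].
  by rewrite lin.
rewrite {2}[w]row_sum_delta lsum; apply: eq_bigr => k _.
by rewrite !mxE mulrC.
Qed.

End InnerProduct.

Section InnerProductCalculus.
Context {R : realType} {V : normedModType R} {n : nat}.
Implicit Types (G : V -> 'M[R]_n) (a b : V -> 'rV[R]_n).

Lemma differentiable_ip G a b x : differentiable G x -> differentiable a x ->
  differentiable b x -> differentiable (fun y => ip (G y) (a y) (b y)) x.
Proof.
move=> dG da db; have : differentiable (fun y => a y *m G y *m (b y)^T) x.
  by do !apply: differentiable_mulmx => //; exact: differentiable_trmx.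
by move/differentiable_mxP; exact.
Qed.

Lemma pd_ip G a b x w : differentiable G x -> differentiable a x ->
  differentiable b x -> pd w (fun y => ip (G y) (a y) (b y)) x =
  ip (pd w G x) (a x) (b x) + ip (G x) (pd w a x) (b x) + ip (G x) (a x) (pd w b x).
Proof.
move=> dG da db.
have d1 := differentiable_mulmx da dG; have d2 := differentiable_trmx db.
rewrite /ip pd_entry; last exact: differentiable_mulmx.
rewrite pd_mulmx// pd_mulmx// pd_trmx// mulmxDl !mxE.
by rewrite (addrC (\sum_j (_ *m _) _ _ * _)).
Qed.

Lemma Ck_ip k (U : set V) G a b : open U -> Ck k U G -> Ck k U a -> Ck k U b ->
  Ck k U (fun y => ip (G y) (a y) (b y)).
Proof.
move=> oU CG Ca Cb; apply: (Ck_entry 0 0 oU).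
by apply: Ck_mulmx => //; [exact: Ck_mulmx|exact: Ck_trmx].
Qed.
End InnerProductCalculus.

(** * Local Riemannian geometry in a chart *)

Ltac mx_zmod :=
  repeat match goal with |- context [?a *m ?b] =>
    let X := fresh "X" in set X := (a *m b); move: X => X end;
  apply/matrixP => ? ?; rewrite !mxE; ring.

(** A Riemannian metric on an open set of coordinates. The local geometry is developed for it, so
    that it applies to charts as well as to the smaller open sets that appear on the way. *)
Record metric_on (R : realType) (n : nat) (G : 'rV[R]_n -> 'M[R]_n)
    (U : set 'rV[R]_n) : Prop := MetricOn {
  mo_open : open U;
  mo_smooth : forall k, Ck k U G;
  mo_sym : forall x, U x -> (G x)^T = G x;
  mo_pos : forall x, U x -> forall u : 'rV[R]_n, u != 0 -> 0 < ip (G x) u u }.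

Section LocalGeometry.
Context {R : realType} {n : nat}.
Local Notation V := 'rV[R]_n.
Variables (G : V -> 'M[R]_n) (U : set V).
Hypothesis gm : metric_on G U.
Let oU := mo_open gm.
Let sG := mo_smooth gm.
Let symG := mo_sym gm.
Let posG := mo_pos gm.
Implicit Types (x u v w z : V).
Local Notation chr := (christoffel G).

Lemma nearU x : U x -> \forall y \near x, U y.
Proof. by move=> Ux; exact: open_nbhs_nbhs. Qed.

Lemma unitG x : U x -> G x \in unitmx.
Proof. by move=> Ux; apply: posdef_unitmx; exact: posG. Qed.

Lemma dG x : U x -> differentiable G x.
Proof. by move=> Ux; exact: (Ck_diff (sG 0%N)). Qed.

Lemma dpdG u x : U x -> differentiable (pd u G) x.
Proof. by move=> Ux; apply: (Ck_diff (Ck_pd _ (sG 1%N))). Qed.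

Lemma ipC x u v : U x -> ip (G x) u v = ip (G x) v u.
Proof. by move=> Ux; rewrite -{1}(symG Ux) ip_tr. Qed.

Lemma ip_pdC x w u v : U x -> ip (pd w G x) u v = ip (pd w G x) v u.
Proof.
move=> Ux; rewrite -ip_tr -pd_trmx; last exact: dG.
congr (ip _ _ _); apply: pd_near_eq.
by apply: filterS (nearU Ux) => y; exact: symG.
Qed.

Lemma chrE x u v : chr x u v = sharp (G x) (fun w =>
  2^-1 * (ip (pd u G x) v w + ip (pd v G x) u w - ip (pd w G x) u v)).
Proof. by rewrite /christoffel; congr (sharp _ _); apply/funext => w; rewrite !pdEx. Qed.

Lemma koszul x u v w : U x -> ip (G x) (chr x u v) w =
  2^-1 * (ip (pd u G x) v w + ip (pd v G x) u w - ip (pd w G x) u v).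
Proof.
move=> Ux; rewrite chrE sharpP//; [exact: symG|exact: unitG|] => a p q.
rewrite !(ipDr, ipZr) pd_dirD; last exact: dG.
rewrite pd_dirZ; last exact: dG.
rewrite ipDm ipZm; ring.
Qed.

Lemma chr_eqP x a b : U x -> (forall w, ip (G x) a w = ip (G x) b w) -> a = b.
Proof. by move=> Ux; apply: ip_inj; exact: unitG. Qed.

Lemma chrC x u v : U x -> chr x u v = chr x v u.
Proof.
move=> Ux; apply: (chr_eqP Ux) => w; rewrite !koszul//.
by rewrite (ip_pdC _ u v Ux) (addrC (ip _ v w)).
Qed.

Lemma chrDr x u v w : U x -> chr x u (v + w) = chr x u v + chr x u w.
Proof.
move=> Ux; apply: (chr_eqP Ux) => z; rewrite ipDl !koszul//.
by rewrite pd_dirD ?ipDl ?ipDr ?ipDm; [ring|exact: dG].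
Qed.

Lemma chrZr x a u v : U x -> chr x u (a *: v) = a *: chr x u v.
Proof.
move=> Ux; apply: (chr_eqP Ux) => z; rewrite ipZl !koszul//.
by rewrite pd_dirZ ?ipZl ?ipZr ?ipZm; [ring|exact: dG].
Qed.

Lemma chrDl x u v w : U x -> chr x (v + w) u = chr x v u + chr x w u.
Proof. by move=> Ux; rewrite chrC// chrDr// !(chrC u)// ![chr x u _]chrC. Qed.

Lemma chrZl x a u v : U x -> chr x (a *: v) u = a *: chr x v u.
Proof. by move=> Ux; rewrite chrC// chrZr// [chr x u _]chrC. Qed.

Lemma metric_compat x w u v : U x ->
  ip (pd w G x) u v = ip (G x) (chr x w u) v + ip (G x) u (chr x w v).
Proof.
move=> Ux; rewrite (ipC u)// !koszul// (ip_pdC _ v u Ux) (ip_pdC u w v Ux) (ip_pdC v w u Ux).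
by field.
Qed.

Lemma Ck_chr k u v : Ck k U (fun x => chr x u v).
Proof.
apply: (Ck_ext (f := fun x => (\row_k (2^-1 * (ip (pd u G x) v (basis_vec k)
   + ip (pd v G x) u (basis_vec k) - ip (pd (basis_vec k) G x) u v))) *m invmx (G x))) => //.
  by move=> x Ux; rewrite chrE.
apply: Ck_mulmx => //; last by apply: Ck_invmx => // x Ux; exact: unitG.
apply: Ck_mx => // i j.
have C w a b : Ck k U (fun x => ip (pd w G x) a b).
  apply: Ck_ip => //; [exact: Ck_pd|exact: Ck_cst|exact: Ck_cst].
have := Ck_mul oU (Ck_cst k U (2^-1 : R)) (Ck_add oU (Ck_add oU (C u v (basis_vec j)) (C v u (basis_vec j))) (Ck_opp oU (C (basis_vec j) u v))).
by apply: Ck_ext => // x Ux; rewrite mxE.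
Qed.

Lemma d_chr u v x : U x -> differentiable (fun x => chr x u v) x.
Proof. by move=> Ux; exact: (Ck_diff (Ck_chr 0 u v)). Qed.

(** The connection matrix of [u], acting on row vectors from the right; it turns iterated
    Christoffel symbols into matrix products, which can be differentiated. *)
Definition cmx x u : 'M[R]_n := \matrix_i chr x u (basis_vec i).

Lemma mul_cmx x u w : U x -> w *m cmx x u = chr x u w.
Proof.
move=> Ux.
have cs (I : Type) (r : seq I) (F : I -> V) :
    chr x u (\sum_(i <- r) F i) = \sum_(i <- r) chr x u (F i).
  elim: r => [|i r IH]; last by rewrite !big_cons chrDr// IH.
  by have := chrZr 0 u 0 Ux; rewrite !big_nil !scale0r.
rewrite mulmx_sum_row {2}[w]row_sum_delta cs; apply: eq_bigr => i _.
by rewrite rowK chrZr.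
Qed.

Lemma Ck_cmx k u : Ck k U (fun x => cmx x u).
Proof.
apply: Ck_mx => // i j; have := Ck_entry 0 j oU (Ck_chr k u (basis_vec i)).
by apply: Ck_ext => // x Ux; rewrite [RHS]mxE.
Qed.

Lemma d_cmx u x : U x -> differentiable (fun x => cmx x u) x.
Proof. by move=> Ux; exact: (Ck_diff (Ck_cmx 0 u)). Qed.

Lemma cmx_sym x u v : U x -> u *m cmx x v = v *m cmx x u.
Proof. by move=> Ux; rewrite !mul_cmx// chrC. Qed.

Lemma pd_cmx x u v w : U x -> w *m pd v (fun y => cmx y u) x = pd v (fun y => chr y u w) x.
Proof.
move=> Ux; have -> : pd v (fun y => chr y u w) x = pd v (fun y => w *m cmx y u) x.
  by apply: pd_near_eq; apply: filterS (nearU Ux) => y Uy; rewrite mul_cmx.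
rewrite pd_mulmx; [|exact: differentiable_cst|exact: d_cmx].
by rewrite pd_cst mul0mx add0r.
Qed.

Lemma nabla_cstE v w : nabla G (cst v) (cst w) = fun y => chr y v w.
Proof. by apply/funext => y; rewrite /nabla derive_cst add0r. Qed.

Lemma curv_endoE x u v w : curv_endo G x u v w =
  (pd u (fun y => chr y v w) x + chr x u (chr x v w))
  - (pd v (fun y => chr y u w) x + chr x v (chr x u w)).
Proof.
rewrite /curv_endo /curvature_fields !nabla_cstE /= {1 2 3}/nabla !pdEx.
have -> : bracket (cst u) (cst v) = cst 0.
  by apply/funext => y; rewrite /bracket !derive_cst subrr.
rewrite pd_dir0 add0r /=.
suff -> : chr x 0 w = 0 by rewrite subr0.
rewrite chrE /sharp.
have -> : (\row_k (2^-1 * (ip (pd 0 G x) w (basis_vec k) + ip (pd w G x) 0 (basis_vec k)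
      - ip (pd (basis_vec k) G x) 0 w))) = 0 :> 'rV[R]_n.
  by apply/rowP => k; rewrite !mxE pd_dir0 ip0m !ip0l addr0 subrr mulr0.
by rewrite mul0mx.
Qed.

Lemma curv_endo_skew x u v w : curv_endo G x u v w = - curv_endo G x v u w.
Proof. by rewrite !curv_endoE opprB. Qed.

(** The curvature endomorphism as a matrix acting from the right, hence with the products in the
    order opposite to the composition of covariant derivatives. *)
Definition rmx x u v : 'M[R]_n :=
  (pd u (fun y => cmx y v) x + cmx x v *m cmx x u)
  - (pd v (fun y => cmx y u) x + cmx x u *m cmx x v).

Lemma mul_rmx x u v w : U x -> w *m rmx x u v = curv_endo G x u v w.
Proof.
move=> Ux; rewrite mulmxBr !mulmxDr !mulmxA !pd_cmx// !mul_cmx//.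
by rewrite curv_endoE.
Qed.

Lemma bianchi1 x u v w : U x ->
  curv_endo G x u v w + curv_endo G x v w u + curv_endo G x w u v = 0.
Proof.
move=> Ux; rewrite !curv_endoE.
have E a b c : pd a (fun y => chr y b c) x = pd a (fun y => chr y c b) x.
  by apply: pd_near_eq; apply: filterS (nearU Ux) => y Uy; exact: chrC.
rewrite (E u w v) (E v u w) (E w v u) (chrC w v)// (chrC u w)// (chrC v u)//.
move: (pd _ _ _) (pd _ _ _) (pd _ _ _) (chr x _ _) (chr x _ _) (chr x _ _) => a b c d e f.
by apply/rowP => j; rewrite !mxE; ring.
Qed.

(** Metric compatibility moves one covariant derivative onto the last argument. In this form the
    skew symmetry in w and z only needs the second derivatives of the metric to commute. *)
Lemma curvE x u v w z : U x -> curv G x u v w z =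
  pd u (fun y => ip (G y) (chr y v w) z) x - ip (G x) (chr x v w) (chr x u z)
  - (pd v (fun y => ip (G y) (chr y u w) z) x - ip (G x) (chr x u w) (chr x v z)).
Proof.
move=> Ux; have E a b : pd a (fun y => ip (G y) (chr y b w) z) x =
    ip (pd a G x) (chr x b w) z + ip (G x) (pd a (fun y => chr y b w) x) z.
  rewrite (pd_ip (b := cst z)); [|exact: dG|exact: d_chr|exact: differentiable_cst].
  by rewrite pd_cst ip0r addr0.
rewrite !E !metric_compat// /curv curv_endoE ipBl !ipDl.
by do 6!move: (ip _ _ _); move=> a b c d e f; ring.
Qed.

Lemma curv_skew34 x u v w z : U x -> curv G x u v w z = - curv G x u v z w.
Proof.
move=> Ux; apply/eqP; rewrite -addr_eq0 !curvE//.
have E a b : pd a (fun y => ip (G y) (chr y b w) z) x + pd a (fun y => ip (G y) (chr y b z) w) x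
   = ip (pd a (pd b G) x) w z.
  have d c p q : differentiable (fun y => ip (G y) (chr y c p) q) x.
    by apply: (differentiable_ip (b := cst q)); [exact: dG|exact: d_chr|exact: differentiable_cst].
  rewrite -pdD//; transitivity (pd a (fun y => ip (pd b G y) w z) x).
    apply: pd_near_eq; apply: filterS (nearU Ux) => y Uy.
    by rewrite metric_compat// (ipC w).
  rewrite (pd_ip (a := cst w) (b := cst z)); [|exact: dpdG|exact: differentiable_cst..].
  by rewrite !pd_cst ip0r ip0l !addr0.
have S : pd u (pd v G) x = pd v (pd u G) x.
  by apply: pd_sym; [apply: filterS (nearU Ux) => y; exact: dG|exact: dpdG..].
have H := etrans (E u v) (etrans (f_equal (fun M => ip M w z) S) (esym (E v u))).
rewrite (ipC (chr x v w) (chr x u z))// (ipC (chr x u w) (chr x v z))//.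
apply/eqP; move: H; do 4!move: (pd _ _ _); move: (ip _ _ _) (ip _ _ _).
by move=> a b p q r s; lra.
Qed.

(** [S a b c] is the covariant derivative of the curvature along a, without the terms in which the
    connection acts on b and c. The cyclic sum vanishes by symmetry of second derivatives and the
    Jacobi identity for the connection matrices. *)
Lemma bianchi2 x t u v : U x ->
  let S a b c := pd a (fun y => rmx y b c) x + rmx x b c *m cmx x a - cmx x a *m rmx x b c in
  S t u v + S u v t + S v t u = 0.
Proof.
move=> Ux S.
have dp a b y : U y -> differentiable (pd a (fun y => cmx y b)) y.
  by move=> Uy; apply: (Ck_diff (Ck_pd _ (Ck_cmx 1%N b))).
have SE a b c : pd a (fun y => rmx y b c) x =
  (pd a (pd b (fun y => cmx y c)) x +
    (pd a (fun y => cmx y c) x *m cmx x b + cmx x c *m pd a (fun y => cmx y b) x))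
  - (pd a (pd c (fun y => cmx y b)) x +
    (pd a (fun y => cmx y b) x *m cmx x c + cmx x b *m pd a (fun y => cmx y c) x)).
  have dm p q : differentiable (fun y => cmx y p *m cmx y q) x.
    by apply: differentiable_mulmx; exact: d_cmx.
  rewrite pdB; [|by apply: differentiableD; [exact: dp|exact: dm]..].
  rewrite !pdD; [|exact: dp|exact: dm|exact: dp|exact: dm].
  by rewrite !pd_mulmx//; exact: d_cmx.
have Y a b c : pd a (pd b (fun y => cmx y c)) x = pd b (pd a (fun y => cmx y c)) x.
  by apply: pd_sym; [apply: filterS (nearU Ux) => y Uy; exact: d_cmx|exact: dp..].
rewrite /S !SE (Y u t v) (Y v u t) (Y v t u) /rmx.
rewrite !(mulmxBl, mulmxBr, mulmxDl, mulmxDr) !mulmxA.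
move: (pd _ (pd _ _) _) (pd _ (pd _ _) _) (pd _ (pd _ _) _) => a b c.
mx_zmod.
Qed.

End LocalGeometry.

(** * Algebraic curvature tensors *)

Section CurvatureLike.
Context {R : realType} {n : nat}.
Local Notation V := 'rV[R]_n.
Implicit Types (u v w z : V) (T : V -> V -> V -> V -> R).

Record curvature_like T : Prop := CurvatureLike {
  cl_lin1 : forall a u u' v w z, T (a *: u + u') v w z = a * T u v w z + T u' v w z;
  cl_lin3 : forall a u v w w' z, T u v (a *: w + w') z = a * T u v w z + T u v w' z;
  cl_skew12 : forall u v w z, T u v w z = - T v u w z;
  cl_skew34 : forall u v w z, T u v w z = - T u v z w;
  cl_bianchi : forall u v w z, T u v w z + T v w u z + T w u v z = 0 }.

Lemma cl_lin2 T : curvature_like T ->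
  forall a u v v' w z, T u (a *: v + v') w z = a * T u v w z + T u v' w z.
Proof.
by move=> cT a u v v' w z; rewrite (cl_skew12 cT) (cl_lin1 cT) !(cl_skew12 cT _ u); ring.
Qed.

Lemma cl_lin4 T : curvature_like T ->
  forall a u v w z z', T u v w (a *: z + z') = a * T u v w z + T u v w z'.
Proof.
by move=> cT a u v w z z'; rewrite (cl_skew34 cT) (cl_lin3 cT) !(cl_skew34 cT _ _ _ w); ring.
Qed.

(** The pair symmetry is a linear combination of four Bianchi identities and of skew symmetries; the
    instances involved are handed to linear arithmetic. *)
Lemma cl_pair T : curvature_like T -> forall u v w z, T u v w z = T w z u v.
Proof.
move=> cT u v w z; have B := cl_bianchi cT; have S1 := cl_skew12 cT; have S2 := cl_skew34 cT.
have := B u v w z; have := B v w z u; have := B w z u v; have := B z u v w.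
have := S1 u w v z; have := S2 v w u z; have := S2 w u v z; have := S1 v w u z.
have := S1 u v w z; have := S2 u v w z; have := S1 w z u v; have := S2 w z u v.
have := S2 v u w z; have := S2 z w u v; have := S1 z u w v; have := S2 z u w v.
have := S1 v z u w; have := S2 v z u w; have := S2 z v u w; have := S2 u z w v.
have := S1 w u z v; have := S1 v w z u; have := S1 u z v w; have := S1 z v w u.
have := S1 w z v u; have := S1 v u z w; have := S1 v u w z; have := S1 u v z w.
lra.
Qed.

Lemma cl_add1 T : curvature_like T -> forall u u' v w z, T (u + u') v w z = T u v w z + T u' v w z.
Proof. by move=> cT u u' v w z; rewrite -{1}(scale1r u) (cl_lin1 cT) mul1r. Qed.
Lemma cl_add2 T : curvature_like T -> forall u v v' w z, T u (v + v') w z = T u v w z + T u v' w z.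
Proof. by move=> cT u v v' w z; rewrite -{1}(scale1r v) (cl_lin2 cT) mul1r. Qed.
Lemma cl_add3 T : curvature_like T -> forall u v w w' z, T u v (w + w') z = T u v w z + T u v w' z.
Proof. by move=> cT u v w w' z; rewrite -{1}(scale1r w) (cl_lin3 cT) mul1r. Qed.
Lemma cl_add4 T : curvature_like T -> forall u v w z z', T u v w (z + z') = T u v w z + T u v w z'.
Proof. by move=> cT u v w z z'; rewrite -{1}(scale1r z) (cl_lin4 cT) mul1r. Qed.

(** Polarisation in the outer and then in the middle arguments makes the tensor skew in every
    adjacent pair, hence invariant under cyclic permutation of the first three arguments, and the
    Bianchi identity reads 3T = 0. *)
Lemma cl_eq0 T : curvature_like T -> (forall u v, T u v v u = 0) ->
  forall u v w z, T u v w z = 0.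
Proof.
move=> cT T0.
have H1 u v z : T u v v z = 0.
  have := T0 (u + z) v; rewrite !(cl_add1 cT, cl_add4 cT) !T0.
  by rewrite (cl_pair cT z v v u) (cl_skew12 cT v u) (cl_skew34 cT u v z) opprK; lra.
move=> u v w z.
have P a b c : T a b c z = - T a c b z.
  have := H1 a (b + c) z; rewrite !(cl_add2 cT, cl_add3 cT) !H1; lra.
have := cl_bianchi cT u v w z; have := P v w u; have := P w u v; have := P u v w.
have := cl_skew12 cT u v w z; have := cl_skew12 cT v w u z; have := cl_skew12 cT w u v z.
have := P v u w; have := P u w v; have := P w v u.
lra.
Qed.

Variable G : 'M[R]_n.
Hypotheses (symG : G^T = G) (posG : forall u, u != 0 -> 0 < ip G u u).
Local Notation g := (ip G).

(** The curvature tensor of constant curvature 1 in the present sign convention: [gg u v v u] is the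
    squared area spanned by u and v. *)
Definition gg u v w z : R := g v w * g u z - g u w * g v z.

Lemma ip_sym u v : g u v = g v u.
Proof. by rewrite -{1}symG ip_tr. Qed.

Lemma gg_curvature_like : curvature_like gg.
Proof.
split=> [a u u' v w z|a u v w w' z|u v w z|u v w z|u v w z];
  rewrite /gg ?ipDl ?ipDr ?ipZl ?ipZr; try ring.
by rewrite (ip_sym w v) (ip_sym w u) (ip_sym v u); ring.
Qed.

Lemma ip_eq0 u : g u u = 0 -> u = 0.
Proof.
move=> H; apply/eqP/negPn/negP => /posG.
by rewrite H ltxx.
Qed.

(** The difference with k times [gg] is a curvature tensor that vanishes on nondegenerate pairs; on
    a degenerate pair the equality case of Cauchy-Schwarz makes the vectors proportional. *)
Lemma constant_sectional T k : curvature_like T ->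
  (forall u v, gg u v v u != 0 -> T u v v u / gg u v v u = k) ->
  forall u v w z, T u v w z = k * gg u v w z.
Proof.
move=> cT sT u v w z; pose S u v w z := T u v w z - k * gg u v w z.
suff : S u v w z = 0 by move/eqP; rewrite subr_eq0 => /eqP.
have cg := gg_curvature_like.
apply: cl_eq0 u v w z.
  split=> [a u u' v w z|a u v w w' z|u v w z|u v w z|u v w z]; rewrite /S.
  - by rewrite (cl_lin1 cT) (cl_lin1 cg); ring.
  - by rewrite (cl_lin3 cT) (cl_lin3 cg); ring.
  - by rewrite (cl_skew12 cT) (cl_skew12 cg); ring.
  - by rewrite (cl_skew34 cT) (cl_skew34 cg); ring.
  - rewrite (_ : _ + _ = (T u v w z + T v w u z + T w u v z)
        - k * (gg u v w z + gg v w u z + gg w u v z)); last by ring.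
    by rewrite (cl_bianchi cT) (cl_bianchi cg) mulr0 subr0.
move=> u v; rewrite /S; have [a0|a0] := eqVneq (gg u v v u) 0; last first.
  by rewrite -[k](sT u v a0) divfK// subrr.
rewrite a0 mulr0 subr0; have [->|v0] := eqVneq v 0.
  by have := cl_lin2 cT (-1) u 0 0 0 u; rewrite scaler0 addr0 mulN1r addNr.
have vv := posG v0; pose c := g u v / g v v.
have vv0 : g v v != 0 by rewrite gt_eqF.
have : u - c *: v = 0.
  apply: ip_eq0; rewrite !(ipBl, ipBr, ipZl, ipZr) (ip_sym v u) /c.
  apply: (mulfI vv0); rewrite mulr0 -a0 /gg (ip_sym v u); field.
  by [].
move/eqP; rewrite subr_eq0 => /eqP ->.
have Z w z : T v v w z = 0 by have := cl_skew12 cT v v w z; lra.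
by have := cl_lin1 cT c v 0 v v (c *: v); rewrite addr0 Z mulr0 add0r
  => ->; have := cl_lin1 cT (-1) 0 0 v v (c *: v); rewrite scaler0 addr0 mulN1r addNr.
Qed.

End CurvatureLike.

(** * Orthonormal frames and traces *)

Section Frames.
Context {R : realType} {n : nat}.
Local Notation V := 'rV[R]_n.
Variable G : 'M[R]_n.
Hypotheses (symG : G^T = G) (posG : forall u : V, u != 0 -> 0 < ip G u u).
Local Notation g := (ip G).

Lemma orthonormal_extend1 a (e : nat -> V) : (a < n)%N ->
  (forall i j, (i < a)%N -> (j < a)%N -> g (e i) (e j) = (i == j)%:R) ->
  exists v, g v v = 1 /\ forall i, (i < a)%N -> g v (e i) = 0 /\ g (e i) v = 0.
Proof.
move=> an eo; pose M : 'M[R]_(n, a) := \matrix_(k, j) (G *m (e j)^T) k 0.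
have : kermx M != 0.
  rewrite kermx_eq0 /row_free; apply/negP => /eqP rM.
  by have := rank_leq_col M; rewrite rM leqNgt an.
move=> /rowV0Pn [w /sub_kermxP wM w0].
have ww := posG w0; have sw : Num.sqrt (g w w) != 0 by rewrite gt_eqF// sqrtr_gt0.
have we i : (i < a)%N -> g w (e i) = 0.
  move=> ia; have /rowP/(_ (Ordinal ia)) := wM.
  rewrite !mxE => H; rewrite /ip -mulmxA mxE -[RHS]H.
  by apply: eq_bigr => k _; rewrite !mxE.
exists ((Num.sqrt (g w w))^-1 *: w); split.
  by rewrite ipZl ipZr mulrA -invfM -expr2 sqr_sqrtr ?mulVf ?gt_eqF// ltW.
by move=> i ia; rewrite ipZl ipZr (ip_sym symG (e i)) we// mulr0.
Qed.

(** Frames are indexed by [nat] with only the values below the bound constrained, which lets a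
    partial frame grow without casts between ordinals. *)
Lemma orthonormal_extend a (e : nat -> V) : (a <= n)%N ->
  (forall i j, (i < a)%N -> (j < a)%N -> g (e i) (e j) = (i == j)%:R) ->
  exists e' : nat -> V, (forall i, (i < a)%N -> e' i = e i) /\
  (forall i j, (i < n)%N -> (j < n)%N -> g (e' i) (e' j) = (i == j)%:R).
Proof.
move=> an; have [d nE] : exists d, (n = a + d)%N by exists (n - a)%N; rewrite subnKC.
elim: d a e an nE => [|d IH] a e an nE eo.
  have na : a = n by rewrite nE addn0.
  by exists e; split => // i j ii jj; apply: eo; rewrite na.
have an' : (a < n)%N by rewrite nE addnS ltnS leq_addr.
have [v [vv ve]] := orthonormal_extend1 an' eo.
pose e1 i := if (i < a)%N then e i else v.
have [] := IH a.+1 e1 an'; first by rewrite nE addnS addSn.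
  move=> i j ia ja; rewrite /e1.
  have E k : (k < a.+1)%N -> (a <= k)%N -> k = a.
    by move=> k1 k2; apply/eqP; rewrite eqn_leq k2 -ltnS k1.
  case: (ltnP i a) => ia'; case: (ltnP j a) => ja'.
  - exact: eo.
  - by rewrite (ve i ia').2 (E j ja ja') (ltn_eqF ia').
  - by rewrite (ve j ja').1 (E i ia ia') (gtn_eqF ja').
  - by rewrite vv (E i ia ia') (E j ja ja') eqxx.
move=> e' [e'1 e'o]; exists e'; split => // i ia.
by rewrite e'1 ?ltnS 1?ltnW// /e1 ia.
Qed.

Lemma orthonormal_exists : exists e : 'I_n -> V, Defs.orthonormal G e.
Proof.
have [e [_ eo]] := @orthonormal_extend 0 (fun=> 0) (leq0n _) (fun i j => ltac:(by [])).
by exists (fun i => e i) => i j; rewrite eo.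
Qed.

Variable e : 'I_n -> V.
Hypothesis eo : Defs.orthonormal G e.

(** Orthonormality says that the frame matrix E has right inverse G E^T; that this is also a left
    inverse is the expansion. *)
Lemma frame_expand u : u = \sum_i g u (e i) *: e i.
Proof.
pose E : 'M[R]_n := \matrix_i e i.
have EGE : E *m (G *m E^T) = 1%:M.
  apply/matrixP => i j; rewrite [RHS]mxE -eo mulmxA /ip.
  rewrite [LHS]mxE [RHS]mxE; apply: eq_bigr => k _.
  congr (_ * _); last by rewrite !mxE.
  by rewrite !mxE; apply: eq_bigr => l _; rewrite !mxE.
have := mulmx1C EGE => H.
rewrite -{1}[u]mulmx1 -H mulmxA mulmx_sum_row; apply: eq_bigr => i _.
congr (_ *: _); last by rewrite rowK.
rewrite /ip -mulmxA [RHS]mxE [LHS]mxE; apply: eq_bigr => k _; congr (_ * _).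
by rewrite !mxE; apply: eq_bigr => l _; rewrite !mxE.
Qed.

Lemma frame_ip u v : g u v = \sum_i g u (e i) * g v (e i).
Proof.
rewrite {1}(frame_expand v) ip_sumr; apply: eq_bigr => i _.
by rewrite ipZr mulrC.
Qed.

Lemma frame_trace (f : V -> V) :
  (forall a u v, f (a *: u + v) = a *: f u + f v) ->
  endo_trace f = \sum_i g (f (e i)) (e i).
Proof.
move=> flin.
have f0 : f 0 = 0 by have := flin (-1) 0 0; rewrite scaler0 addr0 scaleN1r addNr.
have fM u : f u = u *m lin1_mx f.
  have fs : f (\sum_k u 0 k *: delta_mx 0 k) = \sum_k u 0 k *: f (delta_mx 0 k).
    by elim/big_rec2: _ => [//|k y1 y2 _ <-]; rewrite flin.
  rewrite {1}[u]row_sum_delta fs mulmx_sum_row; apply: eq_bigr => k _.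
  by congr (_ *: _); apply/rowP => j; rewrite !mxE.
rewrite /endo_trace; move: (lin1_mx f) fM => M fM.
pose E : 'M[R]_n := \matrix_i e i.
have EGE : E *m (G *m E^T) = 1%:M.
  apply/matrixP => i j; rewrite [RHS]mxE -eo mulmxA /ip.
  rewrite [LHS]mxE [RHS]mxE; apply: eq_bigr => k _.
  congr (_ * _); last by rewrite !mxE.
  by rewrite !mxE; apply: eq_bigr => l _; rewrite !mxE.
have H := mulmx1C EGE.
rewrite -[M]mulmx1 -H mulmxA mxtrace_mulC mulmxA; apply: eq_bigr => i _.
have rE (A : 'M[R]_n) j : (E *m A) i j = (e i *m A) 0 j.
  by rewrite !mxE; apply: eq_bigr => l _; rewrite !mxE.
have cE (X : V) : (X *m E^T) 0 i = (X *m (e i)^T) 0 0.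
  by rewrite !mxE; apply: eq_bigr => k _; rewrite !mxE.
by rewrite fM /ip -!mulmxA rE !mulmxA cE.
Qed.

End Frames.

(** * The DDVV inequality and its equality case *)

Section Spectral.
Context {R : realType} {n : nat}.
Local Notation V := 'rV[R]_n.
Local Notation dot := (@ip R n 1%:M).
Variable A : 'M[R]_n.
Hypothesis symA : A^T = A.

Let sym1 : (1%:M : 'M[R]_n)^T = 1%:M. Proof. exact: trmx1. Qed.

Lemma dotE (u v : V) : dot u v = \sum_i u 0 i * v 0 i.
Proof. by rewrite /ip mulmx1 mxE; apply: eq_bigr => i _; rewrite mxE. Qed.

Lemma dot_pos (u : V) : u != 0 -> 0 < dot u u.
Proof.
move=> u0; rewrite dotE lt_def sumr_ge0 ?andbT => [|i _]; last exact: sqr_ge0.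
apply: contra u0 => /eqP H; apply/eqP/rowP => i; rewrite mxE.
have : u 0 i ^+ 2 = 0.
  by apply: (psumr_eq0P _ H) => // j _; exact: sqr_ge0.
by move/eqP; rewrite sqrf_eq0 => /eqP.
Qed.

Lemma dot_continuous (B : 'M[R]_n) (w : V) : continuous (fun u : V => ip B u w).
Proof.
move=> u; apply: differentiable_continuous.
by apply: (differentiable_ip (G := cst B) (a := id) (b := cst w));
  [exact: differentiable_cst| |exact: differentiable_cst].
Qed.

Lemma dot_continuous2 (B : 'M[R]_n) : continuous (fun u : V => ip B u u).
Proof.
move=> u; apply: differentiable_continuous.
by apply: (differentiable_ip (G := cst B) (a := id) (b := id));
  [exact: differentiable_cst|..].
Qed.

(** The quadratic form of A attains a maximum on the compact set of unit vectors orthogonal to the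
    eigenvectors already found, and a maximiser is an eigenvector. *)
Lemma eigenvector_extend a (e : nat -> V) (d : nat -> R) : (a < n)%N ->
  (forall i j, (i < a)%N -> (j < a)%N -> dot (e i) (e j) = (i == j)%:R) ->
  (forall i, (i < a)%N -> e i *m A = d i *: e i) ->
  exists v l, [/\ dot v v = 1, forall i, (i < a)%N -> dot v (e i) = 0 /\ dot (e i) v = 0
    & v *m A = l *: v].
Proof.
move=> an eo eA; pose D := [set w : V | dot w w = 1 /\ forall i : 'I_a, dot w (e i) = 0].
have D0 : D !=set0.
  have [v [vv ve]] := orthonormal_extend1 sym1 dot_pos an eo.
  by exists v; split => // i; rewrite (ve i _).1.
have cD : compact D.
  apply: bounded_closed_compact.
    exists 1; split=> [|M M1 w [ww _] /=]; first exact: num_real.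
    rewrite [leLHS]/Num.Def.normr /= mx_normrE; apply: bigmax_le => [|[i j] _ /=].
      exact: le_trans (ltW M1).
    apply: le_trans (ltW M1); rewrite (ord1 i) -(@ler_pXn2r _ 2)// ?nnegrE//.
    rewrite expr1n real_normK ?num_real// -ww dotE (bigD1 j)//= expr2 lerDl.
    by apply: sumr_ge0 => k _; exact: sqr_ge0.
  have -> : D = [set w | dot w w = 1] `&` \bigcap_(i in [set: 'I_a]) [set w | dot w (e i) = 0].
    by apply/seteqP; split=> w [H1 H2]; split=> // i; [move=> _|]; exact: H2.
  apply: closedI.
    apply: (@preimage_closed _ _ (fun w : V => dot w w) [set x | x = 1]) => [w _|]; [exact: dot_continuous2|exact: closed_eq].
  apply: closed_bigI => i _.
  apply: (@preimage_closed _ _ (fun w : V => dot w (e i)) [set x | x = 0]) => [w _|]; [exact: dot_continuous|exact: closed_eq].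
have cq : {within D, continuous (fun w : V => ip A w w)}.
  by apply: continuous_subspaceT; exact: dot_continuous2.
have [w] := EVT_max_rV D0 cD cq.
rewrite inE => -[ww we] wmax; pose q := ip A w w.
have {}wmax z : (forall i : 'I_a, dot z (e i) = 0) -> ip A z z <= q * dot z z.
  move=> ze; have [->|z0] := eqVneq z 0; first by rewrite ip0l ip0l mulr0.
  have zz := dot_pos z0; have sz : Num.sqrt (dot z z) != 0 by rewrite gt_eqF// sqrtr_gt0.
  have := wmax ((Num.sqrt (dot z z))^-1 *: z).
  rewrite !ipZl !ipZr !mulrA -invfM -expr2 sqr_sqrtr ?(ltW zz)// => H.
  rewrite -ler_pdivrMr// mulrC; apply: H; rewrite inE; split.
    by rewrite ipZl ipZr mulrA -invfM -expr2 sqr_sqrtr ?(ltW zz)// mulVf ?gt_eqF.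
  by move=> i; rewrite ipZl ze mulr0.
have dAC (B : 'M[R]_n) u v : ip B u v = dot (u *m B) v by rewrite /ip mulmx1.
(* First variation at the maximum: moving from w in the direction z gives a quadratic polynomial in
   t that is nonnegative and vanishes at 0, so its linear coefficient is zero. *)
have key z : (forall i : 'I_a, dot z (e i) = 0) -> dot w z = 0 -> ip A w z = 0.
  move=> ze wz.
  have H t : 0 <= t * (- 2 * ip A w z) + t ^+ 2 * (q * dot z z - ip A z z).
    have := wmax (w + t *: z); rewrite !(ipDl, ipDr, ipZl, ipZr) ww wz.
    rewrite (ip_sym symA z w) (ip_sym sym1 z w) wz -/q => H.
    have {}H := H (fun i => ltac:(by rewrite ipDl ipZl we ze mulr0 addr0)); lra.
  have : forall x y : R, (forall t, 0 <= t * x + t ^+ 2 * y) -> x = 0.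
    move=> x y Hxy; pose y' := `|y| + 1; have y'0 : 0 < y' by rewrite ltr_wpDl.
    have := Hxy (- x / (2 * y')).
    have -> : - x / (2 * y') * x + (- x / (2 * y')) ^+ 2 * y
      = - (x ^+ 2 / (4 * y' ^+ 2)) * (2 * y' - y) by field; rewrite gt_eqF.
    rewrite mulNr oppr_ge0 => Hle.
    have yy : 0 < 2 * y' - y.
      by have := ler_norm y; rewrite /y'; have := normr_ge0 y; lra.
    apply/eqP/negPn/negP => x0; move: Hle; rewrite leNgt => /negP; apply.
    have x20 : 0 < x ^+ 2 by rewrite lt_def sqr_ge0 andbT sqrf_eq0.
    by apply: mulr_gt0 => //; apply: divr_gt0 => //; apply: mulr_gt0 => //; exact: exprn_gt0.
  by move=> /(_ _ _ H); lra.
exists w, q; split=> //.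
  by move=> i ia; have := we (Ordinal ia); rewrite /= (ip_sym sym1 (e i)).
(* The residual is orthogonal to w and to every [e i], so [key] applies to it and yields |r|^2 =
   0. *)
pose r := w *m A - q *: w.
have re (i : 'I_a) : dot r (e i) = 0.
  rewrite /r ipBl ipZl we mulr0 subr0 -dAC (ip_sym symA) dAC eA// ipZl.
  by rewrite (ip_sym sym1) we mulr0.
have rw : dot w r = 0.
  by rewrite /r ipBr ipZr ww mulr1 (ip_sym sym1) -dAC subrr.
have : dot r r = 0 by rewrite {1}/r ipBl ipZl rw mulr0 subr0 -dAC key.
move=> /(ip_eq0 dot_pos) => /eqP; rewrite subr_eq0 => /eqP //.
Qed.

Lemma spectral_theorem : exists (P : 'M[R]_n) (d : 'rV[R]_n),
  P *m P^T = 1%:M /\ P *m A *m P^T = diag_mx d.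
Proof.
suff [e [d [eo eA]]] : exists (e : nat -> V) (d : nat -> R),
    (forall i j, (i < n)%N -> (j < n)%N -> dot (e i) (e j) = (i == j)%:R) /\
    (forall i, (i < n)%N -> e i *m A = d i *: e i).
  exists (\matrix_(i < n) e i), (\row_(i < n) d i).
  have PP : (\matrix_(i < n) e i) *m (\matrix_(i < n) e i)^T = 1%:M.
    apply/matrixP => i j; rewrite !mxE -val_eqE /= -eo// dotE.
    by apply: eq_bigr => k _; rewrite !mxE.
  split=> //; have -> : (\matrix_(i < n) e i) *m A = diag_mx (\row_(i < n) d i) *m (\matrix_(i < n) e i).
    apply/matrixP => i j; rewrite mul_diag_mx !mxE.
    have /rowP/(_ j) := eA i (ltn_ord i); rewrite !mxE => <-.
    by apply: eq_bigr => k _; rewrite !mxE.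
  by rewrite -mulmxA PP mulmx1.
suff H a : (a <= n)%N -> exists (e : nat -> V) (d : nat -> R),
    (forall i j, (i < a)%N -> (j < a)%N -> dot (e i) (e j) = (i == j)%:R) /\
    (forall i, (i < a)%N -> e i *m A = d i *: e i) by exact: H.
elim: a => [_|a IH an]; first by exists (fun=> 0), (fun=> 0).
have [e [d [eo eA]]] := IH (ltnW an).
have [v [l [vv ve vA]]] := eigenvector_extend an eo eA.
exists (fun i => if (i < a)%N then e i else v), (fun i => if (i < a)%N then d i else l).
have E k : (k < a.+1)%N -> (a <= k)%N -> k = a.
  by move=> k1 k2; apply/eqP; rewrite eqn_leq k2 -ltnS k1.
split=> [i j ia ja|i ia].
  case: (ltnP i a) => ia'; case: (ltnP j a) => ja'.
  - exact: eo.
  - by rewrite (ve i ia').2 (E j ja ja') (ltn_eqF ia').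
  - by rewrite (ve j ja').1 (E i ia ia') (gtn_eqF ja').
  - by rewrite vv (E i ia ia') (E j ja ja') eqxx.
by case: ifP => // ia'; exact: eA.
Qed.

End Spectral.

(** * The Frobenius product and commutators *)

Section Frobenius.
Context {R : realType} {n : nat}.
Implicit Types (A B C P : 'M[R]_n).

Definition fr A B : R := \sum_i \sum_j A i j * B i j.
Definition cm A B : 'M[R]_n := A *m B - B *m A.

Lemma frE A B : fr A B = \tr (A *m B^T).
Proof. by apply: eq_bigr => i _; rewrite mxE; apply: eq_bigr => j _; rewrite mxE. Qed.

Lemma fr_ge0 A : 0 <= fr A A.
Proof. by apply: sumr_ge0 => i _; apply: sumr_ge0 => j _; exact: sqr_ge0. Qed.

Lemma fr_eq0 A : fr A A = 0 -> A = 0.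
Proof.
move=> H; apply/matrixP => i j; rewrite mxE.
have H1 : \sum_j A i j * A i j = 0.
  by apply: (psumr_eq0P _ H) => // k _; apply: sumr_ge0 => l _; exact: sqr_ge0.
have /eqP : A i j * A i j = 0 by apply: (psumr_eq0P _ H1) => // k _; exact: sqr_ge0.
by rewrite mulf_eq0 orbb => /eqP.
Qed.

Lemma frC A B : fr A B = fr B A.
Proof. by apply: eq_bigr => i _; apply: eq_bigr => j _; rewrite mulrC. Qed.
Lemma frDl A B C : fr (A + B) C = fr A C + fr B C.
Proof. by rewrite !frE mulmxDl linearD. Qed.
Lemma frZl a A C : fr (a *: A) C = a * fr A C.
Proof. by rewrite !frE -scalemxAl linearZ. Qed.
Lemma frDr A B C : fr C (A + B) = fr C A + fr C B.
Proof. by rewrite !(frC C) frDl. Qed.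
Lemma frZr a A C : fr C (a *: A) = a * fr C A.
Proof. by rewrite !(frC C) frZl. Qed.
Lemma fr0l C : fr 0 C = 0.
Proof. by rewrite -(scale0r 0) frZl mul0r. Qed.
Lemma fr0r C : fr C 0 = 0.
Proof. by rewrite frC fr0l. Qed.
Lemma fr_suml (I : Type) (r : seq I) (P : pred I) (F : I -> 'M[R]_n) C :
  fr (\sum_(i <- r | P i) F i) C = \sum_(i <- r | P i) fr (F i) C.
Proof. by apply: (big_morph (fr ^~ C)) => [A B|]; rewrite ?frDl ?fr0l. Qed.
Lemma fr_sumr (I : Type) (r : seq I) (P : pred I) (F : I -> 'M[R]_n) C :
  fr C (\sum_(i <- r | P i) F i) = \sum_(i <- r | P i) fr C (F i).
Proof. by apply: (big_morph (fr C)) => [A B|]; rewrite ?frDr ?fr0r. Qed.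

Lemma fr_conj P A B : P *m P^T = 1%:M ->
  fr (P *m A *m P^T) (P *m B *m P^T) = fr A B.
Proof.
move=> PP; have PP' := mulmx1C PP.
rewrite !frE !trmx_mul trmxK !mulmxA -(mulmxA _ P^T P) PP' mulmx1.
by rewrite mxtrace_mulC !mulmxA PP' mul1mx.
Qed.

Lemma cm_conj P A B : P *m P^T = 1%:M ->
  cm (P *m A *m P^T) (P *m B *m P^T) = P *m cm A B *m P^T.
Proof.
move=> PP; have PP' := mulmx1C PP.
by rewrite /cm mulmxBr mulmxBl !mulmxA -!(mulmxA _ P^T P) PP' !mulmx1.
Qed.

Lemma cmxx A : cm A A = 0. Proof. exact: subrr. Qed.
Lemma cmDr A B C : cm A (B + C) = cm A B + cm A C.
Proof. by rewrite /cm mulmxDr mulmxDl opprD addrACA. Qed.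
Lemma cmZr A a B : cm A (a *: B) = a *: cm A B.
Proof. by rewrite /cm -scalemxAr -scalemxAl scalerBr. Qed.
Lemma cmN A B : cm A B = - cm B A.
Proof. by rewrite /cm opprB. Qed.
Lemma cmZl A a B : cm (a *: A) B = a *: cm A B.
Proof. by rewrite cmN cmZr (cmN A) scalerN. Qed.
Lemma cm0r A : cm A 0 = 0.
Proof. by rewrite /cm mulmx0 mul0mx subrr. Qed.
Lemma cm_sumr (I : Type) (r : seq I) (F : I -> 'M[R]_n) A :
  cm A (\sum_(i <- r) F i) = \sum_(i <- r) cm A (F i).
Proof. by apply: (big_morph (cm A)) => [B C|]; rewrite ?cmDr ?cm0r. Qed.

Lemma frN A : fr (- A) (- A) = fr A A.
Proof. by rewrite -scaleN1r frZl frZr mulrA mulrNN !mul1r. Qed.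

Lemma fr_cmC A B : fr (cm A B) (cm A B) = fr (cm B A) (cm B A).
Proof. by rewrite cmN frN. Qed.

Lemma fr_cm_diag (d : 'rV[R]_n) B :
  fr (cm (diag_mx d) B) (cm (diag_mx d) B) =
  \sum_i \sum_j (d 0 i - d 0 j) ^+ 2 * B i j ^+ 2.
Proof.
apply: eq_bigr => i _; apply: eq_bigr => j _.
rewrite /cm mul_diag_mx mul_mx_diag !mxE; ring.
Qed.

End Frobenius.

Section Bessel.
Context {R : realType} {n m : nat}.
Variables (B : 'I_m -> 'M[R]_n) (S : pred 'I_m) (p : R).
Hypotheses (p0 : 0 <= p) (orthB : forall a b, S a -> S b -> a != b -> fr (B a) (B b) = 0)
  (leB : forall a, S a -> fr (B a) (B a) <= p).

(** Bessel's inequality for an orthogonal family that is not normalised. With w the sum of the fr(B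
    a, F) B a, expand the nonnegative square of pF - w and divide by p; for p = 0 the vector w is
    zero. *)
Lemma bessel F : \sum_(a | S a) fr (B a) F ^+ 2 <= p * fr F F.
Proof.
pose w := \sum_(a | S a) fr (B a) F *: B a; pose s := \sum_(a | S a) fr (B a) F ^+ 2.
have wF : fr w F = s by rewrite fr_suml; apply: eq_bigr => a _; rewrite frZl expr2.
have ww : fr w w <= p * s.
  rewrite {1}/w fr_suml mulr_sumr; apply: ler_sum => a Sa.
  rewrite frZl /w fr_sumr (bigD1 a)//= frZr big1 => [|b /andP[Sb ba]]; last first.
    by rewrite frZr orthB ?mulr0// eq_sym.
  rewrite addr0 mulrA -expr2 mulrC ler_wpM2r ?sqr_ge0//; exact: leB.
have F0 := fr_ge0 F.
have [pE|pn0] := eqVneq p 0.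
  move: ww; rewrite pE mul0r => ww0.
  have /fr_eq0 w0 : fr w w = 0 by apply/eqP; rewrite eq_le ww0 fr_ge0.
  by rewrite -/s -wF w0 fr0l mul0r.
have pp : 0 < p by rewrite lt_def pn0.
have : 0 <= fr (p *: F - w) (p *: F - w) by exact: fr_ge0.
rewrite -scaleN1r !(frDl, frDr, frZl, frZr) (frC F w) wF => H.
rewrite -(ler_pM2l pp) -/s; move: H ww; move: (fr w w) (fr F F) => x y; lra.
Qed.
End Bessel.

(** * A weighted graph inequality whose extremal case is a star *)

Section StarGraph.
Context {R : realType} {n : nat}.
Variables (h : 'I_n -> R) (s : 'I_n -> 'I_n -> R) (p : R).
Let q := \sum_i h i ^+ 2.
Hypotheses (p0 : 0 <= p) (s0 : forall i j, 0 <= s i j)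
  (sp : forall i j, i != j -> s i j <= p / 2).
(** In the application [h] lists the eigenvalues of one matrix and [s i j] is the sum of the squared
    (i, j) entries of the others. Only the edges with w positive help the sum to be bounded, and the
    whole argument is about the graph they form. *)
Let w i j := (h i - h j) ^+ 2 - q.

Let q_ge2 i j : i != j -> h i ^+ 2 + h j ^+ 2 <= q.
Proof.
move=> ij; rewrite /q (bigD1 i)//= (bigD1 j) 1?eq_sym//= addrA lerDl.
by apply: sumr_ge0 => k _; exact: sqr_ge0.
Qed.

Let q_ge1 i : h i ^+ 2 <= q.
Proof.
rewrite /q (bigD1 i)//= lerDl.
by apply: sumr_ge0 => k _; exact: sqr_ge0.
Qed.

Let q_ge3 i j k : i != j -> i != k -> j != k -> h i ^+ 2 + h j ^+ 2 + h k ^+ 2 <= q.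
Proof.
move=> ij ik jk; rewrite /q (bigD1 i)//= (bigD1 j) 1?eq_sym//= (bigD1 k) /=; last first.
  by rewrite eq_sym ik eq_sym jk.
rewrite !addrA lerDl.
by apply: sumr_ge0 => l _; exact: sqr_ge0.
Qed.

Let q_ge4 i j k l : i != j -> i != k -> j != k -> l != i -> l != j -> l != k ->
  h i ^+ 2 + h j ^+ 2 + h k ^+ 2 + h l ^+ 2 <= q.
Proof.
move=> ij ik jk li lj lk.
rewrite /q (bigD1 i)//= (bigD1 j) 1?eq_sym//= (bigD1 k) /=; last first.
  by rewrite eq_sym ik eq_sym jk.
rewrite (bigD1 l) /=; last by rewrite li lj lk.
rewrite !addrA lerDl.
by apply: sumr_ge0 => l' _; exact: sqr_ge0.
Qed.

Let wii i : w i i <= 0.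
Proof. by rewrite /w subrr expr0n /= sub0r oppr_le0 (le_trans (sqr_ge0 (h i))). Qed.

Let wC i j : w i j = w j i. Proof. by rewrite /w -sqrrN opprB. Qed.

Let w_neq i j : 0 < w i j -> i != j.
Proof. by move=> wij; apply/negP => /eqP ij; move: wij; rewrite ij ltNge wii. Qed.

(** By (x - y)^2 <= 2(x^2 + y^2) the two squared differences sum to at most 2q, whereas each exceeds
    q. *)
Let disjoint_edges a b c d : 0 < w a b -> 0 < w c d ->
  a != c -> a != d -> b != c -> b != d -> False.
Proof.
move=> wab wcd ac ad bc bd; have ab := w_neq wab; have cd := w_neq wcd.
have H : h a ^+ 2 + h b ^+ 2 + h c ^+ 2 + h d ^+ 2 <= q.
  by apply: q_ge4 => //; rewrite eq_sym.
move: wab wcd H; rewrite /w; move: (h a) (h b) (h c) (h d) => x y z u.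
have := sqr_ge0 (x + y); have := sqr_ge0 (z + u); lra.
Qed.

(** The three squared differences sum to 3(x^2 + y^2 + z^2) - (x + y + z)^2, hence to at most 3q. *)
Let no_triangle a b c : 0 < w a b -> 0 < w b c -> 0 < w a c -> False.
Proof.
move=> wab wbc wac; have ab := w_neq wab; have bc := w_neq wbc; have ac := w_neq wac.
move: (q_ge3 ab ac bc) wab wbc wac; rewrite /w; move: (h a) (h b) (h c) => x y z.
have := sqr_ge0 (x + y + z); lra.
Qed.

(* The edges [w > 0] pairwise meet and form no triangle, so they form a star. *)
Lemma star_center a b : 0 < w a b -> exists c, forall i j, 0 < w i j -> (i == c) || (j == c).
Proof.
move=> wab.
have [/forallP Ha|/forallPn[x /forallPn[y]]] :=
  boolP [forall i, forall j, (0 < w i j) ==> ((i == a) || (j == a))].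
  by exists a => i j; have /forallP/(_ j)/implyP := Ha i.
rewrite negb_imply negb_or => /and3P[wxy xa ya].
have [d [wbd da]] : exists d, 0 < w b d /\ d != a.
  have [xb|xb] := eqVneq x b; first by exists y; rewrite -xb.
  have [yb|yb] := eqVneq y b; first by exists x; rewrite wC -yb.
  by exfalso; apply: (disjoint_edges wab wxy); rewrite // eq_sym.
have Hb i j : 0 < w i j -> i != b -> j != b -> i = a -> False.
  move=> wij ib jb ia; have wai : 0 < w a j by rewrite -ia.
  have [jd|jd] := eqVneq j d.
    by apply: (no_triangle wab wbd); rewrite -jd.
  by apply: (disjoint_edges wai wbd) => //; [exact: w_neq|rewrite eq_sym].
exists b => i j wij; apply/negPn; rewrite negb_or; apply/negP => /andP[ib jb].
have [ia|ia] := eqVneq i a; first exact: (Hb i j).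
have [ja|ja] := eqVneq j a; first by apply: (Hb j i) => //; rewrite wC.
by apply: (disjoint_edges wab wij); rewrite // eq_sym.
Qed.

Section Center.
Variable c : 'I_n.
Hypothesis ctr : forall i j, 0 < w i j -> (i == c) || (j == c).
Let J : {set 'I_n} := finset (fun j => 0 < w c j).
Let k : R := #|J|%:R.
Let T := \sum_(j in J) h j.

Let cJ : c \notin J. Proof. by rewrite inE -leNgt. Qed.

(** Completing squares: nonnegativity of the right-hand side is the bound by q, and its vanishing
    term by term is the equality case. *)
Let sum_w : 0 < k -> q - \sum_(j in J) w c j =
  (h c + T) ^+ 2 + k * (\sum_(j in J) (h j - T / k) ^+ 2)
  + (k + 1) * \sum_(j | (j != c) && (j \notin J)) h j ^+ 2.
Proof.
move=> k0; pose S := \sum_(j in J) h j ^+ 2.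
pose O := \sum_(j | (j != c) && (j \notin J)) h j ^+ 2.
have qE : q = h c ^+ 2 + S + O.
  rewrite /q (bigD1 c)//= -addrA; congr (_ + _).
  rewrite (bigID (mem J)) /=; congr (_ + _).
  apply: eq_bigl => j; rewrite andbC; case jJ : (j \in J) => //=.
  by apply/negP => /eqP jc; move: cJ; rewrite -jc jJ.
have cst (a : R) : \sum_(j in J) a = k * a by rewrite sumr_const mulr_natl.
have -> : \sum_(j in J) w c j = k * (h c ^+ 2 - q) - 2 * h c * T + S.
  rewrite -cst /T mulr_sumr -sumrB /S -big_split /=; apply: eq_bigr => j _.
  by rewrite /w; ring.
have -> : \sum_(j in J) (h j - T / k) ^+ 2 = S - 2 * (T / k) * T + k * (T / k) ^+ 2.
  rewrite -cst {3}/T mulr_sumr -sumrB /S -big_split /=; apply: eq_bigr => j _.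
  by ring.
rewrite -/O qE; field.
by rewrite gt_eqF.
Qed.

(** A majorant of [w i j * s i j] carried by the edges of the star, in both orientations, with s
    replaced by its maximum p / 2. *)
Let b i j := (i == c)%:R * (j \in J)%:R * (p / 2 * w c j)
           + (j == c)%:R * (i \in J)%:R * (p / 2 * w c i).

Let sum_b : \sum_i \sum_j b i j = p * \sum_(j in J) w c j.
Proof.
have E (F : 'I_n -> R) : \sum_i \sum_j ((i == c)%:R * (j \in J)%:R * F j) = \sum_(j in J) F j.
  rewrite (bigD1 c)//= [X in _ + X]big1 ?addr0 => [|i ic]; last first.
    by rewrite big1// => j _; rewrite (negbTE ic) !mul0r.
  rewrite [RHS]big_mkcond /=; apply: eq_bigr => j _; rewrite eqxx mul1r.
  by case: (j \in J); rewrite ?mul1r ?mul0r.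
transitivity (\sum_(j in J) (p / 2 * w c j) + \sum_(j in J) (p / 2 * w c j)).
  rewrite -[X in X + _]E -[X in _ + X]E [X in _ + X]exchange_big /= -big_split /=.
  by apply: eq_bigr => i _; rewrite -big_split.
by rewrite -mulr_sumr; field.
Qed.

Let le_b i j : w i j * s i j <= b i j.
Proof.
have p2 : 0 <= p / 2 by rewrite divr_ge0.
have b0 i' j' : 0 <= (i' == c)%:R * (j' \in J)%:R * (p / 2 * w c j').
  rewrite inE; case: ltP => [wcj|_]; last by rewrite mulr0 mul0r.
  by rewrite !mulr_ge0// ltW.
have [wij|wij] := leP (w i j) 0.
  by apply: (le_trans (mulr_le0_ge0 wij (s0 i j))); rewrite addr_ge0.
have ij := w_neq wij.
have le1 : w i j * s i j <= p / 2 * w i j by rewrite mulrC; apply: ler_wpM2r; [exact: ltW|exact: sp].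
case/orP: (ctr wij) => /eqP E; move: wij le1; rewrite E => wij le1.
  have jJ : j \in J by rewrite inE.
  by rewrite /b eqxx jJ !mul1r; apply: (le_trans le1); rewrite lerDl.
have iJ : i \in J by rewrite inE wC.
rewrite /b eqxx iJ !mul1r; apply: (le_trans le1); rewrite [w i c]wC lerDr.
exact: b0.
Qed.

Let sum_w_le : 0 < k -> \sum_(j in J) w c j <= q.
Proof.
move=> k0; rewrite -subr_ge0 sum_w//; apply: addr_ge0.
  apply: addr_ge0; first exact: sqr_ge0.
  by apply: mulr_ge0; [exact: ltW|apply: sumr_ge0 => j _; exact: sqr_ge0].
by apply: mulr_ge0; [exact: addr_ge0 (ltW k0) ler01|apply: sumr_ge0 => j _; exact: sqr_ge0].
Qed.

Lemma star_le_center : 0 < k -> \sum_i \sum_j w i j * s i j <= q * p.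
Proof.
move=> k0; apply: (@le_trans _ _ (\sum_i \sum_j b i j)).
  by apply: ler_sum => i _; apply: ler_sum => j _; exact: le_b.
by rewrite sum_b mulrC ler_wpM2r// sum_w_le.
Qed.

(** Equality makes every square in the identity for q - \sum w vanish, which fixes [h], and makes
    the majorant exact on each edge. With this [h], w is negative off the star, diagonal included,
    so s vanishes there. *)
Lemma star_eq_center : 0 < k -> 0 < p -> 0 < q ->
  \sum_i \sum_j w i j * s i j = q * p ->
  exists (J : {set 'I_n}) (t : R), [/\ c \notin J, (0 < #|J|)%N & t != 0] /\
    [/\ h c = - #|J|%:R * t, (forall j, j \in J -> h j = t),
        (forall j, j != c -> j \notin J -> h j = 0) &
     forall i j, s i j = if (i == c) && (j \in J) || (j == c) && (i \in J) then p / 2 else 0].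
Proof.
move=> k0 pp q0 E.
have bE : \sum_i \sum_j b i j = q * p.
  apply/eqP; rewrite eq_le -{2}E; apply/andP; split; last first.
    by apply: ler_sum => i _; apply: ler_sum => j _; exact: le_b.
  by rewrite sum_b mulrC ler_wpM2r// sum_w_le.
have be i j : w i j * s i j = b i j.
  have H : \sum_i \sum_j (b i j - w i j * s i j) = 0.
    transitivity (\sum_i (\sum_j b i j - \sum_j w i j * s i j)).
      by apply: eq_bigr => ? _; rewrite sumrB.
    by rewrite sumrB bE E subrr.
  have H1 : \sum_j (b i j - w i j * s i j) = 0.
    by apply: (psumr_eq0P _ H) => // i' _; apply: sumr_ge0 => j' _; rewrite subr_ge0 le_b.
  have : b i j - w i j * s i j = 0.
    by apply: (psumr_eq0P _ H1) => // j' _; rewrite subr_ge0 le_b.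
  by move/eqP; rewrite subr_eq0 => /eqP.
have wq : q - \sum_(j in J) w c j = 0.
  apply/eqP; rewrite subr_eq0; apply/eqP; apply: (mulfI (lt0r_neq0 pp)).
  by rewrite -sum_b bE mulrC.
have S0 : 0 <= \sum_(j in J) (h j - T / k) ^+ 2 by apply: sumr_ge0 => j _; exact: sqr_ge0.
have O0 : 0 <= \sum_(j | (j != c) && (j \notin J)) h j ^+ 2.
  by apply: sumr_ge0 => j _; exact: sqr_ge0.
have k1 : 0 < k + 1 by rewrite ltr_wpDr.
move: wq; rewrite sum_w// => H.
have [H1 H2 H3] : [/\ (h c + T) ^+ 2 = 0, \sum_(j in J) (h j - T / k) ^+ 2 = 0 &
    \sum_(j | (j != c) && (j \notin J)) h j ^+ 2 = 0].
  have a1 := sqr_ge0 (h c + T); have a2 := mulr_ge0 (ltW k0) S0; have a3 := mulr_ge0 (ltW k1) O0.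
  have b1 : (h c + T) ^+ 2 = 0 by move: H a1 a2 a3; lra.
  have /eqP b2 : k * (\sum_(j in J) (h j - T / k) ^+ 2) = 0 by move: H a1 a2 a3; lra.
  have /eqP b3 : (k + 1) * \sum_(j | (j != c) && (j \notin J)) h j ^+ 2 = 0 by move: H a1 a2 a3; lra.
  move: b2 b3; rewrite !mulf_eq0 (gt_eqF k0) (gt_eqF k1) /= => /eqP b2 /eqP b3.
  by split.
pose t := T / k.
have hJ j : j \in J -> h j = t.
  move=> jJ; have /eqP : (h j - T / k) ^+ 2 = 0.
    by apply: (psumr_eq0P _ H2) => // i _; exact: sqr_ge0.
  by rewrite sqrf_eq0 subr_eq0 => /eqP.
have hc : h c = - k * t.
  move/eqP: H1; rewrite sqrf_eq0 addr_eq0 => /eqP ->.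
  by rewrite /t mulNr mulrCA divff ?mulr1// gt_eqF.
have hO j : j != c -> j \notin J -> h j = 0.
  move=> jc jJ; have /eqP : h j ^+ 2 = 0.
    by apply: (psumr_eq0P _ H3) => [i _|]; [exact: sqr_ge0|rewrite jc].
  by rewrite sqrf_eq0 => /eqP.
have k_ge1 : 1 <= k by move: k0; rewrite /k ltr0n ler1n.
have t0 : t != 0.
  apply/eqP => t0; suff : q = 0 by move=> qE; rewrite qE ltxx in q0.
  apply: big1 => j _; have [->|jc] := eqVneq j c; first by rewrite hc t0 mulr0 expr0n.
  have [jJ|jJ] := boolP (j \in J); first by rewrite hJ// t0 expr0n.
  by rewrite hO// expr0n.
have t2 : 0 < t ^+ 2 by rewrite lt_def sqr_ge0 andbT sqrf_eq0.
have qE : q = k * (k + 1) * t ^+ 2.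
  rewrite /q (bigD1 c)//= (bigID (mem J)) /= [X in _ + (_ + X)]big1 ?addr0; last first.
    by move=> j /andP[jc jJ]; rewrite hO// expr0n.
  rewrite (eq_bigl (mem J)); last first.
    move=> j; rewrite andbC /=; case jJ : (j \in J) => //=.
    by apply/negP => /eqP jc; move: cJ; rewrite -jc jJ.
  rewrite (eq_bigr (fun=> t ^+ 2)); last by move=> j jJ; rewrite hJ.
  by rewrite sumr_const -mulr_natl hc -/k; ring.
exists J, t; split; first by split=> //; move: k0; rewrite /k ltr0n.
split=> // i j; have := be i j; rewrite /b.
have ctrJ l : l \in J -> w l c != 0 /\ w c l != 0.
  by rewrite inE (wC l) => /lt0r_neq0.
have wneg a e : 0 < k + 1 -> (h a - h e) ^+ 2 < q -> w a e != 0.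
  by move=> _ hq; rewrite /w lt_eqF// subr_lt0.
have h_other a : a != c -> (h a = t \/ h a = 0).
  by move=> ac; have [aJ|aJ] := boolP (a \in J); [left; exact: hJ|right; exact: hO].
have kk : 1 <= k * k by rewrite (le_trans k_ge1)// ler_peMr// ltW.
have [ic|ic] := eqVneq i c; have [jc|jc] := eqVneq j c => /=.
- rewrite ic jc (negbTE cJ) !mulr0 !mul0r addr0 /= => /eqP.
  rewrite mulf_eq0 => /orP[|/eqP//].
  by rewrite (negbTE (wneg _ _ k1 _))// subrr expr0n.
- rewrite ic mul1r !mul0r addr0 orbF; case: ifP => jJ.
    by rewrite mul1r mulrC => /mulIf; apply; case: (ctrJ _ jJ).
  rewrite !mul0r => /eqP; rewrite mulf_eq0 => /orP[|/eqP//].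
  rewrite (negbTE (wneg _ _ k1 _))// (hO _ jc (negbT jJ)) subr0 hc qE; nra.
- rewrite jc mul1r !mul0r add0r /=; case: ifP => iJ.
    by rewrite mul1r wC mulrC => /mulIf; apply; case: (ctrJ _ iJ).
  rewrite !mul0r => /eqP; rewrite mulf_eq0 => /orP[|/eqP//].
  rewrite (negbTE (wneg _ _ k1 _))// (hO _ ic (negbT iJ)) sub0r sqrrN hc qE; nra.
rewrite !mul0r addr0 => /eqP; rewrite mulf_eq0 => /orP[|/eqP//].
rewrite (negbTE (wneg _ _ k1 _))// qE.
by case: (h_other i ic) => ->; case: (h_other j jc) => ->;
  rewrite ?subrr ?sub0r ?subr0 ?sqrrN ?expr0n /=; nra.
Qed.
End Center.

Lemma star_le : \sum_i \sum_j w i j * s i j <= q * p.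
Proof.
have q0 : 0 <= q by apply: sumr_ge0 => j _; exact: sqr_ge0.
have [/existsP[a /existsP[b wab]]|/existsPn H] := boolP [exists a, exists b, 0 < w a b].
  have [c ctr] := star_center wab; apply: (star_le_center ctr).
  rewrite ltr0n card_gt0; apply/set0Pn.
  by case/orP: (ctr _ _ wab) => /eqP E; [exists b|exists a]; rewrite inE -E // wC.
apply: (@le_trans _ _ 0); last exact: mulr_ge0.
apply: sumr_le0 => i _; apply: sumr_le0 => j _; apply: mulr_le0_ge0 => //.
by rewrite leNgt; have /existsPn/(_ j) := H i.
Qed.

Lemma star_eq : 0 < p -> 0 < q -> \sum_i \sum_j w i j * s i j = q * p ->
  exists (c : 'I_n) (J : {set 'I_n}) (t : R), [/\ c \notin J, (0 < #|J|)%N & t != 0] /\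
    [/\ h c = - #|J|%:R * t, (forall j, j \in J -> h j = t),
        (forall j, j != c -> j \notin J -> h j = 0) &
     forall i j, s i j = if (i == c) && (j \in J) || (j == c) && (i \in J) then p / 2 else 0].
Proof.
move=> pp q0 E.
have [/existsP[a /existsP[b wab]]|/existsPn H] := boolP [exists a, exists b, 0 < w a b].
  have [c ctr] := star_center wab; exists c; apply: (star_eq_center ctr) => //.
  rewrite ltr0n card_gt0; apply/set0Pn.
  by case/orP: (ctr _ _ wab) => /eqP E'; [exists b|exists a]; rewrite inE -E' // wC.
exfalso; have : q * p <= 0.
  rewrite -E; apply: sumr_le0 => i _; apply: sumr_le0 => j _; apply: mulr_le0_ge0 => //.
  by rewrite leNgt; have /existsPn/(_ j) := H i.
by rewrite leNgt mulr_gt0.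
Qed.

End StarGraph.

Section Rotations.
Context {R : realType} {m : nat}.
Variable O : 'M[R]_m.
Hypothesis OO : O *m O^T = 1%:M.

Lemma rot_dot (x y : 'I_m -> R) :
  \sum_a (\sum_b O a b * x b) * (\sum_b O a b * y b) = \sum_a x a * y a.
Proof.
pose X : 'rV[R]_m := \row_a x a; pose Y : 'rV[R]_m := \row_a y a.
have E (z : 'I_m -> R) a : \sum_b O a b * z b = ((\row_a z a) *m O^T) 0 a.
  by rewrite mxE; apply: eq_bigr => b _; rewrite !mxE mulrC.
transitivity (((X *m O^T) *m (Y *m O^T)^T) 0 0).
  by rewrite [RHS]mxE; apply: eq_bigr => a _; rewrite (E x) (E y) [X in _ = _ * X]mxE.
rewrite trmx_mul trmxK mulmxA -(mulmxA X) (mulmx1C OO) mulmx1 mxE.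
by apply: eq_bigr => a _; rewrite !mxE.
Qed.

Context {n : nat}.
Implicit Types (B : 'I_m -> 'M[R]_n).

(** The effect on a family of shape operators of a rotation of the orthonormal normal frame. *)
Definition rotf B a : 'M[R]_n := \sum_b O a b *: B b.

Lemma rotfE B a i j : rotf B a i j = \sum_b O a b * B b i j.
Proof. by rewrite summxE; apply: eq_bigr => b _; rewrite mxE. Qed.

Lemma rotf_sym B : (forall a, (B a)^T = B a) -> forall a, (rotf B a)^T = rotf B a.
Proof.
move=> symB a; rewrite linear_sum; apply: eq_bigr => b _.
by rewrite linearZ /= symB.
Qed.

Lemma rotf_fr B : \sum_a fr (rotf B a) (rotf B a) = \sum_a fr (B a) (B a).
Proof.
rewrite exchange_big [RHS]exchange_big; apply: eq_bigr => i _.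
rewrite exchange_big [RHS]exchange_big; apply: eq_bigr => j _.
by rewrite -[RHS]rot_dot; apply: eq_bigr => a _; rewrite !rotfE.
Qed.
End Rotations.

Lemma fr_delta (R : realType) n (X : 'M[R]_n) k l : fr X (delta_mx k l) = X k l.
Proof.
rewrite /fr (bigD1 k)//= [X in _ + X]big1 ?addr0 => [|k' kk]; last first.
  by apply: big1 => l' _; rewrite mxE (negbTE kk) mulr0.
rewrite (bigD1 l)//= big1 ?addr0 => [|l' ll]; last first.
  by rewrite mxE (negbTE ll) andbF mulr0.
by rewrite mxE !eqxx mulr1.
Qed.

(** * The DDVV inequality *)

Section DDVV.
Context {R : realType} {n m : nat}.
Implicit Types (A : 'M[R]_n) (B : 'I_m -> 'M[R]_n) (S : pred 'I_m).

Definition sqn A : R := fr A A.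
Definition Nf B : R := \sum_a sqn (B a).
Definition Kf B : R := \sum_a \sum_b sqn (cm (B a) (B b)).
Definition symf B := forall a, (B a)^T = B a.
Definition orthf B := forall a b, a != b -> fr (B a) (B b) = 0.

Lemma rotf_N (O : 'M[R]_m) B : O *m O^T = 1%:M -> Nf (rotf O B) = Nf B.
Proof. by move=> OO; exact: rotf_fr. Qed.

Lemma rotf_K (O : 'M[R]_m) B : O *m O^T = 1%:M -> Kf (rotf O B) = Kf B.
Proof.
move=> OO; have H (F : 'I_m -> 'M[R]_n) A :
    \sum_b sqn (cm A (rotf O F b)) = \sum_b sqn (cm A (F b)).
  rewrite -(rotf_fr OO (fun b => cm A (F b))); apply: eq_bigr => b _.
  rewrite /rotf cm_sumr /sqn; congr (fr _ _); apply: eq_bigr => c _; exact: cmZr.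
transitivity (\sum_a \sum_b sqn (cm (rotf O B a) (B b))).
  by apply: eq_bigr => a _; exact: H.
rewrite exchange_big /=.
transitivity (\sum_b \sum_a sqn (cm (B b) (rotf O B a))).
  by apply: eq_bigr => b _; apply: eq_bigr => a _; exact: fr_cmC.
by apply: eq_bigr => b _; exact: H.
Qed.

(** A rotation that diagonalises the Gram matrix of the family makes its members pairwise
    orthogonal. *)
Lemma orth_rotation B : exists O : 'M[R]_m, O *m O^T = 1%:M /\ orthf (rotf O B).
Proof.
pose Gr : 'M[R]_m := \matrix_(a, b) fr (B a) (B b).
have symGr : Gr^T = Gr by apply/matrixP => a b; rewrite !mxE frC.
have [Q [d [QQ QG]]] := spectral_theorem symGr.
exists Q; split=> // a b ab.
have : (Q *m Gr *m Q^T) a b = 0 by rewrite QG mxE (negbTE ab).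
move=> <-; rewrite fr_suml -mulmxA mxE; apply: eq_bigr => c _.
rewrite frZl; congr (_ * _); rewrite fr_sumr mxE; apply: eq_bigr => e _.
by rewrite frZr !mxE mulrC.
Qed.

Section Diagonalize.
Variables (A : 'M[R]_n) (B : 'I_m -> 'M[R]_n) (S : pred 'I_m) (p : R).
Hypotheses (symA : A^T = A) (symB : symf B) (p0 : 0 <= p)
  (orthB : forall a b, S a -> S b -> a != b -> fr (B a) (B b) = 0)
  (leB : forall a, S a -> sqn (B a) <= p).

(** In an eigenbasis of A, commutators with A only see the entrywise sums of squares s. Bessel's
    inequality with F = E_ij + E_ji, for which fr(F, F) = 2 and fr(C, F) = 2 C_ij, yields the bound
    p / 2. *)
Lemma diag_reduce : exists (P : 'M[R]_n) (d : 'rV[R]_n),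
  let s i j := \sum_(a | S a) (P *m B a *m P^T) i j ^+ 2 in
  [/\ P *m P^T = 1%:M, P *m A *m P^T = diag_mx d & sqn A = \sum_i d 0 i ^+ 2] /\
  [/\ (forall i j, 0 <= s i j), (forall i j, i != j -> s i j <= p / 2),
      \sum_(a | S a) sqn (B a) = \sum_i \sum_j s i j &
      \sum_(a | S a) sqn (cm A (B a)) = \sum_i \sum_j (d 0 i - d 0 j) ^+ 2 * s i j].
Proof.
have [P [d [PP PA]]] := spectral_theorem symA; exists P, d => s.
pose C a := P *m B a *m P^T.
have symC a : (C a)^T = C a by rewrite /C !trmx_mul trmxK symB mulmxA.
split; split=> //.
- rewrite /sqn -(fr_conj _ _ PP) PA; apply: eq_bigr => i _.
  rewrite (bigD1 i)//= big1 ?addr0 => [|j ji]; last by rewrite !mxE eq_sym (negbTE ji) mul0r.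
  by rewrite !mxE eqxx mulr1n expr2.
- by move=> i j; apply: sumr_ge0 => a _; exact: sqr_ge0.
- move=> i j ij; pose F : 'M[R]_n := delta_mx i j + delta_mx j i.
  have FF : fr F F = 2.
    rewrite /F frDr !fr_delta !mxE !eqxx (eq_sym j i) (negbTE ij) /=; ring.
  have CF a : fr (C a) F = 2 * C a i j.
    have E : C a j i = C a i j by rewrite -{1}(symC a) [LHS]mxE.
    by rewrite /F frDr !fr_delta E; ring.
  have oC a b : S a -> S b -> a != b -> fr (C a) (C b) = 0.
    by move=> Sa Sb ab; rewrite fr_conj// orthB.
  have lC a : S a -> fr (C a) (C a) <= p by move=> Sa; rewrite fr_conj// leB.
  have := bessel p0 oC lC F; rewrite FF.
  under eq_bigr do rewrite CF exprMn.
  by rewrite -mulr_sumr -/(s i j); lra.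
- transitivity (\sum_(a | S a) \sum_i \sum_j C a i j ^+ 2).
    apply: eq_bigr => a _; rewrite /sqn -(fr_conj _ _ PP).
    by apply: eq_bigr => i _; apply: eq_bigr => j _; rewrite expr2.
  by rewrite exchange_big; apply: eq_bigr => i _; rewrite exchange_big.
transitivity (\sum_(a | S a) \sum_i \sum_j (d 0 i - d 0 j) ^+ 2 * C a i j ^+ 2).
  by apply: eq_bigr => a _; rewrite /sqn -(fr_conj _ _ PP) -cm_conj// PA fr_cm_diag.
rewrite exchange_big; apply: eq_bigr => i _; rewrite exchange_big.
by apply: eq_bigr => j _; rewrite -mulr_sumr.
Qed.

Let sum_w (d : 'rV[R]_n) (s : 'I_n -> 'I_n -> R) (q : R) :
  \sum_i \sum_j ((d 0 i - d 0 j) ^+ 2 - q) * s i j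
  = \sum_i \sum_j (d 0 i - d 0 j) ^+ 2 * s i j - q * \sum_i \sum_j s i j.
Proof.
rewrite mulr_sumr -sumrB; apply: eq_bigr => i _.
by rewrite mulr_sumr -sumrB; apply: eq_bigr => j _; rewrite mulrBl.
Qed.

(** The graph inequality, written for the eigenvalues of A: one symmetric matrix against an
    orthogonal family whose squared norms are at most p. *)
Lemma commutator_le :
  \sum_(a | S a) sqn (cm A (B a)) <= sqn A * (\sum_(a | S a) sqn (B a) + p).
Proof.
have [P [d /= [[PP PA qE] [s0 sp Ns Ks]]]] := diag_reduce.
have := star_le (fun i => d 0 i) p0 s0 sp.
by rewrite sum_w -Ks -Ns -qE; lra.
Qed.

Lemma commutator_eq : 0 < p -> 0 < sqn A ->
  \sum_(a | S a) sqn (cm A (B a)) = sqn A * (\sum_(a | S a) sqn (B a) + p) ->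
  exists (P : 'M[R]_n) (d : 'rV[R]_n) (c : 'I_n) (J : {set 'I_n}) (t : R),
  [/\ P *m P^T = 1%:M, P *m A *m P^T = diag_mx d & sqn A = \sum_i d 0 i ^+ 2] /\
  [/\ c \notin J, (0 < #|J|)%N & t != 0] /\
    [/\ d 0 c = - #|J|%:R * t, (forall j, j \in J -> d 0 j = t),
        (forall j, j != c -> j \notin J -> d 0 j = 0) &
     forall i j, \sum_(a | S a) (P *m B a *m P^T) i j ^+ 2 =
       if (i == c) && (j \in J) || (j == c) && (i \in J) then p / 2 else 0] /\
   \sum_(a | S a) sqn (B a) = \sum_i \sum_j \sum_(a | S a) (P *m B a *m P^T) i j ^+ 2.
Proof.
move=> pp A0 E; have [P [d /= [[PP PA qE] [s0 sp Ns Ks]]]] := diag_reduce.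
have q0 : 0 < \sum_i d 0 i ^+ 2 by rewrite -qE.
have [|c [J [t [H1 H2]]]] := @star_eq _ _ (fun i => d 0 i) _ _ p0 s0 sp pp q0.
  by rewrite sum_w -Ks -Ns -qE E; ring.
by exists P, d, c, J, t.
Qed.
End Diagonalize.

Let rest B a0 := \sum_(b | b != a0) sqn (B b).
Let cmrest B a0 := \sum_(b | b != a0) sqn (cm (B a0) (B b)).
Let Krest B a0 := \sum_(a | a != a0) \sum_(b | b != a0) sqn (cm (B a) (B b)).

Let NE B a0 : Nf B = sqn (B a0) + rest B a0.
Proof. by rewrite /Nf (bigD1 a0). Qed.

Let KE B a0 : Kf B = 2 * cmrest B a0 + Krest B a0.
Proof.
rewrite /Kf (bigD1 a0)//= (bigD1 a0)//= {1}/sqn cmxx fr0l add0r.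
have -> : \sum_(i < m | i != a0) \sum_b sqn (cm (B i) (B b)) =
    \sum_(i < m | i != a0) (sqn (cm (B a0) (B i)) + \sum_(b | b != a0) sqn (cm (B i) (B b))).
  by apply: eq_bigr => i _; rewrite (bigD1 a0)//=; congr (_ + _); exact: fr_cmC.
by rewrite big_split /= -/(cmrest B a0) -/(Krest B a0); ring.
Qed.

(** The variation used twice: to lower the constant of the inequality, and to extract first-order
    information from equality. *)
Let scale_at B a0 (r : R) : 'I_m -> 'M[R]_n := fun a => if a == a0 then r *: B a else B a.

Let scale_N B a0 r : Nf (scale_at B a0 r) = r ^+ 2 * sqn (B a0) + rest B a0.
Proof.
rewrite (NE _ a0) /scale_at eqxx /sqn frZl frZr; congr (_ + _); first by ring.
by apply: eq_bigr => b /negbTE ->.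
Qed.

Let scale_K B a0 r : Kf (scale_at B a0 r) = 2 * (r ^+ 2 * cmrest B a0) + Krest B a0.
Proof.
rewrite (KE _ a0); congr (2 * _ + _).
  rewrite /cmrest mulr_sumr; apply: eq_bigr => b /negbTE ba.
  by rewrite /scale_at eqxx ba cmZl /sqn frZl frZr; ring.
apply: eq_bigr => a /negbTE aa; apply: eq_bigr => b /negbTE ba.
by rewrite /scale_at aa ba.
Qed.

Let scale_sym B a0 r : symf B -> symf (scale_at B a0 r).
Proof. by move=> symB a; rewrite /scale_at; case: ifP => _; rewrite ?linearZ /= symB. Qed.

Let sqn_ge0 A : 0 <= sqn A. Proof. exact: fr_ge0. Qed.

Let cmrest_le B a0 p : symf B -> orthf B -> 0 <= p ->
  (forall a, a != a0 -> sqn (B a) <= p) ->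
  cmrest B a0 <= sqn (B a0) * (rest B a0 + p).
Proof.
move=> symB oB p0 pB; apply: commutator_le => //.
by move=> a b _ _; exact: oB.
Qed.

(** For a single matrix the previous estimate is the inequality |[A, B]|^2 <= 2 |A|^2 |B|^2; summed
    over all pairs it provides a first admissible constant. *)
Let rough_bound B : symf B -> Kf B <= 2 * Nf B ^+ 2.
Proof.
move=> symB; have E a b : sqn (cm (B a) (B b)) <= 2 * sqn (B a) * sqn (B b).
  have := @commutator_le (B a) B (pred1 b) (sqn (B b)) (symB a) symB (sqn_ge0 _).
  rewrite !big_pred1_eq => H; apply: le_trans (H _ _) _.
  - by move=> a' b' /eqP -> /eqP ->; rewrite eqxx.
  - by move=> a' /eqP ->.
  - by rewrite le_eqVlt; apply/orP; left; apply/eqP; ring.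
apply: (@le_trans _ _ (\sum_a \sum_b 2 * sqn (B a) * sqn (B b))).
  by apply: ler_sum => a _; apply: ler_sum => b _.
rewrite le_eqVlt; apply/orP; left; apply/eqP.
transitivity (\sum_a 2 * sqn (B a) * Nf B).
  by apply: eq_bigr => a _; rewrite -mulr_sumr.
by rewrite -mulr_suml -mulr_sumr expr2 mulrA.
Qed.

(** In an orthogonalised family the largest member, of squared norm p, is shrunk by the factor 1 - e
    in squared norm. The hypothesis bounds the shrunk family, and what was removed from K is 2e
    times [cmrest], at most 2e p N. With c e = c - 1 the total is at most c N^2 - (c - 1) e p N, and
    N <= m p turns the gain into a multiple of N^2. *)
Let improve c : 1 < c -> c <= 2 -> (forall B, symf B -> Kf B <= c * Nf B ^+ 2) ->
  forall B, symf B -> Kf B <= (c - (c - 1) ^+ 2 / (c * m%:R)) * Nf B ^+ 2.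
Proof.
move=> c1 c2 Hc B0 symB0; have [Q [QQ oB]] := orth_rotation B0.
rewrite -(rotf_N B0 QQ) -(rotf_K B0 QQ).
have := rotf_sym Q symB0; move: (rotf Q B0) oB => B oB symB {Q QQ B0 symB0}.
case: (pickP 'I_m) => [a' _|I0]; last first.
  have z (F : 'I_m -> R) : \sum_a F a = 0 by apply: big1 => a _; have := I0 a.
  by rewrite /Kf /Nf !z expr0n mulr0.
have m0 : 0 < m%:R :> R by rewrite ltr0n (leq_ltn_trans _ (ltn_ord a')).
pose a0 := [arg max_(a > a') sqn (B a)]%O.
have amax a : sqn (B a) <= sqn (B a0).
  by rewrite /a0; case: arg_maxP => // i _; exact.
pose p := sqn (B a0); pose N := Nf B; pose u := cmrest B a0.
have pN : p <= N by rewrite /N (NE B a0) lerDl; apply: sumr_ge0.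
have Np : N <= m%:R * p.
  rewrite /N /Nf; apply: (@le_trans _ _ (\sum_(a < m) p)).
    by apply: ler_sum => a _; exact: amax.
  by rewrite sumr_const card_ord mulr_natl.
have p0 : 0 <= p by exact: sqn_ge0.
have N0 : 0 <= N by exact: le_trans pN.
have up : u <= p * N.
  by rewrite /N (NE B a0) addrC; apply: cmrest_le.
pose e := (c - 1) / c.
have c0 : 0 < c by lra.
have e0 : 0 <= e by rewrite divr_ge0; lra.
have e1 : 0 <= 1 - e.
  by rewrite subr_ge0 ler_pdivrMr//; lra.
have := Hc _ (scale_sym a0 (Num.sqrt (1 - e)) symB).
rewrite scale_N scale_K sqr_sqrtr// -/u -/p => H.
have KE' : Kf B = 2 * ((1 - e) * u) + Krest B a0 + 2 * e * u by rewrite (KE B a0) -/u; ring.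
have NE' : (1 - e) * p + rest B a0 = N - e * p by rewrite /N (NE B a0) -/p; ring.
rewrite NE' in H; rewrite KE' -/N.
have ce : c * e = c - 1 by rewrite /e mulrCA divff ?mulr1// gt_eqF.
apply: (@le_trans _ _ (c * (N - e * p) ^+ 2 + 2 * e * (p * N))).
  by apply: lerD => //; apply: ler_wpM2l => //; exact: mulr_ge0.
have -> : c * (N - e * p) ^+ 2 + 2 * e * (p * N) =
   c * N ^+ 2 - 2 * ((c - 1) * e * (p * N)) + (c * e) * e * p ^+ 2 by ring.
have -> : (c - 1) ^+ 2 / (c * m%:R) = (c - 1) * e / m%:R.
  by rewrite /e; field; rewrite !gt_eqF.
rewrite ce mulrBl.
have h1 : (c - 1) * e * p ^+ 2 <= (c - 1) * e * (p * N).
  by apply: ler_wpM2l; [apply: mulr_ge0; lra|rewrite expr2 ler_wpM2l].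
have h2 : (c - 1) * e / m%:R * N ^+ 2 <= (c - 1) * e * (p * N).
  rewrite -!(mulrA ((c - 1) * e)); apply: ler_wpM2l; first by apply: mulr_ge0; lra.
  by rewrite expr2 mulrA ler_wpM2r// mulrC ler_pdivrMr// mulrC.
by move: h1 h2; lra.
Qed.

(** The infimum of the admissible constants in [1, oo) is itself admissible, and [improve] would
    lower it if it were greater than 1. *)
Lemma ddvv B : symf B -> Kf B <= Nf B ^+ 2.
Proof.
move=> symB; pose D := [set c : R | 1 <= c /\ forall B, symf B -> Kf B <= c * Nf B ^+ 2]%classic.
have D2 : D 2 by split; [lra|exact: rough_bound].
have lbD : has_lbound D by exists 1 => c [].
have hD : has_inf D by split=> //; exists 2.
pose c := inf D.
have c1 : 1 <= c by apply: lb_le_inf => [|x []]; [exists 2|].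
have c2 : c <= 2 by apply: ge_inf.
have cD B' : symf B' -> Kf B' <= c * Nf B' ^+ 2.
  move=> symB'; have [N0|N0] := eqVneq (Nf B') 0.
    by have := D2.2 _ symB'; rewrite N0 expr0n /= !mulr0.
  have Npos : 0 < Nf B' ^+ 2 by rewrite lt_def sqr_ge0 andbT sqrf_eq0.
  rewrite -ler_pdivrMr//; apply: lb_le_inf; first by exists 2.
  by move=> x [_ Hx]; rewrite ler_pdivrMr// Hx.
have [c_gt1|c_le1] := ltP 1 c; last first.
  apply: le_trans (cD _ symB) _; rewrite -[leRHS]mul1r ler_wpM2r// sqr_ge0 //.
exfalso; case: (pickP 'I_m) => [a' _|I0]; last first.
  have z (F : 'I_m -> R) : \sum_a F a = 0 by apply: big1 => a _; have := I0 a.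
  have : D 1 by split=> // B' _; rewrite /Kf /Nf !z expr0n mulr0.
  by move/(ge_inf lbD); rewrite -/c; lra.
have m0 : 0 < m%:R :> R by rewrite ltr0n (leq_ltn_trans _ (ltn_ord a')).
pose e := (c - 1) ^+ 2 / (c * m%:R).
have e0 : 0 < e.
  by apply: divr_gt0; [rewrite exprn_gt0//; lra|rewrite mulr_gt0//; lra].
(* [D] contains only constants at least 1, which bounds it below; the improved constant is truncated
   accordingly. *)
pose c' := Num.max 1 (c - e).
have : D c'.
  split; first by rewrite /c' le_max lexx.
  move=> B' symB'; apply: le_trans (improve c_gt1 c2 cD symB') _.
  by rewrite ler_wpM2r ?sqr_ge0// /c' le_max lexx orbT.
move/(ge_inf lbD); rewrite -/c /c' le_max => /orP[]; lra.
Qed.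

Section Equality.
Variable B : 'I_m -> 'M[R]_n.
Hypotheses (symB : symf B) (oB : orthf B) (eqB : Kf B = Nf B ^+ 2) (N0 : 0 < Nf B).
Let N := Nf B.

(** A polynomial that is nonnegative on [0, oo) and zero at the interior point 1 has zero derivative
    there; the test point 1 - x / y' makes this explicit. *)
Let first_order (x y : R) : (forall r, 0 <= r -> 0 <= (r - 1) * x + (r - 1) ^+ 2 * y) -> x = 0.
Proof.
move=> H; have [//|x0] := eqVneq x 0.
pose y' := `|y| + `|x| + 1; have y'0 : 0 < y' by rewrite ltr_wpDl// addr_ge0.
have yy : y < y' by rewrite /y' -addrA (le_lt_trans (ler_norm y))// ltrDl ltr_wpDl.
have xx : `|x| <= y' by rewrite /y' addrAC lerDr addr_ge0.
have := H (1 - x / y').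
have -> : 1 - x / y' - 1 = - (x / y') by ring.
have -> : - (x / y') * x + (- (x / y')) ^+ 2 * y = - ((x / y') ^+ 2 * (y' - y)).
  by field; rewrite gt_eqF.
move=> H'; have : 0 <= - ((x / y') ^+ 2 * (y' - y)).
  apply: H'; rewrite subr_ge0 ler_pdivrMr// mul1r; exact: le_trans (ler_norm _) xx.
have : 0 < (x / y') ^+ 2 * (y' - y).
  apply: mulr_gt0; last by lra.
  by rewrite lt_def sqr_ge0 andbT sqrf_eq0 mulf_neq0// invr_neq0// gt_eqF.
lra.
Qed.

(** Equality holds for B and the inequality for every rescaling of [B a], so the derivative of N^2 -
    K in the squared scale vanishes at 1. *)
Lemma eq_cmrest a : cmrest B a = sqn (B a) * N.
Proof.
have : 2 * sqn (B a) * N - 2 * cmrest B a = 0.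
  apply: (@first_order _ (sqn (B a) ^+ 2)) => r r0.
  have := ddvv (scale_sym a (Num.sqrt r) symB).
  rewrite scale_N scale_K sqr_sqrtr//; move: eqB; rewrite (KE B a) /N (NE B a).
  move: (Krest B a) (cmrest B a) (rest B a) (sqn (B a)) => k u w p E.
  have -> : k = (p + w) ^+ 2 - 2 * u by rewrite -E; ring.
  rewrite -subr_ge0 => H; apply: le_trans H _; rewrite le_eqVlt; apply/orP; left; apply/eqP.
  by ring.
lra.
Qed.

Let pos_max (S : pred 'I_m) : 0 < \sum_(a | S a) sqn (B a) ->
  exists a, [/\ S a, 0 < sqn (B a) & forall b, S b -> sqn (B b) <= sqn (B a)].
Proof.
move=> Spos.
have [a' Sa'] : exists a, S a.
  case: (pickP S) => [a Sa|S0]; first by exists a.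
  by move: Spos; rewrite big_pred0// ltxx.
pose a0 := [arg max_(a > a' | S a) sqn (B a)]%O.
have [Sa amax] : S a0 /\ forall b, S b -> sqn (B b) <= sqn (B a0).
  by rewrite /a0; case: arg_maxP.
exists a0; split=> //; rewrite lt_def sqn_ge0 andbT; apply/eqP => z.
move: Spos; rewrite big1 ?ltxx// => b Sb.
by apply/eqP; rewrite eq_le sqn_ge0 andbT -z amax.
Qed.

(** For a member of largest norm, [eq_cmrest] is the equality case of the estimate against an
    orthogonal family with p = [sqn (B a)], so the star structure is available; summing its weights
    p / 2 over both orientations computes [rest B a]. *)
Let extremal a : 0 < sqn (B a) -> (forall b, sqn (B b) <= sqn (B a)) ->
  exists (P : 'M[R]_n) (d : 'rV[R]_n) (c : 'I_n) (J : {set 'I_n}) (t : R),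
  [/\ P *m P^T = 1%:M, P *m B a *m P^T = diag_mx d & sqn (B a) = \sum_i d 0 i ^+ 2] /\
  [/\ c \notin J, (0 < #|J|)%N & t != 0] /\
    [/\ d 0 c = - #|J|%:R * t, (forall j, j \in J -> d 0 j = t),
        (forall j, j != c -> j \notin J -> d 0 j = 0) &
     forall i j, \sum_(b | b != a) (P *m B b *m P^T) i j ^+ 2 =
       if (i == c) && (j \in J) || (j == c) && (i \in J) then sqn (B a) / 2 else 0] /\
   rest B a = #|J|%:R * sqn (B a).
Proof.
move=> Ba amax.
have oB' b b' : b != a -> b' != a -> b != b' -> fr (B b) (B b') = 0 by move=> _ _; exact: oB.
have leB' b : b != a -> sqn (B b) <= sqn (B a) by move=> _; exact: amax.
have E0 : \sum_(b | b != a) sqn (cm (B a) (B b)) =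
    sqn (B a) * (\sum_(b | b != a) sqn (B b) + sqn (B a)).
  by rewrite -/(cmrest B a) eq_cmrest /N (NE B a) addrC.
have [P [d [c [J [t [H1 [H2 [H3 H4]]]]]]]] :=
  @commutator_eq (B a) B (fun b => b != a) (sqn (B a)) (symB a) symB (sqn_ge0 _) oB' leB' Ba Ba E0.
exists P, d, c, J, t; split; first exact: H1.
split; first exact: H2.
split; first exact: H3.
rewrite /rest H4; have [_ _ _ sE] := H3; have [cJ _ _] := H2.
pose v := sqn (B a) / 2.
transitivity (\sum_(i : 'I_n) \sum_(j : 'I_n)
    (((i == c)%:R * (j \in J)%:R + (j == c)%:R * (i \in J)%:R) * v)).
  apply: eq_bigr => i _; apply: eq_bigr => j _; rewrite sE.
  have [->|ic] := eqVneq i c; have [->|jc] := eqVneq j c; rewrite ?(negbTE cJ) /=;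
    try (case: (j \in J)); try (case: (i \in J)); rewrite /v /=; ring.
have E (F : 'I_n -> R) : \sum_i \sum_j ((i == c)%:R * F j) = \sum_j F j.
  rewrite (bigD1 c)//= [X in _ + X]big1 ?addr0 => [|i ic]; last first.
    by rewrite big1// => j _; rewrite (negbTE ic) mul0r.
  by apply: eq_bigr => j _; rewrite eqxx mul1r.
have C : \sum_j (j \in J)%:R = #|J|%:R :> R.
  by rewrite -natr_sum -sum1_card [in RHS]big_mkcond; congr (_%:R); apply: eq_bigr => j _; case: ifP.
under eq_bigr do rewrite -mulr_suml big_split /=.
rewrite -mulr_suml big_split /= E [X in _ + X]exchange_big /= E C /v; by field.
Qed.

Lemma eq_structure : exists (P : 'M[R]_n) (c j : 'I_n) (a1 a2 : 'I_m) (t x : R),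
  [/\ P *m P^T = 1%:M, c != j, a1 != a2, t != 0 & x ^+ 2 = t ^+ 2] /\
  forall a, P *m B a *m P^T =
    if a == a1 then t *: (delta_mx j j - delta_mx c c)
    else if a == a2 then x *: (delta_mx c j + delta_mx j c) else 0.
Proof.
have [a1 [_ p1 max1]] : exists a, [/\ predT a, 0 < sqn (B a) & forall b, predT b -> sqn (B b) <= sqn (B a)].
  exact: pos_max.
have {}max1 b : sqn (B b) <= sqn (B a1) by exact: max1.
have [P [d [c [J [t [[PP PA qE] [[cJ J0 t0] [[dc dJ dO sE] rE]]]]]]]] := extremal p1 max1.
have J0' : 0 < #|J|%:R :> R by rewrite ltr0n.
have r0 : 0 < rest B a1 by rewrite rE mulr_gt0.
have [a2 [a21 p2 max2]] := pos_max r0.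
(* The commutator estimate for [a1] with p = [sqn (B a2)], compared with the exact value from
   [eq_cmrest], gives sqn(B a1) <= sqn(B a2). *)
have p21 : sqn (B a2) = sqn (B a1).
  apply/eqP; rewrite eq_le max1 /=.
  have := cmrest_le symB oB (ltW p2) max2.
  by rewrite eq_cmrest /N (NE B a1) addrC ler_pM2l// lerD2l.
have p2' : 0 < sqn (B a2) by [].
have max2' b : sqn (B b) <= sqn (B a2) by rewrite p21.
have [P2 [d2 [c2 [J2 [t2 [[PP2 PA2 qE2] [[cJ2 J02 t20] [[dc2 dJ2 dO2 _] rE2]]]]]]]] := extremal p2' max2'.
have JJ : #|J2|%:R = #|J|%:R :> R.
  have := NE B a1; rewrite (NE B a2) rE rE2 p21 => /addrI /mulIf; apply.
  by rewrite gt_eqF.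
(* The trace of [B a2 ^ 3] computed in both frames forces [#|J| = 1]. *)
pose X := P *m B a2 *m P^T.
have Xs i j : ~~ ((i == c) && (j \in J) || (j == c) && (i \in J)) -> X i j = 0.
  move=> /negbTE H; have := sE i j; rewrite H => /psumr_eq0P H'.
  have := H' (fun k _ => sqr_ge0 _) a2 a21.
  by move/eqP; rewrite sqrf_eq0 => /eqP.
(* [X] is supported on the edges of a star, a graph without closed walks of length 3. *)
have trX : \tr (X *m X *m X) = 0.
  apply: big1 => i _; rewrite mxE; apply: big1 => k _; rewrite mxE mulr_suml; apply: big1 => j _.
  have [ij|/Xs->] := boolP ((i == c) && (j \in J) || (j == c) && (i \in J)); last by rewrite !mul0r.
  have [jk|/Xs->] := boolP ((j == c) && (k \in J) || (k == c) && (j \in J)); last by rewrite mulr0 mul0r.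
  have [ki|/Xs->] := boolP ((k == c) && (i \in J) || (i == c) && (k \in J)); last by rewrite mulr0.
  exfalso; move: ij jk ki; have [->|ic] := eqVneq i c; have [->|jc] := eqVneq j c;
    have [->|kc] := eqVneq k c; rewrite ?(negbTE cJ) /= ?andbF ?orbF //.
have conj3 (Q Y : 'M[R]_n) : Q *m Q^T = 1%:M ->
    \tr ((Q *m Y *m Q^T) *m (Q *m Y *m Q^T) *m (Q *m Y *m Q^T)) = \tr (Y *m Y *m Y).
  move=> QQ; rewrite !mulmxA -!(mulmxA _ Q^T Q) (mulmx1C QQ) !mulmx1.
  by rewrite mxtrace_mulC !mulmxA (mulmx1C QQ) mul1mx.
have : #|J|%:R = 1 :> R.
  move: trX; rewrite conj3// -(conj3 _ _ PP2) PA2.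
  have -> : \tr (diag_mx d2 *m diag_mx d2 *m diag_mx d2) = \sum_i d2 0 i ^+ 3.
    by apply: eq_bigr => i _; rewrite !mulmx_diag !mxE eqxx mulr1n; ring.
  rewrite (bigD1 c2)//= (bigID (mem J2)) /= [X in _ + (_ + X)]big1 ?addr0; last first.
    by move=> j /andP[jc jJ]; rewrite dO2// expr0n.
  rewrite (eq_bigl (fun j => j \in J2)); last first.
    move=> j; rewrite andbC /=; case jJ : (j \in J2) => //=.
    by apply/negP => /eqP jc; move: cJ2; rewrite -jc jJ.
  rewrite (eq_bigr (fun=> t2 ^+ 3)); last by move=> j jJ; rewrite dJ2.
  rewrite sumr_const -(mulr_natl (t2 ^+ 3)) dc2 JJ => H.
  have : t2 ^+ 3 * (#|J|%:R * ((1 - #|J|%:R) * (1 + #|J|%:R))) = 0.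
    by rewrite -[RHS]H; ring.
  move/eqP; rewrite mulf_eq0 expf_eq0 /= (negbTE t20) /= mulf_eq0 (gt_eqF J0') /= mulf_eq0.
  by case/orP => /eqP; move: J0'; lra.
move=> J1; have /eqP/cards1P[j Jj] : #|J| = 1%N by apply/eqP; rewrite -(eqr_nat R) J1.
have cj : c != j by move: cJ; rewrite Jj inE.
have qt : sqn (B a1) = 2 * t ^+ 2.
  rewrite qE (bigD1 c)//= (bigD1 j) 1?eq_sym//= big1 ?addr0; last first.
    by move=> k /andP[kc kj]; rewrite dO ?expr0n// Jj inE.
  by rewrite dc J1 dJ ?Jj ?inE//; ring.
have Bb b : b != a1 -> P *m B b *m P^T = (P *m B b *m P^T) c j *: (delta_mx c j + delta_mx j c).
  move=> ba; set Y := P *m B b *m P^T.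
  have symY : Y^T = Y by rewrite /Y !trmx_mul trmxK symB mulmxA.
  have Ys i k : ~~ ((i == c) && (k == j) || (k == c) && (i == j)) -> Y i k = 0.
    move=> /negbTE H; have := sE i k; rewrite Jj !inE H => /psumr_eq0P H'.
    have := H' (fun k _ => sqr_ge0 _) b ba.
    by move/eqP; rewrite sqrf_eq0 => /eqP.
  have E (x : R) i k : (x *: (delta_mx c j + delta_mx j c) : 'M[R]_n) i k =
      x * (((i == c) && (k == j))%:R + ((k == c) && (i == j))%:R).
    by rewrite !mxE [(i == j) && _]andbC.
  have jc : (j == c) = false by rewrite eq_sym (negbTE cj).
  apply/matrixP => i k; rewrite E.
  have [/andP[/eqP-> /eqP->]|H1] := boolP ((i == c) && (k == j)).
    by rewrite jc /= addr0 mulr1.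
  have [/andP[/eqP-> /eqP->]|H2] := boolP ((k == c) && (i == j)).
    by rewrite add0r mulr1 -{1}symY mxE.
  by rewrite Ys ?negb_or ?H1 ?H2//= addr0 mulr0.
exists P, c, j, a1, a2, t, ((P *m B a2 *m P^T) c j).
have sx b : b != a1 -> sqn (B b) = 2 * (P *m B b *m P^T) c j ^+ 2.
  move=> ba; rewrite /sqn -(fr_conj _ _ PP) {1 2}(Bb b ba) frZl frZr.
  have -> : fr (delta_mx c j + delta_mx j c) (delta_mx c j + delta_mx j c : 'M[R]_n) = 2.
    by rewrite frDr !fr_delta !mxE !eqxx [j == c]eq_sym (negbTE cj) /=; ring.
  by ring.
split.
  split=> //; first by rewrite eq_sym.
  by have := sx _ a21; rewrite p21 qt; lra.
move=> a; have [->|aa1] := eqVneq a a1.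
  rewrite PA; apply/matrixP => i k; rewrite !mxE.
  have [->|ik] := eqVneq i k; last first.
    have F l : (i == l) && (k == l) = false.
      by apply/negP => /andP[/eqP il /eqP kl]; move: ik; rewrite il kl eqxx.
    by rewrite !F subrr mulr0.
  rewrite mulr1n andbb andbb; have [->|kc] := eqVneq k c.
    by rewrite dc J1 (negbTE cj) /=; ring.
  have [->|kj] := eqVneq k j; first by rewrite dJ ?Jj ?inE//=; ring.
  by rewrite dO ?Jj ?inE//= subrr mulr0.
have [->|aa2] := eqVneq a a2; first exact: Bb.
suff : sqn (B a) = 0.
  by move/fr_eq0 => ->; rewrite mulmx0 mul0mx.
have : rest B a1 = sqn (B a1) by rewrite rE J1 mul1r.
rewrite /rest (bigD1 a2)//= p21 => /(canRL (addKr _)); rewrite addNr => /psumr_eq0P H.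
by apply: H => [b _|]; [exact: sqn_ge0|rewrite aa1].
Qed.
End Equality.

End DDVV.

(** * The Gauss equation and the equality in the Wintgen inequality *)

Section Gauss.
Context {R : realType} {n p : nat}.
Local Notation V := 'rV[R]_n.
Local Notation W := 'rV[R]_p.
Variables (G : V -> 'M[R]_n) (U : set V) (Gt : W -> 'M[R]_p) (Ut : set W) (F : V -> W).
Hypotheses (gm : metric_on G U) (gmt : metric_on Gt Ut) (sF : forall k, Ck k U F)
  (FU : forall x, U x -> Ut (F x))
  (iso : forall x, U x -> forall u v,
     ip (G x) u v = ip (Gt (F x)) (pd u F x) (pd v F x)).
Implicit Types (x u v w z : V).
Local Notation chr := (christoffel G).
Local Notation chrt := (christoffel Gt).
Local Notation gt x := (ip (Gt (F x))).
Local Notation h := (second_ff G Gt F).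

Let nU x : U x -> \forall y \near x, U y.
Proof. exact: (nearU gm). Qed.

Lemma dF x : U x -> differentiable F x.
Proof. by move=> Ux; exact: (Ck_diff (sF 0)). Qed.

Lemma dpdF v x : U x -> differentiable (pd v F) x.
Proof. by move=> Ux; exact: (Ck_diff (Ck_pd _ (sF 1))). Qed.

Lemma dpdpdF u v x : U x -> differentiable (pd u (pd v F)) x.
Proof. by move=> Ux; exact: (Ck_diff (Ck_pd _ (Ck_pd _ (sF 2)))). Qed.

Lemma dGtF x : U x -> differentiable (fun y => Gt (F y)) x.
Proof. by move=> Ux; apply: differentiable_comp; [exact: dF|exact: (dG gmt (FU Ux))]. Qed.

(** Writes the Christoffel symbol, whose base point and both arguments vary along [F], as a finite
    sum of products that can be differentiated. *)
Lemma chr_expand y (a b : W) : Ut y ->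
  chrt y a b = \sum_i a 0 i *: (b *m cmx Gt y (basis_vec i)).
Proof.
move=> Uy; have cs (I : Type) (r : seq I) (H : I -> W) :
    chrt y b (\sum_(i <- r) H i) = \sum_(i <- r) chrt y b (H i).
  elim: r => [|i r IH]; last by rewrite !big_cons (chrDr gmt)// IH.
  by have := chrZr gmt 0 b 0 Uy; rewrite !big_nil !scale0r.
rewrite (chrC gmt)// {1}[a]row_sum_delta cs; apply: eq_bigr => i _.
by rewrite (chrZr gmt)// (mul_cmx gmt)// (chrC gmt).
Qed.

Let dcF i x : U x -> differentiable (fun y => cmx Gt (F y) (basis_vec i)) x.
Proof. by move=> Ux; exact: (differentiable_comp (dF Ux) (d_cmx gmt (basis_vec i) (FU Ux))). Qed.

Let chr_alongE (a b : V -> W) x : U x ->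
  \forall y \near x, \sum_i a y 0 i *: (b y *m cmx Gt (F y) (basis_vec i)) = chrt (F y) (a y) (b y).
Proof. by move=> Ux; apply: filterS (nU Ux) => y Uy; rewrite chr_expand//; exact: FU. Qed.

Lemma d_chr_along (a b : V -> W) x : U x -> differentiable a x -> differentiable b x ->
  differentiable (fun y => chrt (F y) (a y) (b y)) x.
Proof.
move=> Ux da db; apply: (near_eq_differentiable (chr_alongE a b Ux)).
apply: differentiable_bsum => i; apply: differentiable_scale.
  exact: (differentiable_mxP _ _).1 da _ _.
by apply: differentiable_mulmx => //; exact: dcF.
Qed.

Lemma pd_chr_along (a b : V -> W) x u : U x -> differentiable a x -> differentiable b x ->
  pd u (fun y => chrt (F y) (a y) (b y)) x =
  pd (pd u F x) (fun z : W => chrt z (a x) (b x)) (F x)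
  + chrt (F x) (pd u a x) (b x) + chrt (F x) (a x) (pd u b x).
Proof.
move=> Ux da db; have UFx := FU Ux.
have da' i := (differentiable_mxP _ _).1 da 0 i.
rewrite -(pd_near_eq u (chr_alongE a b Ux)).
rewrite pd_bsum => [|i]; last first.
  by apply: differentiable_scale => //; apply: differentiable_mulmx => //; exact: dcF.
have -> : pd (pd u F x) (fun z : W => chrt z (a x) (b x)) (F x) =
    \sum_i a x 0 i *: (b x *m pd (pd u F x) (fun z : W => cmx Gt z (basis_vec i)) (F x)).
  have E : \forall z \near F x, \sum_i a x 0 i *: (b x *m cmx Gt z (basis_vec i)) = chrt z (a x) (b x).
    by apply: filterS (nearU gmt UFx) => y Uy; rewrite chr_expand.
  have dc i : differentiable (fun z : W => cmx Gt z (basis_vec i)) (F x) by exact: (d_cmx gmt _ UFx).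
  have db' i : differentiable (fun z : W => b x *m cmx Gt z (basis_vec i)) (F x).
    by apply: differentiable_mulmx => //; exact: differentiable_cst.
  rewrite -(pd_near_eq _ E) pd_bsum => [|i]; last first.
    by apply: differentiable_scale => //; exact: differentiable_cst.
  apply: eq_bigr => i _; rewrite (pd_scale (f := cst (a x 0 i)) _ (differentiable_cst _ _) (db' i)).
  rewrite pd_cst scale0r add0r (pd_mulmx (M := cst (b x)) _ (differentiable_cst _ _) (dc i)).
  by rewrite pd_cst mul0mx add0r.
rewrite !chr_expand// -!big_split /=; apply: eq_bigr => i _.
have dc := dcF i Ux.
rewrite pd_scale//; last exact: differentiable_mulmx.
rewrite pd_mulmx// pd_entry//.
rewrite (pd_chain (f := F) (g := fun z : W => cmx Gt z (basis_vec i)) _ (dF Ux) (d_cmx gmt _ UFx)).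
rewrite scalerDr; move: (_ *: _) (_ *: _) (_ *: _) => A B C.
by rewrite addrA addrC addrA.
Qed.

(** The ambient covariant derivative, along [F], of the image of the constant field v; its
    tangential part is intrinsic and its normal part is h. *)
Definition nt u v x : W := pd u (pd v F) x + chrt (F x) (pd u F x) (pd v F x).

Lemma second_ffE x u v : h x u v = nt u v x - pd (chr x u v) F x.
Proof.
by rewrite /second_ff /= /nabla_along /push (nabla_cstE G u v) /= !pdEx (pdE v F).
Qed.

Lemma nt_sym x u v : U x -> nt u v x = nt v u x.
Proof.
move=> Ux; rewrite /nt (chrC gmt (pd v F x) (pd u F x) (FU Ux)); congr (_ + _).
by apply: pd_sym; [apply: filterS (nU Ux) => y; exact: dF|exact: dpdF..].
Qed.

Lemma d_nt u v x : U x -> differentiable (nt u v) x.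
Proof.
move=> Ux; apply: differentiableD; first exact: dpdpdF.
by apply: d_chr_along => //; exact: dpdF.
Qed.

Lemma pd_gt (S T : V -> W) x u : U x -> differentiable S x -> differentiable T x ->
  pd u (fun y => gt y (S y) (T y)) x =
  gt x (pd u S x + chrt (F x) (pd u F x) (S x)) (T x)
  + gt x (S x) (pd u T x + chrt (F x) (pd u F x) (T x)).
Proof.
move=> Ux dS dT; rewrite pd_ip//; last exact: dGtF.
rewrite (pd_chain (f := F) (g := Gt) _ (dF Ux) (dG gmt (FU Ux))).
rewrite (metric_compat gmt _ _ _ (FU Ux)) ipDl ipDr; do 4!move: (ip _ _ _).
by move=> a b c d; ring.
Qed.

(** Symmetry of [nt] and compatibility with the ambient metric are all that the Koszul formula uses,
    so the tangential part is the Levi-Civita connection of the induced metric. *)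
Lemma nt_tangent x u v w : U x -> gt x (nt u v x) (pd w F x) = ip (G x) (chr x u v) w.
Proof.
move=> Ux; have E a b c : ip (pd a G x) b c = gt x (nt a b x) (pd c F x) + gt x (pd b F x) (nt a c x).
  have -> : ip (pd a G x) b c = pd a (fun y => gt y (pd b F y) (pd c F y)) x.
    rewrite -(@pd_near_eq _ _ _ (fun y => ip (G y) b c)); last first.
      by apply: filterS (nU Ux) => y Uy; exact: iso.
    rewrite (pd_ip (a := cst b) (b := cst c)); [|exact: (dG gm)|exact: differentiable_cst..].
    by rewrite !pd_cst ip0l ip0r !addr0.
  by rewrite pd_gt//; exact: dpdF.
have sC a b c : gt x (pd b F x) (nt a c x) = gt x (nt a c x) (pd b F x).
  exact: (ipC gmt _ _ (FU Ux)).
rewrite (koszul gm)// !E !sC (nt_sym v u)// (nt_sym w v)// (nt_sym w u)//.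
by do 3!move: (ip _ _ _); move=> a b c; field.
Qed.

Lemma second_ff_normal x u v w : U x -> gt x (h x u v) (pd w F x) = 0.
Proof. by move=> Ux; rewrite second_ffE ipBl nt_tangent// -iso// subrr. Qed.

Lemma second_ff_sym x u v : U x -> h x u v = h x v u.
Proof. by move=> Ux; rewrite !second_ffE nt_sym// (chrC gm). Qed.

Lemma pd_linF x (a : R) u v : U x -> pd (a *: u + v) F x = a *: pd u F x + pd v F x.
Proof. by move=> Ux; rewrite pd_dirD ?pd_dirZ//; exact: dF. Qed.

Lemma second_ff_linr x (a : R) u v w : U x -> h x u (a *: v + w) = a *: h x u v + h x u w.
Proof.
move=> Ux; rewrite (second_ff_sym _ (a *: v + w))// !(second_ff_sym u)//.
rewrite !second_ffE (chrDl gm)// (chrZl gm)// pd_linF//.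
have -> : nt (a *: v + w) u x = a *: nt v u x + nt w u x.
  rewrite /nt pd_linF// pd_dirD ?pd_dirZ; try exact: dpdF.
  rewrite (chrDl gmt _ _ _ (FU Ux)) (chrZl gmt _ _ _ (FU Ux)) scalerDr.
  by rewrite addrACA.
by rewrite scalerBr opprD addrACA.
Qed.

Lemma nt_ip x u v w z : U x -> gt x (nt u v x) (nt w z x) =
  ip (G x) (chr x u v) (chr x w z) + gt x (h x u v) (h x w z).
Proof.
move=> Ux; have E a b : nt a b x = h x a b + pd (chr x a b) F x by rewrite second_ffE subrK.
have N1 a b c := second_ff_normal a b c Ux.
have N2 a b c : gt x (pd c F x) (h x a b) = 0 by rewrite (ipC gmt _ _ (FU Ux)).
have N3 := iso Ux (chr x u v) (chr x w z).
move: (E u v) (E w z) (N1 u v (chr x w z)) (N2 w z (chr x u v)) N3.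
move: (h x u v) (h x w z) (pd (chr x u v) F x) (pd (chr x w z) F x) => a b c d -> -> n1 n2 ->.
by rewrite ipDl !ipDr n1 n2 addr0 add0r addrC.
Qed.

(** The curvature of the ambient connection pulled back along [F]: higher derivatives of [F] cancel
    by symmetry, and the derivatives of the ambient Christoffel symbols remain. *)
Lemma nt_curvature x u v w : U x ->
  (pd u (nt v w) x + chrt (F x) (pd u F x) (nt v w x))
  - (pd v (nt u w) x + chrt (F x) (pd v F x) (nt u w x))
  = curv_endo Gt (F x) (pd u F x) (pd v F x) (pd w F x).
Proof.
move=> Ux; have UFx := FU Ux.
have E a b : pd a (nt b w) x = pd a (pd b (pd w F)) x +
   (pd (pd a F x) (fun z : W => chrt z (pd b F x) (pd w F x)) (F x)
   + chrt (F x) (pd a (pd b F) x) (pd w F x) + chrt (F x) (pd b F x) (pd a (pd w F) x)).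
  rewrite pdD; [|exact: dpdpdF|by apply: d_chr_along => //; exact: dpdF].
  by rewrite pd_chr_along//; exact: dpdF.
rewrite !E curv_endoE /nt !(chrDr gmt _ _ _ UFx).
have -> : pd u (pd v (pd w F)) x = pd v (pd u (pd w F)) x.
  by apply: pd_sym; [apply: filterS (nU Ux) => y; exact: dpdF|exact: dpdpdF..].
have -> : pd u (pd v F) x = pd v (pd u F) x.
  by apply: pd_sym; [apply: filterS (nU Ux) => y; exact: dF|exact: dpdF..].
move: (pd v (pd u (pd w F)) x) (chrt _ (pd v (pd u F) x) _) => A B.
move: (chrt _ _ (pd u (pd w F) x)) (chrt _ _ (pd v (pd w F) x)).
move: (chrt _ (pd u F x) (chrt _ _ _)) (chrt _ (pd v F x) (chrt _ _ _)).
move: (pd _ (fun y => chrt y (pd v F x) _) _) (pd _ (fun y => chrt y (pd u F x) _) _).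
by move=> a b c d e f; apply/rowP => j; rewrite !mxE; ring.
Qed.

(** The previous identity is paired with a tangent vector. Metric compatibility, applied to
    [nt_tangent] at nearby points, produces the intrinsic terms and the products of second
    fundamental forms. *)
Lemma gauss_equation x u v w z : U x ->
  curv G x u v w z = curv Gt (F x) (pd u F x) (pd v F x) (pd w F x) (pd z F x)
  + gt x (h x v w) (h x u z) - gt x (h x u w) (h x v z).
Proof.
move=> Ux; rewrite [in RHS]/curv -nt_curvature// ipBl.
have E a b : gt x (pd a (nt b w) x + chrt (F x) (pd a F x) (nt b w x)) (pd z F x) =
  pd a (fun y => ip (G y) (chr y b w) z) x - (ip (G x) (chr x b w) (chr x a z) + gt x (h x b w) (h x a z)).
  rewrite -nt_ip// -(@pd_near_eq _ _ _ (fun y => gt y (nt b w y) (pd z F y))); last first.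
    by apply: filterS (nU Ux) => y Uy; exact: nt_tangent.
  rewrite pd_gt//; [|exact: d_nt|exact: dpdF].
  by rewrite -/(nt a z x) addrK.
rewrite -> (curvE gm u v w z Ux).
have key (a b c d e f r s : R) : a = c - (e + f) -> b = d - (r + s) ->
  c - e - (d - r) = a - b + f - s by move=> -> ->; ring.
exact: key (E u v) (E v u).
Qed.

End Gauss.

Section SumLt.
Context {R : realType}.

Lemma sum_lt (n : nat) (f : 'I_n -> 'I_n -> R) : (forall i j, f i j = f j i) ->
  2 * (\sum_(i < n) \sum_(j < n | (i < j)%N) f i j) + \sum_i f i i = \sum_i \sum_j f i j.
Proof.
move=> fC.
have -> : \sum_i \sum_j f i j = \sum_(i < n) (\sum_(j < n | (i < j)%N) f i j + \sum_(j < n | (j < i)%N) f i j + f i i).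
  apply: eq_bigr => i _; rewrite (bigD1 i)//= addrC; congr (_ + _).
  rewrite (bigID (fun j : 'I_n => (i < j)%N)) /=; congr (_ + _); apply: eq_bigl => j.
    by case: ltngtP => [ij|ij|ij]; rewrite ?andbT ?andbF// -val_eqE /= gtn_eqF.
  by rewrite -val_eqE /=; case: ltngtP => ij.
rewrite big_split /= big_split /=; congr (_ + _).
have -> : \sum_(i < n) \sum_(j < n | (j < i)%N) f i j = \sum_(i < n) \sum_(j < n | (i < j)%N) f i j.
  rewrite (exchange_big_dep xpredT)//=; apply: eq_bigr => j _.
  by apply: eq_bigr => i _.
by ring.
Qed.
End SumLt.

(** * The Wintgen equality as equality in the DDVV inequality *)

Section WintgenAlgebra.
Context {R : realType} {n m : nat}.
Variables (A : 'I_m -> 'M[R]_n).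
Hypotheses (n2 : (2 <= n)%N) (symA : symf A).
Let nn : R := n%:R.

Definition tracefree_part (M : 'M[R]_n) : 'M[R]_n := M - (\tr M / nn)%:M.
Local Notation B := (fun a => tracefree_part (A a)).

Lemma tracefree_sym : symf B.
Proof. by move=> a; rewrite /tracefree_part linearB /= symA tr_scalar_mx. Qed.

Lemma cm_tracefree M N : cm (tracefree_part M) (tracefree_part N) = cm M N.
Proof.
rewrite /cm /tracefree_part !(mulmxBl, mulmxBr) !mul_scalar_mx !mul_mx_scalar.
rewrite !scale_scalar_mx [_ / _ * _]mulrC.
move: (M *m N) (N *m M) ((\tr M / nn) *: N) ((\tr N / nn) *: M) (_%:M) => a b c d e.
by apply/matrixP => i j; rewrite !mxE; ring.
Qed.

Let n0 : nn != 0. Proof. by rewrite pnatr_eq0 -lt0n (leq_trans _ n2). Qed.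
Let n1 : nn - 1 != 0.
Proof. by rewrite subr_eq0 (eqr_nat R n 1) gtn_eqF. Qed.

Lemma sqn_tracefree M : sqn (tracefree_part M) = sqn M - (\tr M) ^+ 2 / nn.
Proof.
rewrite /sqn /tracefree_part -scaleN1r -scalemx1 !(frDl, frDr, frZl, frZr).
have t1 X : fr 1%:M X = \tr X by rewrite frE mul1mx mxtrace_tr.
rewrite !t1 (frC M) !t1 mxtrace1 -/nn; field; exact: n0.
Qed.

(** Twice the double sum on the left is n(n - 1)k plus the sum of the (tr A)^2 - |A|^2, and four
    times the radicand is K of the trace-free parts, commutators being blind to multiples of the
    identity. The equality thus reads 2 sqrt(radicand) = N, which is then squared. *)
Lemma wintgen_ddvv (k : R) :
  2 / (nn * (nn - 1)) * (\sum_(i < n) \sum_(j < n | (i < j)%N)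
      (k + \sum_a (A a j j * A a i i - A a i j * A a j i)))
  = \sum_a (\tr (A a) / nn) ^+ 2
    - 2 / (nn * (nn - 1)) * Num.sqrt (\sum_(i < n) \sum_(j < n | (i < j)%N)
        \sum_(a < m) \sum_(b < m | (a < b)%N) (cm (A a) (A b) i j) ^+ 2) + k ->
  Kf B = Nf B ^+ 2.
Proof.
have T1 : 2 * (\sum_(i < n) \sum_(j < n | (i < j)%N)
      (k + \sum_a (A a j j * A a i i - A a i j * A a j i))) =
   nn * (nn - 1) * k + \sum_a ((\tr (A a)) ^+ 2 - sqn (A a)).
  have fC i j : k + \sum_a (A a j j * A a i i - A a i j * A a j i) =
     k + \sum_a (A a i i * A a j j - A a j i * A a i j).
    by congr (_ + _); apply: eq_bigr => a _; rewrite mulrC; congr (_ - _); exact: mulrC.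
  have := sum_lt fC.
  have -> : \sum_i (k + \sum_a (A a i i * A a i i - A a i i * A a i i)) = nn * k.
    transitivity (\sum_(i < n) k); last by rewrite sumr_const card_ord mulr_natl.
    by apply: eq_bigr => i _; rewrite big1 ?addr0// => a _; rewrite subrr.
  have -> : \sum_i \sum_j (k + \sum_a (A a j j * A a i i - A a i j * A a j i)) =
      nn * nn * k + \sum_a ((\tr (A a)) ^+ 2 - sqn (A a)).
    have cst (y : R) : \sum_(i < n) y = nn * y by rewrite sumr_const card_ord mulr_natl.
    under eq_bigr do rewrite big_split /= cst.
    rewrite big_split /= cst mulrA; congr (_ + _).
    under eq_bigr do rewrite exchange_big /=.
    rewrite exchange_big /=; apply: eq_bigr => a _.
    rewrite expr2 {1}/mxtrace mulr_suml /sqn /fr -sumrB; apply: eq_bigr => i _.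
    rewrite /mxtrace mulr_sumr -sumrB; apply: eq_bigr => j _.
    have -> : A a j i = A a i j by rewrite -{1}(symA a) mxE.
    by rewrite (mulrC (A a j j)).
  by move=> H; apply: (addIr (nn * k)); rewrite H; ring.
have T2 : 4 * (\sum_(i < n) \sum_(j < n | (i < j)%N)
        \sum_(a < m) \sum_(b < m | (a < b)%N) (cm (A a) (A b) i j) ^+ 2) = Kf B.
  have cmt a b : (cm (A a) (A b))^T = - cm (A a) (A b).
    by rewrite /cm linearB /= !trmx_mul !symA opprB.
  have cmij a b i j : cm (A a) (A b) j i = - cm (A a) (A b) i j.
    by have /matrixP/(_ i j) := cmt a b; rewrite mxE => ->; rewrite mxE.
  have E i j : 2 * (\sum_(a < m) \sum_(b < m | (a < b)%N) (cm (A a) (A b) i j) ^+ 2) =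
      \sum_a \sum_b (cm (A a) (A b) i j) ^+ 2.
    rewrite -(@sum_lt _ m (fun a b => (cm (A a) (A b) i j) ^+ 2)).
      rewrite [X in _ + X]big1 ?addr0// => a _.
      by rewrite cmxx mxE expr0n.
    by move=> a b; rewrite cmN [X in X ^+ 2]mxE sqrrN.
  have E2 : 2 * (\sum_(i < n) \sum_(j < n | (i < j)%N) \sum_a \sum_b (cm (A a) (A b) i j) ^+ 2)
      = \sum_i \sum_j \sum_a \sum_b (cm (A a) (A b) i j) ^+ 2.
    rewrite -(@sum_lt _ n (fun i j => \sum_a \sum_b (cm (A a) (A b) i j) ^+ 2)).
      rewrite [X in _ + X]big1 ?addr0// => i _; apply: big1 => a _; apply: big1 => b _.
      have := cmij a b i i => /eqP; rewrite -addr_eq0 -mulr2n mulrn_eq0 /= => /eqP ->.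
      by rewrite expr0n.
    move=> i j; apply: eq_bigr => a _; apply: eq_bigr => b _.
    by rewrite cmij sqrrN.
  have -> : Kf B = \sum_i \sum_j \sum_a \sum_b (cm (A a) (A b) i j) ^+ 2.
    rewrite /Kf; under eq_bigr do under eq_bigr do rewrite cm_tracefree /sqn /fr.
    under eq_bigr do rewrite exchange_big /=.
    rewrite exchange_big /=; apply: eq_bigr => i _.
    under eq_bigr do rewrite exchange_big /=.
    rewrite exchange_big /=; apply: eq_bigr => j _.
    by apply: eq_bigr => a _; apply: eq_bigr => b _; rewrite expr2.
  rewrite -E2; transitivity (2 * (2 * (\sum_(i < n) \sum_(j < n | (i < j)%N)
        \sum_(a < m) \sum_(b < m | (a < b)%N) (cm (A a) (A b) i j) ^+ 2))); first by ring.
  congr (2 * _); rewrite mulr_sumr; apply: eq_bigr => i _.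
  by rewrite mulr_sumr; apply: eq_bigr => j _; exact: E.
have T3 : Nf B = \sum_a (sqn (A a) - (\tr (A a)) ^+ 2 / nn).
  by apply: eq_bigr => a _; exact: sqn_tracefree.
set s := \sum_(i < n) \sum_(j < n | _) (k + _) in T1 *.
set q := \sum_(i < n) _ in T2 *.
have q0 : 0 <= q.
  by apply: sumr_ge0 => i _; apply: sumr_ge0 => j _; apply: sumr_ge0 => a _;
     apply: sumr_ge0 => b _; exact: sqr_ge0.
have -> : \sum_a (\tr (A a) / nn) ^+ 2 = (\sum_a (\tr (A a)) ^+ 2) / nn ^+ 2.
  by rewrite mulr_suml; apply: eq_bigr => a _; rewrite expr_div_n.
move: T1 T3; rewrite !sumrB -mulr_suml.
set t := \sum_a (\tr (A a)) ^+ 2; set N := \sum_a sqn (A a) => T1 T3.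
rewrite -!mulrA => E.
have {}E : 2 * Num.sqrt q = Nf B.
  have sE : s = (nn * (nn - 1) * k + (t - N)) / 2 by rewrite -T1; field.
  have : nn * (nn - 1) * (2 * ((nn * (nn - 1))^-1 * s)) = nn * (nn - 1) * (t / nn ^+ 2 - 2 * ((nn * (nn - 1))^-1 * Num.sqrt q) + k) by rewrite E.
  have -> : nn * (nn - 1) * (2 * ((nn * (nn - 1))^-1 * s)) = 2 * s by field; rewrite n0 n1.
  have -> : nn * (nn - 1) * (t / nn ^+ 2 - 2 * ((nn * (nn - 1))^-1 * Num.sqrt q) + k) =
    t - t / nn - 2 * Num.sqrt q + nn * (nn - 1) * k by field; rewrite n0 n1.
  by rewrite T3 T1; lra.
by rewrite -E exprMn sqr_sqrtr// -T2; ring.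
Qed.

End WintgenAlgebra.

(** * Planar normal form of the Gauss term *)

Section PlanarForm.
Context {R : realType} {n m : nat}.
Local Notation V := 'rV[R]_n.
Variables (G : 'M[R]_n) (e : 'I_n -> V) (al : 'I_m -> V -> V -> R).
Hypotheses (symG : G^T = G) (posG : forall u : V, u != 0 -> 0 < ip G u u)
  (eo : Defs.orthonormal G e) (alC : forall a u v, al a u v = al a v u)
  (al_lin : forall a r u v w, al a u (r *: v + w) = r * al a u v + al a u w).
Local Notation g := (ip G).
Let A a : 'M[R]_n := \matrix_(i, j) al a (e i) (e j).
Let lam a := \tr (A a) / n%:R.

Definition plane_shape (e1 e2 : V) (s t : R) (u v : V) : R :=
  s * (g u e1 * g v e1 - g u e2 * g v e2) + t * (g u e1 * g v e2 + g u e2 * g v e1).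
Definition plane_proj (e1 e2 : V) (u v : V) : R := g u e1 * g v e1 + g u e2 * g v e2.

(** Constant curvature c, a product of g with a traceless symmetric form on the plane of e1 and e2,
    and a multiple of the curvature form of that plane. The factor 2 nu arises from two shape
    operators whose trace-free parts have determinant - nu on the plane. *)
Definition planar_curvature (e1 e2 : V) (c s t nu : R) (u v w z : V) : R :=
  c * gg G u v w z
  + (plane_shape e1 e2 s t v w * g u z + g v w * plane_shape e1 e2 s t u z
     - plane_shape e1 e2 s t u w * g v z - g u w * plane_shape e1 e2 s t v z)
  - 2 * nu * (plane_proj e1 e2 v w * plane_proj e1 e2 u z
              - plane_proj e1 e2 u w * plane_proj e1 e2 v z).

Let crd (u : V) : V := \row_i g u (e i).

Let symA : symf A.
Proof. by move=> a; apply/matrixP => i j; rewrite !mxE alC. Qed.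

Let alE a u v : al a u v = ip (A a) (crd u) (crd v).
Proof.
have lin0 u' : al a u' 0 = 0.
  by have := al_lin a (-1) u' 0 0; rewrite scaler0 addr0 mulN1r addNr.
have ls u' (I : Type) (r : seq I) (c : I -> R) (F : I -> V) :
    al a u' (\sum_(i <- r) c i *: F i) = \sum_(i <- r) c i * al a u' (F i).
  by elim: r => [|i r IH]; rewrite ?big_nil// !big_cons al_lin IH.
rewrite {1}(frame_expand eo v) ls [RHS]/ip mxE.
apply: eq_bigr => j _; rewrite alC {1}(frame_expand eo u) ls !mxE mulrC; congr (_ * _).
by apply: eq_bigr => i _; rewrite !mxE alC.
Qed.

Let gE u v : g u v = ip 1%:M (crd u) (crd v).
Proof. by rewrite dotE (frame_ip eo); apply: eq_bigr => i _; rewrite !mxE. Qed.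

(** Rotating the normal frame does not change the Gauss sum and brings the trace-free shape
    operators to the DDVV normal form. Two of them survive, and since x^2 = t^2 their products
    combine into the curvature form of the plane. *)
Lemma planar_form : (2 <= n)%N ->
  Kf (fun a => tracefree_part (A a)) = Nf (fun a => tracefree_part (A a)) ^+ 2 ->
  (forall a u v, al a u v = lam a * g u v) \/
  exists e1 e2 c s t nu, [/\ g e1 e1 = 1, g e2 e2 = 1, g e1 e2 = 0 & 0 < nu] /\
    forall u v w z, \sum_a (al a v w * al a u z - al a u w * al a v z)
      = planar_curvature e1 e2 c s t nu u v w z.
Proof.
move=> n2; set B := fun a => tracefree_part (A a) => eqB.
have symB : symf B := tracefree_sym symA.
have AB a : A a = B a + (lam a)%:M by rewrite /B /tracefree_part subrK.
have [N0|N0] := eqVneq (Nf B) 0.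
  left=> a u v; have B0 : B a = 0.
    by apply: fr_eq0; apply: (psumr_eq0P _ N0) => // b _; exact: fr_ge0.
  by rewrite alE gE AB B0 add0r -scalemx1 ipZm.
right; have {N0} Npos : 0 < Nf B.
  by rewrite lt_def N0; apply: sumr_ge0 => b _; exact: fr_ge0.
have [Q [QQ oB]] := orth_rotation B.
have symB' := rotf_sym Q symB.
have eqB' : Kf (rotf Q B) = Nf (rotf Q B) ^+ 2 by rewrite rotf_K// rotf_N.
have N' : 0 < Nf (rotf Q B) by rewrite rotf_N.
have [P [c [j [a1 [a2 [t [x [[PP cj a12 t0 xt] PB]]]]]]]] := eq_structure symB' oB eqB' N'.
pose lam' a := \sum_b Q a b * lam b.
have rotE a : rotf Q A a = rotf Q B a + (lam' a)%:M.
  apply/matrixP => i k; rewrite mxE !rotfE [(_%:M) i k]mxE -mulr_natr mulr_suml -big_split /=.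
  by apply: eq_bigr => b _; rewrite AB mxE [(_%:M) i k]mxE -mulr_natr; ring.
pose al' a u v := \sum_b Q a b * al b u v.
pose f l : V := \sum_k P l k *: e k.
have crdP u l : (crd u *m P^T) 0 l = g u (f l).
  by rewrite mxE ip_sumr; apply: eq_bigr => k _; rewrite !mxE ipZr mulrC.
have ff k l : g (f k) (f l) = (k == l)%:R.
  have /matrixP/(_ k l) := PP; rewrite [RHS]mxE => <-.
  rewrite (frame_ip eo) mxE; apply: eq_bigr => i _; rewrite mxE.
  have E l' : g (f l') (e i) = P l' i.
    rewrite ip_suml (bigD1 i)//= big1 ?addr0 => [|k' ki]; last first.
      by rewrite ipZl eo (negbTE ki) mulr0.
    by rewrite ipZl eo eqxx mulr1.
  by rewrite !E.
have ip_delta k l (x' y' : V) : ip (delta_mx k l) x' y' = x' 0 k * y' 0 l.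
  rewrite /ip mxE (bigD1 l)//= big1 ?addr0 => [|i il].
    rewrite [y'^T _ _]mxE; congr (_ * _); rewrite mxE (bigD1 k)//= big1 ?addr0.
      by rewrite mxE !eqxx mulr1.
    by move=> i ik; rewrite mxE (negbTE ik) mulr0.
  rewrite [X in X * _](_ : _ = 0) ?mul0r// mxE big1// => k' _.
  by rewrite mxE (negbTE il) andbF mulr0.
have al'E a u v : al' a u v = lam' a * g u v
    + (a == a1)%:R * t * (g u (f j) * g v (f j) - g u (f c) * g v (f c))
    + (a == a2)%:R * x * (g u (f c) * g v (f j) + g u (f j) * g v (f c)).
  have -> : al' a u v = ip (rotf Q A a) (crd u) (crd v).
    rewrite /al' /rotf.
    rewrite (big_morph (fun M => ip M (crd u) (crd v)) (fun M N => ipDm M N _ _) (ip0m _ _)).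
    by apply: eq_bigr => b _; rewrite ipZm alE.
  rewrite rotE ipDm -scalemx1 ipZm -gE addrC -addrA; congr (_ + _).
  have -> : rotf Q B a = P^T *m (P *m rotf Q B a *m P^T) *m P.
    by rewrite !mulmxA (mulmx1C PP) mul1mx -mulmxA (mulmx1C PP) mulmx1.
  have -> M : ip (P^T *m M *m P) (crd u) (crd v) = ip M (crd u *m P^T) (crd v *m P^T).
    by rewrite /ip !mulmxA trmx_mul trmxK !mulmxA.
  rewrite PB -!crdP; have [->|aa1] := eqVneq a a1.
    rewrite (negbTE a12) mul1r !mul0r addr0 ipZm -scaleN1r ipDm ipZm !ip_delta; ring.
  have [_|_] := eqVneq a a2; last by rewrite ip0m !mul0r addr0.
  by rewrite mul1r !mul0r add0r ipZm ipDm !ip_delta.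
(* The cross terms between the traces and the two surviving operators give the plane shape; the
   minus sign appears because [a1] has eigenvalue t on [f j], the second basis vector, and - t on
   [f c], the first. *)
exists (f c), (f j), (\sum_a lam' a ^+ 2), (- lam' a1 * t), (lam' a2 * x), (t ^+ 2).
split.
  rewrite !ff !eqxx (negbTE cj); split=> //.
  by rewrite lt_def sqr_ge0 andbT sqrf_eq0.
move=> u v w z.
have -> : \sum_a (al a v w * al a u z - al a u w * al a v z) =
    \sum_a (al' a v w * al' a u z - al' a u w * al' a v z).
  by rewrite sumrB -(rot_dot QQ (fun a => al a v w)) -(rot_dot QQ (fun a => al a u w)) -sumrB.
have a21 : a2 != a1 by rewrite eq_sym.
have -> : \sum_a lam' a ^+ 2 = lam' a1 ^+ 2 + (lam' a2 ^+ 2 + \sum_(i | (i != a1) && (i != a2)) lam' i ^+ 2).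
  by rewrite (bigD1 a1)//= (bigD1 a2).
rewrite (bigD1 a1)//= (bigD1 a2)//=.
have -> : \sum_(i | (i != a1) && (i != a2))
   (al' i v w * al' i u z - al' i u w * al' i v z) =
   (\sum_(i | (i != a1) && (i != a2)) lam' i ^+ 2) * gg G u v w z.
  rewrite mulr_suml; apply: eq_bigr => i /andP[/negbTE i1 /negbTE i2].
  by rewrite !al'E i1 i2 /gg /=; ring.
rewrite !al'E !eqxx (negbTE a12) (negbTE a21) /planar_curvature /plane_shape /plane_proj /gg /=.
move: (\sum_(i | _) _) (lam' a1) (lam' a2) xt => L l1 l2.
move: (g u (f c)) (g u (f j)) (g v (f c)) (g v (f j)) (g w (f c)) (g w (f j)) (g z (f c)) (g z (f j)).
move=> u1 u2 v1 v2 w1 w2 z1 z2 xt.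
have XX : forall y : R, x ^+ 2 * y = t ^+ 2 * y by move=> y; rewrite xt.
have := XX ((v1 * w2 + v2 * w1) * (u1 * z2 + u2 * z1) - (u1 * w2 + u2 * w1) * (v1 * z2 + v2 * z1)).
move: (g v w) (g u z) (g u w) (g v z) => a b c' d H.
apply/eqP; rewrite -subr_eq0; apply/eqP.
transitivity (x ^+ 2 * ((v1 * w2 + v2 * w1) * (u1 * z2 + u2 * z1) - (u1 * w2 + u2 * w1) * (v1 * z2 + v2 * z1))
  - t ^+ 2 * ((v1 * w2 + v2 * w1) * (u1 * z2 + u2 * z1) - (u1 * w2 + u2 * w1) * (v1 * z2 + v2 * z1))).
  by ring.
by rewrite H subrr.
Qed.

End PlanarForm.

Section CurvatureTensor.
Context {R : realType} {n : nat}.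
Local Notation V := 'rV[R]_n.
Variables (G : V -> 'M[R]_n) (U : set V).
Hypothesis gm : metric_on G U.
Implicit Types (x u v w z : V).

Lemma curv_endo_lin3 x u v (a : R) w w' : U x ->
  curv_endo G x u v (a *: w + w') = a *: curv_endo G x u v w + curv_endo G x u v w'.
Proof. by move=> Ux; rewrite -!(mul_rmx gm)// mulmxDl scalemxAl. Qed.

Lemma curv_endo_lin1 x (a : R) u u' v w : U x ->
  curv_endo G x (a *: u + u') v w = a *: curv_endo G x u v w + curv_endo G x u' v w.
Proof.
move=> Ux; rewrite !curv_endoE.
have dc b c : differentiable (fun y => christoffel G y b c) x by exact: (d_chr gm).
rewrite pd_dirD// pd_dirZ//.
have -> : pd v (fun y => christoffel G y (a *: u + u') w) x =
    a *: pd v (fun y => christoffel G y u w) x + pd v (fun y => christoffel G y u' w) x.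
  rewrite -(@pd_near_eq _ _ _ (fun y => cst a y *: christoffel G y u w + christoffel G y u' w)).
    rewrite pdD//; last by apply: differentiable_scale => //; exact: differentiable_cst.
    by rewrite pd_scale// pd_cst scale0r add0r.
  by apply: filterS (nearU gm Ux) => y Uy; rewrite (chrDl gm)// (chrZl gm).
rewrite !(chrDl gm)// !(chrZl gm)// (chrDr gm)// (chrZr gm)//.
do 4!move: (pd _ _ _).
move: (christoffel G x u (_ _ _)) (christoffel G x u' (_ _ _)).
move: (christoffel G x v (christoffel G x u w)) (christoffel G x v (christoffel G x u' w)).
by move=> A B C D P Q S T; apply/rowP => j; rewrite !mxE; ring.
Qed.

Lemma curv_like x : U x -> curvature_like (curv G x).
Proof.
move=> Ux; split=> *; rewrite /curv.
- by rewrite curv_endo_lin1// ipDl ipZl.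
- by rewrite curv_endo_lin3// ipDl ipZl.
- by rewrite curv_endo_skew ipNl.
- exact: (curv_skew34 gm).
by rewrite -!ipDl (bianchi1 gm)// ip0l.
Qed.

Lemma constant_curv_form x k : U x ->
  (forall u v, area2 G x u v != 0 -> sectional G x u v = k) ->
  forall u v w z, curv G x u v w z = k * gg (G x) u v w z.
Proof.
move=> Ux sk; have sG := mo_sym gm Ux; have pG := mo_pos gm Ux.
apply: (constant_sectional sG pG (curv_like Ux)) => u v.
have -> : gg (G x) u v v u = area2 G x u v.
  by rewrite /gg /area2 (ip_sym sG v u) mulrC expr2.
exact: sk.
Qed.

End CurvatureTensor.

Section WintgenPoint.
Context {R : realType} {n m : nat}.
Local Notation V := 'rV[R]_n.
Local Notation W := 'rV[R]_(n + m).
Variables (G : V -> 'M[R]_n) (U : set V) (Gt : W -> 'M[R]_(n + m)) (Ut : set W) (F : V -> W)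
  (k : R).
Hypotheses (gm : metric_on G U) (gmt : metric_on Gt Ut) (sF : forall l, Ck l U F)
  (FU : forall x, U x -> Ut (F x))
  (iso : forall x, U x -> forall u v,
     ip (G x) u v = ip (Gt (F x)) (pd u F x) (pd v F x))
  (ck : forall y, Ut y -> forall u v w z, curv Gt y u v w z = k * gg (Gt y) u v w z).
Variable x : V.
Hypothesis Ux : U x.
Local Notation g := (ip (G x)).
Local Notation gt := (ip (Gt (F x))).
Local Notation h := (second_ff G Gt F x).

Let symg := mo_sym gm Ux.
Let posg := mo_pos gm Ux.
Let symgt := mo_sym gmt (FU Ux).
Let posgt := mo_pos gmt (FU Ux).

Lemma gauss_space_form u v w z : curv G x u v w z =
  k * gg (G x) u v w z + gt (h v w) (h u z) - gt (h u w) (h v z).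
Proof.
by rewrite (gauss_equation gm gmt sF FU iso _ _ _ _ Ux) (ck (FU Ux)) /gg -!iso.
Qed.

Variable e : 'I_n -> V.
Hypothesis eo : Defs.orthonormal (G x) e.

(** The image of a tangent frame is orthonormal by isometry, and its completion to an ambient frame
    supplies the m normal vectors. *)
Lemma normal_frame_exists : exists xi : 'I_m -> W, orthonormal_normal Gt F x xi.
Proof.
pose e0 (i : nat) : W := if insub i is Some i' then pd (e i') F x else 0.
have e0E (i : 'I_n) : e0 i = pd (e i) F x by rewrite /e0 valK.
have nm : (n <= n + m)%N by exact: leq_addr.
have [|E [E0 Eo]] := orthonormal_extend symgt posgt nm (e := e0).
  move=> i j ii jj; have := eo (Ordinal ii) (Ordinal jj).
  by rewrite iso// -!e0E.
exists (fun a => E (n + a)%N); split=> [a u|a b].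
  rewrite pdEx (frame_expand eo u).
  have ls (I : Type) (r : seq I) (c : I -> R) (H : I -> V) :
      pd (\sum_(i <- r) c i *: H i) F x = \sum_(i <- r) c i *: pd (H i) F x.
    elim: r => [|i r IH]; first by rewrite !big_nil pd_dir0.
    by rewrite !big_cons (pd_linF sF)// IH.
  rewrite ls ip_sumr big1// => i _; rewrite ipZr -e0E -E0//.
  have ii : (i < n + m)%N by exact: ltn_addr.
  have aa : (n + a < n + m)%N by rewrite ltn_add2l.
  by rewrite Eo// gtn_eqF ?mulr0// ltn_addr.
have aa : (n + a < n + m)%N by rewrite ltn_add2l.
have bb : (n + b < n + m)%N by rewrite ltn_add2l.
by rewrite Eo// eqn_add2l.
Qed.

Variable xi : 'I_m -> W.
Hypothesis xio : orthonormal_normal Gt F x xi.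

Lemma normal_expand (y : W) : (forall u, gt y (pd u F x) = 0) ->
  y = \sum_a gt y (xi a) *: xi a.
Proof.
move=> yn; have [xn xo] := xio.
pose E (i : 'I_(n + m)) : W := match fintype.split i with inl i => pd (e i) F x | inr a => xi a end.
have El i : E (lshift m i) = pd (e i) F x by rewrite /E (unsplitK (inl i : ('I_n + 'I_m)%type)).
have Er a : E (rshift n a) = xi a by rewrite /E (unsplitK (inr a : ('I_n + 'I_m)%type)).
have Eo : Defs.orthonormal (Gt (F x)) E.
  have N a i : gt (xi a) (pd (e i) F x) = 0 by have := xn a (e i); rewrite pdEx.
  move=> i j; case: (splitP i) => [i' ii|a ia]; case: (splitP j) => [j' jj|b jb].
  - have -> : i = lshift m i' by exact: val_inj.
    have -> : j = lshift m j' by exact: val_inj.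
    by rewrite !El -iso// eo eq_lshift.
  - have -> : i = lshift m i' by exact: val_inj.
    have -> : j = rshift n b by exact: val_inj.
    by rewrite El Er eq_lrshift (ip_sym symgt) N.
  - have -> : i = rshift n a by exact: val_inj.
    have -> : j = lshift m j' by exact: val_inj.
    by rewrite El Er eq_rlshift N.
  - have -> : i = rshift n a by exact: val_inj.
    have -> : j = rshift n b by exact: val_inj.
    by rewrite !Er xo eq_rshift.
rewrite {1}(frame_expand Eo y) big_split_ord /= big1 ?add0r => [|i _]; last first.
  by rewrite El yn scale0r.
by apply: eq_bigr => a _; rewrite Er.
Qed.

Lemma second_ff_expand u v : h u v = \sum_a gt (h u v) (xi a) *: xi a.
Proof. by apply: normal_expand => w; exact: (second_ff_normal gm gmt sF FU iso). Qed.

Lemma second_ff_ip u v w z : gt (h u v) (h w z) = \sum_a gt (h u v) (xi a) * gt (h w z) (xi a).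
Proof.
have key (y : W) : y = \sum_a gt y (xi a) *: xi a ->
    gt (h u v) y = \sum_a gt (h u v) (xi a) * gt y (xi a).
  move=> E; rewrite {1}E ip_sumr; apply: eq_bigr => a _.
  by rewrite ipZr mulrC.
exact: key (second_ff_expand w z).
Qed.

Let al a u v := gt (h u v) (xi a).
Let A a : 'M[R]_n := \matrix_(i, j) al a (e i) (e j).

Let alC a u v : al a u v = al a v u.
Proof. by rewrite /al (second_ff_sym gm gmt sF FU). Qed.

Let al_lin a r u v w : al a u (r *: v + w) = r * al a u v + al a u w.
Proof. by rewrite /al (second_ff_linr gm gmt sF FU)// ipDl ipZl. Qed.

Lemma shape_op_ip (y : W) u v : g (shape_op G Gt F x y u) v = gt (h u v) y.
Proof.
rewrite /shape_op sharpP//; [|exact: posdef_unitmx|].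
  exact: (ip_sym symgt).
by move=> a w z; rewrite (second_ff_linr gm gmt sF FU)// ipDr ipZr.
Qed.

(** Matrices of shape operators multiply in the order opposite to the operators, so the commutators
    agree up to sign; the squares remove it. *)
Lemma normal_curvE i j a b :
  normal_curv G Gt F x (e i) (e j) (xi a) (xi b) ^+ 2 = (cm (A a) (A b) i j) ^+ 2.
Proof.
have E c d : g (shape_op G Gt F x (xi c) (shape_op G Gt F x (xi d) (e i))) (e j) =
    (A d *m A c) i j.
  have SE : shape_op G Gt F x (xi d) (e i) = \sum_l A d i l *: e l.
    rewrite [LHS](frame_expand eo); apply: eq_bigr => l _; congr (_ *: _).
    by rewrite [RHS]mxE; exact: shape_op_ip.
  have ls (I : Type) (r : seq I) (c' : I -> R) (H : I -> V) :
      al c (e j) (\sum_(i <- r) c' i *: H i) = \sum_(i <- r) c' i * al c (e j) (H i).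
    elim: r => [|i' r IH]; last by rewrite !big_cons al_lin IH.
    by rewrite !big_nil; have := al_lin c (-1) (e j) 0 0; rewrite scaler0 addr0 mulN1r addNr.
  transitivity (al c (e j) (\sum_l A d i l *: e l)).
    by rewrite -SE alC; exact: shape_op_ip.
  by rewrite ls [RHS]mxE; apply: eq_bigr => l _; rewrite alC [A c l j]mxE.
have -> : normal_curv G Gt F x (e i) (e j) (xi a) (xi b) = (A b *m A a) i j - (A a *m A b) i j.
  by rewrite /normal_curv ipBl; congr (_ - _); exact: E.
have -> : cm (A a) (A b) i j = (A a *m A b) i j - (A b *m A a) i j.
  by rewrite /cm; move: (A a *m A b) (A b *m A a) => M N; rewrite !mxE.
by rewrite -sqrrN opprB.
Qed.

Lemma mean_vec_sqr : mean_curv G Gt F x e ^+ 2 = \sum_a (\tr (A a) / n%:R) ^+ 2.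
Proof.
have mE : mean_vec G Gt F x e = \sum_a (\tr (A a) / n%:R) *: xi a.
  rewrite /mean_vec.
  under eq_bigr do rewrite second_ff_expand.
  rewrite exchange_big /= scaler_sumr; apply: eq_bigr => a _.
  rewrite -scaler_suml scalerA mulrC; congr ((_ / _) *: _).
  by apply: eq_bigr => i _; rewrite mxE.
have [_ xo] := xio.
have mm : gt (mean_vec G Gt F x e) (mean_vec G Gt F x e) = \sum_a (\tr (A a) / n%:R) ^+ 2.
  rewrite mE ip_suml; apply: eq_bigr => a _; rewrite ipZl ip_sumr (bigD1 a)//= big1 ?addr0.
    by rewrite ipZr xo eqxx mulr1 expr2.
  by move=> b ba; rewrite ipZr xo eq_sym (negbTE ba) mulr0.
rewrite /mean_curv sqr_sqrtr mm //.
by apply: sumr_ge0 => a _; exact: sqr_ge0.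
Qed.

Hypothesis wintgen :
  norm_scalar_curv G x e = mean_curv G Gt F x e ^+ 2
      - norm_normal_curv G Gt F x e xi + k.

Lemma wintgen_point : (2 <= n)%N ->
  (exists eta, forall u v, h u v = g u v *: eta) \/
  exists e1 e2 c s t nu, [/\ g e1 e1 = 1, g e2 e2 = 1, g e1 e2 = 0 & 0 < nu] /\
    forall u v w z, curv G x u v w z = planar_curvature (G x) e1 e2 c s t nu u v w z.
Proof.
move=> n2; have curvA u v w z : curv G x u v w z = k * gg (G x) u v w z
    + \sum_a (al a v w * al a u z - al a u w * al a v z).
  have E1 := second_ff_ip v w u z; have E2 := second_ff_ip u w v z.
  have key (a b c d r : R) : b = d -> c = r -> a + b - c = a + (d - r).
    by move=> -> ->; rewrite addrA.
  by rewrite gauss_space_form sumrB; exact: key E1 E2.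
have symA : symf A by move=> a; apply/matrixP => i j; rewrite !mxE alC.
have := wintgen; rewrite mean_vec_sqr /norm_scalar_curv /norm_normal_curv.
have -> : \sum_(i < n) \sum_(j < n | (i < j)%N) curv G x (e i) (e j) (e j) (e i) =
    \sum_(i < n) \sum_(j < n | (i < j)%N) (k + \sum_a (A a j j * A a i i - A a i j * A a j i)).
  apply: eq_bigr => i _; apply: eq_bigr => j ij; rewrite curvA /gg !eo !eqxx.
  have -> : (i == j) = false by apply/negbTE; rewrite -val_eqE /= ltn_eqF.
  rewrite mul0r subr0 !mulr1; congr (_ + _); apply: eq_bigr => a _.
  by rewrite !mxE.
have -> : \sum_(i < n) \sum_(j < n | (i < j)%N) \sum_(a < m) \sum_(b < m | (a < b)%N)
       normal_curv G Gt F x (e i) (e j) (xi a) (xi b) ^+ 2 =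
    \sum_(i < n) \sum_(j < n | (i < j)%N) \sum_(a < m) \sum_(b < m | (a < b)%N)
       (cm (A a) (A b) i j) ^+ 2.
  apply: eq_bigr => i _; apply: eq_bigr => j _; apply: eq_bigr => a _.
  by apply: eq_bigr => b _; exact: normal_curvE.
move/(wintgen_ddvv n2 symA) => eqB.
have [um|[e1 [e2 [c [s [t [nu [H1 H2]]]]]]]] := planar_form eo alC al_lin n2 eqB.
  left; exists (\sum_a (\tr (A a) / n%:R) *: xi a) => u v.
  rewrite second_ff_expand scaler_sumr; apply: eq_bigr => a _.
  by rewrite -/(al a u v) um scalerA mulrC.
right; exists e1, e2, (k + c), s, t, nu; split=> // u v w z.
by rewrite curvA H2 /planar_curvature; ring.
Qed.

End WintgenPoint.

(** Subtracting two components on which the second tensor takes the same value eliminates its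
    coefficient. *)
Lemma dep_key1 (R : realType) (al be nu r r2 q q2 d y : R) :
  al * r + be * q = 0 -> al * r2 + be * q2 = 0 ->
  r2 = r + 2 * nu * d -> q = y -> q2 = y -> al * nu * d = 0.
Proof. by move=> h1 h2 h3 h4 h5; move: h1 h2; rewrite h3 h4 h5; lra. Qed.

Lemma dep_key2 (R : realType) (al be r q y z : R) :
  al * r + be * q = 0 -> r = y -> q = z -> al * y + be * z = 0.
Proof. by move=> h1 h2 h3; rewrite -h2 -h3. Qed.

(** * The curvature condition at a point *)

Section Contractions.
Context {R : realType} {n : nat}.
Local Notation V := 'rV[R]_n.
Variables (G : V -> 'M[R]_n) (U : set V).
Hypothesis gm : metric_on G U.
Variable x : V.
Hypothesis Ux : U x.
Implicit Types (u v w z : V).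
Local Notation g := (ip (G x)).
Let symg := mo_sym gm Ux.
Let posg := mo_pos gm Ux.
Let gu : G x \in unitmx := posdef_unitmx posg.
Let cl := curv_like gm Ux.

Lemma ricci_frame (e : 'I_n -> V) u v : Defs.orthonormal (G x) e ->
  ricci G x u v = \sum_i curv G x (e i) u v (e i).
Proof.
by move=> eo; rewrite /ricci (frame_trace eo)// => a w z; exact: (curv_endo_lin1 gm).
Qed.

Lemma ricci_lin2 (a : R) u v w : ricci G x u (a *: v + w) = a * ricci G x u v + ricci G x u w.
Proof.
have [e eo] := orthonormal_exists symg posg.
rewrite !(ricci_frame _ _ eo) mulr_sumr -big_split /=; apply: eq_bigr => i _.
by rewrite (cl_lin3 cl).
Qed.

Lemma ricci_lin1 (a : R) u v w : ricci G x (a *: u + v) w = a * ricci G x u w + ricci G x v w.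
Proof.
have [e eo] := orthonormal_exists symg posg.
rewrite !(ricci_frame _ _ eo) mulr_sumr -big_split /=; apply: eq_bigr => i _.
by rewrite (cl_lin2 cl).
Qed.

Lemma ricci_op_ip u v : g (ricci_op G x u) v = ricci G x u v.
Proof. exact: (sharpP v symg gu (fun a w z => ricci_lin2 a u w z)). Qed.

Lemma ricci_op_lin (a : R) u v : ricci_op G x (a *: u + v) = a *: ricci_op G x u + ricci_op G x v.
Proof.
apply: (ip_inj gu) => w; apply: etrans (ricci_op_ip _ w) _.
apply: etrans (ricci_lin1 a u v w) _; rewrite ipDl ipZl.
by congr (_ * _ + _); symmetry; exact: ricci_op_ip.
Qed.

Lemma scalar_curv_frame (e : 'I_n -> V) : Defs.orthonormal (G x) e ->
  scalar_curv G x = \sum_i ricci G x (e i) (e i).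
Proof.
move=> eo; rewrite /scalar_curv (frame_trace eo); last exact: ricci_op_lin.
by apply: eq_bigr => i _; rewrite ricci_op_ip.
Qed.

Lemma weylE u v w z : weyl G x u v w z = curv G x u v w z - (n%:R - 2)^-1 *
  (ricci G x v w * g u z - g u w * ricci G x v z
   + (g v w * ricci G x u z - ricci G x u w * g v z)
   - scalar_curv G x / (n%:R - 1) * gg (G x) u v w z).
Proof.
rewrite /weyl /weyl_endo /wedge_endo /gg /curv.
have Hu := ricci_op_ip u; have Hv := ricci_op_ip v; move: Hu Hv.
move: (ricci_op G x u) (ricci_op G x v) (ricci G x u) (ricci G x v) => ru rv Ru Rv Hu Hv.
move: (curv_endo G x u v w) (scalar_curv G x) => r k.
by rewrite !(ipBl, ipDl, ipNl, ipZl) !Hu !Hv; ring.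
Qed.

Lemma weyl_const c : (3 <= n)%N -> (forall u v w z, curv G x u v w z = c * gg (G x) u v w z) ->
  forall u v w z, weyl G x u v w z = 0.
Proof.
move=> n3 Rc u v w z; have [e eo] := orthonormal_exists symg posg.
have nE : \sum_i g (e i) (e i) = n%:R.
  by under eq_bigr do rewrite eo eqxx; rewrite sumr_const card_ord.
have ricE a b : ricci G x a b = c * (n%:R - 1) * g a b.
  have sE p q : \sum_i g (e i) p * g (e i) q = g p q.
    by rewrite (frame_ip eo); apply: eq_bigr => i _; rewrite !(ip_sym symg (e i)).
  rewrite (ricci_frame _ _ eo).
  have E i : curv G x (e i) a b (e i) = c * g a b * g (e i) (e i) + - c * (g (e i) a * g (e i) b).
    by rewrite Rc /gg (ip_sym symg a (e i)); ring.
  by under eq_bigr do rewrite E; rewrite big_split /= -!mulr_sumr sE nE; ring.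
rewrite weylE (scalar_curv_frame eo).
under eq_bigr do rewrite ricE.
rewrite -mulr_sumr nE !ricE Rc /gg.
have n1 : n%:R - 1 != 0 :> R by rewrite subr_eq0 (eqr_nat R n 1) gtn_eqF// (leq_trans _ n3).
have n2 : n%:R - 2 != 0 :> R by rewrite subr_eq0 (eqr_nat R n 2) gtn_eqF// (leq_trans _ n3).
by field; rewrite n1 n2.
Qed.

Lemma dep_const c : (3 <= n)%N -> (forall u v w z, curv G x u v w z = c * gg (G x) u v w z) ->
  lin_dep6 (RC_CR G x) (Qg_gRic G x).
Proof.
move=> n3 Rc; have W0 := weyl_const n3 Rc.
(* The Weyl tensor vanishes, hence so do R.C and C.R, and the first tensor is zero by itself. *)
exists 1, 0; split=> [|x1 x2 x3 x4 u v]; first by left; exact: oner_neq0.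
have WE a b d : weyl_endo G x a b d = 0.
  by apply: (ip_inj gu) => z; rewrite ip0l; exact: W0.
rewrite mul0r addr0 mul1r /RC_CR /endo_act !W0 !WE !addr0 oppr0 sub0r opprK.
by rewrite !Rc /gg !ip0l !ip0r !(mul0r, mulr0, subrr, addr0).
Qed.

Section Planar.
Variables (e1 e2 : V) (c s t nu : R).
Hypotheses (n4 : (4 <= n)%N) (e11 : g e1 e1 = 1) (e22 : g e2 e2 = 1) (e12 : g e1 e2 = 0)
  (Rp : forall u v w z, curv G x u v w z = planar_curvature (G x) e1 e2 c s t nu u v w z).
Let nn : R := n%:R.
Let e21 : g e2 e1 = 0. Proof. by rewrite (ip_sym symg). Qed.
Local Notation S := (plane_shape (G x) e1 e2 s t).
Local Notation pi := (plane_proj (G x) e1 e2).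

Let n1 : nn - 1 != 0.
Proof. by rewrite subr_eq0 (eqr_nat R n 1) gtn_eqF// (leq_trans _ n4). Qed.
Let n2 : nn - 2 != 0.
Proof. by rewrite subr_eq0 (eqr_nat R n 2) gtn_eqF// (leq_trans _ n4). Qed.

Lemma planar_ricci u v : ricci G x u v = (nn - 1) * c * g u v + (nn - 2) * S u v - 2 * nu * pi u v.
Proof.
have [e eo] := orthonormal_exists symg posg.
have nE : \sum_i g (e i) (e i) = nn.
  by under eq_bigr do rewrite eo eqxx; rewrite sumr_const card_ord.
have sE p q : \sum_i g (e i) p * g (e i) q = g p q.
  by rewrite (frame_ip eo); apply: eq_bigr => i _; rewrite !(ip_sym symg (e i)).
rewrite (ricci_frame _ _ eo).
(* Grouped so that the index i only occurs in products g(e i, p) g(e i, q), each of which sums to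
   g(p, q). *)
have E i : curv G x (e i) u v (e i) =
   (c * g u v + S u v) * g (e i) (e i) + - c * (g (e i) u * g (e i) v)
   + (g u v * s - 2 * nu * pi u v) * (g (e i) e1 * g (e i) e1)
   + (- g u v * s - 2 * nu * pi u v) * (g (e i) e2 * g (e i) e2)
   + (2 * t * g u v) * (g (e i) e1 * g (e i) e2)
   + (- s * g v e1 - t * g v e2) * (g (e i) u * g (e i) e1)
   + (s * g v e2 - t * g v e1) * (g (e i) u * g (e i) e2)
   + (- s * g u e1 - t * g u e2) * (g (e i) v * g (e i) e1)
   + (s * g u e2 - t * g u e1) * (g (e i) v * g (e i) e2)
   + (2 * nu) * ((g u e1 * g v e1) * (g (e i) e1 * g (e i) e1)
       + (g u e2 * g v e2) * (g (e i) e2 * g (e i) e2)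
       + (g u e1 * g v e2 + g u e2 * g v e1) * (g (e i) e1 * g (e i) e2)).
  rewrite Rp /planar_curvature /gg /plane_shape /plane_proj (ip_sym symg u (e i)); ring.
under eq_bigr do rewrite E.
rewrite !big_split /= -!mulr_sumr !big_split /= -!mulr_sumr !sE nE e11 e22 e12.
by rewrite /plane_shape /plane_proj; ring.
Qed.

Lemma planar_scal : scalar_curv G x = nn * (nn - 1) * c - 4 * nu.
Proof.
have [e eo] := orthonormal_exists symg posg.
have nE : \sum_i g (e i) (e i) = nn.
  by under eq_bigr do rewrite eo eqxx; rewrite sumr_const card_ord.
have sE p q : \sum_i g (e i) p * g (e i) q = g p q.
  by rewrite (frame_ip eo); apply: eq_bigr => i _; rewrite !(ip_sym symg (e i)).
rewrite (scalar_curv_frame eo).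
have E i : ricci G x (e i) (e i) = (nn - 1) * c * g (e i) (e i)
   + ((nn - 2) * s - 2 * nu) * (g (e i) e1 * g (e i) e1)
   + (- (nn - 2) * s - 2 * nu) * (g (e i) e2 * g (e i) e2)
   + ((nn - 2) * 2 * t) * (g (e i) e1 * g (e i) e2).
  by rewrite planar_ricci /plane_shape /plane_proj; ring.
under eq_bigr do rewrite E.
by rewrite !big_split /= -!mulr_sumr !sE nE e11 e22 e12; ring.
Qed.

(** c, s and t drop out: the products of g with a symmetric form that is g itself or trace-free are
    invisible to the Weyl tensor. *)
Lemma planar_weyl u v w z : weyl G x u v w z =
  - 4 * nu / ((nn - 1) * (nn - 2)) * gg (G x) u v w z
  + 2 * nu / (nn - 2) * (pi v w * g u z + g v w * pi u z - pi u w * g v z - g u w * pi v z)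
  - 2 * nu * (pi v w * pi u z - pi u w * pi v z).
Proof.
rewrite weylE Rp /planar_curvature planar_scal !planar_ricci /gg -/nn.
move: (pi _ _) (pi _ _) (pi _ _) (pi _ _) (S _ _) (S _ _) (S _ _) (S _ _) (g _ _) (g _ _) (g _ _) (g _ _).
by move=> a1 a2 a3 a4 b1 b2 b3 b4 c1 c2 c3 c4; field; rewrite n1 n2.
Qed.

Variables (e3 e4 : V).
Hypotheses (e33 : g e3 e3 = 1) (e44 : g e4 e4 = 1) (e34 : g e3 e4 = 0)
  (e13 : g e1 e3 = 0) (e14 : g e1 e4 = 0) (e23 : g e2 e3 = 0) (e24 : g e2 e4 = 0).

Let e31 : g e3 e1 = 0. Proof. by rewrite (ip_sym symg). Qed.
Let e32 : g e3 e2 = 0. Proof. by rewrite (ip_sym symg). Qed.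
Let e41 : g e4 e1 = 0. Proof. by rewrite (ip_sym symg). Qed.
Let e42 : g e4 e2 = 0. Proof. by rewrite (ip_sym symg). Qed.
Let e43 : g e4 e3 = 0. Proof. by rewrite (ip_sym symg). Qed.
Let gE := (e11, e12, e13, e14, e21, e22, e23, e24, e31, e32, e33, e34, (e41, e42, e43, e44)).
(** The sectional value of the Weyl tensor on a plane spanned by a vector of the distinguished plane
    and one orthogonal to it. For the curvature tensor, the value on (e1, e3) is c + s. *)
Let gam := 2 * nu * (nn - 3) / ((nn - 1) * (nn - 2)).

Let curv13 w : curv_endo G x e1 e3 w =
  (c * g e3 w) *: e1 - (c * g e1 w) *: e3 + g e3 w *: (s *: e1 + t *: e2) - S e1 w *: e3.
Proof.
apply: (ip_inj gu) => z; rewrite -/(curv G x e1 e3 w z) Rp.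
rewrite !(ipBl, ipDl, ipNl, ipZl) /planar_curvature /gg /plane_shape /plane_proj !gE.
by rewrite (ip_sym symg z e1) (ip_sym symg z e2); ring.
Qed.

Let weyl13 w : weyl_endo G x e1 e3 w = (gam * g e3 w) *: e1 - (gam * g e1 w) *: e3.
Proof.
apply: (ip_inj gu) => z; rewrite -/(weyl G x e1 e3 w z) planar_weyl.
rewrite !(ipBl, ipDl, ipNl, ipZl) /gg /plane_proj !gE (ip_sym symg w e1) (ip_sym symg z e1) /gam.
by field; rewrite n1 n2.
Qed.

(** The two components differ by replacing e4 with e2. The second tensor takes the same value on
    both, while R.C - C.R changes by 2 nu (c + s - gam). *)
Lemma dep_equations al be :
  (forall x1 x2 x3 x4 u v, al * RC_CR G x x1 x2 x3 x4 u v + be * Qg_gRic G x x1 x2 x3 x4 u v = 0) ->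
  al * nu * (c + s - gam) = 0 /\
  al * ((c + s) * (- 4 * nu / ((nn - 1) * (nn - 2)) - gam) + gam * s)
    + be * (2 * nu - (nn - 2) * s) = 0.
Proof.
move=> H; have H1 := H e1 e4 e4 e3 e1 e3; have H2 := H e1 e2 e2 e3 e1 e3.
have Z (a : R) (v : V) : a = 0 -> a *: v = 0 by move=> ->; rewrite scale0r.
have C1 : curv_endo G x e1 e3 e1 = (- (c + s)) *: e3.
  rewrite curv13 /plane_shape !gE; apply/rowP => j; rewrite !mxE; ring.
have C2 : curv_endo G x e1 e3 e2 = (- t) *: e3.
  rewrite curv13 /plane_shape !gE; apply/rowP => j; rewrite !mxE; ring.
have C3 : curv_endo G x e1 e3 e3 = (c + s) *: e1 + t *: e2.
  rewrite curv13 /plane_shape !gE; apply/rowP => j; rewrite !mxE; ring.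
have C4 : curv_endo G x e1 e3 e4 = 0.
  rewrite curv13 /plane_shape !gE; apply/rowP => j; rewrite !mxE; ring.
have W1 : weyl_endo G x e1 e3 e1 = (- gam) *: e3.
  by rewrite weyl13 !gE mulr0 mulr1 scale0r sub0r scaleNr.
have W2 : weyl_endo G x e1 e3 e2 = 0 by rewrite weyl13 !gE mulr0 !scale0r subr0.
have W3 : weyl_endo G x e1 e3 e3 = gam *: e1.
  by rewrite weyl13 !gE mulr0 mulr1 scale0r subr0.
have W4 : weyl_endo G x e1 e3 e4 = 0 by rewrite weyl13 !gE mulr0 !scale0r subr0.
have RC4 : RC_CR G x e1 e4 e4 e3 e1 e3 =
    (c + s) * (- 4 * nu / ((nn - 1) * (nn - 2)) - gam) + gam * s.
  rewrite /RC_CR /endo_act C1 C3 C4 W1 W3 W4 !planar_weyl !Rp.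
  rewrite /planar_curvature /gg /plane_shape /plane_proj.
  rewrite !(ipDl, ipZl, ipDr, ipZr, ip0l, ip0r) !gE /gam.
  by field; rewrite n1 n2.
have RC2 : RC_CR G x e1 e2 e2 e3 e1 e3 = RC_CR G x e1 e4 e4 e3 e1 e3 + 2 * nu * (c + s - gam).
  apply: etrans (esym (congr1 (+%R^~ _) RC4)).
  rewrite /RC_CR /endo_act C1 C2 C3 W1 W2 W3 !planar_weyl !Rp.
  rewrite /planar_curvature /gg /plane_shape /plane_proj.
  rewrite !(ipDl, ipZl, ipDr, ipZr, ip0l, ip0r) !gE /gam.
  by field; rewrite n1 n2.
have Q4 : Qg_gRic G x e1 e4 e4 e3 e1 e3 = 2 * nu - (nn - 2) * s.
  rewrite /Qg_gRic /tachibana /endo_act /wedge_endo /kulkarni_nomizu !planar_ricci.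
  rewrite /plane_shape /plane_proj !(ipBl, ipDl, ipNl, ipZl, ipBr, ipDr, ipNr, ipZr) !gE.
  by ring.
have Q2 : Qg_gRic G x e1 e2 e2 e3 e1 e3 = 2 * nu - (nn - 2) * s.
  rewrite /Qg_gRic /tachibana /endo_act /wedge_endo /kulkarni_nomizu !planar_ricci.
  rewrite /plane_shape /plane_proj !(ipBl, ipDl, ipNl, ipZl, ipBr, ipDr, ipNr, ipZr) !gE.
  by ring.
by split; [exact: dep_key1 H1 H2 RC2 Q4 Q2|exact: dep_key2 H1 RC4 Q4].
Qed.

End Planar.
End Contractions.

(** * From linear dependence to the rigid planar form *)

Section TypeTwo.
Context {R : realType} {n : nat}.
Local Notation V := 'rV[R]_n.
Variables (G : V -> 'M[R]_n) (U : set V).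
Hypotheses (gm : metric_on G U) (n4 : (4 <= n)%N).
Implicit Types (x u v w z : V).
Let nn : R := n%:R.

Definition tau : R := 2 * (nn - 3) / ((nn - 1) * (nn - 2)).

Let nn4 : 4 <= nn. Proof. by rewrite /nn (ler_nat R 4 n). Qed.

Lemma tau_gt0 : 0 < tau.
Proof. by move: nn4 => h; rewrite /tau; apply: divr_gt0; apply: mulr_gt0; lra. Qed.

Definition pseudosymmetric_at x (e1 e2 : V) (nu : R) : Prop :=
  [/\ ip (G x) e1 e1 = 1, ip (G x) e2 e2 = 1, ip (G x) e1 e2 = 0 & 0 < nu] /\
  forall u v w z, curv G x u v w z = planar_curvature (G x) e1 e2 (nu * tau) 0 0 nu u v w z.

(** Another orthonormal basis of the plane, taken from the 3-4-5 triangle: the coefficients stay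
    rational and the new s involves t. *)
Lemma planar_rebase x (e1 e2 : V) c s t nu u v w z :
  planar_curvature (G x) e1 e2 c s t nu u v w z =
  planar_curvature (G x) ((3 / 5) *: e1 + (4 / 5) *: e2) ((4 / 5) *: e1 - (3 / 5) *: e2)
    c ((- 7 * s + 24 * t) / 25) ((24 * s + 7 * t) / 25) nu u v w z.
Proof.
rewrite /planar_curvature /plane_shape /plane_proj !(ipBr, ipDr, ipNr, ipZr) /gg.
move: (ip (G x) u e1) (ip (G x) u e2) (ip (G x) v e1) (ip (G x) v e2) (ip (G x) w e1) (ip (G x) w e2)
  (ip (G x) z e1) (ip (G x) z e2) (ip _ _ _) (ip _ _ _) (ip _ _ _) (ip _ _ _).
by move=> u1 u2 v1 v2 w1 w2 z1 z2 a b p q; field.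
Qed.

Lemma planar_swap x (e1 e2 : V) c s t nu u v w z :
  planar_curvature (G x) e1 e2 c s t nu u v w z =
  planar_curvature (G x) e2 e1 c (- s) t nu u v w z.
Proof. by rewrite /planar_curvature /plane_shape /plane_proj; ring. Qed.

Lemma normal_plane_exists x (e1 e2 : V) : U x ->
  ip (G x) e1 e1 = 1 -> ip (G x) e2 e2 = 1 -> ip (G x) e1 e2 = 0 ->
  exists e : 'I_n -> V, Defs.orthonormal (G x) e /\
    forall i : 'I_n, (i == 0%N :> nat -> e i = e1) /\ (i == 1%N :> nat -> e i = e2).
Proof.
move=> Ux e11 e22 e12; have e21 : ip (G x) e2 e1 = 0 by rewrite (ip_sym (mo_sym gm Ux)).
pose p (i : nat) : V := if i == 0%N then e1 else e2.
have po i j : (i < 2)%N -> (j < 2)%N -> ip (G x) (p i) (p j) = (i == j)%:R.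
  by case: i j => [|[|i]] [|[|j]].
have n2 : (2 <= n)%N by exact: leq_trans n4.
have [E [E0 Eo]] := orthonormal_extend (mo_sym gm Ux) (mo_pos gm Ux) n2 po.
exists (fun i => E i); split=> [i j|i]; first by rewrite Eo.
by split=> /eqP ->; rewrite E0.
Qed.

(** The relation c + s = gam holds in every orthonormal basis of the plane. The given basis, its
    swap and the 3-4-5 basis state it for s, - s and a combination of s and t, whence s = t = 0 and
    c = gam. The second relation, in the first two bases, rules out that the coefficient of R.C -
    C.R is zero. *)
Lemma dep_pseudosymmetric x (e1 e2 : V) c s t nu : U x ->
  [/\ ip (G x) e1 e1 = 1, ip (G x) e2 e2 = 1, ip (G x) e1 e2 = 0 & 0 < nu] ->
  (forall u v w z, curv G x u v w z = planar_curvature (G x) e1 e2 c s t nu u v w z) ->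
  lin_dep6 (RC_CR G x) (Qg_gRic G x) -> pseudosymmetric_at x e1 e2 nu.
Proof.
move=> Ux [e11 e22 e12 nu0] Rp [al [be [alb dep]]].
have sg := ip_sym (mo_sym gm Ux).
have e21 : ip (G x) e2 e1 = 0 by rewrite sg.
have [e [eo eE]] := normal_plane_exists Ux e11 e22 e12.
have h0 : (0 < n)%N := leq_trans (isT : (0 < 4)%N) n4.
have h1 : (1 < n)%N := leq_trans (isT : (1 < 4)%N) n4.
have h2 : (2 < n)%N := leq_trans (isT : (2 < 4)%N) n4.
pose i0 := Ordinal h0; pose i1 := Ordinal h1; pose i2 := Ordinal h2; pose i3 := Ordinal n4.
have E0 : e i0 = e1 by apply: (eE i0).1.
have E1 : e i1 = e2 by apply: (eE i1).2.
have e33 : ip (G x) (e i2) (e i2) = 1 by rewrite eo.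
have e44 : ip (G x) (e i3) (e i3) = 1 by rewrite eo.
have e34 : ip (G x) (e i2) (e i3) = 0 by rewrite eo.
have e13 : ip (G x) e1 (e i2) = 0 by rewrite -E0 eo.
have e14 : ip (G x) e1 (e i3) = 0 by rewrite -E0 eo.
have e23 : ip (G x) e2 (e i2) = 0 by rewrite -E1 eo.
have e24 : ip (G x) e2 (e i3) = 0 by rewrite -E1 eo.
have [A1 A2] := dep_equations gm Ux n4 e11 e22 e12 Rp e33 e44 e34 e13 e14 e23 e24 dep.
have Rs u v w z : curv G x u v w z = planar_curvature (G x) e2 e1 c (- s) t nu u v w z.
  by rewrite Rp planar_swap.
have [B1 B2] := dep_equations gm Ux n4 e22 e11 e21 Rs e33 e44 e34 e23 e24 e13 e14 dep.
have Rb u v w z := etrans (Rp u v w z) (planar_rebase x e1 e2 c s t nu u v w z).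
pose a := (3 / 5) *: e1 + (4 / 5) *: e2; pose b := (4 / 5) *: e1 - (3 / 5) *: e2.
have aa : ip (G x) a a = 1.
  by rewrite /a !(ipDl, ipDr, ipZl, ipZr) e11 e12 e21 e22; field.
have bb : ip (G x) b b = 1.
  by rewrite /b !(ipBl, ipDl, ipNl, ipBr, ipDr, ipNr, ipZl, ipZr) e11 e12 e21 e22; field.
have ab : ip (G x) a b = 0.
  by rewrite /a /b !(ipBl, ipDl, ipNl, ipBr, ipDr, ipNr, ipZl, ipZr) e11 e12 e21 e22; field.
have a3 : ip (G x) a (e i2) = 0 by rewrite /a ipDl !ipZl e13 e23 !mulr0 addr0.
have a4 : ip (G x) a (e i3) = 0 by rewrite /a ipDl !ipZl e14 e24 !mulr0 addr0.
have b3 : ip (G x) b (e i2) = 0 by rewrite /b ipBl !ipZl e13 e23 !mulr0 subr0.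
have b4 : ip (G x) b (e i3) = 0 by rewrite /b ipBl !ipZl e14 e24 !mulr0 subr0.
have [C1 _] := dep_equations gm Ux n4 aa bb ab Rb e33 e44 e34 a3 a4 b3 b4 dep.
clear aa bb ab a3 a4 b3 b4 a b Rb Rs dep eE E0 E1 eo.
have al0 : al != 0.
  apply/eqP => al0; have be0 : be != 0 by case: alb => //; rewrite al0 eqxx.
  move: A2 B2; rewrite al0 !mul0r !add0r => /eqP; rewrite mulf_eq0 (negbTE be0) /= => /eqP A2.
  move=> /eqP; rewrite mulf_eq0 (negbTE be0) /= => /eqP B2.
  by move: A2 B2 nu0; rewrite mulrN; move: ((_ - _) * s) => y; lra.
have nun : al * nu != 0 by rewrite mulf_neq0// gt_eqF.
have canc y : al * nu * y = 0 -> y = 0 by move/eqP; rewrite mulf_eq0 (negbTE nun) => /eqP.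
have {}A1 := canc _ A1; have {}B1 := canc _ B1; have {}C1 := canc _ C1.
have [s0 [t0 c0]] : s = 0 /\ (t = 0 /\ c = nu * tau).
  have -> : nu * tau = 2 * nu * (n%:R - 3) / ((n%:R - 1) * (n%:R - 2)).
    by rewrite /tau -/nn; ring.
  move: A1 B1 C1; move: (2 * nu * _ / _) => y A1 B1 C1.
  have s0 : s = 0 by lra.
  split=> //; split; last by lra.
  by move: C1; rewrite s0; lra.
by split=> // u v w z; rewrite Rp s0 t0 c0.
Qed.

Section Point.
Variables (x : V) (e1 e2 : V) (nu : R).
Hypotheses (Ux : U x) (ps : pseudosymmetric_at x e1 e2 nu).
Let e11 : ip (G x) e1 e1 = 1. Proof. by case: ps => [[]]. Qed.
Let e22 : ip (G x) e2 e2 = 1. Proof. by case: ps => [[]]. Qed.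
Let e12 : ip (G x) e1 e2 = 0. Proof. by case: ps => [[]]. Qed.
Let nu0 : 0 < nu. Proof. by case: ps => [[]]. Qed.
Let e21 : ip (G x) e2 e1 = 0. Proof. by rewrite (ip_sym (mo_sym gm Ux)). Qed.

(** The rank-one map that sends w to the H-product of w and v times u, as a matrix acting on
    rows. *)
Definition outer (H : 'M[R]_n) (v u : V) : 'M[R]_n := H *m v^T *m u.

Lemma mul_outer H w v u : w *m outer H v u = ip H w v *: u.
Proof. by rewrite /outer !mulmxA [w *m H *m v^T]mx11_scalar mul_scalar_mx. Qed.

Definition plane_mx : 'M[R]_n := outer (G x) e1 e1 + outer (G x) e2 e2.

Lemma mul_plane_mx u : u *m plane_mx = ip (G x) u e1 *: e1 + ip (G x) u e2 *: e2.
Proof. by rewrite mulmxDr !mul_outer. Qed.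

Lemma plane_mx_idem : plane_mx *m plane_mx = plane_mx.
Proof.
apply/row_matrixP => i; rewrite !rowE mulmxA !mul_plane_mx !(ipDl, ipZl) e11 e12 e21 e22.
by rewrite !mulr0 !mulr1 addr0 add0r.
Qed.

Lemma tr_plane_mx : \tr plane_mx = 2.
Proof.
have E v : \tr (outer (G x) v v) = ip (G x) v v.
  by rewrite /outer mxtrace_mulC mulmxA /mxtrace big_ord1.
by rewrite linearD /= !E e11 e22.
Qed.

Lemma plane_mx_sym u v : ip (G x) (u *m plane_mx) v = ip (G x) u (v *m plane_mx).
Proof.
rewrite !mul_plane_mx !(ipDl, ipDr, ipZl, ipZr).
by rewrite !(ip_sym (mo_sym gm Ux) v); ring.
Qed.

Lemma plane_mx_form u v : ip (G x) (u *m plane_mx) v = plane_proj (G x) e1 e2 u v.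
Proof.
rewrite mul_plane_mx !(ipDl, ipZl) /plane_proj.
by rewrite !(ip_sym (mo_sym gm Ux) v).
Qed.

End Point.

Definition ricci_mx x : 'M[R]_n :=
  (\matrix_(i, j) ricci G x (basis_vec i) (basis_vec j)) *m invmx (G x).

Lemma mul_ricci_mx x u v : U x -> ip (G x) (u *m ricci_mx x) v = ricci G x u v.
Proof.
move=> Ux; have gu := unitG gm Ux.
rewrite /ip /ricci_mx mulmxA mulmxKV// -/(ip _ u v).
have ls1 (I : Type) (r : seq I) (c : I -> R) (F : I -> V) p :
    ricci G x (\sum_(i <- r) c i *: F i) p = \sum_(i <- r) c i * ricci G x (F i) p.
  elim: r => [|i r IH]; last by rewrite !big_cons (ricci_lin1 gm)// IH.
  by rewrite !big_nil; have := ricci_lin1 gm Ux (-1) 0 0 p; rewrite scaler0 addr0 mulN1r addNr.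
have ls2 (I : Type) (r : seq I) (c : I -> R) (F : I -> V) p :
    ricci G x p (\sum_(i <- r) c i *: F i) = \sum_(i <- r) c i * ricci G x p (F i).
  elim: r => [|i r IH]; last by rewrite !big_cons (ricci_lin2 gm)// IH.
  by rewrite !big_nil; have := ricci_lin2 gm Ux (-1) p 0 0; rewrite scaler0 addr0 mulN1r addNr.
have Ev p : ricci G x p v = \sum_j v 0 j * ricci G x p (basis_vec j).
  by rewrite {1}[v]row_sum_delta ls2.
rewrite {2}[u]row_sum_delta ls1 /ip mxE.
under eq_bigr do rewrite !mxE mulr_suml.
rewrite exchange_big /=; apply: eq_bigr => i _.
rewrite Ev mulr_sumr; apply: eq_bigr => j _.
by rewrite !mxE -mulrA (mulrC (v 0 j)).
Qed.

Lemma Ck_ricci_mx k : Ck k U ricci_mx.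
Proof.
have oU := mo_open gm.
apply: Ck_mulmx => //; last first.
  by apply: Ck_invmx => //; [move=> x Ux; exact: (unitG gm)|exact: mo_smooth gm k].
apply: Ck_mx => // i j.
(* The trace defining the Ricci tensor, written with [rmx], whose entries are smooth. *)
apply: (Ck_ext (f := fun x => \sum_k (basis_vec j *m rmx G x (basis_vec k) (basis_vec i)) 0 k)) => //.
  move=> x Ux; rewrite [RHS]mxE; apply: eq_bigr => l _.
  by rewrite (mul_rmx gm)// [RHS]mxE.
apply: Ck_sum => // l; apply: Ck_entry => //; apply: Ck_mulmx => //; first exact: Ck_cst.
have Cc b := Ck_cmx gm k.+1 b.
apply: Ck_add => //; last apply: Ck_opp => //; apply: Ck_add => //;
  try exact: (Ck_pd _ (Cc _)); by apply: Ck_mulmx => //; exact: (Ck_cmx gm).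
Qed.

End TypeTwo.

(** * Open sets of pseudosymmetric points *)

Section ScalarBianchi.
Context {R : realType} {n : nat}.
Local Notation V := 'rV[R]_n.
Variables (G : V -> 'M[R]_n) (U : set V).
Hypothesis gm : metric_on G U.
Implicit Types (x t u v w z : V).
Local Notation chr := (christoffel G).

Definition nabla_curv x t u v w z : R :=
  pd t (fun y => curv G y u v w z) x - curv G x (chr x t u) v w z - curv G x u (chr x t v) w z
  - curv G x u v (chr x t w) z - curv G x u v w (chr x t z).

Lemma d_rmx u v x : U x -> differentiable (fun y => rmx G y u v) x.
Proof.
move=> Ux; have Cc b : Ck 1 U (fun y => cmx G y b) := Ck_cmx gm 1 b.
have d1 a b : differentiable (pd a (fun y => cmx G y b)) x by exact: (Ck_diff (Ck_pd _ (Cc b))).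
have d2 a b : differentiable (fun y => cmx G y a *m cmx G y b) x.
  by apply: differentiable_mulmx; exact: (d_cmx gm).
by apply: differentiableB; apply: differentiableD; [exact: d1|exact: d2|exact: d1|exact: d2].
Qed.

Let bianchi_key (p a1 a2 q b1 b2 r c1 c2 A1 A2 A3 A4 B1 B2 : R) :
  (p - A1 - A2) + (q - A3 - A4) + (r - B1 - B2) = 0 ->
  a1 + b2 = 0 -> b1 + c2 = 0 -> c1 + a2 = 0 ->
  (p - a1 - a2 - A1 - A2) + (q - b1 - b2 - A3 - A4) + (r - c1 - c2 - B1 - B2) = 0.
Proof. lra. Qed.

Let bianchi_key0 (A B C D : R) : A + B + C - D - B = C + A - D.
Proof. by ring. Qed.

Let distr (w : V) (A B C : 'M[R]_n) : w *m (A + B *m C - C *m B) = w *m A + (w *m B) *m C - (w *m C) *m B.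
Proof. by rewrite mulmxBr mulmxDr !mulmxA. Qed.

(** The terms in which the connection acts on the first two arguments cancel in pairs, the
    connection being symmetric and the curvature skew; the others assemble into the matrix
    identity. *)
Lemma nabla_curv_bianchi x t u v w z : U x ->
  nabla_curv x t u v w z + nabla_curv x u v t w z + nabla_curv x v t u w z = 0.
Proof.
move=> Ux.
have E a b c : pd a (fun y => curv G y b c w z) x - curv G x b c (chr x a w) z - curv G x b c w (chr x a z)
   = ip (G x) (w *m (pd a (fun y => rmx G y b c) x + rmx G x b c *m cmx G x a - cmx G x a *m rmx G x b c)) z.
  rewrite -(@pd_near_eq _ _ _ (fun y => ip (G y) (cst w y *m rmx G y b c) (cst z y))); last first.
    by apply: filterS (nearU gm Ux) => y Uy; rewrite (mul_rmx gm).
  have dw : differentiable (fun y => cst w y *m rmx G y b c) x.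
    by apply: differentiable_mulmx; [exact: differentiable_cst|exact: d_rmx].
  rewrite pd_ip; [|exact: (dG gm)|by []|exact: differentiable_cst].
  rewrite pd_mulmx; [|exact: differentiable_cst|exact: d_rmx].
  rewrite !pd_cst mul0mx add0r ip0r addr0 (metric_compat gm)//.
  rewrite (distr w (pd a (fun y => rmx G y b c) x) (rmx G x b c) (cmx G x a)).
  rewrite [in RHS]ipBl [in RHS]ipDl (mul_cmx gm a (w *m rmx G x b c) Ux) (mul_cmx gm a w Ux).
  rewrite /curv -(mul_rmx gm b c (chr x a w) Ux) -(mul_rmx gm b c w Ux).
  exact: bianchi_key0.
have cl := curv_like gm Ux.
rewrite /nabla_curv; apply: bianchi_key.
- apply: etrans (congr2 +%R (congr2 +%R (E t u v) (E u v t)) (E v t u)) _.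
  rewrite -!ipDl -!mulmxDr.
  by have := bianchi2 gm t u v Ux => /= ->; rewrite mulmx0 ip0l.
- by rewrite -(chrC gm t u Ux); apply/eqP; rewrite addr_eq0; apply/eqP; exact: (cl_skew12 cl).
- by rewrite -(chrC gm u v Ux); apply/eqP; rewrite addr_eq0; apply/eqP; exact: (cl_skew12 cl).
- by rewrite -(chrC gm v t Ux); apply/eqP; rewrite addr_eq0; apply/eqP; exact: (cl_skew12 cl).
Qed.

(** The common shape of the two curvature forms to be differentiated: k = tau with the projection P
    in the rigid planar case, k = 1 with p, q, r, s zero for Schur's lemma. *)
Lemma pd_kform (f a b c d p q r s : V -> R) (k : R) x t :
  differentiable f x -> differentiable a x -> differentiable b x -> differentiable c x ->
  differentiable d x -> differentiable p x -> differentiable q x -> differentiable r x ->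
  differentiable s x ->
  pd t (fun y => f y * (k * (a y * b y - c y * d y) - 2 * (p y * q y - r y * s y))) x =
  pd t f x * (k * (a x * b x - c x * d x) - 2 * (p x * q x - r x * s x))
  + f x * (k * (pd t a x * b x + a x * pd t b x - (pd t c x * d x + c x * pd t d x))
     - 2 * (pd t p x * q x + p x * pd t q x - (pd t r x * s x + r x * pd t s x))).
Proof.
move=> df da db dc dd dp dq dr ds.
have dab := differentiableM da db; have dcd := differentiableM dc dd.
have dpq := differentiableM dp dq; have drs := differentiableM dr ds.
have d1 : differentiable (fun y => a y * b y - c y * d y) x := differentiableB dab dcd.
have d2 : differentiable (fun y => p y * q y - r y * s y) x := differentiableB dpq drs.
have e1 : differentiable (fun y => k * (a y * b y - c y * d y)) x.
  by apply: differentiableM => //; exact: differentiable_cst.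
have e2 : differentiable (fun y => 2 * (p y * q y - r y * s y)) x.
  by apply: differentiableM => //; exact: differentiable_cst.
rewrite (pdM (f := f) _ df (differentiableB e1 e2)) (pdB _ e1 e2).
rewrite (pdM (f := cst k) _ (differentiable_cst _ _) d1) (pdM (f := cst 2) _ (differentiable_cst _ _) d2).
rewrite !pd_cst !mul0r !add0r (pdB _ dab dcd) (pdB _ dpq drs).
by rewrite (pdM _ da db) (pdM _ dc dd) (pdM _ dp dq) (pdM _ dr ds).
Qed.

End ScalarBianchi.

(* The covariant derivative of [P] along [t], for [P] acting on row vectors by [u |-> u *m P y]. *)
HB.lock Definition nabla_mx (R : realType) (n : nat) (G P : 'rV[R]_n -> 'M[R]_n) (y t : 'rV[R]_n) : 'M[R]_n :=
  pd t P y + P y *m cmx G y t - cmx G y t *m P y.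

Lemma nabla_mxE (R : realType) (n : nat) (G P : 'rV[R]_n -> 'M[R]_n) (y t : 'rV[R]_n) :
  nabla_mx G P y t = pd t P y + P y *m cmx G y t - cmx G y t *m P y.
Proof. by rewrite unlock. Qed.

(** * The covariant derivative of the curvature in terms of f and P *)

Section PseudosymmetricPoint.
Context {R : realType} {n : nat}.
Local Notation V := 'rV[R]_n.
Variables (G : V -> 'M[R]_n) (U : set V).
Hypotheses (gm : metric_on G U) (n4 : (4 <= n)%N).
Variables (f : V -> R) (P : V -> 'M[R]_n).
Hypotheses (df : forall x, U x -> differentiable f x) (dP : forall x, U x -> differentiable P x)
  (f0 : forall x, U x -> 0 < f x)
  (psU : forall x, U x -> exists e1 e2, pseudosymmetric_at G x e1 e2 (f x) /\ P x = plane_mx G x e1 e2).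
Implicit Types (x t u v w z : V).
Local Notation chr := (christoffel G).

Let P_idem x : U x -> P x *m P x = P x.
Proof. by move=> Ux; have [e1 [e2 [ps ->]]] := psU Ux; exact: (plane_mx_idem gm Ux ps). Qed.

Let P_sym x u v : U x -> ip (G x) (u *m P x) v = ip (G x) u (v *m P x).
Proof. by move=> Ux; have [e1 [e2 [ps ->]]] := psU Ux; exact: (plane_mx_sym gm _ _ Ux). Qed.

Lemma curvP x u v w z : U x -> curv G x u v w z = f x * (@tau R n *
   (ip (G x) v w * ip (G x) u z - ip (G x) u w * ip (G x) v z)
   - 2 * (ip (G x) (v *m P x) w * ip (G x) (u *m P x) z
          - ip (G x) (u *m P x) w * ip (G x) (v *m P x) z)).
Proof.
move=> Ux; have [e1 [e2 [[_ Rp] ->]]] := psU Ux.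
rewrite Rp /planar_curvature !(plane_mx_form gm _ _ Ux) /gg /plane_shape; ring.
Qed.

Local Notation B x t := (nabla_mx G P x t).
Local Notation pi x u v := (ip (G x) (u *m P x) v).
Local Notation b x t u v := (ip (G x) (u *m B x t) v).

Lemma pd_g x t u v : U x -> pd t (fun y => ip (G y) u v) x = ip (G x) (chr x t u) v + ip (G x) u (chr x t v).
Proof.
move=> Ux; have d1 (w : V) : differentiable (fun _ : V => w) x by exact: differentiable_cst.
rewrite (pd_ip (a := cst u) (b := cst v) _ (dG gm Ux) (d1 u) (d1 v)) !pd_cst ip0l ip0r !addr0.
exact: (metric_compat gm).
Qed.

Lemma d_g x u v : U x -> differentiable (fun y => ip (G y) u v) x.
Proof.
move=> Ux; apply: (differentiable_ip (a := cst u) (b := cst v) (dG gm Ux));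
exact: differentiable_cst.
Qed.

Lemma d_pi x u v : U x -> differentiable (fun y => pi y u v) x.
Proof.
move=> Ux; apply: (differentiable_ip (a := fun y => u *m P y) (b := cst v) (dG gm Ux)).
  by apply: (differentiable_mulmx (M := cst u)); [exact: differentiable_cst|exact: dP].
exact: differentiable_cst.
Qed.

Let pi_key (A B1 C D : R) : A + C + B1 = (B1 + A - D) + D + C.
Proof. by ring. Qed.

Lemma pd_pi x t u v : U x ->
  pd t (fun y => pi y u v) x = b x t u v + pi x (chr x t u) v + pi x u (chr x t v).
Proof.
move=> Ux; have d1 (w : V) : differentiable (fun _ : V => w) x by exact: differentiable_cst.
have d2 : differentiable (fun y => u *m P y) x.
  by apply: (differentiable_mulmx (M := cst u)); [exact: differentiable_cst|exact: dP].
rewrite (pd_ip (a := fun y => u *m P y) (b := cst v) _ (dG gm Ux) d2 (d1 v)).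
rewrite (pd_mulmx (M := cst u) _ (d1 u) (dP Ux)).
rewrite !pd_cst mul0mx add0r ip0r addr0 (metric_compat gm)//.
rewrite nabla_mxE mulmxBr mulmxDr !mulmxA ipBl ipDl (mul_cmx gm _ (u *m P x) Ux) (mul_cmx gm _ u Ux).
exact: pi_key.
Qed.

Let curvp_key (F F' T vw uz uw vz gvw guz guw gvz avw auz auw avz Gvw vGw Guz uGz Guw uGw Gvz vGz
   gGvw gvGw gGuz guGz gGuw guGw gGvz gvGz : R) :
  (F' * (T * (gvw * guz - guw * gvz) - 2 * (vw * uz - uw * vz))
  + F * (T * ((gGvw + gvGw) * guz + gvw * (gGuz + guGz) - ((gGuw + guGw) * gvz + guw * (gGvz + gvGz)))
    - 2 * ((avw + Gvw + vGw) * uz + vw * (auz + Guz + uGz) - ((auw + Guw + uGw) * vz + uw * (avz + Gvz + vGz)))))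
  - F * (T * (gvw * gGuz - gGuw * gvz) - 2 * (vw * Guz - Guw * vz))
  - F * (T * (gGvw * guz - guw * gGvz) - 2 * (Gvw * uz - uw * Gvz))
  - F * (T * (gvGw * guz - guGw * gvz) - 2 * (vGw * uz - uGw * vz))
  - F * (T * (gvw * guGz - guw * gvGz) - 2 * (vw * uGz - uw * vGz))
  = F' * (T * (gvw * guz - guw * gvz) - 2 * (vw * uz - uw * vz))
    - 2 * F * (avw * uz + vw * auz - auw * vz - uw * avz).
Proof. by ring. Qed.

(** The connection terms cancel, the metric being parallel; df and the covariant derivative of P
    remain. *)
Lemma nabla_curvP x t u v w z : U x -> nabla_curv G x t u v w z =
  pd t f x * (@tau R n * (ip (G x) v w * ip (G x) u z - ip (G x) u w * ip (G x) v z)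
    - 2 * (pi x v w * pi x u z - pi x u w * pi x v z))
  - 2 * f x * (b x t v w * pi x u z + pi x v w * b x t u z
     - b x t u w * pi x v z - pi x u w * b x t v z).
Proof.
move=> Ux; rewrite /nabla_curv (pd_near_eq (g := fun y => f y * (@tau R n *
   (ip (G y) v w * ip (G y) u z - ip (G y) u w * ip (G y) v z)
   - 2 * (pi y v w * pi y u z - pi y u w * pi y v z)))); last first.
  by apply: filterS (nearU gm Ux) => y Uy; exact: curvP.
rewrite pd_kform; [|exact: df|exact: d_g|exact: d_g|exact: d_g|exact: d_g|exact: d_pi|exact: d_pi|exact: d_pi|exact: d_pi].
by rewrite !pd_pi// !pd_g// !curvP//; exact: curvp_key.
Qed.

Lemma b_sym x t u v : U x -> b x t u v = b x t v u.
Proof.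
move=> Ux.
have ps y p q : U y -> pi y p q = pi y q p by move=> Uy; rewrite P_sym// (ipC gm).
have E : pd t (fun y => pi y u v) x = pd t (fun y => pi y v u) x.
  by apply: pd_near_eq; apply: filterS (nearU gm Ux) => y Uy; exact: ps.
move: E; rewrite !pd_pi// (ps x (chr x t u))// (ps x u)//.
by rewrite -!addrA [pi x v _ + _]addrC => /addIr.
Qed.

(** The derivative of P^2 = P. It says that the covariant derivative of P exchanges kernel and range
    of P, in the forms extracted by the next four lemmas. *)
Lemma nabla_idem x t : U x -> B x t *m P x + P x *m B x t = B x t.
Proof.
move=> Ux; have E : pd t (fun y => P y *m P y) x = pd t P x.
  by apply: pd_near_eq; apply: filterS (nearU gm Ux) => y Uy; exact: P_idem.
move: E; rewrite (pd_mulmx _ (dP Ux) (dP Ux)) nabla_mxE => E.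
rewrite !(mulmxBl, mulmxDl, mulmxBr, mulmxDr) -!mulmxA (P_idem Ux) !mulmxA (P_idem Ux) -[in RHS]E.
move: (pd t P x *m P x) (P x *m pd t P x) => Q1 Q2; move: (_ *m P x) (P x *m _ ) => Q3 Q4.
by apply/matrixP => i j; rewrite !mxE; ring.
Qed.

Lemma nabla_kk x t u : U x -> u *m P x = 0 -> u *m B x t *m P x = u *m B x t.
Proof.
by move=> Ux up; have := congr1 (mulmx u) (nabla_idem t Ux); rewrite mulmxDr !mulmxA up mul0mx addr0.
Qed.

Lemma nabla_ll x t u : U x -> u *m P x = u -> u *m B x t *m P x = 0.
Proof.
move=> Ux up; have := congr1 (mulmx u) (nabla_idem t Ux); rewrite mulmxDr !mulmxA up.
by move=> /(canRL (addrK _)); rewrite subrr.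
Qed.

Lemma b_kk x t u v : U x -> u *m P x = 0 -> v *m P x = 0 -> b x t u v = 0.
Proof. by move=> Ux up vp; rewrite -nabla_kk// P_sym// vp ip0r. Qed.

Lemma b_ll x t u v : U x -> u *m P x = u -> v *m P x = v -> b x t u v = 0.
Proof. by move=> Ux up vp; rewrite -vp -P_sym// nabla_ll// ip0l. Qed.

End PseudosymmetricPoint.

(** * Consequences of the second Bianchi identity for f and P *)

Section PseudosymmetricBianchi.
Context {R : realType} {n : nat}.
Local Notation V := 'rV[R]_n.
Variables (G : V -> 'M[R]_n) (U : set V).
Hypotheses (gm : metric_on G U) (n4 : (4 <= n)%N).
Variables (f : V -> R) (P : V -> 'M[R]_n).
Hypotheses (df : forall x, U x -> differentiable f x) (dP : forall x, U x -> differentiable P x)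
  (f0 : forall x, U x -> 0 < f x)
  (psU : forall x, U x -> exists e1 e2, pseudosymmetric_at G x e1 e2 (f x) /\ P x = plane_mx G x e1 e2).
Implicit Types (x t u v w z : V).
Local Notation chr := (christoffel G).
Local Notation B x t := (nabla_mx G P x t).
Local Notation pi x u v := (ip (G x) (u *m P x) v).
Local Notation b x t u v := (ip (G x) (u *m B x t) v).

Lemma pseudosymmetric_frame x : U x -> exists (e : 'I_n -> V) (i0 i1 : 'I_n),
  [/\ Defs.orthonormal (G x) e, i0 != i1, e i0 *m P x = e i0, e i1 *m P x = e i1
    & forall i, i != i0 -> i != i1 -> e i *m P x = 0].
Proof.
move=> Ux; have [e1 [e2 [[[e11 e22 e12 nu0] _] PE]]] := psU Ux.
have [e [eo ee]] := normal_plane_exists gm n4 Ux e11 e22 e12.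
have n0 : (0 < n)%N by apply: leq_trans n4.
have n1 : (1 < n)%N by apply: leq_trans n4.
pose i0 := Ordinal n0; pose i1 := Ordinal n1.
have E0 : e i0 = e1 by case: (ee i0) => h _; exact: h.
have E1 : e i1 = e2 by case: (ee i1) => _ h; exact: h.
exists e, i0, i1; split => //.
- by rewrite PE mul_plane_mx -E0 -E1 !eo /= ?eqxx ?mulr1n ?mulr0n scale1r scale0r addr0.
- by rewrite PE mul_plane_mx -E0 -E1 !eo /= ?eqxx ?mulr1n ?mulr0n scale1r scale0r add0r.
- by move=> i h0 h1; rewrite PE mul_plane_mx -E0 -E1 !eo (negPf h0) (negPf h1) !scale0r addr0.
Qed.

Lemma ord_avoid (i j k : 'I_n) : exists l : 'I_n, [/\ l != i, l != j & l != k].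
Proof.
have [l hl] : exists l : 'I_n, l \notin [:: i; j; k].
  apply/existsP; apply: contraTT n4; rewrite -ltnNge negb_exists => /forallP H.
  have := @uniq_leq_size _ (enum 'I_n) [:: i; j; k] (enum_uniq _).
  by rewrite size_enum_ord; apply => l _; have := H l; rewrite negbK.
by exists l; move: hl; rewrite !inE !negb_or => /and3P[].
Qed.

Let K x t u v w z :=
  pd t f x * (@tau R n * (ip (G x) v w * ip (G x) u z - ip (G x) u w * ip (G x) v z)
    - 2 * (pi x v w * pi x u z - pi x u w * pi x v z))
  - 2 * f x * (b x t v w * pi x u z + pi x v w * b x t u z
     - b x t u w * pi x v z - pi x u w * b x t v z).

Let form_bianchi x t u v w z : U x ->
  K x t u v w z + K x u v t w z + K x v t u w z = 0.
Proof.
move=> Ux; rewrite -(nabla_curv_bianchi gm t u v w z Ux).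
by rewrite !(nabla_curvP gm df dP psU).
Qed.

Let s0 := (mulr1n, mulr0n, mulr0, mul0r, mulr1, mul1r, addr0, add0r, subr0, sub0r, oppr0).

(** As in Schur's lemma, suitable components isolate tau times a derivative of f. For a direction of
    the plane the two other vectors are taken in ker P; for a direction of ker P, one in ker P and
    one in the plane. *)
Lemma pd_pseudosymmetric_eq0 x t : U x -> pd t f x = 0.
Proof.
move=> Ux; have [e [i0 [i1 [eo ne p0 p1 pk]]]] := pseudosymmetric_frame Ux.
have bkk := b_kk gm dP psU; have bll := b_ll gm dP psU.
have t0 : @tau R n != 0 by rewrite gt_eqF// tau_gt0.
have D a c (i : 'I_n) : a != i0 -> a != i1 -> c != i0 -> c != i1 -> a != c ->
    e i *m P x = e i -> pd (e i) f x = 0.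
  move=> a0 a1 c0 c1 ac pi_.
  have ia : (i == a) = false.
    apply/eqP => iE; move: (eo i i); rewrite -{1}pi_ iE pk// ip0l eqxx => /esym/eqP.
    by rewrite oner_eq0.
  have ic : (i == c) = false.
    apply/eqP => iE; move: (eo i i); rewrite -{1}pi_ iE pk// ip0l eqxx => /esym/eqP.
    by rewrite oner_eq0.
  have ai : (a == i) = false by rewrite eq_sym.
  have ci : (c == i) = false by rewrite eq_sym.
  have ca : (c == a) = false by rewrite eq_sym (negPf ac).
  have nb := (ia, ic, ai, ci, negPf ac, ca).
  have := form_bianchi (e a) (e c) (e i) (e a) (e c) Ux; rewrite /K.
  rewrite (pk a)// (pk c)// pi_ !ip0l !eo !eqxx ?nb !s0.
  by move/eqP; rewrite ?mulrN1 ?mulrN ?mulr1 oppr_eq0 mulf_eq0 (negPf t0) orbF => /eqP.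
have Dl a : a != i0 -> a != i1 -> pd (e a) f x = 0.
  move=> a0 a1; have [c [c0 c1 ca]] := ord_avoid i0 i1 a.
  have a0' : (i0 == a) = false by rewrite eq_sym (negPf a0).
  have c0' : (i0 == c) = false by rewrite eq_sym (negPf c0).
  have ac : (a == c) = false by rewrite eq_sym (negPf ca).
  have nb := (negPf a0, negPf c0, negPf ca, a0', c0', ac).
  have := form_bianchi (e a) (e c) (e i0) (e c) (e i0) Ux; rewrite /K.
  rewrite (bkk x (e a) (e c) (e c))//; try exact: pk.
  rewrite (pk a)// (pk c)// p0 !ip0l !eo !eqxx ?nb !s0.
  rewrite (bkk x (e c) (e a) (e c))//; try exact: pk.
  rewrite !s0.
  by move/eqP; rewrite ?mulrN1 ?mulrN ?mulr1 oppr_eq0 mulf_eq0 (negPf t0) orbF => /eqP.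
have De i : pd (e i) f x = 0.
  have [->|h0] := eqVneq i i0.
    have [c [c0 c1 _]] := ord_avoid i0 i1 i1; have [a [a0 a1 ac]] := ord_avoid i0 i1 c.
    exact: (D a c).
  have [->|h1] := eqVneq i i1; last exact: Dl.
  have [c [c0 c1 _]] := ord_avoid i0 i1 i1; have [a [a0 a1 ac]] := ord_avoid i0 i1 c.
  exact: (D a c).
rewrite (frame_expand eo t) -pdEx.
rewrite deriveE; last exact: df.
rewrite linear_sum big1// => i _; rewrite linearZ /= -deriveE; last exact: df.
by rewrite pdEx De scaler0.
Qed.

Let p_orth x u v : U x -> u *m P x = u -> v *m P x = 0 -> ip (G x) u v = 0.
Proof.
move=> Ux up vp; have [e1 [e2 [ps PE]]] := psU Ux.
by rewrite -up PE (plane_mx_sym gm _ _ Ux) -PE vp ip0r.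
Qed.

Let nb_key (F A1 A2 A3 X Y Z : R) : 0 < F ->
  0 * A1 - 2 * F * X + (0 * A2 - 2 * F * Y) + (0 * A3 - 2 * F * Z) = 0 -> X + Y + Z = 0.
Proof.
move=> F0 H; have : F * (X + Y + Z) = 0 by lra.
by move/eqP; rewrite mulf_eq0 gt_eqF//= => /eqP.
Qed.

Lemma nabla_bianchi x t u v w z : U x ->
  (b x t v w * pi x u z + pi x v w * b x t u z - b x t u w * pi x v z - pi x u w * b x t v z)
  + (b x u t w * pi x v z + pi x t w * b x u v z - b x u v w * pi x t z - pi x v w * b x u t z)
  + (b x v u w * pi x t z + pi x u w * b x v t z - b x v t w * pi x u z - pi x t w * b x v u z) = 0.
Proof.
move=> Ux; have := form_bianchi t u v w z Ux; rewrite /K !pd_pseudosymmetric_eq0//.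
exact: nb_key (f0 Ux).
Qed.

Lemma cmx_lin x c u v : U x -> cmx G x (c *: u + v) = c *: cmx G x u + cmx G x v.
Proof.
move=> Ux; apply/row_matrixP => i; rewrite !rowE; move: (delta_mx 0 i) => w.
rewrite mulmxDr -scalemxAr (cmx_sym gm w _ Ux) (cmx_sym gm w u Ux) (cmx_sym gm w v Ux).
by rewrite mulmxDl -scalemxAl.
Qed.

Lemma nabla_mx_lin x c u v : U x -> B x (c *: u + v) = c *: B x u + B x v.
Proof.
move=> Ux; rewrite !nabla_mxE pd_dirD ?pd_dirZ; try exact: dP.
rewrite cmx_lin// mulmxDr mulmxDl -scalemxAr -scalemxAl.
move: (pd u P x) (pd v P x) (P x *m _) (P x *m _) (_ *m P x) (_ *m P x) => Q1 Q2 Q3 Q4 Q5 Q6.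
by apply/matrixP => i j; rewrite !mxE; ring.
Qed.

Let ipDD (H : 'M[R]_n) (u1 u2 v1 v2 : V) :
  ip H (u1 + u2) (v1 + v2) = ip H u1 v1 + ip H u1 v2 + (ip H u2 v1 + ip H u2 v2).
Proof. by rewrite ipDl !ipDr. Qed.

(** The components of the Bianchi identity on a, the two plane directions and a vector of ker P
    isolate the mixed entries of the derivative along a; the other entries vanish because P is a
    projection. *)
Lemma nabla_mx_kernel x a : U x -> a *m P x = 0 -> B x a = 0.
Proof.
move=> Ux ap; have [e [i0 [i1 [eo ne p0 p1 pk]]]] := pseudosymmetric_frame Ux.
have bkk := b_kk gm dP psU; have bll := b_ll gm dP psU; have bs := b_sym gm dP psU.
have e00 : ip (G x) (e i0) (e i0) = 1 by rewrite eo eqxx.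
have e11 : ip (G x) (e i1) (e i1) = 1 by rewrite eo eqxx.
have e01 : ip (G x) (e i0) (e i1) = 0 by rewrite eo (negPf ne).
have e10 : ip (G x) (e i1) (e i0) = 0 by rewrite eo eq_sym (negPf ne).
have E1 p : p *m P x = 0 -> b x a (e i1) p = 0.
  move=> pp; have := nabla_bianchi a (e i0) (e i1) (e i0) p Ux.
  have o0 := p_orth Ux p0 pp; have o1 := p_orth Ux p1 pp.
  rewrite p0 p1 ap !ip0l e00 e10 o0 o1 (bkk x (e i1) a p)// !s0.
  by move/eqP; rewrite oppr_eq0 => /eqP.
have E0 p : p *m P x = 0 -> b x a (e i0) p = 0.
  move=> pp; have := nabla_bianchi a (e i0) (e i1) (e i1) p Ux.
  have o0 := p_orth Ux p0 pp; have o1 := p_orth Ux p1 pp.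
  by rewrite p0 p1 ap !ip0l e11 e01 o0 o1 (bkk x (e i0) a p)// !s0.
have E q p : q *m P x = q -> p *m P x = 0 -> b x a q p = 0.
  move=> qq pp; rewrite {1}(frame_expand eo q) mulmx_suml ip_suml big1// => i _.
  rewrite -scalemxAl ipZl; have [->|h0] := eqVneq i i0; first by rewrite E0// mulr0.
  have [->|h1] := eqVneq i i1; first by rewrite E1// mulr0.
  by rewrite (p_orth Ux qq (pk i h0 h1)) mul0r.
apply/row_matrixP => i; rewrite !rowE mulmx0; apply: (ip_inj (unitG gm Ux)) => v.
have PP : P x *m P x = P x.
  by have [e1 [e2 [ps ->]]] := psU Ux; exact: (plane_mx_idem gm Ux ps).
have l w : w *m P x *m P x = w *m P x by rewrite -mulmxA PP.
have k w : (w - w *m P x) *m P x = 0 by rewrite mulmxBl l subrr.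
move: (delta_mx 0 i) => u; rewrite ip0l.
rewrite -[X in ip _ (X *m _) _](subrK (u *m P x)) -[X in ip _ _ X](subrK (v *m P x)) mulmxDl ipDD.
by rewrite (bkk x a _ _ Ux (k u) (k v)) (bll x a _ _ Ux (l u) (l v)) (bs x a _ _ Ux) !E// !addr0.
Qed.

(** The derivative of P along s is zero, so the component of the Bianchi identity on s and the two
    plane directions only contains this divergence. *)
Lemma nabla_trace x (e : 'I_n -> V) (i0 i1 : 'I_n) s : U x ->
  Defs.orthonormal (G x) e -> i0 != i1 -> e i0 *m P x = e i0 -> e i1 *m P x = e i1 ->
  (forall i, i != i0 -> i != i1 -> e i *m P x = 0) ->
  s *m P x = 0 -> b x (e i0) s (e i0) + b x (e i1) s (e i1) = 0.
Proof.
move=> Ux eo ne p0 p1 pk sp.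
have bkk := b_kk gm dP psU; have bll := b_ll gm dP psU.
have := nabla_bianchi s (e i0) (e i1) (e i0) (e i1) Ux.
rewrite nabla_mx_kernel// !mulmx0 !ip0l p0 p1 sp ip0l.
rewrite (bll x (e i0) (e i1) (e i0))// (bll x (e i1) (e i0) (e i0))//.
have e10 : (i1 == i0) = false by rewrite eq_sym (negPf ne).
by rewrite !eo !eqxx ?(negPf ne) ?e10 !s0.
Qed.

End PseudosymmetricBianchi.

(** * The Ricci identity for P and the contradiction *)

Section PseudosymmetricContradiction.
Context {R : realType} {n : nat}.
Local Notation V := 'rV[R]_n.
Variables (G : V -> 'M[R]_n) (U : set V).
Hypotheses (gm : metric_on G U) (n4 : (4 <= n)%N).
Variables (f : V -> R) (P : V -> 'M[R]_n).
Hypotheses (df : forall x, U x -> differentiable f x) (CP : forall k, Ck k U P)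
  (f0 : forall x, U x -> 0 < f x)
  (psU : forall x, U x -> exists e1 e2, pseudosymmetric_at G x e1 e2 (f x) /\ P x = plane_mx G x e1 e2).
Implicit Types (x t u v w z : V).
Local Notation chr := (christoffel G).
Local Notation B x t := (nabla_mx G P x t).
Local Notation b x t u v := (ip (G x) (u *m B x t) v).

Let dP x (Ux : U x) : differentiable P x := Ck_diff (CP 0) Ux.

Lemma mxtrace_frame (H A : 'M[R]_n) (e : 'I_n -> V) : Defs.orthonormal H e ->
  \tr A = \sum_i ip H (e i *m A) (e i).
Proof.
move=> eo; rewrite -(frame_trace eo (f := fun u => u *m A)); last first.
  by move=> a u v; rewrite mulmxDl -scalemxAl.
by rewrite /endo_trace; congr (\tr _); apply/matrixP => i j; rewrite [RHS]mxE -rowE [RHS]mxE.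
Qed.

Let entry_row (A : 'M[R]_n) : \sum_k (basis_vec k *m A) 0 k = \tr A.
Proof. by apply: eq_bigr => k _; rewrite /basis_vec -rowE mxE. Qed.

Let row_sum u : u = \sum_k u 0 k *: basis_vec k.
Proof. by rewrite {1}(row_sum_delta u). Qed.

Lemma nabla_mx_sum x u : U x -> B x u = \sum_k u 0 k *: B x (basis_vec k).
Proof.
move=> Ux; have L := nabla_mx_lin gm dP _ _ _ Ux.
have B0 : B x 0 = 0 by have := L (-1) 0 0; rewrite scaler0 addr0 scaleN1r addNr.
rewrite {1}[u]row_sum.
elim/big_rec2: _ => [|k y1 y2 _ <-]; first exact: B0.
exact: L.
Qed.

(** The derivative of P with the roles of its arguments exchanged: v is sent to the value at u of
    the derivative of P along v. For u in ker P this map kills ker P and takes its values in the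
    plane. *)
Definition nabla_tr_mx x u : 'M[R]_n := \matrix_k (u *m B x (basis_vec k)).
Local Notation N := nabla_tr_mx.

Lemma mul_nabla_tr_mx x u v : U x -> v *m N x u = u *m B x v.
Proof.
move=> Ux; rewrite nabla_mx_sum// {1}[v]row_sum mulmx_suml mulmx_sumr.
apply: eq_bigr => k _; rewrite -scalemxAl -scalemxAr; congr (_ *: _).
by rewrite -rowE rowK.
Qed.

(** Only the two plane directions contribute to the trace. There the component of s in ker P gives
    the divergence of [nabla_trace], and its component in the plane gives nothing. *)
Lemma tr_nabla_tr_mx x s : U x -> \tr (N x s) = 0.
Proof.
move=> Ux; have [e [i0 [i1 [eo ne p0 p1 pk]]]] := pseudosymmetric_frame gm n4 psU Ux.
rewrite (mxtrace_frame _ eo) (bigD1 i0)//= (bigD1 i1)/=; last by rewrite eq_sym.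
rewrite big1 => [|i /andP[h0 h1]]; last first.
  by rewrite mul_nabla_tr_mx// (nabla_mx_kernel gm n4 df dP f0 psU)// ?pk// mulmx0 ip0l.
have bll := b_ll gm dP psU.
have PP : P x *m P x = P x.
  by have [e1 [e2 [ps ->]]] := psU Ux; exact: (plane_mx_idem gm Ux ps).
have k : (s - s *m P x) *m P x = 0 by rewrite mulmxBl -mulmxA PP subrr.
have l : s *m P x *m P x = s *m P x by rewrite -mulmxA PP.
rewrite addr0 !mul_nabla_tr_mx//.
have T := nabla_trace gm n4 df dP f0 psU Ux eo ne p0 p1 pk k.
rewrite -[X in ip _ (X *m B x (e i0)) _ + _](subrK (s *m P x)).
rewrite -[X in _ + ip _ (X *m B x (e i1)) _](subrK (s *m P x)).
rewrite !(mulmxDl (s - s *m P x)) !(ipDl _ ((s - s *m P x) *m _)).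
by rewrite (bll x (e i0) (s *m P x))// (bll x (e i1) (s *m P x))// !addr0.
Qed.

Let CB k u : Ck k U (fun y => B y u).
Proof.
have oU := mo_open gm.
apply: (Ck_ext (f := fun y => pd u P y + P y *m cmx G y u + - (cmx G y u *m P y)) oU).
  by move=> y Uy; rewrite nabla_mxE.
apply: Ck_add => //; last by apply: Ck_opp => //; apply: Ck_mulmx => //; exact: Ck_cmx.
by apply: Ck_add => //; [exact: Ck_pd|apply: Ck_mulmx => //; exact: Ck_cmx].
Qed.

Let dB u x (Ux : U x) : differentiable (fun y => B y u) x := Ck_diff (CB 0 u) Ux.

(** The Ricci identity for P: second derivatives of P commute, and the derivatives of the connection
    matrices are collected in [rmx]. *)
Lemma nabla_mx_commute x t u : U x ->
  pd t (fun y => B y u) x - pd u (fun y => B y t) x =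
  B x t *m cmx G x u - cmx G x u *m B x t - B x u *m cmx G x t + cmx G x t *m B x u
  + P x *m rmx G x t u - rmx G x t u *m P x.
Proof.
move=> Ux.
have E a c : pd a (fun y => B y c) x =
    pd a (pd c P) x + (pd a P x *m cmx G x c + P x *m pd a (fun y => cmx G y c) x)
    - (pd a (fun y => cmx G y c) x *m P x + cmx G x c *m pd a P x).
  rewrite (pd_near_eq (g := fun y => pd c P y + P y *m cmx G y c - cmx G y c *m P y)); last first.
    by apply: filterS (nearU gm Ux) => y Uy; rewrite nabla_mxE.
  have dc := d_cmx gm c Ux; have dp := dP Ux.
  have d1 : differentiable (fun y => P y *m cmx G y c) x by exact: differentiable_mulmx.
  have d2 : differentiable (fun y => cmx G y c *m P y) x by exact: differentiable_mulmx.
  have d3 : differentiable (pd c P) x by exact: (Ck_diff (Ck_pd c (CP 1)) Ux).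
  rewrite (pdB _ (differentiableD d3 d1) d2) (pdD _ d3 d1).
  by rewrite (pd_mulmx _ dp dc) (pd_mulmx _ dc dp).
have Y : pd t (pd u P) x = pd u (pd t P) x.
  apply: pd_sym; [apply: filterS (nearU gm Ux) => y Uy; exact: dP
    |exact: (Ck_diff (Ck_pd _ (CP 1)) Ux)..].
rewrite (E t u) (E u t) Y !nabla_mxE /rmx.
move: (pd t P x) (pd u P x) (pd t (fun y => cmx G y u) x) (pd u (fun y => cmx G y t) x).
move: (pd u (pd t P) x) (cmx G x t) (cmx G x u) (P x) => Q ct cu p pt pu tu ut.
rewrite !(mulmxDl, mulmxBl, mulmxDr, mulmxBr, mulmxN, mulNmx) !mulmxA.
mx_zmod.
Qed.

(** The constant vector t is known to lie in the kernel of P only at x, so [nabla_mx_kernel] cannot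
    be differentiated as it stands. It gives B y t = B y (t P y) nearby, and at x, where t P = 0,
    the product rule leaves only the derivative of t P. *)
Lemma pd_nabla_mx_kernel x t u : U x -> t *m P x = 0 ->
  pd u (fun y => B y t) x = B x (t *m B x u) + B x (chr x u t).
Proof.
move=> Ux tp; have L := nabla_mx_lin gm dP.
have dt : differentiable (fun y => t *m P y) x.
  by apply: (differentiable_mulmx (M := cst t)); [exact: differentiable_cst|exact: dP].
have dk (k : 'I_n) : differentiable (fun y => (t *m P y) 0 k) x.
  by move/differentiable_mxP : dt; exact.
have pt : pd u (fun y => t *m P y) x = t *m pd u P x.
  rewrite (pd_mulmx (M := cst t) _ (differentiable_cst _ _) (dP Ux)).
  by rewrite pd_cst mul0mx add0r.
rewrite (pd_near_eq (g := fun y => \sum_k (t *m P y) 0 k *: B y (basis_vec k))); last first.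
  apply: filterS (nearU gm Ux) => y Uy; rewrite -nabla_mx_sum//.
  have PP : P y *m P y = P y.
    by have [e1 [e2 [ps ->]]] := psU Uy; exact: (plane_mx_idem gm Uy ps).
  have := L y (-1) (t *m P y) t Uy; rewrite (nabla_mx_kernel gm n4 df dP f0 psU); first last.
  - by rewrite scaleN1r mulmxDl mulNmx -mulmxA PP addNr.
  - by [].
  by rewrite scaleN1r addrC => /esym/subr0_eq.
rewrite pd_bsum; last by move=> k; apply: differentiable_scale; [exact: dk|exact: dB].
have -> : B x (t *m B x u) + B x (chr x u t) = B x (t *m pd u P x).
  have := L x 1 (t *m B x u) (chr x u t) Ux; rewrite !scale1r => <-.
  have := L x 1 (t *m pd u P x) (chr x u t - chr x u t *m P x) Ux.
  rewrite !scale1r (nabla_mx_kernel gm n4 df dP f0 psU (a := chr x u t - _))//; last first.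
    have [e1 [e2 [ps PE]]] := psU Ux.
    by rewrite mulmxBl -(mulmxA (chr x u t)) PE (plane_mx_idem gm Ux ps) subrr.
  rewrite addr0 => <-; congr (B x _).
  rewrite nabla_mxE mulmxBr mulmxDr !mulmxA tp mul0mx addr0 (mul_cmx gm u t Ux).
  by rewrite -addrA [- _ + _]addrC.
rewrite nabla_mx_sum//; apply: eq_bigr => k _.
rewrite (pd_scale _ (dk k) (dB _ Ux)) tp mxE scale0r addr0; congr (_ *: _).
by rewrite pd_entry// pt.
Qed.

Let tr_key (a b1 c d : R) : a + b1 - b1 + c - d = 0 -> c = 0 -> a = d.
Proof. lra. Qed.

(** The identity tr N(s) = 0 is differentiated along t, and the derivatives are exchanged by the
    Ricci identity. In the trace the connection terms cancel; the product N(t) N(s) and one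
    curvature term remain. *)
Lemma tr_nabla_tr_mxM x t s : U x -> t *m P x = 0 -> s *m P x = 0 ->
  \tr (N x t *m N x s) = \sum_k (s *m rmx G x t (basis_vec k) *m P x) 0 k.
Proof.
move=> Ux tp sp.
have H : \sum_k (s *m pd t (fun y => B y (basis_vec k)) x) 0 k = 0.
  have d1 k : differentiable (fun y => s *m B y (basis_vec k)) x.
    by apply: (differentiable_mulmx (M := cst s)); [exact: differentiable_cst|exact: dB].
  have d2 k : differentiable (fun y => (s *m B y (basis_vec k)) 0 k) x.
    by move/differentiable_mxP : (d1 k); exact.
  have : pd t (fun y => \sum_k (s *m B y (basis_vec k)) 0 k) x = 0.
    rewrite (pd_near_eq (g := cst 0)); first exact: pd_cst.
    apply: filterS (nearU gm Ux) => y Uy; rewrite -[cst 0 y](tr_nabla_tr_mx s Uy) -entry_row.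
    by apply: eq_bigr => k _; rewrite mul_nabla_tr_mx.
  rewrite pd_bsum// => HH; rewrite -[RHS]HH; apply: eq_bigr => k _; rewrite (pd_entry _ _ _ (d1 k)).
  by rewrite (pd_mulmx (M := cst s) _ (differentiable_cst _ _) (dB _ Ux)) pd_cst mul0mx add0r.
have E u : s *m pd t (fun y => B y u) x =
    u *m (N x t *m N x s) + u *m (cmx G x t *m N x s) - u *m (N x s *m cmx G x t)
    + u *m N x (s *m cmx G x t) - s *m rmx G x t u *m P x.
  have := nabla_mx_commute t u Ux.
  rewrite (pd_nabla_mx_kernel u Ux tp) (nabla_mx_kernel gm n4 df dP f0 psU Ux tp).
  move/(canRL (subrK _)) => ->.
  rewrite !mul0mx !mulmx0 subrr sub0r.
  rewrite [u *m (N x t *m _)]mulmxA [u *m (N x s *m _)]mulmxA [u *m (cmx G x t *m _)]mulmxA.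
  rewrite !mul_nabla_tr_mx// -(cmx_sym gm t u Ux) (mul_cmx gm u t Ux).
  move: (rmx G x t u) => r.
  rewrite !(mulmxDr s, mulmxBr s, mulmxN s) !mulmxA sp mul0mx addr0.
  move: (s *m B x (t *m _)) (s *m B x (chr _ _ _)) (s *m B x u *m _) (_ *m B x u) => Q1 Q2 Q3 Q4.
  by apply/rowP => j; rewrite !mxE; ring.
move: H; under eq_bigr do rewrite E.
have L (A1 A2 A3 A4 : 'M[R]_n) (F : 'I_n -> V) :
    \sum_k (basis_vec k *m A1 + basis_vec k *m A2 - basis_vec k *m A3 + basis_vec k *m A4 - F k) 0 k
    = \tr A1 + \tr A2 - \tr A3 + \tr A4 - \sum_k (F k) 0 k.
  rewrite -!entry_row -big_split /= -sumrB -big_split -sumrB /=.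
  by apply: eq_bigr => k _; rewrite !mxE.
rewrite L [\tr (N x s *m _)]mxtrace_mulC => /tr_key; apply.
exact: tr_nabla_tr_mx.
Qed.

(** p, q, r are the entries of a traceless 2x2 matrix, and with q = s + j, r = s - j its trace form
    is 2(p^2 + s^2 - j^2). Two orthogonal vectors of square - 2c have j^2 >= c and j'^2 >= c, while
    Cauchy-Schwarz on the (p, s) parts forces c (j^2 + j'^2) <= c^2. *)
Let no_negative_plane (c p q r p' q' r' : R) : 0 < c ->
  p * p + q * r + (r * q + p * p) = - (2 * c) ->
  p' * p' + q' * r' + (r' * q' + p' * p') = - (2 * c) ->
  p * p' + q * r' + (r * q' + p * p') = 0 -> False.
Proof.
move=> c0 H1 H2 H3; set s := (q + r) / 2; set j := (q - r) / 2.
set s' := (q' + r') / 2; set j' := (q' - r') / 2.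
have E1 : p ^+ 2 + s ^+ 2 = j ^+ 2 - c.
  suff : p ^+ 2 + s ^+ 2 - j ^+ 2 = (p * p + q * r + (r * q + p * p)) / 2 by rewrite H1; lra.
  by rewrite /s /j; field.
have E2 : p' ^+ 2 + s' ^+ 2 = j' ^+ 2 - c.
  suff : p' ^+ 2 + s' ^+ 2 - j' ^+ 2 = (p' * p' + q' * r' + (r' * q' + p' * p')) / 2 by rewrite H2; lra.
  by rewrite /s' /j'; field.
have E3 : p * p' + s * s' = j * j'.
  suff : p * p' + s * s' - j * j' = (p * p' + q * r' + (r * q' + p * p')) / 2 by rewrite H3; lra.
  by rewrite /s /j /s' /j'; field.
have C : (p * p' + s * s') ^+ 2 <= (p ^+ 2 + s ^+ 2) * (p' ^+ 2 + s' ^+ 2).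
  rewrite -subr_ge0 (_ : _ - _ = (p * s' - s * p') ^+ 2) ?sqr_ge0//; ring.
have J : c <= j ^+ 2 by have := sqr_ge0 p; have := sqr_ge0 s; lra.
have J' : c <= j' ^+ 2 by have := sqr_ge0 p'; have := sqr_ge0 s'; lra.
move: C; rewrite E1 E2 E3 exprMn => C.
have : c * (j ^+ 2 + j' ^+ 2) <= c * c by lra.
by rewrite ler_pM2l//; lra.
Qed.

(** The projection in the curvature term keeps two plane directions, and each contributes - f tau
    g(t, s), because the terms of the curvature in P vanish on t. *)
Lemma tr_nabla_tr_mx_curv x (e : 'I_n -> V) (i0 i1 : 'I_n) t s : U x ->
  Defs.orthonormal (G x) e -> i0 != i1 -> e i0 *m P x = e i0 -> e i1 *m P x = e i1 ->
  (forall i, i != i0 -> i != i1 -> e i *m P x = 0) -> t *m P x = 0 -> s *m P x = 0 ->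
  \tr (N x t *m N x s) = - (2 * (f x * @tau R n * ip (G x) t s)).
Proof.
move=> Ux eo ne p0 p1 pk tp sp; rewrite tr_nabla_tr_mxM//.
pose F u := s *m rmx G x t u *m P x.
have Fl a u v : F (a *: u + v) = a *: F u + F v.
  rewrite /F (mul_rmx gm t (a *: u + v) s Ux) (mul_rmx gm t u s Ux) (mul_rmx gm t v s Ux) (curv_endo_skew G x t (a *: u + v)) (curv_endo_skew G x t u) (curv_endo_skew G x t v) (curv_endo_lin1 gm a u v t s Ux).
  by rewrite opprD mulmxDl -scalerN -scalemxAl.
have -> : \sum_k (s *m rmx G x t (basis_vec k) *m P x) 0 k = endo_trace F.
  by apply: eq_bigr => k _; rewrite [RHS]mxE.
have Ps u v : ip (G x) (u *m P x) v = ip (G x) u (v *m P x).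
  by have [e1 [e2 [ps ->]]] := psU Ux; exact: (plane_mx_sym gm _ _ Ux).
rewrite (frame_trace eo Fl) (bigD1 i0)//= (bigD1 i1)/=; last by rewrite eq_sym.
rewrite big1 => [|i /andP[h0 h1]]; last by rewrite /F Ps pk// ip0r.
have E u : u *m P x = u -> ip (G x) u u = 1 -> ip (G x) (F u) u = - (f x * @tau R n * ip (G x) t s).
  move=> up uu; rewrite /F Ps up (mul_rmx gm _ _ _ Ux) -/(curv G x t u s u).
  rewrite (curvP gm psU t u s u Ux) tp !ip0l up uu.
  have -> : ip (G x) u s = 0 by rewrite -up Ps sp ip0r.
  by ring.
have ee i : ip (G x) (e i) (e i) = 1 by rewrite eo eqxx.
rewrite addr0; apply: etrans (congr2 +%R (E _ p0 (ee i0)) (E _ p1 (ee i1))) _.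
by rewrite -opprD -mulr2n -[_ *+ 2]mulr_natl.
Qed.

(** Both maps act on the plane as 2x2 matrices, whose last diagonal entry is minus the first one by
    [nabla_trace]. *)
Lemma tr_nabla_tr_mx_frame x (e : 'I_n -> V) (i0 i1 : 'I_n) t s : U x ->
  Defs.orthonormal (G x) e -> i0 != i1 -> e i0 *m P x = e i0 -> e i1 *m P x = e i1 ->
  (forall i, i != i0 -> i != i1 -> e i *m P x = 0) -> t *m P x = 0 -> s *m P x = 0 ->
  \tr (N x t *m N x s) =
  b x (e i0) t (e i0) * b x (e i0) s (e i0) + b x (e i0) t (e i1) * b x (e i1) s (e i0)
  + (b x (e i1) t (e i0) * b x (e i0) s (e i1) + b x (e i0) t (e i0) * b x (e i0) s (e i0)).
Proof.
move=> Ux eo ne p0 p1 pk tp sp.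
have L := nabla_mx_lin gm dP _ _ _ Ux.
have T r : r *m P x = 0 -> b x (e i1) r (e i1) = - b x (e i0) r (e i0).
  move=> rp; apply/eqP; rewrite -addr_eq0 addrC.
  by rewrite (nabla_trace gm n4 df dP f0 psU Ux eo ne p0 p1 pk rp).
have kern := nabla_mx_kernel gm n4 df dP f0 psU Ux.
have X i : t *m B x (e i) = b x (e i) t (e i0) *: e i0 + b x (e i) t (e i1) *: e i1.
  rewrite {1}(frame_expand eo (t *m B x (e i))) (bigD1 i0)//= (bigD1 i1)/=; last by rewrite eq_sym.
  rewrite big1 ?addr0// => j /andP[h0 h1].
  by rewrite (b_kk gm dP psU (e i) Ux tp (pk j h0 h1)) scale0r.
rewrite (mxtrace_frame _ eo) (bigD1 i0)//= (bigD1 i1)/=; last by rewrite eq_sym.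
rewrite big1 => [|i /andP[h0 h1]]; last first.
  by rewrite mulmxA (mul_nabla_tr_mx t)// (kern _ (pk i h0 h1)) mulmx0 mul0mx ip0l.
have Y i j : ip (G x) (e i *m (N x t *m N x s)) (e j) =
    b x (e i) t (e i0) * b x (e i0) s (e j) + b x (e i) t (e i1) * b x (e i1) s (e j).
  have L2 p q : B x (p *: e i0 + q *: e i1) = p *: B x (e i0) + q *: B x (e i1).
    have := L q (e i1) 0; have -> : B x 0 = 0 by apply: kern; rewrite mul0mx.
    by rewrite !addr0 L => ->.
  rewrite mulmxA (mul_nabla_tr_mx t (e i))// (mul_nabla_tr_mx s)//.
  rewrite [in LHS](X i) L2 mulmxDr -!scalemxAr ipDl !ipZl //.
by rewrite addr0 !Y !(T t)// !(T s)// mulrNN.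
Qed.

(* [N x t] acts on the plane [range P] as a traceless 2x2 matrix, and its trace form is negative
   definite in [t] on [ker P]; but the trace form on traceless 2x2 matrices has signature (2, 1). *)
Lemma no_pseudosymmetric x : ~ U x.
Proof.
move=> Ux; have [e [i0 [i1 [eo ne p0 p1 pk]]]] := pseudosymmetric_frame gm n4 psU Ux.
have [i2 [i20 i21 _]] := ord_avoid n4 i0 i1 i1.
have [i3 [i30 i31 i32]] := ord_avoid n4 i0 i1 i2.
have c0 : 0 < f x * @tau R n by rewrite mulr_gt0 ?f0// tau_gt0.
have H t s tp sp := etrans (esym (@tr_nabla_tr_mx_frame x e i0 i1 t s Ux eo ne p0 p1 pk tp sp))
  (@tr_nabla_tr_mx_curv x e i0 i1 t s Ux eo ne p0 p1 pk tp sp).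
have k2 := pk _ i20 i21; have k3 := pk _ i30 i31.
have H2 := H _ _ k2 k2; have H3 := H _ _ k3 k3; have H23 := H _ _ k2 k3.
rewrite eo eqxx mulr1 in H2; rewrite eo eqxx mulr1 in H3.
rewrite eo eq_sym (negPf i32) !mulr0 oppr0 in H23.
exact: (no_negative_plane c0 H2 H3 H23).
Qed.

End PseudosymmetricContradiction.

(** * Recovering f and P from the Ricci tensor *)

Section NoPseudosymmetric.
Context {R : realType} {n : nat}.
Local Notation V := 'rV[R]_n.
Variables (G : V -> 'M[R]_n) (U : set V).
Hypotheses (gm : metric_on G U) (n4 : (4 <= n)%N).
Implicit Types (x t u v w z : V).
Let nn : R := n%:R.
Let nn4 : 4 <= nn. Proof. by rewrite /nn (ler_nat R 4 n). Qed.

Definition tracefree_ricci_mx x : 'M[R]_n := ricci_mx G x - (n%:R^-1 * \tr (ricci_mx G x))%:M.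

Lemma Ck_tracefree_ricci_mx k : Ck k U tracefree_ricci_mx.
Proof.
have oU := mo_open gm; have CM := Ck_ricci_mx gm k.
have Ctr : Ck k U (fun y => \tr (ricci_mx G y)).
  by apply: Ck_sum => // i; exact: Ck_entry.
have CI : Ck k U (fun y => (n%:R^-1 * \tr (ricci_mx G y))%:M : 'M[R]_n).
  apply: (Ck_ext (f := fun y => (cst n%:R^-1 y * \tr (ricci_mx G y)) *: cst (1%:M : 'M[R]_n) y) oU).
    by move=> y _; rewrite /= scalemx1.
  by apply: Ck_scale => //; [apply: Ck_mul => //|]; exact: Ck_cst.
exact: (Ck_add oU CM (Ck_opp oU CI)).
Qed.

Lemma tracefree_ricci_mx_pseudosymmetric x e1 e2 nu : U x -> pseudosymmetric_at G x e1 e2 nu ->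
  tracefree_ricci_mx x = (- 2 * nu) *: (plane_mx G x e1 e2 - (2 / n%:R)%:M).
Proof.
move=> Ux ps; have [[e11 e22 e12 _] Rp] := ps.
have E : ricci_mx G x = ((nn - 1) * (nu * @tau R n))%:M - (2 * nu) *: plane_mx G x e1 e2.
  apply/row_matrixP => i; rewrite !rowE; move: (delta_mx 0 i) => u.
  apply: (ip_inj (unitG gm Ux)) => v.
  rewrite (mul_ricci_mx gm _ _ Ux) (planar_ricci gm Ux e11 e22 e12 Rp).
  rewrite mulmxBr mul_mx_scalar -scalemxAr ipBl !ipZl (plane_mx_form gm _ _ Ux).
  by rewrite /plane_shape !mul0r addr0 mulr0 addr0.
have T : \tr (ricci_mx G x) = nn * ((nn - 1) * (nu * @tau R n)) - 4 * nu.
  rewrite E linearB /= linearZ /= mxtrace_scalar (tr_plane_mx ps) -mulr_natl -/nn; lra.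
have n0 : nn != 0 by rewrite gt_eqF//; have := nn4; lra.
rewrite /tracefree_ricci_mx T {1}E; move: (plane_mx _ _ _ _) => Q.
by apply/matrixP => i j; rewrite !mxE; case: (i == j); rewrite ?mulr1n ?mulr0n -/nn; field; rewrite -/nn ?n0.
Qed.

(** The trace-free Ricci endomorphism is - 2 nu (P - 2/n). As P has rank 2, its square has trace 8
    nu^2 (n - 2)/n. Solving for nu^2, then for P, gives expressions independent of the choice of e1
    and e2. *)
Let q x : R := n%:R * \tr (tracefree_ricci_mx x *m tracefree_ricci_mx x) / (8 * (n%:R - 2)).
Let f x : R := Num.sqrt (q x).
Let P x : 'M[R]_n := (2 / n%:R)%:M - (2 * f x)^-1 *: tracefree_ricci_mx x.

Let fP x e1 e2 nu : U x -> pseudosymmetric_at G x e1 e2 nu -> f x = nu /\ P x = plane_mx G x e1 e2.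
Proof.
move=> Ux ps; have [[_ _ _ nu0] _] := ps.
have M0 := tracefree_ricci_mx_pseudosymmetric Ux ps.
have n0 : nn != 0 by rewrite gt_eqF//; have := nn4; lra.
have n2 : nn - 2 != 0 by rewrite gt_eqF//; have := nn4; lra.
have fE : f x = nu.
  have -> : f x = Num.sqrt (nu ^+ 2); last by rewrite sqrtr_sqr ger0_norm// ltW.
  congr Num.sqrt; rewrite /q M0 -scalemxAl -scalemxAr scalerA linearZ /=.
  have T c : \tr ((plane_mx G x e1 e2 - c%:M) *m (plane_mx G x e1 e2 - c%:M)) = 2 - 4 * c + nn * c ^+ 2.
    rewrite mulmxBl !mulmxBr (plane_mx_idem gm Ux ps) mul_scalar_mx mul_mx_scalar mul_scalar_mx.
    rewrite !linearB /= !mxtraceZ (tr_plane_mx ps) mxtrace_scalar -[_ *+ n]mulr_natl -/nn; ring.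
  by rewrite T -/nn; field; rewrite n2 n0.
split => //; rewrite /P fE M0 scalerA.
have -> : (2 * nu)^-1 * (-2 * nu) = -1 by field; rewrite gt_eqF.
by rewrite scaleN1r opprK addrC subrK.
Qed.

Lemma pseudosymmetric_open_empty :
  (forall x, U x -> exists e1 e2 nu, pseudosymmetric_at G x e1 e2 nu) -> forall x, ~ U x.
Proof.
move=> H; have oU := mo_open gm.
have psU x : U x -> exists e1 e2, pseudosymmetric_at G x e1 e2 (f x) /\ P x = plane_mx G x e1 e2.
  move=> Ux; have [e1 [e2 [nu ps]]] := H x Ux; have [fE PE] := fP Ux ps.
  by exists e1, e2; rewrite fE.
have f0 x : U x -> 0 < f x.
  by move=> Ux; have [e1 [e2 [[[]]]]] := psU x Ux.
have CM := Ck_tracefree_ricci_mx.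
have Cq : Ck 0 U q.
  have Ct : Ck 0 U (fun y => \tr (tracefree_ricci_mx y *m tracefree_ricci_mx y)).
    by apply: Ck_sum => // i; apply: Ck_entry => //; exact: Ck_mulmx.
  apply: (Ck_ext (f := fun y => cst (n%:R / (8 * (n%:R - 2))) y *
    \tr (tracefree_ricci_mx y *m tracefree_ricci_mx y)) oU).
    by move=> y _; rewrite /q /= mulrAC.
  by apply: Ck_mul => //; exact: Ck_cst.
have df x : U x -> differentiable f x.
  move=> Ux; apply: (differentiable_comp (f := q) (g := Num.sqrt)); first exact: Ck_diff Cq Ux.
  apply/derivable1_diffP; apply: ex_derive; apply: is_derive1_sqrt.
  by rewrite -sqrtr_gt0; exact: f0.
have CP k : Ck k U f -> Ck k U P.
  move=> Cf; apply: (Ck_ext (f := fun y => cst ((2 / n%:R)%:M) y +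
    - ((cst 2 y * f y)^-1 *: tracefree_ricci_mx y)) oU) => //.
  apply: Ck_add => //; first exact: Ck_cst.
  apply: Ck_opp => //; apply: Ck_scale => //; apply: Ck_Rinv => //.
    by move=> x Ux; rewrite mulf_neq0 ?pnatr_eq0// gt_eqF// f0.
  by apply: Ck_mul => //; exact: Ck_cst.
have dP x : U x -> differentiable P x.
  by apply: (@Ck_diff _ _ _ 0); apply: CP; split.
have pf x t : U x -> pd t f x = 0 := @pd_pseudosymmetric_eq0 _ _ _ _ gm n4 _ _ df dP psU x t.
(* Up to here f is only known to be differentiable; its derivatives being zero, it belongs to every
   class, and then so does P. *)
have Cf k : Ck k U f.
  case: k => [|k]; split => //v.
  by apply: (Ck_ext (f := cst 0) oU); [move=> y Uy; rewrite pf|exact: Ck_cst].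
by move=> x; apply: (no_pseudosymmetric gm n4 df (fun k => CP k (Cf k)) f0 psU).
Qed.

End NoPseudosymmetric.

(** * Local expressions in charts *)

Section Charts.
Context {R : realType} {n p : nat}.
Variables (M : riemannian R n) (N : riemannian R p) (f : M -> N).

Lemma loc_dom_open i j : continuous f -> open (loc_dom f i j).
Proof.
move=> cf; rewrite openE => x [q [di dj] <-]; rewrite /interior.
have ic : (mf_chart i @` mf_dom i) (mf_chart i q) by exists q.
have oI : \forall y \near mf_chart i q, (mf_chart i @` mf_dom i) y.
  by apply: open_nbhs_nbhs; split => //; exact: mf_img_open.
have oA : open (mf_dom i `&` f @^-1` mf_dom j).
  apply: openI; first exact: mf_dom_open.
  by apply: open_comp; [move=> ? _; exact: cf|exact: mf_dom_open].
have oP : \forall y \near mf_chart i q, (mf_dom i `&` f @^-1` mf_dom j) (mf_inv i y).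
  have := mf_inv_cont ic; apply; rewrite mf_chartK//.
  by apply: open_nbhs_nbhs; split.
near=> y.
have [r ri ry] : (mf_chart i @` mf_dom i) y by near: y.
have : (mf_dom i `&` f @^-1` mf_dom j) (mf_inv i y) by near: y.
by rewrite -ry mf_chartK// => ?; exists r.
Unshelve. all: by end_near. Qed.

Lemma loc_domS i j : loc_dom f i j `<=` mf_chart i @` mf_dom i.
Proof. by move=> x [q [di _] <-]; exists q. Qed.

Lemma loc_in i j x : loc_dom f i j x -> (mf_chart j @` mf_dom j) (loc f i j x).
Proof. by move=> [q [di dj] <-]; exists (f q) => //; rewrite /loc /= mf_chartK. Qed.

Lemma metric_on_chart i : metric_on (@rm_metric _ _ M i) (mf_chart i @` mf_dom i).
Proof.
split; [exact: mf_img_open|by move=> k; apply/smooth_onP: k; exact: rm_smooth|exact: rm_sym|exact: rm_pos].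
Qed.

Lemma metric_on_loc i j : continuous f -> metric_on (@rm_metric _ _ M i) (loc_dom f i j).
Proof.
move=> cf; have [_ s sy po] := metric_on_chart i; split.
- exact: loc_dom_open.
- by move=> k; apply: Ck_subset (s k); exact: loc_domS.
- by move=> x /loc_domS; exact: sy.
- by move=> x /loc_domS; exact: po.
Qed.
End Charts.

(** * Umbilicity from the linear dependence *)

Section Umbilic.
Context {R : realType} {n m : nat}.
Local Notation V := 'rV[R]_n.
Local Notation W := 'rV[R]_(n + m).
Variables (G : V -> 'M[R]_n) (U : set V) (Gt : W -> 'M[R]_(n + m)) (Ut : set W) (F : V -> W)
  (k : R).
Hypotheses (gm : metric_on G U) (gmt : metric_on Gt Ut) (sF : forall l, Ck l U F)
  (FU : forall x, U x -> Ut (F x))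
  (iso : forall x, U x -> forall u v, ip (G x) u v = ip (Gt (F x)) (pd u F x) (pd v F x))
  (ck : forall y, Ut y -> forall u v w z, curv Gt y u v w z = k * gg (Gt y) u v w z).
Hypothesis n4 : (4 <= n)%N.
Implicit Types (x u v w z : V).

Lemma umbilic_curv x eta : U x ->
  (forall u v, second_ff G Gt F x u v = ip (G x) u v *: eta) ->
  forall u v w z, curv G x u v w z = (k + ip (Gt (F x)) eta eta) * gg (G x) u v w z.
Proof.
move=> Ux um u v w z; rewrite (gauss_space_form gm gmt sF FU iso ck Ux) !um !ipZl !ipZr /gg.
by ring.
Qed.

Lemma umbilic_mean_vec x (e : 'I_n -> V) eta : Defs.orthonormal (G x) e ->
  (forall u v, second_ff G Gt F x u v = ip (G x) u v *: eta) -> mean_vec G Gt F x e = eta.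
Proof.
move=> eo um; rewrite /mean_vec; under eq_bigr do rewrite um eo eqxx scale1r.
rewrite sumr_const card_ord -[eta *+ n]scaler_nat scalerA mulVf ?scale1r// pnatr_eq0 -lt0n.
exact: leq_trans n4.
Qed.

Lemma const_ricci_mx x c : U x ->
  (forall u v w z, curv G x u v w z = c * gg (G x) u v w z) -> ricci_mx G x = ((n%:R - 1) * c)%:M.
Proof.
move=> Ux Rc; have symg := mo_sym gm Ux; have posg := mo_pos gm Ux.
have [e eo] := orthonormal_exists symg posg.
apply/row_matrixP => i; rewrite !rowE; move: (delta_mx 0 i) => u.
apply: (ip_inj (unitG gm Ux)) => v.
rewrite (mul_ricci_mx gm _ _ Ux) (ricci_frame gm Ux _ _ eo) mul_mx_scalar ipZl.
under eq_bigr do rewrite Rc /gg eo eqxx mulr1 mulrBr.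
rewrite sumrB sumr_const card_ord -mulr_sumr -[_ *+ n]mulr_natl.
have -> : \sum_i ip (G x) (e i) v * ip (G x) u (e i) = ip (G x) u v.
  rewrite (frame_ip eo u v); apply: eq_bigr => j _.
  by rewrite mulrC (ip_sym symg (e j)).
by ring.
Qed.

Lemma const_tracefree_ricci x c : U x ->
  (forall u v w z, curv G x u v w z = c * gg (G x) u v w z) -> tracefree_ricci_mx G x = 0.
Proof.
move=> Ux Rc; have n0 : n%:R != 0 :> R by rewrite pnatr_eq0 -lt0n; apply: leq_trans n4.
rewrite /tracefree_ricci_mx (const_ricci_mx Ux Rc) mxtrace_scalar -[_ * c *+ n]mulr_natl mulKf// subrr.
by [].
Qed.

Hypothesis wintgen : forall x, U x -> forall (e : 'I_n -> V) (xi : 'I_m -> W),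
  Defs.orthonormal (G x) e -> orthonormal_normal Gt F x xi ->
  norm_scalar_curv G x e = mean_curv G Gt F x e ^+ 2 - norm_normal_curv G Gt F x e xi + k.
Hypothesis dep : forall x, U x -> lin_dep6 (RC_CR G x) (Qg_gRic G x).

Let umbilic_or_pseudosymmetric x : U x ->
  (exists eta, forall u v, second_ff G Gt F x u v = ip (G x) u v *: eta) \/
  (exists e1 e2 nu, pseudosymmetric_at G x e1 e2 nu).
Proof.
move=> Ux; have [e eo] := orthonormal_exists (mo_sym gm Ux) (mo_pos gm Ux).
have [xi xio] := normal_frame_exists gmt sF FU iso Ux eo.
have n2 : (2 <= n)%N by apply: leq_trans n4.
have [um|[e1 [e2 [c [s [t [nu [H1 H2]]]]]]]] :=
  wintgen_point gm gmt sF FU iso ck Ux eo xio (wintgen Ux eo xio) n2; first by left.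
by right; exists e1, e2, nu; exact: (dep_pseudosymmetric gm n4 Ux H1 H2 (dep Ux)).
Qed.

(** Umbilic points have constant sectional curvature, hence no trace-free Ricci part. The open set
    where this part is nonzero consists therefore of points of the other kind, and has just been
    shown to be empty. *)
Lemma dep_umbilic x : U x -> exists eta, forall u v, second_ff G Gt F x u v = ip (G x) u v *: eta.
Proof.
move=> Ux; have [//|[e1 [e2 [nu ps]]]] := umbilic_or_pseudosymmetric Ux; exfalso.
pose U' : set V := [set y | U y /\ tracefree_ricci_mx G y != 0].
have oU' : open U'.
  rewrite openE => y [Uy ty]; rewrite /interior.
  have ct : {for y, continuous (tracefree_ricci_mx G)}.
    by apply: differentiable_continuous; exact: (Ck_diff (Ck_tracefree_ricci_mx gm 0) Uy).
  have nt : \forall z \near y, tracefree_ricci_mx G z != 0 by apply: cvgr_neq0 ct ty.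
  by near=> z; split; near: z => //; exact: (nearU gm Uy).
have gm' : metric_on G U'.
  split => //; first by move=> l; apply: Ck_subset (mo_smooth gm l) => y [].
    by move=> y [Uy _]; exact: (mo_sym gm).
  by move=> y [Uy _]; exact: (mo_pos gm).
apply: (pseudosymmetric_open_empty gm' n4 _ (x := x)).
  move=> y [Uy ty]; have [[eta um]|//] := umbilic_or_pseudosymmetric Uy.
  by move: ty; rewrite (const_tracefree_ricci Uy (umbilic_curv Uy um)) eqxx.
split => //; rewrite (tracefree_ricci_mx_pseudosymmetric gm n4 Ux ps).
have [[_ _ _ nu0] _] := ps.
rewrite scaler_eq0 negb_or; apply/andP; split.
  by rewrite mulNr oppr_eq0 mulf_neq0 ?pnatr_eq0// gt_eqF.
(* Otherwise the projection would be the scalar 2/n, which is idempotent only for n = 2. *)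
apply/negP => /eqP /subr0_eq E; have := plane_mx_idem gm Ux ps.
have n5 : 4 <= n%:R :> R by rewrite (ler_nat R 4 n).
have n0 : n%:R != 0 :> R by rewrite gt_eqF//; lra.
have i0 : 'I_n by apply: (@Ordinal n 0); apply: leq_trans n4.
rewrite E -scalar_mxM => /matrixP /(_ i0 i0); rewrite !mxE eqxx !mulr1n => /eqP.
rewrite -subr_eq0 (_ : _ - _ = 2 * (2 - n%:R) / n%:R ^+ 2); last by field.
by rewrite !mulf_eq0 invr_eq0 sqrf_eq0 (negPf n0) pnatr_eq0 /= orbF subr_eq0 => /eqP; lra.
Unshelve. all: by end_near. Qed.

End Umbilic.

(** * Linear total differential equations *)

Section MatrixNorm.
Context {R : realType}.

Lemma mx_entry_norm m n (M : 'M[R]_(m, n)) i j : `|M i j| <= `|M|.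
Proof.
rewrite [leRHS]mx_normrE; exact: (le_bigmax_cond 0 (fun ij : 'I_m * 'I_n => `|M ij.1 ij.2|) (j := (i, j))).
Qed.

Lemma mx_norm_le m n (M : 'M[R]_(m, n)) c : 0 <= c -> (forall i j, `|M i j| <= c) -> `|M| <= c.
Proof. by move=> c0 H; rewrite [leLHS]mx_normrE; apply: bigmax_le => // -[i j] _; exact: H. Qed.

Lemma mx_norm_mul m n p (A : 'M[R]_(m, n)) (B : 'M[R]_(n, p)) :
  `|A *m B| <= n%:R * `|A| * `|B|.
Proof.
apply: mx_norm_le => [|i j]; first by rewrite !mulr_ge0.
rewrite mxE; apply: (le_trans (ler_norm_sum _ _ _)).
have -> : n%:R * `|A| * `|B| = \sum_(k < n) `|A| * `|B|.
  by rewrite sumr_const card_ord -[RHS]mulr_natl mulrA.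
apply: ler_sum => k _.
by rewrite normrM ler_pM// mx_entry_norm.
Qed.

Lemma small_eq0 (a D : R) : (forall k, `|a| <= D / 2 ^+ k) -> a = 0.
Proof.
move=> H; apply/eqP/negPn/negP => a0.
have a1 : 0 < `|a| by rewrite normr_gt0.
have [k kD] : exists k : nat, D / `|a| < k%:R.
  exists (Num.bound (D / `|a|)); apply: archi_boundP; rewrite divr_ge0//.
  by have := H 0%N; rewrite expr0 divr1; exact: le_trans.
have := H k; rewrite ler_pdivlMr ?exprn_gt0// leNgt => /negP; apply.
move: kD; rewrite ltr_pdivrMr// => /lt_le_trans; apply.
by rewrite mulrC ler_pM2l// -natrX ler_nat ltnW// ltn_expl.
Qed.

(** Nested intervals: a k minus and plus 2C / 2^k are monotone, and the supremum of the lower ends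
    is the limit. *)
Lemma geometric_limit (a : nat -> R) C : 0 <= C -> (forall k, `|a k.+1 - a k| <= C / 2 ^+ k) ->
  exists l, forall k, `|a k - l| <= 2 * C / 2 ^+ k.
Proof.
move=> C0 H.
have e0 k : 0 <= C / 2 ^+ k by rewrite divr_ge0// exprn_ge0.
have S k : C / 2 ^+ k.+1 = C / 2 ^+ k / 2.
  by rewrite exprS invfM mulrCA mulrC [C / _]mulrC.
pose lo k := a k - 2 * (C / 2 ^+ k); pose hi k := a k + 2 * (C / 2 ^+ k).
have lo1 k : lo k <= lo k.+1.
  by rewrite /lo S; have := H k; rewrite ler_norml => /andP[]; lra.
have hi1 k : hi k.+1 <= hi k.
  by rewrite /hi S; have := H k; rewrite ler_norml => /andP[]; lra.
have lom k j : lo k <= lo (k + j)%N.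
  by elim: j => [|j IH]; rewrite ?addn0// addnS; apply: le_trans IH _.
have him k j : hi (k + j)%N <= hi k.
  by elim: j => [|j IH]; rewrite ?addn0// addnS; apply: le_trans IH.
have lohi k j : lo k <= hi j.
  apply: le_trans (lom k j) _; apply: le_trans (_ : hi (k + j)%N <= _); last by rewrite addnC.
  by rewrite /lo /hi; have := e0 (k + j)%N; lra.
have hs : has_sup (range lo).
  by split; [exists (lo 0%N), 0%N|exists (hi 0%N) => _ [k _ <-]].
exists (sup (range lo)) => k.
have l1 : lo k <= sup (range lo) by apply: ub_le_sup; [case: hs|exists k].
have l2 : sup (range lo) <= hi k by apply: ge_sup; [case: hs|move=> _ [j _ <-]].
by move: l1 l2; rewrite /lo /hi -mulrA ler_norml; lra.
Qed.

End MatrixNorm.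

Section Primitive.
Context {R : realType}.

Lemma primitive (g : R -> R) : continuous g -> exists F : R -> R, F 0 = 0 /\
  forall t : R, 0 <= t <= 1 -> differentiable F t /\ pd (1 : R) F t = g t.
Proof.
(* Integrating from -1, with integrability up to 2, makes 0 and 1 interior points, so that the
   derivative there is two-sided. *)
move=> cg; pose F t := (\int[lebesgue_measure]_(s in [set` `[-1, t]]) (g s))%R.
exists (fun t => F t - F 0); split=> [|t /andP[t0 t1]]; first by rewrite subrr.
have gi : lebesgue_measure.-integrable `[-1, 2] (EFin \o g).
  by apply: continuous_compact_integrable; [exact: segment_compact|exact: continuous_subspaceT].
have t2 : t < 2 by apply: le_lt_trans t1 _; rewrite ltr1n.
have tm : -1 < t by apply: lt_le_trans t0; rewrite ltrN10.
have [dF dE] := @continuous_FTC1_closed R g (-1) t 2 t2 gi tm (cg t).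
have df : differentiable F t by apply/derivable1_diffP.
split; first by apply: differentiableB => //; exact: differentiable_cst.
rewrite (pdB (g := cst (F 0)) _ df (differentiable_cst _ _)) pd_cst subr0 -pdEx.
by rewrite -dE derive1E.
Qed.

Lemma primitive_mx m n (g : R -> 'M[R]_(m, n)) : continuous g ->
  exists F : R -> 'M[R]_(m, n), F 0 = 0 /\
  forall t : R, 0 <= t <= 1 -> differentiable F t /\ pd (1 : R) F t = g t.
Proof.
move=> cg; have H (ij : 'I_m * 'I_n) : exists F : R -> R, F 0 = 0 /\
    forall t : R, 0 <= t <= 1 -> differentiable F t /\ pd (1 : R) F t = g t ij.1 ij.2.
  apply: (primitive (g := fun t => g t ij.1 ij.2)) => t.
  by apply: (@continuous_comp _ _ _ g (fun M : 'M[R]_(m, n) => M ij.1 ij.2) t (cg t)); exact: coord_continuous.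
have [F FP] := choice H; exists (fun t => \matrix_(i, j) F (i, j) t); split.
  by apply/matrixP => i j; rewrite !mxE; case: (FP (i, j)).
move=> t t01.
have d : differentiable (fun t => \matrix_(i, j) F (i, j) t) t.
  apply/differentiable_mxP => i j; have [_ /(_ t t01)[dF _]] := FP (i, j).
  by rewrite (_ : (fun s => _) = F (i, j))//; apply/funext => s; rewrite mxE.
split => //; apply/matrixP => i j; rewrite -(pd_entry _ _ _ d).
have [_ /(_ t t01)[_ <-]] := FP (i, j).
by congr pd; apply/funext => s; rewrite mxE.
Qed.

Lemma norm_le_deriv m n (F : R -> 'M[R]_(m, n)) K : F 0 = 0 ->
  (forall t : R, 0 <= t <= 1 -> differentiable F t /\ `|pd (1 : R) F t| <= K) ->
  forall t : R, 0 <= t <= 1 -> `|F t| <= K.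
Proof.
move=> F0 H t /andP[t0 t1].
have K0 : 0 <= K by have [|_] := H 0; [rewrite lexx ler01|apply: le_trans].
apply: mx_norm_le => // i j.
have [->|tn] := eqVneq t 0; first by rewrite F0 mxE normr0.
have tp : 0 < t by rewrite lt_neqAle eq_sym tn.
have dF (s : R) : 0 <= s <= 1 -> differentiable (fun s : R => F s i j) s.
  by move=> /H[/differentiable_mxP d _]; exact: d.
have [||c] := @MVT R (fun s : R => F s i j) (fun s : R => pd (1 : R) F s i j) 0 t tp.
- move=> s; rewrite in_itv /= => /andP[s0 s1].
  have s01 : 0 <= s <= 1 by lra.
  apply: DeriveDef; first by apply/derivable1_diffP; exact: dF.
  by rewrite pdEx pd_entry//; exact: (H s s01).1.
- apply: continuous_in_subspaceT => s; rewrite inE /= in_itv /= => /andP[s0 s1].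
  by apply: differentiable_continuous; apply: dF; lra.
rewrite in_itv /= => /andP[c0 c1]; rewrite F0 mxE !subr0 => ->.
have [|_ hK] := H c; first by lra.
rewrite normrM (ger0_norm t0) -[leRHS]mulr1 ler_pM//.
exact: le_trans (mx_entry_norm _ _ _) hK.
Qed.

(** The factor 1/2 takes the place of an exponential: for the maximum M of |E| on [0, 1], the mean
    value bound gives M <= M / 2 + rho. *)
Lemma gronwall m n (E : R -> 'M[R]_(m, n)) rho : E 0 = 0 ->
  (forall t : R, 0 <= t <= 1 -> differentiable E t /\ `|pd (1 : R) E t| <= `|E t| / 2 + rho) ->
  forall t : R, 0 <= t <= 1 -> `|E t| <= 2 * rho.
Proof.
move=> E0 H; have [c] : exists2 c, c \in `[0, 1]%R & forall t : R, t \in `[0, 1]%R -> `|E t| <= `|E c|.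
  apply: EVT_max => //; apply: continuous_in_subspaceT => s; rewrite inE /= in_itv /= => s01.
  apply: (continuous_comp (f := E) (g := fun M => `|M|)); last exact: norm_continuous.
  by apply: differentiable_continuous; exact: (H s s01).1.
rewrite in_itv /= => c01 M.
have hc : `|E c| <= `|E c| / 2 + rho.
  apply: (norm_le_deriv E0 _ c01) => t t01; have [d e] := H t t01; split => //.
  by have := M t; rewrite in_itv /= t01 => /(_ isT); lra.
by move=> t t01; have := M t; rewrite in_itv /= t01 => /(_ isT); lra.
Qed.

End Primitive.
Section ContinuousMatrix.
Context {R : realType} {T : topologicalType}.

Lemma continuous_mx m n (f : T -> 'M[R]_(m, n)) t :
  (forall i j, {for t, continuous (fun s => f s i j)}) -> {for t, continuous f}.
Proof.
move=> H; apply/cvgrPdist_le => e e0.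
have F : \forall s \near t, forall ij : 'I_m * 'I_n, `|f t ij.1 ij.2 - f s ij.1 ij.2| <= e.
  by apply: filter_forall => ij; have /cvgrPdist_le := H ij.1 ij.2; exact.
apply: filterS F => s F; apply: mx_norm_le => [|i j]; first exact: ltW.
by rewrite !mxE; exact: (F (i, j)).
Qed.

Lemma continuous_mulmx m n p (f : T -> 'M[R]_(m, n)) (g : T -> 'M[R]_(n, p)) t :
  {for t, continuous f} -> {for t, continuous g} -> {for t, continuous (fun s => f s *m g s)}.
Proof.
move=> cf cg; apply: continuous_mx => i j.
have -> : (fun s => (f s *m g s) i j) = (fun s => \sum_k f s i k * g s k j).
  by apply/funext => s; rewrite mxE.
have cM k : {for t, continuous (fun s => f s i k * g s k j)}.
  apply: cvgM.
    by apply: (@continuous_comp _ _ _ f (fun M : 'M[R]_(m, n) => M i k) t cf); exact: coord_continuous.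
  by apply: (@continuous_comp _ _ _ g (fun M : 'M[R]_(n, p) => M k j) t cg); exact: coord_continuous.
elim: (index_enum _) => [|k r IH].
  have -> : (fun s => \sum_(k <- [::]) f s i k * g s k j) = cst 0.
    by apply/funext => s; rewrite big_nil.
  exact: cvg_cst.
have -> : (fun s => \sum_(k <- k :: r) f s i k * g s k j) =
    (fun s => f s i k * g s k j + \sum_(k <- r) f s i k * g s k j).
  by apply/funext => s; rewrite big_cons.
by apply: cvgD; [exact: cM|exact: IH].
Qed.

End ContinuousMatrix.

Section LinearODE.
Context {R : realType} {N : nat}.
Local Notation E := 'rV[R]_N.

(* The projection of the line onto [0, 1]. *)
Let clamp (t : R) : R := (1 + `|t| - `|t - 1|) / 2.

Let clamp_id (t : R) : 0 <= t <= 1 -> clamp t = t.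
Proof. by move=> /andP[t0 t1]; rewrite /clamp (ger0_norm t0) distrC ger0_norm ?subr_ge0//; lra. Qed.

Let clamp01 (t : R) : 0 <= clamp t <= 1.
Proof.
rewrite /clamp.
have h (r : R) : (0 <= r /\ `|r| = r) \/ (r <= 0 /\ `|r| = - r).
  by have [r0|/ltW r0] := lerP 0 r; [left; rewrite ger0_norm|right; rewrite ler0_norm].
by case: (h t) => -[t0 ->]; case: (h (t - 1)) => -[t1 ->]; apply/andP; split; lra.
Qed.

Let continuous_clamp : continuous clamp.
Proof.
move=> t; rewrite /clamp; apply: cvgMl; apply: cvgB.
  by apply: cvgD; [exact: cvg_cst|exact: norm_continuous].
apply: (@continuous_comp _ _ _ (fun t : R => t - 1) (fun s : R => `|s|)); last exact: norm_continuous.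
by apply: cvgB; [exact: cvg_id|exact: cvg_cst].
Qed.

(** Picard iteration, which the smallness of B makes a contraction by 1/2 on the whole of [0, 1].
    The iterates are composed with [clamp] so as to be continuous on the line, as the existence of
    primitives asks. *)
Lemma linear_ode (B : R -> 'M[R]_N) (y0 : E) :
  (forall t : R, 0 <= t <= 1 -> {for t, continuous B}) ->
  (forall t : R, 0 <= t <= 1 -> forall y : E, `|y *m B t| <= `|y| / 2) ->
  exists y : R -> E, y 0 = y0 /\
    forall t : R, 0 <= t <= 1 -> differentiable y t /\ pd (1 : R) y t = y t *m B t.
Proof.
move=> cB hB; pose C t := B (clamp t).
have cC : continuous C.
  by move=> t; apply: (@continuous_comp _ _ _ clamp B); [exact: continuous_clamp|exact: cB].
have /choice[prim primP] (g : R -> E) : exists F : R -> E, continuous g -> F 0 = 0 /\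
    forall t : R, 0 <= t <= 1 -> differentiable F t /\ pd (1 : R) F t = g t.
  have [cg|ncg] := pselect (continuous g); last by exists g.
  by have [F FP] := primitive_mx cg; exists F.
have cM (u : R -> E) : continuous u -> continuous (fun s => u s *m C s).
  by move=> cu t; apply: continuous_mulmx; [exact: cu|exact: cC].
pose step (u : R -> E) : R -> E := fun t => y0 + prim (fun s => u s *m C s) (clamp t).
pose u k := iter k step (cst y0).
have cstep v : continuous v -> continuous (step v).
  move=> cv t; apply: cvgD; first exact: cvg_cst.
  apply: (@continuous_comp _ _ _ clamp (prim _)); first exact: continuous_clamp.
  by apply: differentiable_continuous; have [_ /(_ _ (clamp01 t))[]] := primP _ (cM v cv).
have cu k : continuous (u k).
  by elim: k => [|k IH]; [move=> t; exact: cvg_cst|exact: cstep].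
have contract v w D : continuous v -> continuous w -> (forall t, `|v t - w t| <= D) ->
    forall t, `|step v t - step w t| <= D / 2.
  move=> cv cw H t; rewrite /step opprD addrACA subrr add0r.
  have [p0 pd_v] := primP _ (cM v cv); have [q0 pd_w] := primP _ (cM w cw).
  apply: (norm_le_deriv (F := fun s => prim (fun s => v s *m C s) s - prim (fun s => w s *m C s) s) _ _ (clamp01 t)).
    by rewrite p0 q0 subrr.
  move=> s s01; have [dv ev] := pd_v s s01; have [dw ew] := pd_w s s01.
  split; first exact: differentiableB.
  rewrite (pdB _ dv dw) ev ew -mulmxBl; apply: le_trans (hB _ (clamp01 s) _) _.
  by rewrite ler_pM2r// invr_gt0.
have geo k t : `|u k.+1 t - u k t| <= `|y0| / 2 ^+ k.
  elim: k t => [|k IH] t; last first.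
    rewrite exprSr invfM mulrA; exact: (contract (u k.+1) (u k)).
  rewrite expr0 divr1 /u /= /step /= addrC addKr.
  have [p0 pd_v] := primP _ (cM (cst y0) (fun t => cvg_cst _)).
  apply: (norm_le_deriv p0 _ (clamp01 t)) => s s01; have [dv ev] := pd_v s s01.
  split => //; rewrite ev; apply: le_trans (hB _ (clamp01 s) _) _.
  by have := normr_ge0 y0; lra.
have /choice[l lP] (t : R) : exists l : E, forall k, `|u k t - l| <= 2 * `|y0| / 2 ^+ k.
  have /choice[l lP] (j : 'I_N) : exists l : R, forall k, `|u k t 0 j - l| <= 2 * `|y0| / 2 ^+ k.
    apply: geometric_limit => // k.
    by apply: le_trans (geo k t); have := mx_entry_norm (u k.+1 t - u k t) 0 j; rewrite !mxE.
  exists (\row_j l j) => k; apply: mx_norm_le => [|i j]; first by rewrite divr_ge0 ?mulr_ge0// exprn_ge0.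
  by rewrite !mxE ord1; exact: lP.
have cl : continuous l.
  move=> t; apply/cvgrPdist_le => e e0.
  have [k kP] : exists k : nat, 2 * `|y0| / 2 ^+ k <= e / 4.
    have [h|h] := pselect (exists k : nat, 2 * `|y0| / 2 ^+ k <= e / 4) => //.
    suff : e / 4 = 0 by move/eqP; rewrite mulf_eq0 invr_eq0 pnatr_eq0 orbF gt_eqF.
    apply: (@small_eq0 _ _ (2 * `|y0|)) => k; rewrite ger0_norm; last by rewrite divr_ge0// ltW.
    by rewrite leNgt; apply/negP => hk; apply: h; exists k; exact: ltW.
  have /cvgrPdist_le/(_ (e / 2))[|r r0 H] := cu k t; first by rewrite divr_gt0.
  exists r => // s /H us; have := lP t k; have := lP s k; move: us => /=.
  have -> : l t - l s = - (u k t - l t) + (u k t - u k s) + (u k s - l s).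
    by apply/rowP => j; rewrite !mxE; ring.
  move=> h1 h2 h3; apply: (le_trans (ler_normD _ _)); apply: le_trans (lerD (ler_normD _ _) (lexx _)) _.
  by rewrite normrN; lra.
have lE t : l t = step l t.
  apply/eqP; rewrite -subr_eq0 -normr_eq0; apply/eqP.
  apply: (@small_eq0 _ _ (2 * `|y0|)) => k; rewrite normr_id.
  have h1 := lP t k.+1.
  have h2 := contract (u k) l _ (cu k) cl (fun s => lP s k) t.
  have -> : l t - step l t = - (u k.+1 t - l t) + (u k.+1 t - step l t).
    by rewrite opprB addrA subrK.
  apply: (le_trans (ler_normD _ _)); rewrite normrN.
  have := lerD h1 h2; rewrite exprS invfM.
  by rewrite -[u k.+1 t]/(step (u k) t); lra.
have [p0 dl] := primP _ (cM l cl).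
exists (fun t => y0 + prim (fun s => l s *m C s) t); split; first by rewrite p0 addr0.
move=> t t01; have [dt et] := dl t t01; split.
  by apply: differentiableD => //; exact: differentiable_cst.
rewrite (pdD (f := cst y0) _ (differentiable_cst _ _) dt) pd_cst add0r et.
by rewrite lE /step /C clamp_id.
Qed.

End LinearODE.

Section LocalBounds.
Context {R : realType} {n : nat}.
Local Notation V := 'rV[R]_n.

Lemma near_bound (I : finType) m p (f : I -> V -> 'M[R]_(m, p)) (x0 : V) :
  (forall i, {for x0, continuous (f i)}) ->
  exists K : R, 0 < K /\ \forall x \near x0, forall i, `|f i x| <= K.
Proof.
move=> cf; exists (1 + \sum_i (`|f i x0| + 1)).
have s0 i : 0 <= `|f i x0| + 1 by rewrite addr_ge0.
split; first by rewrite ltr_pwDl// sumr_ge0.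
have F : \forall x \near x0, forall i, `|f i x0 - f i x| <= 1.
  apply: (@filter_forall V I (fun i x => `|f i x0 - f i x| <= 1) (nbhs x0)) => i.
  by have /cvgrPdist_le := cf i; apply.
apply: filterS F => x F i.
have le : `|f i x0| + 1 <= \sum_i (`|f i x0| + 1) by rewrite (bigD1 i)//= lerDl sumr_ge0.
have := F i; rewrite distrC => Fi; have := ler_normB (f i x - f i x0) (- f i x0).
by rewrite opprK subrK normrN; lra.
Qed.

Lemma lin_bound m p (F : V -> 'M[R]_(m, p)) K u : (forall a u v, F (a *: u + v) = a *: F u + F v) ->
  (forall k, `|F (basis_vec k)| <= K) -> `|F u| <= n%:R * K * `|u|.
Proof.
move=> Fl FK; have F0 : F 0 = 0 by have := Fl (-1) 0 0; rewrite scaler0 addr0 scaleN1r addNr.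
have -> : F u = \sum_k u 0 k *: F (basis_vec k).
  rewrite {1}(row_sum_delta u); elim/big_rec2: _ => [//|k y1 y2 _ <-]; exact: Fl.
apply: (le_trans (ler_norm_sum _ _ _)).
have -> : n%:R * K * `|u| = \sum_(k < n) K * `|u|.
  by rewrite sumr_const card_ord -[RHS]mulr_natl mulrA.
apply: ler_sum => k _; rewrite normrZ mulrC ler_pM//; exact: mx_entry_norm.
Qed.

Lemma pd1_line m p (f : V -> 'M[R]_(m, p)) (y u : V) (t : R) : differentiable f (t *: u + y) ->
  differentiable (fun s : R => f (s *: u + y)) t /\
  pd (1 : R) (fun s : R => f (s *: u + y)) t = pd u f (t *: u + y).
Proof.
move=> df; have d := pd_line df.
split; first by apply/derivable1_diffP; exact: (@ex_derive _ _ _ _ _ _ _ d).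
by rewrite -pdEx; exact: (@derive_val _ _ _ _ _ _ _ d).
Qed.

Lemma near0_lt e : 0 < e -> \forall v \near (0 : V), `|v| < e.
Proof.
by move=> e0; apply/nbhs_ballP; exists e => // v; rewrite -ball_normE /= sub0r normrN.
Qed.

Lemma pd1_id (t : R) : pd (1 : R) (id : R -> R) t = 1.
Proof. by rewrite -pdEx derive_id. Qed.

End LocalBounds.

(** The mean value bound is applied to f1 - f1(0), then to f - f(0) - s f1(0). *)
Lemma taylor2 (R : realType) m p (f f1 : R -> 'M[R]_(m, p)) K :
  (forall s : R, 0 <= s <= 1 -> differentiable f s /\ pd (1 : R) f s = f1 s) ->
  (forall s : R, 0 <= s <= 1 -> differentiable f1 s /\ `|pd (1 : R) f1 s| <= K) ->
  `|f 1 - f 0 - f1 0| <= K.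
Proof.
move=> H H1; have i1 : 0 <= (1 : R) <= 1 by rewrite ler01 lexx.
have B1 : forall s : R, 0 <= s <= 1 -> `|f1 s - f1 0| <= K.
  apply: (norm_le_deriv (F := fun s => f1 s - f1 0)); first by rewrite subrr.
  move=> s s01; have [d e] := H1 s s01; split.
    by apply: differentiableB => //; exact: differentiable_cst.
  by rewrite (pdB (g := cst (f1 0)) _ d (differentiable_cst _ _)) pd_cst subr0.
have dl (s : R) : differentiable (fun s : R => s *: f1 0) s by exact: differentiableZl.
have := norm_le_deriv (F := fun s => f s - f 0 - s *: f1 0) (K := K) _ _ i1.
rewrite scale1r; apply; first by rewrite scale0r subrr subr0.
move=> s s01; have [d e] := H s s01.
have d0 : differentiable (fun s => f s - f 0) s.
  by apply: differentiableB => //; exact: differentiable_cst.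
have did : differentiable (id : R -> R) s by apply/derivable1_diffP; exact: derivable_id.
split; first exact: differentiableB.
rewrite (pdB (f := fun s => f s - f 0) _ d0 (dl s)) (pdB (g := cst (f 0)) _ d (differentiable_cst _ _)).
rewrite pd_cst subr0 e (pd_scale (f := id) (M := cst (f1 0)) _ did (differentiable_cst _ _)).
by rewrite pd_cst scaler0 addr0 -pdEx derive_id scale1r; exact: B1.
Qed.

(** The defect of y + t y b as a solution along the neighbouring ray: a and b are the values of A on
    w and v, the double letters its derivatives and rho a Taylor remainder. Flatness, which is the
    hypothesis, removes the terms of first order in v. *)
Lemma frobenius_key (R : realType) N (yq y : 'rV[R]_N) (a b aw av wv rho : 'M[R]_N) (t : R) :
  aw + b *m a = wv + a *m b ->
  yq *m (a + b + t *: (aw + av) + rho) - y *m a - (y *m b + t *: (y *m a *m b + y *m wv)) =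
  (yq - y - t *: (y *m b)) *m (a + b + t *: (aw + av) + rho)
  + y *m (rho + t *: (av + b *m b + t *: (b *m (aw + av)) + b *m rho)).
Proof.
move/(canRL (addrK _)); rewrite addrC => E.
have -> : wv = aw + b *m a - a *m b.
  by apply/eqP; rewrite eq_sym subr_eq; apply/eqP; rewrite E; apply/matrixP => i j; rewrite !mxE; ring.
rewrite !(mulmxDl, mulmxDr, mulmxN, mulNmx, scalerDr, scalerN, =^~ scalemxAl, =^~ scalemxAr).
rewrite !mulmxA.
repeat match goal with |- context [?a *m ?b] =>
    let X := fresh "X" in set X := (a *m b); move: X => X end.
by apply/matrixP => i j; rewrite !mxE; ring.
Qed.

Section Frobenius.
Context {R : realType} {n N : nat}.
Local Notation V := 'rV[R]_n.
Local Notation E := 'rV[R]_N.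
Variables (U : set V) (A : V -> V -> 'M[R]_N).
Hypotheses (oU : open U) (CA : forall k u, Ck k U (fun x => A x u))
  (lA : forall x, U x -> forall a u v, A x (a *: u + v) = a *: A x u + A x v)
  (flat : forall x, U x -> forall u v,
     pd u (fun y => A y v) x + A x u *m A x v = pd v (fun y => A y u) x + A x v *m A x u).
Variables (x0 : V) (Ux0 : U x0) (Y0 : E).

Let nU x : U x -> \forall y \near x, U y.
Proof. by move=> Ux; exact: open_nbhs_nbhs. Qed.

Let dA x u (Ux : U x) : differentiable (fun y => A y u) x := Ck_diff (CA 0 u) Ux.
Let dpA x u v (Ux : U x) : differentiable (pd v (fun y => A y u)) x :=
  Ck_diff (Ck_pd v (CA 1 u)) Ux.
Let dppA x u v w (Ux : U x) : differentiable (pd w (pd v (fun y => A y u))) x :=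
  Ck_diff (Ck_pd w (Ck_pd v (CA 2 u))) Ux.

Let pdA_lin v x a u w : U x ->
  pd v (fun y => A y (a *: u + w)) x = a *: pd v (fun y => A y u) x + pd v (fun y => A y w) x.
Proof.
move=> Ux; rewrite (pd_near_eq (g := fun y => cst a y *: A y u + A y w)); last first.
  by apply: filterS (nU Ux) => y Uy; exact: lA.
have ds : differentiable (fun y => cst a y *: A y u) x.
  by apply: differentiable_scale; [exact: differentiable_cst|exact: dA].
rewrite (pdD _ ds (dA w Ux)) (pd_scale (f := cst a) _ (differentiable_cst _ _) (dA u Ux)).
by rewrite pd_cst scale0r add0r.
Qed.

Let ppA_lin3 v z x a u w : U x -> pd z (pd v (fun y => A y (a *: u + w))) x =
  a *: pd z (pd v (fun y => A y u)) x + pd z (pd v (fun y => A y w)) x.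
Proof.
move=> Ux; rewrite (pd_near_eq (g := fun y => cst a y *: pd v (fun y => A y u) y + pd v (fun y => A y w) y)); last first.
  by apply: filterS (nU Ux) => y Uy; exact: pdA_lin.
have ds : differentiable (fun y => cst a y *: pd v (fun y => A y u) y) x.
  by apply: differentiable_scale; [exact: differentiable_cst|exact: dpA].
rewrite (pdD _ ds (dpA w v Ux)) (pd_scale (f := cst a) _ (differentiable_cst _ _) (dpA u v Ux)).
by rewrite pd_cst scale0r add0r.
Qed.

Let ppA_lin2 q z x a u w : U x -> pd z (pd (a *: u + w) (fun y => A y q)) x =
  a *: pd z (pd u (fun y => A y q)) x + pd z (pd w (fun y => A y q)) x.
Proof.
move=> Ux; rewrite (pd_near_eq (g := fun y => cst a y *: pd u (fun y => A y q) y + pd w (fun y => A y q) y)); last first.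
  by apply: filterS (nU Ux) => y Uy; rewrite pd_dirD ?pd_dirZ//; exact: dA.
have ds : differentiable (fun y => cst a y *: pd u (fun y => A y q) y) x.
  by apply: differentiable_scale; [exact: differentiable_cst|exact: dpA].
rewrite (pdD _ ds (dpA q w Ux)) (pd_scale (f := cst a) _ (differentiable_cst _ _) (dpA q u Ux)).
by rewrite pd_cst scale0r add0r.
Qed.

(** Linearity in the directions reduces the bounds to finitely many basis vectors, for which
    continuity at x0 suffices. *)
Let bounds : exists r K : R, [/\ 0 < r, 0 < K & forall x, `|x0 - x| < r -> U x /\ forall u v,
  [/\ `|A x u| <= K * `|u|, `|pd v (fun y => A y u) x| <= K * `|v| * `|u|
    & `|pd v (pd v (fun y => A y u)) x| <= K * `|v| * `|v| * `|u|]].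
Proof.
have c1 k : {for x0, continuous (fun x => A x (basis_vec k))}.
  by apply: differentiable_continuous; exact: dA.
have c2 (kl : 'I_n * 'I_n) : {for x0, continuous (pd (basis_vec kl.2) (fun x => A x (basis_vec kl.1)))}.
  by apply: differentiable_continuous; exact: dpA.
have c3 (kl : 'I_n * 'I_n * 'I_n) : {for x0, continuous
    (pd (basis_vec kl.2) (pd (basis_vec kl.1.2) (fun x => A x (basis_vec kl.1.1))))}.
  by apply: differentiable_continuous; exact: dppA.
have [K1 [K10 H1]] := near_bound c1; have [K2 [K20 H2]] := near_bound c2.
have [K3 [K30 H3]] := near_bound c3.
have near4 : \forall x \near x0, [/\ U x, forall k, `|A x (basis_vec k)| <= K1,
    forall kl : 'I_n * 'I_n, `|pd (basis_vec kl.2) (fun x => A x (basis_vec kl.1)) x| <= K2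
    & forall kl : 'I_n * 'I_n * 'I_n,
       `|pd (basis_vec kl.2) (pd (basis_vec kl.1.2) (fun x => A x (basis_vec kl.1.1))) x| <= K3].
  by near=> x; split; near: x => //; exact: nU.
move/nbhs_ballP : near4 => [r /= r0 rP].
pose nn : R := n%:R; have nn0 : 0 <= nn by rewrite ler0n.
pose K := nn * K1 + nn * (nn * K2) + nn * (nn * (nn * K3)) + 1.
have p1 : 0 <= nn * K1 by rewrite mulr_ge0// ltW.
have p2 : 0 <= nn * (nn * K2) by rewrite !mulr_ge0// ltW.
have p3 : 0 <= nn * (nn * (nn * K3)) by rewrite !mulr_ge0// ltW.
exists r, K; split => //; first by rewrite /K; lra.
move=> x xr; have [|Ux h1 h2 h3] := rP x; first by rewrite -ball_normE.
split=> // u v; split.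
- apply: le_trans (lin_bound _ (lA Ux) h1) _.
  by apply: ler_wpM2r => //; rewrite /K -/nn; lra.
- have b1 k : `|pd v (fun y => A y (basis_vec k)) x| <= nn * K2 * `|v|.
    apply: (lin_bound (F := fun v => pd v (fun y => A y (basis_vec k)) x)) => [a p q|l].
      by rewrite pd_dirD ?pd_dirZ//; exact: dA.
    exact: (h2 (k, l)).
  apply: le_trans (lin_bound (F := fun u => pd v (fun y => A y u) x) u _ b1) _.
    by move=> a p q; exact: pdA_lin.
  by rewrite -!mulrA mulrA mulrA; apply: ler_wpM2r; [rewrite mulr_ge0|rewrite /K -/nn; lra].
have b1 k l : `|pd v (pd (basis_vec l) (fun y => A y (basis_vec k))) x| <= nn * K3 * `|v|.
  apply: (lin_bound (F := fun v => pd v (pd (basis_vec l) (fun y => A y (basis_vec k))) x)) => [a p q|j].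
    by rewrite pd_dirD ?pd_dirZ//; exact: dpA.
  exact: (h3 (k, l, j)).
have b2 k : `|pd v (pd v (fun y => A y (basis_vec k))) x| <= nn * (nn * K3 * `|v|) * `|v|.
  apply: (lin_bound (F := fun w => pd v (pd w (fun y => A y (basis_vec k))) x)) => [a p q|j].
    exact: ppA_lin2.
  exact: b1.
apply: le_trans (lin_bound (F := fun u => pd v (pd v (fun y => A y u)) x) u _ b2) _.
  by move=> a p q; exact: ppA_lin3.
have -> : nn * (nn * (nn * K3 * `|v|) * `|v|) * `|u| = nn * (nn * (nn * K3)) * (`|v| * `|v| * `|u|) by ring.
by rewrite -!(mulrA K) ; apply: ler_wpM2r; [rewrite !mulr_ge0|rewrite /K -/nn; lra].
Unshelve. all: by end_near. Qed.

(** [Y w] is the solution along the ray t -> x0 + t w. The condition N K r <= 1/2 is the smallness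
    required for Picard iteration, and also gives the bound by twice the initial value. *)
Let ode_step (K r : R) : 0 < r -> 0 < K -> r <= 2^-1 -> N%:R * K * r <= 2^-1 ->
  (forall x, `|x0 - x| < r -> U x /\ forall u v,
  [/\ `|A x u| <= K * `|u|, `|pd v (fun y => A y u) x| <= K * `|v| * `|u|
    & `|pd v (pd v (fun y => A y u)) x| <= K * `|v| * `|v| * `|u|]) ->
  exists Y : V -> R -> E, forall w, `|w| < r -> Y w 0 = Y0 /\
    forall t : R, 0 <= t <= 1 -> [/\ differentiable (Y w) t,
      pd (1 : R) (Y w) t = Y w t *m A (t *: w + x0) w & `|Y w t| <= 2 * `|Y0|].
Proof.
move=> r0 K0 r2 NKr H.
suff /choice[Y YP] : forall w, exists Yw : R -> E, `|w| < r -> Yw 0 = Y0 /\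
    forall t : R, 0 <= t <= 1 -> [/\ differentiable Yw t,
      pd (1 : R) Yw t = Yw t *m A (t *: w + x0) w & `|Yw t| <= 2 * `|Y0|] by exists Y.
move=> w.
have [wr|nwr] := pselect (`|w| < r); last by exists (cst Y0).
have inb (t : R) : 0 <= t <= 1 -> `|x0 - (t *: w + x0)| < r.
  move=> /andP[t0 t1]; rewrite opprD addrCA subrr addr0 normrN normrZ ger0_norm//.
  by apply: le_lt_trans wr; rewrite ler_piMl.
have hB (t : R) (y : E) : 0 <= t <= 1 -> `|y *m A (t *: w + x0) w| <= `|y| / 2.
  move=> t01; have [_ /(_ w 0)[h _ _]] := H _ (inb t t01).
  apply: (le_trans (mx_norm_mul _ _)).
  have : N%:R * `|y| * `|A (t *: w + x0) w| <= N%:R * `|y| * (K * r).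
    by apply: ler_wpM2l; rewrite ?mulr_ge0//; apply: le_trans h _; rewrite ler_pM2l// ltW.
  move=> /le_trans; apply; have := ler_wpM2l (normr_ge0 y) NKr; lra.
have [||Yw [Yw0 YwP]] := @linear_ode R N (fun t => A (t *: w + x0) w) Y0.
- move=> t t01; apply: differentiable_continuous.
  by apply: (pd1_line (f := fun y => A y w) _).1; apply: dA; exact: (H _ (inb t t01)).1.
- by move=> t t01 y; exact: hB.
exists Yw => _; split => // t t01; have [d e] := YwP t t01; split => //.
have g : `|Yw t - Y0| <= 2 * (`|Y0| / 2).
  apply: (gronwall (E := fun t => Yw t - Y0) _ _ t01); first by rewrite Yw0 subrr.
  move=> s s01; have [ds es] := YwP s s01; split.
    by apply: differentiableB => //; exact: differentiable_cst.
  rewrite (pdB (g := cst Y0) _ ds (differentiable_cst _ _)) pd_cst subr0 es.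
  rewrite -{1}[Yw s](subrK Y0) mulmxDl; apply: (le_trans (ler_normD _ _)).
  by apply: lerD; exact: hB.
by have := ler_normD (Yw t - Y0) Y0; rewrite subrK; lra.
Qed.

Let rem_key (n1 n2 n3 n4 n5 n6 r0 a0 b0 c0 d0 ra aa ba ca da : R) :
  n1 <= r0 + n2 -> n2 <= n3 -> n3 <= n4 + d0 -> n4 <= n5 + n6 -> n5 <= a0 + b0 -> n6 <= c0 ->
  r0 <= ra -> a0 <= aa -> b0 <= ba -> c0 <= ca -> d0 <= da ->
  n1 <= ra + aa + ba + ca + da.
Proof. lra. Qed.

(* By flatness, [Y w t + t *: (Y w t *m A (t w + x0) v)] solves the equation along the ray of
   [w + v] up to terms quadratic in [v]. *)
Let step_estimate (K r : R) (Y : V -> R -> E) w v : 0 < K -> r <= 2^-1 -> N%:R * K * r <= 2^-1 ->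
  (forall x, `|x0 - x| < r -> U x /\ forall u v,
  [/\ `|A x u| <= K * `|u|, `|pd v (fun y => A y u) x| <= K * `|v| * `|u|
    & `|pd v (pd v (fun y => A y u)) x| <= K * `|v| * `|v| * `|u|]) ->
  `|w| < r -> `|v| < r - `|w| ->
  (forall w, `|w| < r -> Y w 0 = Y0 /\
    forall t : R, 0 <= t <= 1 -> [/\ differentiable (Y w) t,
      pd (1 : R) (Y w) t = Y w t *m A (t *: w + x0) w & `|Y w t| <= 2 * `|Y0|]) ->
  forall C, C = K + K + N%:R * (K * K) + N%:R * (K * (2 * K)) + N%:R * (K * K) ->
  `|Y (w + v) 1 - Y w 1 - Y w 1 *m A (1 *: w + x0) v| <= 2 * (N%:R * (2 * `|Y0|) * (C * (`|v| * `|v|))).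
Proof.
move=> K0 r2 NKr H wr vr YP C CE.
have v0 := normr_ge0 v; have w0 := normr_ge0 w.
set q := w + v; have qr : `|q| < r by apply: (le_lt_trans (ler_normD _ _)); lra.
have q1 : `|q| <= 1 by lra.
have w1 : `|w| <= 1 by lra.
have v1 : `|v| <= 1 by lra.
have [yq0 yqP] := YP q qr; have [yw0 ywP] := YP w wr.
have inb (s t : R) : 0 <= s <= 1 -> 0 <= t <= 1 -> `|x0 - (s *: (t *: v) + (t *: w + x0))| < r.
  move=> /andP[s0 s1] /andP[t0 t1].
  have -> : x0 - (s *: (t *: v) + (t *: w + x0)) = - (s *: (t *: v) + t *: w).
    by apply/rowP => j; rewrite !mxE; ring.
  rewrite normrN; apply: (le_lt_trans (ler_normD _ _)); rewrite !normrZ (ger0_norm s0) (ger0_norm t0).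
  have h1 : t * `|v| <= `|v| by rewrite ler_piMl.
  have h2 : s * (t * `|v|) <= t * `|v| by rewrite ler_piMl// mulr_ge0.
  have h3 : t * `|w| <= `|w| by rewrite ler_piMl.
  by lra.
have p0 t : t *: w + x0 = 0 *: (t *: v) + (t *: w + x0) by rewrite scale0r add0r.
have p1 t : t *: q + x0 = 1 *: (t *: v) + (t *: w + x0).
  by rewrite scale1r /q scalerDr addrA [t *: w + _]addrC.
have i0 : 0 <= (0 : R) <= 1 by rewrite lexx ler01.
have i1 : 0 <= (1 : R) <= 1 by rewrite lexx ler01.
have B0 t : 0 <= t <= 1 -> `|x0 - (t *: w + x0)| < r by move=> t01; rewrite p0; exact: inb.
have B1 t : 0 <= t <= 1 -> `|x0 - (t *: q + x0)| < r by move=> t01; rewrite p1; exact: inb.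
pose a t := A (t *: w + x0) w; pose b t := A (t *: w + x0) v.
pose aw t := pd v (fun y => A y w) (t *: w + x0); pose av t := pd v (fun y => A y v) (t *: w + x0).
pose wv t := pd w (fun y => A y v) (t *: w + x0).
(* The second-order Taylor remainder of A(., q) from t w + x0 to t q + x0, hence quadratic in v. *)
pose rho t := A (t *: q + x0) q - (a t + b t + t *: (aw t + av t)).
have V2 : 0 <= `|v| * `|v| by rewrite mulr_ge0.
have lin2 (g : V -> 'M[R]_N) (gl : forall c u1 u2, g (c *: u1 + u2) = c *: g u1 + g u2) : g q = g w + g v.
  by rewrite /q -[w]scale1r gl !scale1r.
have rhoE (t : R) : 0 <= t <= 1 -> `|rho t| <= K * (`|v| * `|v|).
  move=> t01; have [t0 t1] := andP t01.
  have := taylor2 (f := fun s : R => A (s *: (t *: v) + (t *: w + x0)) q)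
    (f1 := fun s : R => pd (t *: v) (fun y => A y q) (s *: (t *: v) + (t *: w + x0)))
    (K := K * (`|v| * `|v|)).
  rewrite /= -p0 -p1.
  have Uw := (H _ (B0 t t01)).1.
  rewrite (pd_dirZ _ _ (dA q Uw)) (lin2 (A (t *: w + x0)) (lA Uw)).
  rewrite (lin2 (fun u => pd v (fun y => A y u) (t *: w + x0))); last by move=> *; exact: pdA_lin.
  have -> : rho t = A (t *: q + x0) q - (A (t *: w + x0) w + A (t *: w + x0) v)
      - t *: (aw t + av t) by rewrite /rho [- (_ + t *: _)]opprD addrA.
  apply.
    by move=> s s01; apply: (pd1_line (f := fun y => A y q)); apply: dA; exact: (H _ (inb s t s01 t01)).1.
  move=> s s01; have [Us /(_ q (t *: v))[_ _ h]] := H _ (inb s t s01 t01).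
  have [d e] := pd1_line (f := pd (t *: v) (fun y => A y q)) (dpA q (t *: v) Us).
  split=> //; rewrite e; apply: (le_trans h); rewrite normrZ (ger0_norm t0) -!mulrA ler_pM2l//.
  have h1 : t * `|v| <= `|v| by rewrite ler_piMl.
  have h2 : t * (`|v| * `|q|) <= `|v|.
    by apply: le_trans h1; rewrite ler_wpM2l// ler_piMr.
  rewrite mulrA; apply: ler_pM => //; rewrite mulr_ge0// mulr_ge0//.
have key (t : R) (t01 : 0 <= t <= 1) := frobenius_key (Y q t) (Y w t) (av t) (rho t) t
  (flat (H _ (B0 t t01)).1 v w).
have := gronwall (E := fun t : R => Y q t - Y w t - t *: (Y w t *m b t))
  (rho := N%:R * (2 * `|Y0|) * (C * (`|v| * `|v|))) _ _ i1.
rewrite scale1r; apply; first by rewrite yq0 yw0 subrr scale0r subr0.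
move=> t t01; have [dq eq_ nq] := yqP t t01; have [dw ew nw] := ywP t t01.
have [t0 t1] := andP t01.
have [Uw bnd] := H _ (B0 t t01).
have [db eb] := pd1_line (f := fun y => A y v) (dA v Uw).
have dwb : differentiable (fun t : R => Y w t *m b t) t by exact: differentiable_mulmx.
have did : differentiable (id : R -> R) t by apply/derivable1_diffP; exact: derivable_id.
have dtwb : differentiable (fun t : R => t *: (Y w t *m b t)) t by exact: differentiable_scale.
have dqw := differentiableB dq dw.
split; first exact: differentiableB.
rewrite (pdB _ dqw dtwb) (pdB _ dq dw) (pd_scale (f := id) _ did dwb) (pd_mulmx _ dw db).
rewrite (pd1_id t) scale1r eq_ ew eb.
have qE : A (t *: q + x0) q = a t + b t + t *: (aw t + av t) + rho t by rewrite /rho [RHS]addrC subrK.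
pose rem := rho t + t *: (av t + b t *m b t + t *: (b t *m (aw t + av t)) + b t *m rho t).
apply: (@le_trans _ _ `|(Y q t - Y w t - t *: (Y w t *m b t)) *m A (t *: q + x0) q + Y w t *m rem|).
  by rewrite le_eqVlt; apply/orP; left; apply/eqP; congr `|_|; rewrite qE; exact: (key t t01).
apply: (le_trans (ler_normD _ _)); apply: lerD.
  have [_ /(_ q 0)[h _ _]] := H _ (B1 t t01).
  move: (Y q t - Y w t - t *: (Y w t *m b t)) => y; apply: (le_trans (mx_norm_mul _ _)).
  have : N%:R * `|y| * `|A (t *: q + x0) q| <= N%:R * `|y| * (K * r).
    by apply: ler_wpM2l; rewrite ?mulr_ge0//; apply: le_trans h _; rewrite ler_pM2l// ltW.
  by move=> /le_trans; apply; have := ler_wpM2l (normr_ge0 y) NKr; lra.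
apply: (le_trans (mx_norm_mul _ _)); have NN0 : 0 <= N%:R :> R by rewrite ler0n.
have remE : `|rem| <= C * (`|v| * `|v|).
  have bE : `|b t| <= K * `|v| by have [h _ _] := bnd v 0.
  have avE : `|av t| <= K * (`|v| * `|v|) by have [_ h _] := bnd v v; rewrite mulrA.
  have awE : `|aw t| <= K * `|v|.
    by have [_ h _] := bnd w v; apply: (le_trans h); rewrite ler_piMr// mulr_ge0// ltW.
  have avE' : `|av t| <= K * `|v|.
    by apply: le_trans avE _; rewrite ler_pM2l// ler_piMr.
  have rE := rhoE t t01.
  have rE' : `|rho t| <= K * `|v|.
    by apply: le_trans rE _; rewrite ler_pM2l// ler_piMr.
  have Kv : 0 <= K * `|v| by rewrite mulr_ge0// ltW.
  have M (X Z : 'M[R]_N) c d : 0 <= c -> 0 <= d -> `|X| <= c -> `|Z| <= d -> `|X *m Z| <= N%:R * (c * d).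
    move=> c0 d0 hX hZ; apply: (le_trans (mx_norm_mul _ _)); rewrite -mulrA ler_wpM2l//.
    exact: ler_pM.
  have bb := M _ _ _ _ Kv Kv bE bE.
  have br := M _ _ _ _ Kv Kv bE rE'.
  have sE : `|aw t + av t| <= 2 * (K * `|v|).
    by apply: (le_trans (ler_normD _ _)); rewrite mulr_natl mulr2n; exact: lerD.
  have bs := M _ _ _ _ Kv (mulr_ge0 (ler0n _ 2) Kv) bE sE.
  have T (X : 'M[R]_N) : `|t *: X| <= `|X| by rewrite normrZ (ger0_norm t0) ler_piMl.
  have h1 := ler_normD (rho t) (t *: (av t + b t *m b t + t *: (b t *m (aw t + av t)) + b t *m rho t)).
  have h2 := T (av t + b t *m b t + t *: (b t *m (aw t + av t)) + b t *m rho t).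
  have h3 := ler_normD (av t + b t *m b t + t *: (b t *m (aw t + av t))) (b t *m rho t).
  have h4 := ler_normD (av t + b t *m b t) (t *: (b t *m (aw t + av t))).
  have h5 := ler_normD (av t) (b t *m b t).
  have h6 := T (b t *m (aw t + av t)).
  have -> : C * (`|v| * `|v|) = K * (`|v| * `|v|) + K * (`|v| * `|v|) + N%:R * (K * `|v| * (K * `|v|))
      + N%:R * (K * `|v| * (2 * (K * `|v|))) + N%:R * (K * `|v| * (K * `|v|)) by rewrite CE; ring.
  rewrite /rem.
  exact: (rem_key h1 h2 h3 h4 h5 h6 rE avE bb bs br).
by apply: ler_pM => //; rewrite ?mulr_ge0// ?ler_wpM2l.
Qed.

(* Solve the equation along the rays issued from [x0]. *)
Lemma frobenius : exists (r : R) (Y : V -> E), [/\ 0 < r, Y x0 = Y0 &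
  forall x, `|x0 - x| < r -> U x /\ differentiable Y x /\ forall u, pd u Y x = Y x *m A x u].
Proof.
have [r1 [K [r10 K0 H1]]] := bounds.
pose NN : R := N%:R; have NN0 : 0 <= NN by rewrite ler0n.
have NK0 : 0 < NN * K + 1 by rewrite ltr_wpDl// mulr_ge0// ltW.
(* Below r1 for the bounds on A, below 1/2 so that all displacements have norm at most 1, and below
   the last term so that N K r <= 1/2. *)
pose r := Num.min r1 (Num.min 2^-1 ((NN * K + 1)^-1 / 2)).
have r0 : 0 < r by rewrite !lt_min r10 invr_gt0 ltr0n divr_gt0 ?invr_gt0.
have r2 : r <= 2^-1 by rewrite /r !ge_min lexx !orbT.
have NKr : NN * K * r <= 2^-1.
  apply: (@le_trans _ _ ((NN * K + 1) * r)); first by rewrite ler_pM2r// lerDl.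
  rewrite mulrC -ler_pdivlMr//; rewrite mulrC; by rewrite /r !ge_min lexx !orbT.
have H x : `|x0 - x| < r -> U x /\ forall u v,
  [/\ `|A x u| <= K * `|u|, `|pd v (fun y => A y u) x| <= K * `|v| * `|u|
    & `|pd v (pd v (fun y => A y u)) x| <= K * `|v| * `|v| * `|u|].
  by move=> xr; apply: H1; apply: lt_le_trans xr _; rewrite /r ge_min lexx.
have [Y YP] := ode_step r0 K0 r2 NKr H.
exists r, (fun x => Y (x - x0) 1); split => //.
  rewrite subrr; have [|Y00 YYP] := YP 0; first by rewrite normr0.
  have F0 : Y 0 0 - Y0 = 0 by rewrite Y00 subrr.
  have FD (t : R) : 0 <= t <= 1 ->
      differentiable (fun t : R => Y 0 t - Y0) t /\ `|pd (1 : R) (fun t : R => Y 0 t - Y0) t| <= 0.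
    move=> t01; have [d e _] := YYP t t01; split.
      by apply: differentiableB => //; exact: differentiable_cst.
    rewrite (pdB (g := cst Y0) _ d (differentiable_cst _ _)) pd_cst subr0 e.
    have -> : A (t *: (0 : V) + x0) 0 = 0.
      have := lA (x := t *: (0 : V) + x0) _ (-1) 0 0; rewrite !scaler0 !add0r scaleN1r addNr.
      by apply.
    by rewrite mulmx0 normr0.
  have i1 : 0 <= (1 : R) <= 1 by rewrite ler01 lexx.
  have := norm_le_deriv (F := fun t : R => Y 0 t - Y0) F0 FD i1.
  by rewrite normr_le0 subr_eq0 => /eqP.
move=> x xr; have [Ux _] := H x xr; split => //.
have dAx := lA Ux.
pose L u : E := Y (x - x0) 1 *m A x u.
have Llin a u v : L (a *: u + v) = a *: L u + L v by rewrite /L dAx mulmxDr -scalemxAr.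
pose Lm : 'M[R]_(n, N) := \matrix_k L (basis_vec k).
have LE u : L u = u *m Lm.
  have L0 : L 0 = 0 by have := Llin (-1) 0 0; rewrite scaler0 addr0 scaleN1r addNr.
  rewrite {1 2}(row_sum_delta u) mulmx_suml.
  elim/big_rec2: _ => [//|k y1 y2 _ <-]; rewrite Llin -scalemxAl; congr (_ *: _ + _).
  by rewrite -rowE rowK.
have cL : continuous (mulmxr Lm : V -> E).
  move=> u; apply: (@continuous_mulmx R V _ _ _ (id : V -> V) (cst Lm) u); last exact: cst_continuous.
  by move=> B hB.
have wr : `|x - x0| < r by rewrite distrC.
have [Yw0 YwP] := YP _ wr.
pose C : R := K + K + NN * (K * K) + NN * (K * (2 * K)) + NN * (K * K).
have C0 : 0 <= C by rewrite /C !addr_ge0// ?mulr_ge0// ltW.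
have est v : `|v| < r - `|x - x0| ->
    `|Y (x - x0 + v) 1 - Y (x - x0) 1 - L v| <= 2 * (NN * (2 * `|Y0|) * (C * (`|v| * `|v|))).
  move=> vr; have := step_estimate K0 r2 NKr H wr vr YP (erefl C); rewrite scale1r subrK; exact.
pose D := 2 * (NN * (2 * `|Y0|)) * C.
have D0 : 0 <= D by rewrite !mulr_ge0.
(* The error is at most D |v|^2, hence at most e |v| once |v| <= e / (D + 1). *)
have [d pdL] : differentiable (fun x => Y (x - x0) 1) x /\ forall v, pd v (fun x => Y (x - x0) 1) x = mulmxr Lm v.
  apply: differentiable_pd_eps => // e e0; near=> v.
  have v1 : `|v| < r - `|x - x0| by near: v; apply: near0_lt; rewrite subr_gt0.
  have v2 : `|v| <= e / (D + 1) by apply: ltW; near: v; apply: near0_lt; rewrite divr_gt0// ltr_wpDl.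
  have vE : v + x - x0 = x - x0 + v by rewrite -addrA addrC.
  rewrite /= -LE vE; apply: (le_trans (est v v1)).
  have -> : 2 * (NN * (2 * `|Y0|) * (C * (`|v| * `|v|))) = D * `|v| * `|v| by rewrite /D; ring.
  apply: ler_wpM2r => //; apply: (@le_trans _ _ ((D + 1) * `|v|)).
    by rewrite ler_wpM2r// lerDl.
  by rewrite mulrC -ler_pdivlMr// ltr_wpDl.
by split => // u; rewrite pdL /= -LE.
Unshelve. all: by end_near. Qed.

End Frobenius.

(** * Conformal flatness *)

Section ConstantCurvature.
Context {R : realType} {n : nat}.
Local Notation V := 'rV[R]_n.
Variables (G : V -> 'M[R]_n) (U : set V) (c : R).
Hypotheses (gm : metric_on G U)
  (Rc : forall x, U x -> forall u v w z, curv G x u v w z = c * gg (G x) u v w z).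
Implicit Types (x u v w : V).

Lemma curv_endo_const x u v w : U x ->
  curv_endo G x u v w = c *: (ip (G x) v w *: u - ip (G x) u w *: v).
Proof.
move=> Ux; apply: (chr_eqP gm Ux) => z; have := Rc Ux u v w z; rewrite /curv /gg => ->.
by rewrite ipZl ipBl !ipZl.
Qed.

End ConstantCurvature.

(** One component of the curvature of g / mu^2, its connection being written as that of g minus a
    shift. T stands for the gradient of mu and NT for its squared norm; letters G and P mark
    Christoffel terms and their derivatives. The Hessian equation is already substituted, and the
    cancellation uses constant curvature and the value of NT. *)
Lemma conformal_curv_key (R : realType) (c mu Ta Tb Tw ab aw bw TGab TGaw TGbw Gabw bGaw aGbw NT
    a b w T GaT GbT Gab Gaw Gbw GaGbw GbGaw PaGbw PbGaw : R) :
  mu != 0 -> NT = c * (2 * mu - mu ^+ 2) ->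
  PaGbw + GaGbw - (PbGaw + GbGaw) = c * (bw * a - aw * b) ->
  let s := mu^-1 in let k := c * (mu - 1) in
  (PaGbw - (- (s ^+ 2 * Ta) * (Tb * w + Tw * b - bw * T)
      + s * ((TGab - k * ab) * w + (TGaw - k * aw) * b - ((Gabw + bGaw) * T + bw * (- GaT - k * a))))
   + (GaGbw - s * (Tb * Gaw + Tw * Gab - bw * GaT)
      - s * (Ta * (Gbw - s * (Tb * w + Tw * b - bw * T))
         + (TGbw - s * (Tb * Tw + Tw * Tb - bw * NT)) * a
         - (aGbw - s * (Tb * aw + Tw * ab - bw * Ta)) * T)))
  - (PbGaw - (- (s ^+ 2 * Tb) * (Ta * w + Tw * a - aw * T)
      + s * ((TGab - k * ab) * w + (TGbw - k * bw) * a - ((Gabw + aGbw) * T + aw * (- GbT - k * b))))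
   + (GbGaw - s * (Ta * Gbw + Tw * Gab - aw * GbT)
      - s * (Tb * (Gaw - s * (Ta * w + Tw * a - aw * T))
         + (TGaw - s * (Ta * Tw + Tw * Ta - aw * NT)) * b
         - (bGaw - s * (Ta * bw + Tw * ab - aw * Tb)) * T))) = 0.
Proof.
move=> mu0 -> H s k; have -> : PaGbw = c * (bw * a - aw * b) + (PbGaw + GbGaw) - GaGbw by rewrite -H; ring.
by rewrite /s /k; field.
Qed.

Section Conformal.
Context {R : realType} {n : nat}.
Local Notation V := 'rV[R]_n.
Variables (G : V -> 'M[R]_n) (U : set V) (c : R) (mu : V -> R) (T : V -> V).
Hypotheses (gm : metric_on G U)
  (Rc : forall x, U x -> forall u v w z, curv G x u v w z = c * gg (G x) u v w z)
  (Cmu : forall k, Ck k U mu) (mu0 : forall x, U x -> 0 < mu x)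
  (dT : forall x, U x -> differentiable T x)
  (pmu : forall x, U x -> forall u, pd u mu x = ip (G x) (T x) u)
  (pT : forall x, U x -> forall u, pd u T x = - christoffel G x u (T x) - (c * (mu x - 1)) *: u)
  (nT : forall x, U x -> ip (G x) (T x) (T x) = c * (2 * mu x - mu x ^+ 2)).
Implicit Types (x u v w z : V).
Local Notation chr := (christoffel G).

(* [g / mu^2] is flat for [mu = 1 + v] when [v] solves the system above. *)
Definition conformal_factor y : R := (mu y)^-1 * (mu y)^-1.
Local Notation phi := conformal_factor.
Local Notation Gh := (fun y => phi y *: G y).
Local Notation chrh := (christoffel (fun y => phi y *: G y)).
Let oU := mo_open gm.
Let mun x (Ux : U x) : mu x != 0. Proof. by rewrite gt_eqF// mu0. Qed.
Let dmu x (Ux : U x) : differentiable mu x := Ck_diff (Cmu 0) Ux.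

Let Cs k : Ck k U (fun y => (mu y)^-1).
Proof. by apply: Ck_Rinv. Qed.

Lemma Ck_conformal_factor k : Ck k U phi.
Proof. by apply: Ck_mul. Qed.

Lemma conformal_factor_gt0 x : U x -> 0 < phi x.
Proof. by move=> Ux; rewrite mulr_gt0// invr_gt0 mu0. Qed.

Let ipZm (a : R) (H : 'M[R]_n) u v : ip (a *: H) u v = a * ip H u v.
Proof. by rewrite /ip -scalemxAr -scalemxAl mxE. Qed.

Let gmh : metric_on Gh U.
Proof.
split => //.
- by move=> k; apply: Ck_scale => //; [exact: Ck_conformal_factor|exact: mo_smooth gm k].
- by move=> x Ux; rewrite linearZ /= (mo_sym gm Ux).
- by move=> x Ux u u0; rewrite ipZm mulr_gt0 ?conformal_factor_gt0// (mo_pos gm Ux).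
Qed.

Let ps x u : U x -> pd u (fun y => (mu y)^-1) x = - ((mu x)^-1 ^+ 2 * ip (G x) (T x) u).
Proof. by move=> Ux; rewrite (pd_Rinv _ (dmu Ux) (mun Ux)) pmu// exprVn. Qed.

Let pGh x u : U x -> pd u Gh x =
  (- (2 * (mu x)^-1 ^+ 3 * ip (G x) (T x) u)) *: G x + phi x *: pd u G x.
Proof.
move=> Ux; have dphi := Ck_diff (Ck_conformal_factor 0) Ux.
have ds := Ck_diff (Cs 0) Ux.
rewrite (pd_scale _ dphi (dG gm Ux)); congr (_ *: _ + _).
by rewrite (pdM _ ds ds) !ps//; ring.
Qed.

(** The classical amount by which the Levi-Civita connection of g exceeds that of g / mu^2. *)
Definition conformal_shift x u v : V := (mu x)^-1 *:
  (ip (G x) (T x) u *: v + ip (G x) (T x) v *: u - ip (G x) u v *: T x).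

Let chrh_key (s Tu Tv Tw uv uw vw gu gv gw X : R) :
  X = 2^-1 * (gu + gv - gw) ->
  s * s * (X - s * (Tu * vw + Tv * uw - uv * Tw)) =
  2^-1 * (- (2 * s ^+ 3 * Tu) * vw + s * s * gu + (- (2 * s ^+ 3 * Tv) * uw + s * s * gv)
    - (- (2 * s ^+ 3 * Tw) * uv + s * s * gw)).
Proof. by move=> ->; field. Qed.

Lemma conformal_christoffel x u v : U x -> chrh x u v = chr x u v - conformal_shift x u v.
Proof.
move=> Ux; apply: (chr_eqP gmh Ux) => w; rewrite (koszul gmh _ _ _ Ux) !pGh//.
rewrite !ipDm !ipZm ipBl /conformal_shift ipZl ipBl ipDl !ipZl; apply/esym.
exact: chrh_key (koszul gm u v w Ux).
Qed.

Let pip x a u : U x -> pd a (fun y => ip (G y) (T y) u) x =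
  ip (G x) (T x) (chr x a u) - c * (mu x - 1) * ip (G x) a u.
Proof.
move=> Ux; rewrite (pd_ip (b := cst u) _ (dG gm Ux) (dT Ux) (differentiable_cst _ _)).
rewrite pd_cst ip0r addr0 (metric_compat gm)// pT// ipBl ipNl ipZl; ring.
Qed.

Let dip x u : U x -> differentiable (fun y => ip (G y) (T y) u) x.
Proof.
move=> Ux; apply: (differentiable_ip (b := cst u) (dG gm Ux) (dT Ux)).
exact: differentiable_cst.
Qed.

Let pshift x a b w : U x -> pd a (fun y => conformal_shift y b w) x =
  - ((mu x)^-1 ^+ 2 * ip (G x) (T x) a) *:
    (ip (G x) (T x) b *: w + ip (G x) (T x) w *: b - ip (G x) b w *: T x)
  + (mu x)^-1 *: ((ip (G x) (T x) (chr x a b) - c * (mu x - 1) * ip (G x) a b) *: w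
     + (ip (G x) (T x) (chr x a w) - c * (mu x - 1) * ip (G x) a w) *: b
     - ((ip (G x) (chr x a b) w + ip (G x) b (chr x a w)) *: T x
        + ip (G x) b w *: (- chr x a (T x) - (c * (mu x - 1)) *: a))).
Proof.
move=> Ux; have dc (p : V) : differentiable (fun _ : V => p) x by exact: differentiable_cst.
have d1 : differentiable (fun y => ip (G y) (T y) b *: w) x.
  by apply: (differentiable_scale (M := fun=> w)) => //; exact: dip.
have d2 : differentiable (fun y => ip (G y) (T y) w *: b) x.
  by apply: (differentiable_scale (M := fun=> b)) => //; exact: dip.
have d3 : differentiable (fun y => ip (G y) b w *: T y) x.
  by apply: differentiable_scale; [exact: (d_g gm)|exact: dT].
have d12 := differentiableD d1 d2; have d123 := differentiableB d12 d3.
rewrite (pd_scale (f := fun y => (mu y)^-1) _ (Ck_diff (Cs 0) Ux) d123) ps//; congr (_ + _ *: _).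
rewrite (pdB _ d12 d3) (pdD _ d1 d2).
rewrite (pd_scale (M := cst w) _ (dip b Ux) (dc w)) (pd_scale (M := cst b) _ (dip w Ux) (dc b)).
rewrite (pd_scale _ (d_g gm b w Ux) (dT Ux)) !pd_cst !scaler0 !addr0 !pip//.
by rewrite (pd_g gm)// pT.
Qed.

Let d_shift x b w : U x -> differentiable (fun y => conformal_shift y b w) x.
Proof.
move=> Ux; have dc (p : V) : differentiable (fun _ : V => p) x by exact: differentiable_cst.
apply: differentiable_scale; first exact: (Ck_diff (Cs 0) Ux).
apply: differentiableB; last by apply: differentiable_scale; [exact: (d_g gm)|exact: dT].
apply: differentiableD.
  by apply: (differentiable_scale (M := fun=> w)) => //; exact: dip.
by apply: (differentiable_scale (M := fun=> b)) => //; exact: dip.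
Qed.

Lemma conformal_flat x a b w : U x -> curv_endo Gh x a b w = 0.
Proof.
move=> Ux; rewrite curv_endoE.
have E p q : pd p (fun y => chrh y q w) x =
    pd p (fun y => chr y q w) x - pd p (fun y => conformal_shift y q w) x.
  rewrite -(pdB _ (d_chr gm q w Ux) (d_shift q w Ux)); apply: pd_near_eq.
  by apply: filterS (nearU gm Ux) => y Uy; exact: conformal_christoffel.
have S p q : chr x p (chr x q w - conformal_shift x q w) = chr x p (chr x q w) - (mu x)^-1 *:
    (ip (G x) (T x) q *: chr x p w + ip (G x) (T x) w *: chr x p q - ip (G x) q w *: chr x p (T x)).
  rewrite -(mul_cmx gm p _ Ux) /conformal_shift mulmxBl -scalemxAl mulmxBl mulmxDl -!scalemxAl.
  by rewrite (mul_cmx gm p (chr x q w) Ux) (mul_cmx gm p w Ux) (mul_cmx gm p q Ux) (mul_cmx gm p (T x) Ux).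
have C p q : chrh x p (chrh x q w) = chr x p (chr x q w) - (mu x)^-1 *:
    (ip (G x) (T x) q *: chr x p w + ip (G x) (T x) w *: chr x p q - ip (G x) q w *: chr x p (T x))
    - conformal_shift x p (chr x q w - conformal_shift x q w).
  apply: etrans (congr1 (chrh x p) (conformal_christoffel q w Ux)) _.
  apply: etrans (conformal_christoffel p _ Ux) _.
  by rewrite (S p q).
have E' p q := etrans (E p q) (congr1 (fun z => pd p (fun y => chr y q w) x - z) (pshift p q w Ux)).
apply: etrans (congr2 (fun p q => p - q) (congr2 +%R (E' a b) (C a b)) (congr2 +%R (E' b a) (C b a))) _.
rewrite (chrC gm b a Ux).
have Rab := curv_endo_const gm Rc a b w Ux; rewrite curv_endoE in Rab.
rewrite /conformal_shift.
have N := nT Ux; have m0 := mun Ux.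
rewrite !(ipBr, ipDr, ipZr) (ipC gm b a Ux) (ipC gm a (T x) Ux) (ipC gm b (T x) Ux).
move: Rab N m0.
move: (pd a (fun y => chr y b w) x) (pd b (fun y => chr y a w) x).
move: (chr x a (chr x b w)) (chr x b (chr x a w)) => AB BA.
move: (ip (G x) (T x) (chr x a b)) (ip (G x) (T x) (chr x a w)) (ip (G x) (T x) (chr x b w)) => t1 t2 t3.
move: (ip (G x) (chr x a b) w) (ip (G x) b (chr x a w)) (ip (G x) a (chr x b w)) => h1 h2 h3.
move: (chr x a (T x)) (chr x b (T x)) (chr x a b) (chr x a w) (chr x b w) => Qa Qb Qab Qaw Qbw.
move: (ip (G x) (T x) a) (ip (G x) (T x) b) (ip (G x) (T x) w) (ip (G x) (T x) (T x)) => Ta Tb Tw NT.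
move: (ip (G x) a b) (ip (G x) a w) (ip (G x) b w) => iab iaw ibw PA PB.
move=> Rab N m0; apply/rowP => j.
move/rowP : Rab => /(_ j); rewrite !mxE => Rab.
have := conformal_curv_key Ta Tb Tw iab t1 t2 t3 h1 h2 h3 (T x 0 j) (w 0 j) (Qa 0 j) (Qb 0 j) (Qab 0 j) (Qaw 0 j) (Qbw 0 j) m0 N Rab.
by move=> /= <-; ring.
Qed.

End Conformal.

(** * Schur's lemma *)

Section Schur.
Context {R : realType} {n : nat}.
Local Notation V := 'rV[R]_n.
Variables (G : V -> 'M[R]_n) (U : set V) (c : V -> R).
Hypotheses (gm : metric_on G U) (n4 : (4 <= n)%N) (dc : forall x, U x -> differentiable c x)
  (Rc : forall x, U x -> forall u v w z, curv G x u v w z = c x * gg (G x) u v w z).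
Implicit Types (x t u v w z : V).

Let schur_key (F F' gvw guz guw gvz a1 a2 b1 b2 c1 c2 d1 d2 : R) :
  (F' * (1 * (gvw * guz - guw * gvz) - 2 * (0 * 0 - 0 * 0))
   + F * (1 * ((a1 + a2) * guz + gvw * (b1 + b2) - ((c1 + c2) * gvz + guw * (d1 + d2)))
     - 2 * (0 * 0 + 0 * 0 - (0 * 0 + 0 * 0))))
  - F * (gvw * b1 - c1 * gvz) - F * (a1 * guz - guw * d1) - F * (a2 * guz - c2 * gvz)
  - F * (gvw * b2 - guw * d2) = F' * (gvw * guz - guw * gvz).
Proof. ring. Qed.

Let nabla_curv_const x t u v w z : U x -> nabla_curv G x t u v w z = pd t c x * gg (G x) u v w z.
Proof.
move=> Ux; have d0 : differentiable (cst 0 : V -> R) x by exact: differentiable_cst.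
rewrite /nabla_curv (pd_near_eq (g := fun y => c y * (1 * (ip (G y) v w * ip (G y) u z
   - ip (G y) u w * ip (G y) v z) - 2 * (cst 0 y * cst 0 y - cst 0 y * cst 0 y)))); last first.
  apply: filterS (nearU gm Ux) => y Uy; rewrite Rc// /gg /=.
  by rewrite mul1r mul0r subrr mulr0 subr0.
rewrite pd_kform; [|exact: dc|exact: (d_g gm)|exact: (d_g gm)|exact: (d_g gm)|exact: (d_g gm)|exact: d0|exact: d0|exact: d0|exact: d0].
by rewrite !pd_cst !(pd_g gm)// !Rc// /gg; exact: schur_key.
Qed.

(** The Bianchi component on [e i] and two further vectors of an orthonormal frame isolates the
    derivative of c along [e i]. *)
Lemma schur x t : U x -> pd t c x = 0.
Proof.
move=> Ux; have [e eo] := orthonormal_exists (mo_sym gm Ux) (mo_pos gm Ux).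
have E i : pd (e i) c x = 0.
  have [a [ai _ _]] := ord_avoid n4 i i i; have [b [bi ba _]] := ord_avoid n4 i a a.
  have ia : (i == a) = false by rewrite eq_sym (negPf ai).
  have ib : (i == b) = false by rewrite eq_sym (negPf bi).
  have ab : (a == b) = false by rewrite eq_sym (negPf ba).
  have := nabla_curv_bianchi gm (e a) (e b) (e i) (e a) (e b) Ux.
  rewrite !nabla_curv_const// /gg !eo !eqxx ?ia ?ib ?ab ?(negPf ai) ?(negPf bi) ?(negPf ba).
  by rewrite !(mulr1n, mulr0n, mulr0, mul0r, mulr1, subr0, sub0r, add0r, oppr0, mulrN1) => /eqP; rewrite oppr_eq0 => /eqP.
rewrite (frame_expand eo t) -pdEx deriveE; last exact: dc.
rewrite linear_sum big1// => i _; rewrite linearZ /= -deriveE; last exact: dc.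
by rewrite pdEx E scaler0.
Qed.

End Schur.

(** The mean value bound with K = 0 on the segment from x0; the function is turned into a 1x1 matrix
    to fit that bound. *)
Lemma pd0_const (R : realType) (n : nat) (f : 'rV[R]_n -> R) (x0 : 'rV[R]_n) (r : R) :
  (forall x, `|x0 - x| < r -> differentiable f x /\ forall u, pd u f x = 0) ->
  forall x, `|x0 - x| < r -> f x = f x0.
Proof.
move=> H x xr; pose g (y : 'rV[R]_n) := f y *: (1%:M : 'M[R]_1).
have d1 y : differentiable (cst (1%:M : 'M[R]_1) : 'rV[R]_n -> 'M[R]_1) y by exact: differentiable_cst.
have inb (t : R) : 0 <= t <= 1 -> `|x0 - (t *: (x - x0) + x0)| < r.
  move=> /andP[t0 t1]; rewrite opprD addrCA subrr addr0 normrN normrZ ger0_norm//.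
  by apply: le_lt_trans xr; rewrite [`|x0 - x|]distrC ler_piMl.
have dg y : `|x0 - y| < r -> differentiable g y.
  by move=> yr; apply: differentiable_scale; [exact: (H y yr).1|exact: d1].
have F0 : g (0 *: (x - x0) + x0) - g x0 = 0 by rewrite scale0r add0r subrr.
have FD (t : R) : 0 <= t <= 1 -> differentiable (fun t : R => g (t *: (x - x0) + x0) - g x0) t /\
    `|pd (1 : R) (fun t : R => g (t *: (x - x0) + x0) - g x0) t| <= 0.
  move=> t01; have [d e] := pd1_line (dg _ (inb t t01)); split.
    by apply: differentiableB => //; exact: differentiable_cst.
  rewrite (pdB (g := cst (g x0)) _ d (differentiable_cst _ _)) pd_cst subr0 e.
  have [df pf] := H _ (inb t t01).
  by rewrite (pd_scale (M := cst 1%:M) _ df (d1 _)) pf pd_cst scale0r scaler0 addr0 normr0.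
have i1 : 0 <= (1 : R) <= 1 by rewrite ler01 lexx.
have := norm_le_deriv (F := fun t : R => g (t *: (x - x0) + x0) - g x0) F0 FD i1.
rewrite normr_le0 scale1r subrK subr_eq0 => /eqP /matrixP /(_ 0 0).
by rewrite !mxE /= !mulr1.
Qed.

Section BlockDerivative.
Context {R : realType} {V : normedModType R} {m1 m2 n1 n2 : nat}.
Variables (A : V -> 'M[R]_(m1, n1)) (B : V -> 'M[R]_(m1, n2))
  (C : V -> 'M[R]_(m2, n1)) (D : V -> 'M[R]_(m2, n2)).

Lemma Ck_block k U : open U -> Ck k U A -> Ck k U B -> Ck k U C -> Ck k U D ->
  Ck k U (fun y => block_mx (A y) (B y) (C y) (D y)).
Proof.
move=> oU cA cB cC cD; apply: Ck_mx => // i j.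
rewrite -[i]splitK -[j]splitK.
case: (fintype.split i) => i'; case: (fintype.split j) => j' /=.
- by apply: (Ck_ext (f := fun y => A y i' j') oU) => [y _|]; [rewrite block_mxEul|exact: Ck_entry].
- by apply: (Ck_ext (f := fun y => B y i' j') oU) => [y _|]; [rewrite block_mxEur|exact: Ck_entry].
- by apply: (Ck_ext (f := fun y => C y i' j') oU) => [y _|]; [rewrite block_mxEdl|exact: Ck_entry].
- by apply: (Ck_ext (f := fun y => D y i' j') oU) => [y _|]; [rewrite block_mxEdr|exact: Ck_entry].
Qed.

Lemma pd_block x u : differentiable (fun y => block_mx (A y) (B y) (C y) (D y)) x ->
  differentiable A x -> differentiable B x -> differentiable C x -> differentiable D x ->
  pd u (fun y => block_mx (A y) (B y) (C y) (D y)) x =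
  block_mx (pd u A x) (pd u B x) (pd u C x) (pd u D x).
Proof.
move=> d dA dB dC dD; apply/matrixP => i j; rewrite -(pd_entry _ _ _ d).
rewrite -[i]splitK -[j]splitK.
case: (fintype.split i) => i'; case: (fintype.split j) => j' /=.
- by rewrite block_mxEul -(pd_entry _ _ _ dA); congr pd; apply/funext => y; rewrite block_mxEul.
- by rewrite block_mxEur -(pd_entry _ _ _ dB); congr pd; apply/funext => y; rewrite block_mxEur.
- by rewrite block_mxEdl -(pd_entry _ _ _ dC); congr pd; apply/funext => y; rewrite block_mxEdl.
- by rewrite block_mxEdr -(pd_entry _ _ _ dD); congr pd; apply/funext => y; rewrite block_mxEdr.
Qed.
End BlockDerivative.

(** * The Hessian equation as a total differential equation *)

Section HessianSystem.
Context {R : realType} {n : nat}.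
Local Notation V := 'rV[R]_n.
Variables (G : V -> 'M[R]_n) (U : set V) (c : R).
Hypotheses (gm : metric_on G U)
  (Rc : forall x, U x -> forall u v w z, curv G x u v w z = c * gg (G x) u v w z).
Implicit Types (x u v w : V).

(** The unknown is the row (v, T). Multiplied by this matrix it becomes (g(T, u), - c v u - Gamma(u,
    T)), the derivatives along u prescribed for v and for its gradient T. *)
Let A x u : 'M[R]_(1 + n) := block_mx 0 (- c *: u) (G x *m u^T) (- cmx G x u).

Let oU := mo_open gm.

Let CG k (u : V) : Ck k U (fun x => G x *m u^T).
Proof. by apply: Ck_mulmx => //; [exact: mo_smooth gm k|exact: (@Ck_cst _ _ _ k U u^T)]. Qed.

Let CN k (u : V) : Ck k U (fun x => - cmx G x u).
Proof. by apply: Ck_opp => //; exact: Ck_cmx. Qed.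

Let CA k u : Ck k U (fun x => A x u).
Proof. by apply: Ck_block => //; first [exact: CG | exact: CN | exact: Ck_cst]. Qed.

Let lA x : U x -> forall a u v, A x (a *: u + v) = a *: A x u + A x v.
Proof.
move=> Ux a u v; rewrite /A (cmx_lin gm)// [(a *: u + v)^T]linearP /= mulmxDr -scalemxAr.
rewrite scale_block_mx add_block_mx scaler0 addr0 opprD scalerN; congr block_mx.
by rewrite scalerDr !scalerA mulrC.
Qed.

(** Blockwise: the upper blocks are the symmetry of the metric and of the connection, the lower left
    one is metric compatibility, and the lower right one is constant curvature. *)
Let flat x : U x -> forall u v,
  pd u (fun y => A y v) x + A x u *m A x v = pd v (fun y => A y u) x + A x v *m A x u.
Proof.
move=> Ux u v.
have dGx := dG gm Ux.
have E p q : pd p (fun y => A y q) x = block_mx 0 0 (pd p G x *m q^T) (- pd p (fun y => cmx G y q) x).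
  rewrite (pd_block (A := cst 0) (B := cst (- c *: q))); first last.
  - exact: (Ck_diff (CN 0 q) Ux).
  - exact: (Ck_diff (CG 0 q) Ux).
  - exact: differentiable_cst.
  - exact: differentiable_cst.
  - exact: (Ck_diff (CA 0 q) Ux).
  rewrite !pd_cst (pd_mulmx (N := cst q^T) _ dGx (differentiable_cst _ _)) pd_cst mulmx0 addr0.
  by rewrite (pdN _ (d_cmx gm q Ux)).
rewrite !E !mulmx_block !add_block_mx !mul0mx !mulmx0 !add0r; congr block_mx.
- have F p q : p *m (G x *m q^T) = (ip (G x) p q)%:M by rewrite mulmxA; exact: mx11_scalar.
  by rewrite -!scalemxAl !F (ipC gm v u Ux).
- by rewrite !mulmxN -!scalemxAl (cmx_sym gm u v Ux).
- apply/row_matrixP => i; rewrite !rowE; move: (delta_mx 0 i) => w.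
  have F H p q : p *m (H *m q^T) = (ip H p q)%:M by rewrite mulmxA; exact: mx11_scalar.
  rewrite !mulmxDr !mulNmx !mulmxN !(mulmxA w (cmx G x _)) (mul_cmx gm u w Ux) (mul_cmx gm v w Ux) !F.
  rewrite (metric_compat gm u w v Ux) (metric_compat gm v w u Ux) (chrC gm v u Ux).
  by rewrite -!raddfB /= addrAC subrr add0r addrAC subrr add0r.
have H : rmx G x u v = c *: (G x *m v^T *m u - G x *m u^T *m v).
  apply/row_matrixP => i; rewrite !rowE; move: (delta_mx 0 i) => w.
  rewrite (mul_rmx gm u v w Ux) (curv_endo_const gm Rc u v w Ux) -scalemxAr mulmxBr; congr (_ *: _).
  have F p q : w *m (G x *m p^T *m q) = ip (G x) w p *: q.
    by rewrite !mulmxA [w *m G x *m p^T]mx11_scalar mul_scalar_mx.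
  by rewrite !F (ipC gm w u Ux) (ipC gm w v Ux).
move: H; rewrite /rmx !mulNmx !mulmxN !opprK -!scalemxAr.
move: (pd u _ x) (pd v _ x) (cmx G x u *m _) (cmx G x v *m _) (G x *m u^T *m _) (G x *m v^T *m _).
by move=> Q1 Q2 Q3 Q4 Q5 Q6 /matrixP H; apply/matrixP => i j; move: (H i j); rewrite !mxE; lra.
Qed.

(* The overdetermined system [Hess v = - c v g], [v = 1] and [dv = 0] at [x0]; it is integrable
   because the curvature is constant. *)
Lemma hessian_system x0 : U x0 -> exists (r : R) (v : V -> R) (T : V -> V),
  [/\ 0 < r, v x0 = 1, T x0 = 0, forall x, `|x0 - x| < r -> U x &
   forall x, `|x0 - x| < r -> [/\ differentiable v x, differentiable T x,
     forall u, pd u v x = ip (G x) (T x) u &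
     forall u, pd u T x = - christoffel G x u (T x) - (c * v x) *: u]].
Proof.
move=> Ux0; have [r [Y [r0 Y0 YP]]] := frobenius oU CA lA flat Ux0 (row_mx 1%:M 0 : 'rV[R]_(1 + n)).
pose L1 : 'M[R]_(1 + n, 1) := col_mx 1%:M 0; pose L2 : 'M[R]_(1 + n, n) := col_mx 0 1%:M.
exists r, (fun y => (Y y *m L1) 0 0), (fun y => Y y *m L2); split => //.
- by rewrite Y0 mul_row_col mulmx1 mulmx0 addr0 mxE.
- by rewrite Y0 mul_row_col mulmx0 mul0mx addr0.
- by move=> x /YP[].
move=> x /YP[Ux [dY pY]].
have dL p (L : 'M[R]_(1 + n, p)) : differentiable (fun y => Y y *m L) x.
  by apply: (differentiable_mulmx (N := cst L)) => //; exact: differentiable_cst.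
have pL p (L : 'M[R]_(1 + n, p)) u : pd u (fun y => Y y *m L) x = Y x *m A x u *m L.
  rewrite (pd_mulmx (N := cst L) _ dY (differentiable_cst _ _)) pd_cst mulmx0 addr0.
  by rewrite pY.
have YE : Y x = row_mx (Y x *m L1) (Y x *m L2).
  by rewrite -{1 2 3}[Y x]hsubmxK !mul_row_col !mulmx1 !mulmx0 addr0 add0r.
split => //.
- by move/differentiable_mxP : (dL _ L1); exact.
- move=> u; rewrite (pd_entry _ _ _ (dL _ L1)) pL {1}YE -mulmxA mul_block_col mul_row_col.
  by rewrite !mulmx0 !mulmx1 !addr0 mulmx0 add0r mulmxA.
move=> u; rewrite pL {1}YE -mulmxA mul_block_col mul_row_col.
rewrite !mulmx0 !mulmx1 !add0r mulmxN (mul_cmx gm _ _ Ux) addrC.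
rewrite {1}[Y x *m L1]mx11_scalar mul_scalar_mx scalerA mulrN scaleNr mulrC.
by [].
Qed.

End HessianSystem.

(** * Local conformal flatness of constant curvature metrics *)

Section LocallyConformallyFlat.
Context {R : realType} {n : nat}.
Local Notation V := 'rV[R]_n.
Variables (G : V -> 'M[R]_n).
Hypothesis n4 : (4 <= n)%N.

Let disc (x0 : V) (r : R) : set V := [set y | `|x0 - y| < r].

Let open_disc x0 r : open (disc x0 r).
Proof.
rewrite openE => y yr; apply/nbhs_ballP; exists (r - `|x0 - y|) => /=; first by rewrite subr_gt0.
move=> z; rewrite -ball_normE /= /disc /= => yz.
by have := ler_normD (x0 - y) (y - z); rewrite addrA subrK; lra.
Qed.

Let metric_on_sub U U' : metric_on G U -> open U' -> U' `<=` U -> metric_on G U'.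
Proof.
move=> gm oU' UU; split => //.
- by move=> k; apply: Ck_subset (mo_smooth gm k).
- by move=> x /UU; exact: (mo_sym gm).
- by move=> x /UU; exact: (mo_pos gm).
Qed.

Lemma constant_conformally_flat U c (x0 : V) : metric_on G U -> U x0 ->
  (forall x, U x -> forall u v w z, curv G x u v w z = c * gg (G x) u v w z) ->
  exists (U' : set V) (phi : V -> R), [/\ open U' /\ U' x0, U' `<=` U,
    smooth_on U' phi, (forall y, U' y -> 0 < phi y) &
    forall y, U' y -> forall u v w, curv_endo (fun z => phi z *: G z) y u v w = 0].
Proof.
move=> gm Ux0 Rc; have [r [v [T [r0 v0 T0 rU H]]]] := hessian_system gm Rc Ux0.
have dv0 : differentiable v x0 by case: (H x0) => //; rewrite subrr normr0.
(* v is 1 at x0; the disc is shrunk to keep v positive, so that the conformal factor with mu = 1 + v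
   is defined and positive. *)
have nv : \forall y \near x0, 0 < v y.
  apply: (@cvgr_gt _ _ (nbhs x0) _ v (v x0)); first exact: differentiable_continuous.
  by rewrite v0.
have /nbhs_ballP[r1 /= r10 r1P] := nv.
pose r2 := Num.min r r1; have r20 : 0 < r2 by rewrite lt_min r0.
pose U' := disc x0 r2.
have U'r y : U' y -> `|x0 - y| < r by move=> h; apply: lt_le_trans h _; rewrite ge_min lexx.
have vp y : U' y -> 0 < v y.
  move=> h; apply: r1P; rewrite -ball_normE /=; apply: lt_le_trans h _.
  by rewrite ge_min lexx orbT.
have UU : U' `<=` U by move=> y /U'r /rU.
have oU' : open U' by exact: open_disc.
have gm' := metric_on_sub gm oU' UU.
have xU' : U' x0 by rewrite /U' /disc /= subrr normr0.
have dv y : U' y -> differentiable v y by move=> /U'r /H[].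
have dT y : U' y -> differentiable T y by move=> /U'r /H[].
have pv y : U' y -> forall u, pd u v y = ip (G y) (T y) u by move=> /U'r /H[].
have pT y : U' y -> forall u, pd u T y = - christoffel G y u (T y) - (c * v y) *: u.
  by move=> /U'r /H[].
(* Bootstrap: the system expresses the derivatives of v and T through v, T and the metric. *)
have CvT k : Ck k U' v /\ Ck k U' T.
  elim: k => [|k [Cv CT]]; first by split; split.
  split; split => // u.
    apply: (Ck_ext (f := fun y => ip (G y) (T y) (cst u y)) oU'); first by move=> y Uy; rewrite pv.
    by apply: Ck_ip => //; [exact: mo_smooth gm' k|exact: Ck_cst].
  apply: (Ck_ext (f := fun y => - (T y *m cmx G y u) + - ((cst c y * v y) *: cst u y)) oU').
    by move=> y Uy; rewrite pT// (mul_cmx gm' _ _ Uy).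
  apply: Ck_add => //; apply: Ck_opp => //.
    by apply: Ck_mulmx => //; exact: (Ck_cmx gm').
  by apply: Ck_scale => //; [apply: Ck_mul => //; exact: Ck_cst|exact: Ck_cst].
(* c v^2 + |T|^2 is a first integral of the system, and the initial values v = 1, T = 0 make it
   equal to c. *)
have n_T y : U' y -> ip (G y) (T y) (T y) = c * (1 - v y ^+ 2).
  move=> Uy; pose h y := c * (v y * v y) + ip (G y) (T y) (T y).
  have hE : h y = h x0.
    apply: (@pd0_const _ _ h x0 r2) => // z Uz.
    have dvz := dv z Uz; have dTz := dT z Uz; have dGz := dG gm' Uz.
    have d1 := differentiableM dvz dvz.
    have d2 : differentiable (fun y => c * (v y * v y)) z.
      by apply: (differentiableM (f := cst c)) => //; exact: differentiable_cst.
    have d3 := differentiable_ip dGz dTz dTz.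
    split; first exact: differentiableD.
    move=> u; rewrite (pdD _ d2 d3) (pdM (f := cst c) _ (differentiable_cst _ _) d1) pd_cst mul0r add0r.
    rewrite (pdM _ dvz dvz) (pd_ip _ dGz dTz dTz) (metric_compat gm' u _ _ Uz) pv// pT//.
    rewrite !(ipBl, ipBr, ipNl, ipNr, ipZl, ipZr) (ipC gm' u (T z) Uz) /=; ring.
  move: hE; rewrite /h v0 T0 ip0l; lra.
pose mu y := 1 + v y.
have Cmu k : Ck k U' mu := Ck_add oU' (@Ck_cst _ _ _ k U' (1 : R)) (CvT k).1.
have mu0 y : U' y -> 0 < mu y by move=> /vp; rewrite /mu; lra.
have vE y : mu y - 1 = v y by rewrite /mu addrC addKr.
have pmu y : U' y -> forall u, pd u mu y = ip (G y) (T y) u.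
  move=> Uy u; rewrite (pdD (f := cst (1 : R)) _ (differentiable_cst _ _) (dv y Uy)) pd_cst add0r.
  exact: pv.
have pT' y : U' y -> forall u, pd u T y = - christoffel G y u (T y) - (c * (mu y - 1)) *: u.
  by move=> Uy u; rewrite vE; exact: pT.
have nT y : U' y -> ip (G y) (T y) (T y) = c * (2 * mu y - mu y ^+ 2).
  by move=> Uy; rewrite n_T// /mu; ring.
have Rc' y : U' y -> forall u v w z, curv G y u v w z = c * gg (G y) u v w z by move=> /UU; exact: Rc.
exists U', (conformal_factor mu); split => //.
- by apply/smooth_onP => k; exact: (Ck_conformal_factor gm' Cmu mu0).
- by move=> y Uy; exact: (conformal_factor_gt0 mu0).
- by move=> y Uy u w z; exact: (conformal_flat gm' Rc' Cmu mu0 dT pmu pT' nT).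
Qed.

(** The constants given point by point are the normalised scalar curvature, hence a differentiable
    function; Schur's lemma then makes it constant on a ball around x0. *)
Lemma pointwise_constant_conformally_flat U (x0 : V) : metric_on G U -> U x0 ->
  (forall x, U x -> exists c, forall u v w z, curv G x u v w z = c * gg (G x) u v w z) ->
  exists (U' : set V) (phi : V -> R), [/\ open U' /\ U' x0, U' `<=` U,
    smooth_on U' phi, (forall y, U' y -> 0 < phi y) &
    forall y, U' y -> forall u v w, curv_endo (fun z => phi z *: G z) y u v w = 0].
Proof.
move=> gm Ux0 Rex; have oU := mo_open gm.
have n1 : n%:R * (n%:R - 1) != 0 :> R.
  have : 4 <= n%:R :> R by rewrite (ler_nat R 4 n).
  by move=> h; rewrite mulf_neq0// gt_eqF//; lra.
pose c x : R := (n%:R * (n%:R - 1))^-1 * \tr (ricci_mx G x).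
have Rc x : U x -> forall u v w z, curv G x u v w z = c x * gg (G x) u v w z.
  move=> Ux; have [d Rd] := Rex x Ux.
  suff -> : c x = d by [].
  rewrite /c (const_ricci_mx gm Ux Rd) mxtrace_scalar -[_ * d *+ n]mulr_natl mulrA.
  by rewrite mulKf.
have dc x : U x -> differentiable c x.
  have Ctr : Ck 0 U (fun y => \tr (ricci_mx G y)).
    by apply: Ck_sum => // i; apply: Ck_entry => //; exact: (Ck_ricci_mx gm).
  move=> Ux; apply: (differentiableM (f := cst (n%:R * (n%:R - 1))^-1)).
    exact: differentiable_cst.
  exact: (Ck_diff Ctr Ux).
have /nbhs_ballP[r /= r0 rP] : \forall y \near x0, U y by exact: open_nbhs_nbhs.
have rU : disc x0 r `<=` U by move=> y h; apply: rP; rewrite -ball_normE.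
have gm' := metric_on_sub gm (@open_disc x0 r) rU.
have cE x : disc x0 r x -> c x = c x0.
  apply: pd0_const => y /rU Uy; split; first exact: dc.
  by move=> u; exact: (schur gm n4 dc Rc).
have [||U' [phi [h1 h2 h3 h4 h5]]] := @constant_conformally_flat (disc x0 r) (c x0) x0 gm'.
- by rewrite /disc /= subrr normr0.
- by move=> x xr u v w z; rewrite Rc ?cE//; exact: rU.
by exists U', phi; split => // y /h2 /rU.
Qed.

End LocallyConformallyFlat.

Theorem theorem16 (R : realType) (n m : nat) (k : R)
    (M : riemannian R n) (N : riemannian R (n + m)) (f : M -> N) :
  (4 <= n)%N -> (1 <= m)%N ->
  constant_curvature N k ->
  isometric_immersion f ->
  wintgen_ideal f m k ->
  (RC_CR_dep_Q M <-> totally_umbilical f) /\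
  (totally_umbilical f -> conformally_flat M).
Proof.
move=> n4 _ Nk [cf immf] wf.
have gm i j := metric_on_loc i j cf.
have gmt j := @metric_on_chart _ _ N j.
have sF i j l : Ck l (loc_dom f i j) (loc f i j).
  by have [/smooth_onP s _] := immf i j; exact: s.
have FU i j x : loc_dom f i j x -> (mf_chart j @` mf_dom j) (loc f i j x) := @loc_in _ _ _ _ _ f i j x.
have iso i j x : loc_dom f i j x -> forall u v, ip (rm_metric i x) u v =
    ip (rm_metric j (loc f i j x)) (pd u (loc f i j) x) (pd v (loc f i j) x).
  by move=> Ux u v; have [_ h] := immf i j; rewrite (h x Ux) !pdEx.
have ck j y : (mf_chart j @` mf_dom j) y -> forall u v w z,
    curv (@rm_metric _ _ N j) y u v w z = k * gg (rm_metric j y) u v w z.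
  by move=> Uy; apply: (constant_curv_form (gmt j) Uy) => u v; exact: Nk.
(* The intrinsic conclusions mention a chart of M only, whereas umbilicity is stated for a pair of
   charts. *)
have cover i x : (mf_chart i @` mf_dom i) x -> exists j, loc_dom f i j x.
  by move=> [q di <-]; have [j dj] := mf_cover (f q); exists j, q.
have umb i j x : totally_umbilical f -> loc_dom f i j x -> exists c, forall u v w z,
    curv (@rm_metric _ _ M i) x u v w z = c * gg (rm_metric i x) u v w z.
  move=> um Ux; have [e eo] := orthonormal_exists (mo_sym (gm i j) Ux) (mo_pos (gm i j) Ux).
  exists (k + ip (rm_metric j (loc f i j x)) (mean_vec (rm_metric i) (rm_metric j) (loc f i j) x e)
    (mean_vec (rm_metric i) (rm_metric j) (loc f i j) x e)).
  apply: (umbilic_curv (gm i j) (gmt j) (sF i j) (@FU i j) (@iso i j) (@ck j) Ux).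
  exact: um.
split; first split.
- move=> dep i j x Ux e G Gt eo u v.
  have [eta h] := dep_umbilic (gm i j) (gmt j) (sF i j) (@FU i j) (@iso i j) (@ck j) n4
    (wf i j) (fun y Uy => dep i y (loc_domS Uy)) Ux.
  by rewrite (umbilic_mean_vec n4 eo h).
- move=> um i x Ux; have [j Uj] := cover i x Ux; have [c Rc] := umb i j x um Uj.
  by apply: (dep_const (gm i j) Uj _ Rc); apply: leq_trans n4.
move=> um i x Ux; have [j Uj] := cover i x Ux.
have [U' [phi [h1 h2 h3 h4 h5]]] := pointwise_constant_conformally_flat n4 (gm i j) Uj
  (fun y Uy => umb i j y um Uy).
by exists U', phi; split => // y /h2; exact: loc_domS.
Qed.
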